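(* Let $c(n)$, $n\ge 0$, be the Fourier coefficients of the modular invariant $j$. Then the sequence $\{c(n)\}_{n\ge 1}$ satisfies the Laguerre inequality of order two, i.e. for all $n\ge 1$, $$\frac12\sum_{k=0}^{4}(-1)^{k+2}\binom{4}{k}c(n+k)\,c(n+4-k)\ge 0.$$
   Context: The modular invariant $j$ is defined for $\tau$ in the upper half-plane, with $q=e^{2\pi i\tau}$, by $$j(\tau)=\frac{\left(1+240\sum_{n\ge 1}\sigma_3(n)q^n\right)^3}{q\prod_{n\ge 1}(1-q^n)^{24}}=q^{-1}+\sum_{n\ge 0}c(n)q^n=q^{-1}+744+196884q+21493760q^2+\cdots,$$ where $\sigma_3(n)=\sum_{d\mid n}d^3$. This defines the integers $c(n)$, $n\ge 0$. A sequence $\{a_n\}_{n\ge 1}$ satisfies the Laguerre inequality of order $m$ if for all $n\ge 1$, $\frac12\sum_{k=0}^{2m}(-1)^{k+m}\binom{2m}{k}a_{n+k}a_{2m-k+n}\ge 0$. *)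

(* Defs.v *)
From Stdlib Require Import Reals List Arith.
From Coquelicot Require Import Coquelicot.

(** Total limit, in the style of Coquelicot's [RInt]: the limit if it exists,
    an unspecified complex number otherwise. *)
Definition Clim_seq (u : nat -> C) : C :=
  @iota C_CompleteNormedModule
    (fun l => filterlim u eventually (locally l)).

Definition Cseries (a : nat -> C) : C := Clim_seq (fun N => sum_n a N).

(** [Cprod u N = u 1 * ... * u N]. *)
Fixpoint Cprod (u : nat -> C) (N : nat) : C :=
  match N with
  | O => RtoC 1
  | S N' => Cmult (Cprod u N') (u N)
  end.

Definition Cexp (z : C) : C :=
  Cmult (RtoC (exp (Re z))) (cos (Im z), sin (Im z)).

Definition divisor_sigma (k n : nat) : nat :=
  list_sum (map (fun d => d ^ k)
                (filter (fun d => n mod d =? 0) (seq 1 n)))%nat.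

Definition q_param (tau : C) : C := Cexp (2 * PI * Ci * tau)%C.

Definition modular_j (tau : C) : C :=
  let q := q_param tau in
  ((1 + 240 * Cseries (fun n => INR (divisor_sigma 3 (S n)) * q ^ S n)) ^ 3
   / (q * Clim_seq (Cprod (fun n => (1 - q ^ n) ^ 24))))%C.

(** [c] is the sequence of Fourier coefficients c(0), c(1), ... of [modular_j],
    the coefficient of q^{-1} being 1.  Such a [c] is unique, as a power series
    converging on the punctured unit disc determines its coefficients. *)
Definition j_fourier_coefficients (c : nat -> Z) : Prop :=
  forall tau : C, (0 < Im tau)%R ->
    is_series (fun n => RtoC (IZR (c n)) * q_param tau ^ n)%C
              (modular_j tau - / q_param tau)%C.

(** Only the terms a 1, a 2, ... occur; [Binomial.C] is the binomial
    coefficient and [sum_f_R0 f N] is f 0 + ... + f N. *)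
Definition laguerre_inequality (m : nat) (a : nat -> R) : Prop :=
  forall n : nat, (1 <= n)%nat ->
    (1 / 2 * sum_f_R0 (fun k => (-1) ^ (k + m) * Binomial.C (2 * m) k
                                * a (n + k)%nat * a (2 * m - k + n)%nat)
                      (2 * m) >= 0)%R.

(* Main.v *)
(** In the strip |Re t| <= 1/2, the function j - 1/q is well approximated by the Poincare-type series
    B(t) = sum over integers m of [exp(2 pi i/(t+m)) - 1 - 2 pi i/(t+m)], because j(-1/t) = j(t)
    and j(t) - 1/q is bounded for Im t >= 1.  By Lipschitz' formula, B has the Bessel-type
    coefficients 4 pi^2 (phi(4 pi^2 n) - 1), where phi(x) is the sum of x^k/(k! (k+1)!).  Bounding
    j - 1/q - B on the line Im t = 1/sqrt n gives c(n), of order exp(4 pi sqrt n), up to an error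
    of order exp((5/2) pi sqrt n).

    The modularity of j comes from E4 and the discriminant: the double sums defining E4 may be
    interchanged, whereas for E2 the interchange produces the quasi-modular correction term, which
    makes the logarithmic derivative of [mdelta(-1/t) / (t^12 mdelta(t))] vanish.

    The Laguerre expression of phi has a lower bound because the homogeneous parts of
    phi(x) phi(y) have positive coefficients in x + y and x y, and the powers of
    x y = z^2 - s^2 are convex in s^2, where x, y = z +- s.  This beats the error term for
    n >= 100.  For n < 100 the coefficients are computed exactly from E4^3 / eprod modulo a power
    of q, two functions of small real q > 0 being compared up to O(q^M). *)

Require Import Defs.
From Stdlib Require Import Reals Lra Lia Psatz List Arith ZArith.
From Coquelicot Require Import Coquelicot.

Local Open Scope R_scope.

(** * Series of complex numbers *)

(** No contour integral and no holomorphy is used: complex analysis enters through absolutely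
    convergent double sums, uniqueness of power series coefficients on a real interval, and
    derivatives along real segments. The root is Herglotz' identity [eis 2 = csc2]. Its Taylor
    coefficients give Lipschitz' formula, its values near [1/2] give zeta(2) and zeta(4), and
    integration along a segment gives the cotangent series behind the quasi-modular term. Averaging
    over roots of unity replaces Cauchy's integral for coefficients.

    The obstacle is cancellation: [c(n) c(n+4) - 4 c(n+1) c(n+3) + 3 c(n+2)^2] is smaller than its
    terms by a power of [n], so an asymptotic formula with polynomial relative error would have to
    be carried to several orders. An exponentially small relative error avoids this. On the line
    [y = 1 / sqrt n] extracting a coefficient costs [exp(2 pi sqrt n)] and the modular image of the
    strip costs [exp(pi sqrt n / 2)]; their product stays so far below [exp(4 pi sqrt n)] that very
    crude constants are affordable from [n = 100] on. *)

Definition Ccv (u : nat -> C) (l : C) : Prop :=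
  is_lim_seq (fun n => Cmod (u n - l)%C) 0.

Lemma C_ext (z w : C) : Re z = Re w -> Im z = Im w -> z = w.
Proof. destruct z, w; simpl; intros; subst; reflexivity. Qed.

Lemma im_le_Cmod (z : C) : Rabs (Im z) <= Cmod z.
Proof. eapply Rle_trans; [|apply Rmax_Cmod]. apply Rmax_r. Qed.

Lemma Cmod_le_abs (z : C) : Cmod z <= Rabs (Re z) + Rabs (Im z).
Proof.
  unfold Cmod, Re, Im. apply Rsqr_incr_0_var.
  - rewrite Rsqr_sqrt by nra. unfold Rsqr.
    pose proof (Rabs_pos (fst z)). pose proof (Rabs_pos (snd z)).
    rewrite <- (pow2_abs (fst z)), <- (pow2_abs (snd z)). nra.
  - pose proof (Rabs_pos (fst z)). pose proof (Rabs_pos (snd z)). lra.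
Qed.

Lemma Cmod_sub_sym (z w : C) : Cmod (z - w)%C = Cmod (w - z)%C.
Proof. rewrite <- Cmod_opp. f_equal. ring. Qed.

Lemma Cmod_triangle_sub (z w : C) : Cmod (z - w)%C <= Cmod z + Cmod w.
Proof. unfold Cminus. rewrite <- (Cmod_opp w). apply Cmod_triangle. Qed.

Lemma Cmod_triangle_rev (z w : C) : Cmod z - Cmod w <= Cmod (z - w)%C.
Proof.
  pose proof (Cmod_triangle (z - w)%C w) as H.
  replace (z - w + w)%C with z in H by ring. lra.
Qed.

Lemma Ccv_squeeze (u : nat -> C) (l : C) (e : nat -> R) :
  (forall n, Cmod (u n - l)%C <= e n) -> is_lim_seq e 0 -> Ccv u l.
Proof.
  intros H He. unfold Ccv.
  apply (is_lim_seq_le_le (fun _ => 0) _ e); [|apply is_lim_seq_const|exact He].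
  intros n; split; [apply Cmod_ge_0|apply H].
Qed.

Lemma Ccv_Re (u : nat -> C) (l : C) :
  Ccv u l -> is_lim_seq (fun n => Re (u n)) (Re l).
Proof.
  intros H. apply is_lim_seq_spec. intros eps.
  apply is_lim_seq_spec in H. destruct (H eps) as [N HN]. exists N. intros n Hn.
  specialize (HN n Hn). rewrite Rminus_0_r, Rabs_pos_eq in HN by apply Cmod_ge_0.
  eapply Rle_lt_trans; [|exact HN].
  replace (Re (u n) - Re l) with (Re (u n - l)%C) by reflexivity. apply re_le_Cmod.
Qed.

Lemma Ccv_Im (u : nat -> C) (l : C) :
  Ccv u l -> is_lim_seq (fun n => Im (u n)) (Im l).
Proof.
  intros H. apply is_lim_seq_spec. intros eps.
  apply is_lim_seq_spec in H. destruct (H eps) as [N HN]. exists N. intros n Hn.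
  specialize (HN n Hn). rewrite Rminus_0_r, Rabs_pos_eq in HN by apply Cmod_ge_0.
  eapply Rle_lt_trans; [|exact HN].
  replace (Im (u n) - Im l) with (Im (u n - l)%C) by reflexivity. apply im_le_Cmod.
Qed.

Lemma Ccv_of_components (u : nat -> C) (l : C) :
  is_lim_seq (fun n => Re (u n)) (Re l) ->
  is_lim_seq (fun n => Im (u n)) (Im l) -> Ccv u l.
Proof.
  intros H1 H2.
  apply (Ccv_squeeze _ _ (fun n => Rabs (Re (u n) - Re l) + Rabs (Im (u n) - Im l))).
  - intros n. apply (Cmod_le_abs (u n - l)%C).
  - replace (Finite 0) with (Rbar_plus (Rabs (Re l - Re l)) (Rabs (Im l - Im l))).
    + apply is_lim_seq_plus'; apply (is_lim_seq_abs _ (Finite _));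
        apply is_lim_seq_minus'; auto; apply is_lim_seq_const.
    + simpl. f_equal. rewrite !Rminus_diag, Rabs_R0. ring.
Qed.

Lemma Ccv_unique (u : nat -> C) (l1 l2 : C) : Ccv u l1 -> Ccv u l2 -> l1 = l2.
Proof.
  intros H1 H2. apply C_ext.
  - pose proof (is_lim_seq_unique _ _ (Ccv_Re _ _ H1)) as E1.
    rewrite (is_lim_seq_unique _ _ (Ccv_Re _ _ H2)) in E1. congruence.
  - pose proof (is_lim_seq_unique _ _ (Ccv_Im _ _ H1)) as E1.
    rewrite (is_lim_seq_unique _ _ (Ccv_Im _ _ H2)) in E1. congruence.
Qed.

(** The passage from the filters in [is_series] and [Clim_seq] to moduli. Balls of the uniform
    structure are squares, hence [eps / 2] for each component in the second half. *)
Lemma Ccv_filterlim (u : nat -> C) (l : C) :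
  Ccv u l <-> filterlim u eventually (locally l).
Proof.
  split.
  - intros H P [eps HP].
    apply is_lim_seq_spec in H. destruct (H eps) as [N HN]. exists N. intros n Hn.
    specialize (HN n Hn). rewrite Rminus_0_r, Rabs_pos_eq in HN by apply Cmod_ge_0.
    apply HP. apply C_NormedModule_mixin_compat1. exact HN.
  - intros H. apply is_lim_seq_spec. intros eps.
    assert (H2 : 0 < eps / 2) by (destruct eps; simpl; lra).
    specialize (H (fun z => ball l (mkposreal _ H2) z)).
    destruct H as [N HN]; [exists (mkposreal _ H2); auto|].
    exists N. intros n Hn. rewrite Rminus_0_r, Rabs_pos_eq by apply Cmod_ge_0.
    destruct (HN n Hn) as [HR HI].
    eapply Rle_lt_trans; [apply Cmod_le_abs|].
    change (Rabs (fst (u n) - fst l) < eps / 2) in HR.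
    change (Rabs (snd (u n) - snd l) < eps / 2) in HI.
    change (Rabs (fst (u n) - fst l) + Rabs (snd (u n) - snd l) < eps).
    lra.
Qed.

Lemma Ccv_ext (u v : nat -> C) (l : C) :
  (forall n, u n = v n) -> Ccv u l -> Ccv v l.
Proof.
  intros H. apply is_lim_seq_ext. intros n. now rewrite H.
Qed.

Lemma Ccv_const (l : C) : Ccv (fun _ => l) l.
Proof.
  apply (Ccv_squeeze _ _ (fun _ => 0)); [|apply is_lim_seq_const].
  intros _. replace (l - l)%C with (RtoC 0) by ring. rewrite Cmod_0. lra.
Qed.

Lemma Ccv_plus (u v : nat -> C) (l m : C) :
  Ccv u l -> Ccv v m -> Ccv (fun n => (u n + v n)%C) (l + m)%C.
Proof.
  intros H1 H2. apply (Ccv_squeeze _ _ (fun n => Cmod (u n - l)%C + Cmod (v n - m)%C)).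
  - intros n. replace (u n + v n - (l + m))%C with ((u n - l) + (v n - m))%C by ring.
    apply Cmod_triangle.
  - replace (Finite 0) with (Finite (0 + 0)) by (f_equal; ring).
    apply is_lim_seq_plus'; assumption.
Qed.

Lemma Ccv_mult (u v : nat -> C) (l m : C) :
  Ccv u l -> Ccv v m -> Ccv (fun n => (u n * v n)%C) (l * m)%C.
Proof.
  intros H1 H2.
  apply (Ccv_squeeze _ _ (fun n => Cmod (u n - l)%C * Cmod (v n - m)%C
     + (Cmod l * Cmod (v n - m)%C + Cmod m * Cmod (u n - l)%C))).
  - intros n.
    replace (u n * v n - l * m)%C
      with ((u n - l) * (v n - m) + (l * (v n - m) + m * (u n - l)))%C by ring.
    rewrite <- !Cmod_mult.
    eapply Rle_trans; [apply Cmod_triangle|]. apply Rplus_le_compat_l, Cmod_triangle.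
  - replace (Finite 0) with (Finite (0 * 0 + (Cmod l * 0 + Cmod m * 0))) by (f_equal; ring).
    apply is_lim_seq_plus'; [now apply is_lim_seq_mult'|].
    apply is_lim_seq_plus'; now apply (is_lim_seq_scal_l _ _ (Finite 0)).
Qed.

Lemma Ccv_opp (u : nat -> C) (l : C) : Ccv u l -> Ccv (fun n => (- u n)%C) (- l)%C.
Proof.
  intros H. apply (Ccv_squeeze _ _ (fun n => Cmod (u n - l)%C)); [|exact H].
  intros n. right. rewrite <- Cmod_opp. f_equal. ring.
Qed.

Lemma Ccv_minus (u v : nat -> C) (l m : C) :
  Ccv u l -> Ccv v m -> Ccv (fun n => (u n - v n)%C) (l - m)%C.
Proof. intros. apply Ccv_plus; [|apply Ccv_opp]; assumption. Qed.

Lemma Ccv_scal (c : C) (u : nat -> C) (l : C) :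
  Ccv u l -> Ccv (fun n => (c * u n)%C) (c * l)%C.
Proof. apply Ccv_mult, Ccv_const. Qed.

Lemma Ccv_Cmod (u : nat -> C) (l : C) :
  Ccv u l -> is_lim_seq (fun n => Cmod (u n)) (Cmod l).
Proof.
  intros H. apply is_lim_seq_spec. intros eps.
  apply is_lim_seq_spec in H. destruct (H eps) as [N HN]. exists N. intros n Hn.
  specialize (HN n Hn). rewrite Rminus_0_r, Rabs_pos_eq in HN by apply Cmod_ge_0.
  eapply Rle_lt_trans; [|exact HN].
  apply Rabs_le. split.
  - pose proof (Cmod_triangle_rev l (u n)). rewrite Cmod_sub_sym in H0. lra.
  - apply Cmod_triangle_rev.
Qed.

Lemma Ccv_Cmod_le (u : nat -> C) (l : C) (M : R) :
  (forall n, Cmod (u n) <= M) -> Ccv u l -> Cmod l <= M.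
Proof.
  intros H Hl. apply Ccv_Cmod in Hl.
  apply (is_lim_seq_le _ (fun _ => M) (Cmod l) M H Hl), is_lim_seq_const.
Qed.

(** A lower bound on all terms gives [|1/u - 1/l| <= |u - l| / d^2] at every index. For the infinite
    products below, [Cprod_lower] supplies it. *)
Lemma Ccv_inv (u : nat -> C) (l : C) (d : R) :
  0 < d -> (forall n, d <= Cmod (u n)) -> Ccv u l -> Ccv (fun n => (/ u n)%C) (/ l)%C.
Proof.
  intros Hd H Hl.
  assert (Hld : d <= Cmod l).
  { apply (is_lim_seq_le (fun _ => d) _ d (Cmod l) H);
      [apply is_lim_seq_const|now apply Ccv_Cmod]. }
  apply (Ccv_squeeze _ _ (fun n => (/ (d * d)) * Cmod (u n - l)%C)).
  - intros n. specialize (H n).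
    assert (u n <> 0)%C by (apply Cmod_gt_0; lra).
    assert (l <> 0)%C by (apply Cmod_gt_0; lra).
    replace (/ u n - / l)%C with ((l - u n) * / (u n * l))%C by (field; auto).
    rewrite Cmod_mult, Cmod_inv, Cmod_mult, (Cmod_sub_sym l) by (apply Cmult_neq_0; auto).
    rewrite Rmult_comm. apply Rmult_le_compat_r; [apply Cmod_ge_0|].
    apply Rinv_le_contravar; nra.
  - replace (Finite 0) with (Rbar_mult (/ (d * d)) 0) by (simpl; f_equal; ring).
    now apply is_lim_seq_scal_l.
Qed.

Lemma Ccv_incr_1 (u : nat -> C) (l : C) : Ccv u l <-> Ccv (fun n => u (S n)) l.
Proof. apply (is_lim_seq_incr_1 (fun n => Cmod (u n - l)%C)). Qed.

Lemma Clim_seq_unique (u : nat -> C) (l : C) : Ccv u l -> Clim_seq u = l.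
Proof.
  intros H. unfold Clim_seq.
  apply (iota_filterlim_locally (V := C_CompleteNormedModule) u l).
  now apply Ccv_filterlim.
Qed.

(** [csn a n] sums the [n] terms [a 0, ..., a (n-1)]. *)
Fixpoint csn (a : nat -> C) (n : nat) : C :=
  match n with O => RtoC 0 | S k => (csn a k + a k)%C end.

Lemma sum_n_csn (a : nat -> C) (n : nat) : sum_n (G := C_AbelianMonoid) a n = csn a (S n).
Proof.
  induction n.
  - rewrite sum_O. simpl. now rewrite Cplus_0_l.
  - rewrite sum_Sn, IHn. reflexivity.
Qed.

Lemma csn_ext (a b : nat -> C) (n : nat) :
  (forall k, (k < n)%nat -> a k = b k) -> csn a n = csn b n.
Proof.
  induction n; simpl; intros H; [reflexivity|]. rewrite IHn, H; auto.
Qed.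

Lemma csn_plus (a b : nat -> C) (n : nat) :
  csn (fun k => a k + b k)%C n = (csn a n + csn b n)%C.
Proof. induction n; simpl; [ring|rewrite IHn; ring]. Qed.

Lemma csn_scal (c : C) (a : nat -> C) (n : nat) :
  csn (fun k => c * a k)%C n = (c * csn a n)%C.
Proof. induction n; simpl; [ring|rewrite IHn; ring]. Qed.

Lemma csn_S_first (a : nat -> C) (n : nat) :
  csn a (S n) = (a O + csn (fun k => a (S k)) n)%C.
Proof. induction n; simpl in *; [ring|rewrite IHn; ring]. Qed.

Lemma csn_Cmod (a : nat -> C) (n : nat) :
  Cmod (csn a (S n)) <= sum_f_R0 (fun k => Cmod (a k)) n.
Proof.
  induction n.
  - simpl. rewrite Cplus_0_l. lra.
  - simpl in *. eapply Rle_trans; [apply Cmod_triangle|]. lra.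
Qed.

Lemma Re_csn (a : nat -> C) (n : nat) :
  Re (csn a (S n)) = sum_f_R0 (fun k => Re (a k)) n.
Proof.
  induction n; [unfold csn, Re, Im; simpl; ring|].
  change (csn a (S (S n))) with (csn a (S n) + a (S n))%C.
  simpl sum_f_R0. rewrite <- IHn. reflexivity.
Qed.

Lemma Im_csn (a : nat -> C) (n : nat) :
  Im (csn a (S n)) = sum_f_R0 (fun k => Im (a k)) n.
Proof.
  induction n; [unfold csn, Re, Im; simpl; ring|].
  change (csn a (S (S n))) with (csn a (S n) + a (S n))%C.
  simpl sum_f_R0. rewrite <- IHn. reflexivity.
Qed.

(** * Absolutely convergent complex series *)

Definition csm (a : nat -> C) : Prop := ex_series (fun n => Cmod (a n)).

(** Total, through the real [Series] of each component, so that sums can be written before their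
    convergence is known; [csum_cv] gives the value its meaning. *)
Definition csum (a : nat -> C) : C :=
  (Series (fun n => Re (a n)), Series (fun n => Im (a n))).

Lemma ex_series_nonneg_le (a b : nat -> R) :
  (forall n, 0 <= a n <= b n) -> ex_series b -> ex_series a.
Proof.
  intros H Hb. apply (ex_series_le (V := R_CompleteNormedModule) a b); [|exact Hb].
  intros n. change (Rabs (a n) <= b n). rewrite Rabs_pos_eq; apply H.
Qed.

Lemma csm_le (a : nat -> C) (b : nat -> R) :
  (forall n, Cmod (a n) <= b n) -> ex_series b -> csm a.
Proof.
  intros H. apply ex_series_nonneg_le. intros n; split; [apply Cmod_ge_0|apply H].
Qed.

Lemma csm_ext (a b : nat -> C) : (forall n, a n = b n) -> csm a -> csm b.
Proof. intros H. apply ex_series_ext. intros n. now rewrite H. Qed.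

Lemma csm_Re (a : nat -> C) : csm a -> ex_series (fun n => Re (a n)).
Proof.
  intros H. apply (ex_series_le (V := R_CompleteNormedModule) _ (fun n => Cmod (a n))).
  - intros n. apply re_le_Cmod.
  - exact H.
Qed.

Lemma csm_Im (a : nat -> C) : csm a -> ex_series (fun n => Im (a n)).
Proof.
  intros H. apply (ex_series_le (V := R_CompleteNormedModule) _ (fun n => Cmod (a n))).
  - intros n. apply im_le_Cmod.
  - exact H.
Qed.

Lemma csum_ext (a b : nat -> C) : (forall n, a n = b n) -> csum a = csum b.
Proof.
  intros H. unfold csum. f_equal; apply Series_ext; intros n; now rewrite H.
Qed.

Lemma is_series_partial (a : nat -> R) (l : R) :
  is_series a l -> is_lim_seq (sum_f_R0 a) l.
Proof.
  intros H. apply (is_lim_seq_ext (sum_n a)); [intros n; apply sum_n_Reals|exact H].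
Qed.

Lemma partial_is_series (a : nat -> R) (l : R) :
  is_lim_seq (sum_f_R0 a) l -> is_series a l.
Proof.
  intros H. change (is_lim_seq (sum_n a) l).
  apply (is_lim_seq_ext (sum_f_R0 a)); [intros n; symmetry; apply sum_n_Reals|exact H].
Qed.

Lemma csum_cv (a : nat -> C) : csm a -> Ccv (csn a) (csum a).
Proof.
  intros H. apply Ccv_incr_1. apply Ccv_of_components.
  - apply (is_lim_seq_ext (sum_f_R0 (fun k => Re (a k)))).
    + intros n. now rewrite Re_csn.
    + apply is_series_partial, Series_correct, csm_Re, H.
  - apply (is_lim_seq_ext (sum_f_R0 (fun k => Im (a k)))).
    + intros n. now rewrite Im_csn.
    + apply is_series_partial, Series_correct, csm_Im, H.
Qed.

Lemma is_series_Ccv (a : nat -> C) (l : C) :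
  is_series (V := C_NormedModule) a l <-> Ccv (csn a) l.
Proof.
  unfold is_series. rewrite <- Ccv_filterlim, (Ccv_incr_1 (csn a)).
  split; apply Ccv_ext; intros n; [|symmetry]; apply sum_n_csn.
Qed.

Lemma csum_unique (a : nat -> C) (l : C) : Ccv (csn a) l -> csum a = l.
Proof.
  intros H. apply Ccv_incr_1 in H. unfold csum. apply C_ext; simpl; apply is_series_unique.
  - apply Ccv_Re in H. apply partial_is_series.
    apply (is_lim_seq_ext (fun n => Re (csn a (S n)))); [intros n; apply Re_csn|exact H].
  - apply Ccv_Im in H. apply partial_is_series.
    apply (is_lim_seq_ext (fun n => Im (csn a (S n)))); [intros n; apply Im_csn|exact H].
Qed.

Lemma Cseries_csum (a : nat -> C) : csm a -> Cseries a = csum a.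
Proof.
  intros H. apply Clim_seq_unique.
  apply (Ccv_ext (fun n => csn a (S n))); [intros n; symmetry; apply sum_n_csn|].
  apply (proj1 (Ccv_incr_1 (csn a) _)), csum_cv, H.
Qed.

Lemma csm_plus (a b : nat -> C) : csm a -> csm b -> csm (fun n => a n + b n)%C.
Proof.
  intros Ha Hb. apply (csm_le _ (fun n => Cmod (a n) + Cmod (b n))).
  - intros n. apply Cmod_triangle.
  - apply (ex_series_plus (V := R_NormedModule)); assumption.
Qed.

Lemma csm_scal (c : C) (a : nat -> C) : csm a -> csm (fun n => c * a n)%C.
Proof.
  intros Ha. apply (ex_series_ext (fun n => Cmod c * Cmod (a n))).
  - intros n. now rewrite Cmod_mult.
  - now apply (ex_series_scal_l (V := R_NormedModule) (Cmod c)).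
Qed.

Lemma csm_opp (a : nat -> C) : csm a -> csm (fun n => - a n)%C.
Proof. apply ex_series_ext. intros n. now rewrite Cmod_opp. Qed.

Lemma csm_minus (a b : nat -> C) : csm a -> csm b -> csm (fun n => a n - b n)%C.
Proof. intros Ha Hb. apply csm_plus; [exact Ha|now apply csm_opp]. Qed.

Lemma csm_S (a : nat -> C) : csm a <-> csm (fun n => a (S n)).
Proof. apply (ex_series_incr_1 (V := R_NormedModule) (fun n => Cmod (a n))). Qed.

Lemma csum_plus (a b : nat -> C) :
  csm a -> csm b -> csum (fun n => a n + b n)%C = (csum a + csum b)%C.
Proof.
  intros Ha Hb. apply csum_unique.
  apply (Ccv_ext (fun n => csn a n + csn b n)%C); [intros; symmetry; apply csn_plus|].
  apply Ccv_plus; now apply csum_cv.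
Qed.

Lemma csum_scal (c : C) (a : nat -> C) :
  csm a -> csum (fun n => c * a n)%C = (c * csum a)%C.
Proof.
  intros Ha. apply csum_unique.
  apply (Ccv_ext (fun n => c * csn a n)%C); [intros; symmetry; apply csn_scal|].
  apply Ccv_scal; now apply csum_cv.
Qed.

Lemma csum_opp (a : nat -> C) :
  csm a -> csum (fun n => - a n)%C = (- csum a)%C.
Proof.
  intros Ha. rewrite (csum_ext _ (fun n => (- (1)) * a n)%C) by (intros; ring).
  rewrite csum_scal by exact Ha. ring.
Qed.

Lemma csum_minus (a b : nat -> C) :
  csm a -> csm b -> csum (fun n => a n - b n)%C = (csum a - csum b)%C.
Proof.
  intros Ha Hb. unfold Cminus. rewrite csum_plus, csum_opp; auto. now apply csm_opp.
Qed.

Lemma csum_S (a : nat -> C) :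
  csm a -> csum a = (a O + csum (fun n => a (S n)))%C.
Proof.
  intros Ha. apply csum_unique, Ccv_incr_1.
  apply (Ccv_ext (fun n => a O + csn (fun k => a (S k)) n)%C).
  - intros n. symmetry. apply csn_S_first.
  - apply Ccv_plus; [apply Ccv_const|apply csum_cv]. now apply (proj1 (csm_S a)).
Qed.

Lemma Series_partial_le (b : nat -> R) (n : nat) :
  (forall k, 0 <= b k) -> ex_series b -> sum_f_R0 b n <= Series b.
Proof.
  intros H Hb. apply Series_correct, is_series_partial in Hb.
  apply (is_lim_seq_incr_compare (sum_f_R0 b) _ Hb).
  intros k. simpl. specialize (H (S k)). lra.
Qed.

Lemma csum_Cmod (a : nat -> C) (b : nat -> R) :
  (forall n, Cmod (a n) <= b n) -> ex_series b -> Cmod (csum a) <= Series b.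
Proof.
  intros H Hb.
  assert (Hc : Ccv (fun n => csn a (S n)) (csum a)).
  { apply (proj1 (Ccv_incr_1 (csn a) _)), csum_cv, (csm_le a b); auto. }
  apply (Ccv_Cmod_le _ _ _) with (2 := Hc). intros n.
  eapply Rle_trans; [apply csn_Cmod|].
  eapply Rle_trans; [apply (sum_Rle _ b); intros; apply H|].
  apply Series_partial_le; [|exact Hb].
  intros k. eapply Rle_trans; [apply Cmod_ge_0|apply H].
Qed.

Lemma csum_0 : csum (fun _ => RtoC 0) = RtoC 0.
Proof.
  apply csum_unique. apply (Ccv_ext (fun _ => RtoC 0)); [|apply Ccv_const].
  induction n; simpl; [reflexivity|]. rewrite <- IHn. ring.
Qed.

Lemma csm_0 : csm (fun _ => RtoC 0).
Proof.
  apply (ex_series_ext (fun n => 0 * (/ 2) ^ n)).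
  - intros n. rewrite Cmod_0. apply Rmult_0_l.
  - apply (ex_series_scal_l (V := R_NormedModule) 0), ex_series_geom.
    rewrite Rabs_pos_eq; lra.
Qed.

Lemma csm_csn (f : nat -> nat -> C) (J : nat) :
  (forall j, csm (fun i => f i j)) -> csm (fun i => csn (f i) J).
Proof.
  intros H. induction J; simpl; [apply csm_0|now apply csm_plus].
Qed.

Lemma csum_csn (f : nat -> nat -> C) (J : nat) :
  (forall j, csm (fun i => f i j)) ->
  csum (fun i => csn (f i) J) = csn (fun j => csum (fun i => f i j)) J.
Proof.
  intros H. induction J; simpl; [apply csum_0|].
  rewrite csum_plus, IHJ; auto. now apply csm_csn.
Qed.

Lemma csn_shift_tail (a : nat -> C) (n : nat) :
  csm a -> (csum a - csn a n = csum (fun k => a (n + k)%nat))%C.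
Proof.
  intros H. revert a H. induction n; intros a H; simpl; [unfold Cminus; ring_simplify; reflexivity|].
  assert (Hs : csm (fun k => a (n + k)%nat)).
  { clear IHn. apply (ex_series_incr_n (V := R_NormedModule) (fun k => Cmod (a k)) n) in H. exact H. }
  replace (csum a - (csn a n + a n))%C with ((csum a - csn a n) - a n)%C by ring.
  rewrite IHn by exact H. rewrite csum_S by exact Hs. rewrite Nat.add_0_r.
  rewrite (csum_ext (fun k => a (n + S k)%nat) (fun k => a (S (n + k))))
    by (intros; f_equal; lia).
  ring.
Qed.

Lemma ex_series_shift (b : nat -> R) (n : nat) :
  ex_series b -> ex_series (fun k => b (n + k)%nat).
Proof. apply (ex_series_incr_n (V := R_NormedModule) b n). Qed.

Lemma Series_tail_lim (b : nat -> R) :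
  ex_series b -> is_lim_seq (fun n => Series (fun k => b (n + k)%nat)) 0.
Proof.
  intros Hb. apply is_lim_seq_incr_1.
  apply (is_lim_seq_ext (fun n => Series b - sum_f_R0 b n)).
  - intros n. rewrite (Series_incr_n b (S n)) by (auto; lia). simpl pred.
    simpl. ring.
  - replace (Finite 0) with (Finite (Series b - Series b)) by (f_equal; ring).
    apply is_lim_seq_minus'; [apply is_lim_seq_const|].
    apply is_series_partial, Series_correct, Hb.
Qed.

(** For finitely many columns the exchange is linearity; the remaining columns contribute at most
    [Series al] times a tail of [Series be]. A product majorant is available for every double sum
    exchanged below. *)
Lemma csum_fubini (a : nat -> nat -> C) (al be : nat -> R) :
  (forall i j, Cmod (a i j) <= al i * be j) ->
  (forall i, 0 <= al i) -> (forall j, 0 <= be j) ->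
  ex_series al -> ex_series be ->
  csum (fun i => csum (a i)) = csum (fun j => csum (fun i => a i j)).
Proof.
  intros H Hal Hbe Sal Sbe.
  assert (R1 : forall i, csm (a i)).
  { intros i. apply (csm_le _ (fun j => al i * be j)); [apply H|].
    now apply (ex_series_scal_l (V := R_NormedModule) (al i)). }
  assert (R2 : forall j, csm (fun i => a i j)).
  { intros j. apply (csm_le _ (fun i => al i * be j)); [intros; apply H|].
    now apply (ex_series_scal_r (be j)). }
  assert (R3 : csm (fun i => csum (a i))).
  { apply (csm_le _ (fun i => al i * Series be)); [|now apply (ex_series_scal_r (Series be))].
    intros i. rewrite <- Series_scal_l. apply csum_Cmod; [apply H|].
    now apply (ex_series_scal_l (V := R_NormedModule) (al i)). }
  symmetry. apply csum_unique.
  apply (Ccv_squeeze _ _ (fun J => Series al * Series (fun k => be (J + k)%nat))).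
  - intros J. rewrite <- csum_csn by exact R2.
    rewrite Cmod_sub_sym, <- csum_minus by (auto; now apply csm_csn).
    rewrite Rmult_comm, <- Series_scal_l.
    apply csum_Cmod.
    + intros i. rewrite csn_shift_tail by auto.
      rewrite Rmult_comm, <- Series_scal_l. apply csum_Cmod; [intros; apply H|].
      apply (ex_series_scal_l (V := R_NormedModule) (al i)). now apply ex_series_shift.
    + now apply (ex_series_scal_l (V := R_NormedModule) _ al).
  - replace (Finite 0) with (Rbar_mult (Series al) 0) by (simpl; f_equal; ring).
    apply is_lim_seq_scal_l. now apply Series_tail_lim.
Qed.

Lemma csm_fubini_rows (a : nat -> nat -> C) (al be : nat -> R) :
  (forall i j, Cmod (a i j) <= al i * be j) ->
  (forall i, 0 <= al i) -> ex_series al -> ex_series be ->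
  csm (fun i => csum (a i)).
Proof.
  intros H Hal Sal Sbe.
  apply (csm_le _ (fun i => al i * Series be)); [|now apply (ex_series_scal_r (Series be))].
  intros i. rewrite <- Series_scal_l. apply csum_Cmod; [apply H|].
  now apply (ex_series_scal_l (V := R_NormedModule) (al i)).
Qed.

Lemma csum_even_odd (a : nat -> C) :
  csm a -> csm (fun n => a (2 * n)%nat) -> csm (fun n => a (2 * n + 1)%nat) ->
  csum a = (csum (fun n => a (2 * n)%nat) + csum (fun n => a (2 * n + 1)%nat))%C.
Proof.
  intros H H0 H1. rewrite <- csum_plus by assumption. symmetry. apply csum_unique.
  apply (Ccv_ext (fun n => csn a (2 * n))).
  - induction n; [reflexivity|].
    replace (2 * S n)%nat with (S (S (2 * n))) by lia. cbn [csn]. rewrite IHn.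
    replace (S (2 * n)) with (2 * n + 1)%nat by lia. ring.
  - apply csum_cv in H.
    apply (is_lim_seq_subseq (fun n => Cmod (csn a n - csum a)%C) 0 (fun n => (2 * n)%nat)); [|exact H].
    apply eventually_subseq. intros n. lia.
Qed.

(** * Complex-valued functions of a real variable *)

(** Derivatives along a real parameter suffice, since complex functions are only ever differentiated
    along segments. *)
Definition cderiv (f : R -> C) (t : R) (l : C) : Prop :=
  is_derive (fun s => Re (f s)) t (Re l) /\ is_derive (fun s => Im (f s)) t (Im l).

Lemma cderiv_ext (f g : R -> C) (t : R) (l m : C) :
  (forall s, f s = g s) -> l = m -> cderiv f t l -> cderiv g t m.
Proof.
  intros H <- [H1 H2]; split; [eapply is_derive_ext; [|exact H1]|eapply is_derive_ext; [|exact H2]];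
    intros s; simpl; now rewrite H.
Qed.

Lemma cderiv_eq (f : R -> C) (t : R) (l m : C) : cderiv f t l -> l = m -> cderiv f t m.
Proof. now intros H <-. Qed.

Lemma cderiv_const (c : C) (t : R) : cderiv (fun _ => c) t (RtoC 0).
Proof. split; apply (is_derive_const (K := R_AbsRing) (V := R_NormedModule)). Qed.

Lemma cderiv_plus (f g : R -> C) (t : R) (l m : C) :
  cderiv f t l -> cderiv g t m -> cderiv (fun s => (f s + g s)%C) t (l + m)%C.
Proof.
  intros [H1 H2] [H3 H4]. split.
  - apply (is_derive_plus (K := R_AbsRing) (V := R_NormedModule)
      (fun s => Re (f s)) (fun s => Re (g s))); assumption.
  - apply (is_derive_plus (K := R_AbsRing) (V := R_NormedModule)
      (fun s => Im (f s)) (fun s => Im (g s))); assumption.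
Qed.

Lemma is_derive_mul (f g : R -> R) (t l m : R) :
  is_derive f t l -> is_derive g t m -> is_derive (fun s => f s * g s) t (l * g t + f t * m).
Proof.
  intros H1 H2. apply (is_derive_mult f g t l m H1 H2). intros; apply Rmult_comm.
Qed.

Lemma cderiv_mult (f g : R -> C) (t : R) (l m : C) :
  cderiv f t l -> cderiv g t m ->
  cderiv (fun s => (f s * g s)%C) t (l * g t + f t * m)%C.
Proof.
  intros [H1 H2] [H3 H4]. split.
  - eapply is_derive_ext with (f := fun s => Re (f s) * Re (g s) - Im (f s) * Im (g s)).
    + intros s. reflexivity.
    + replace (Re (l * g t + f t * m)%C) with
        ((Re l * Re (g t) + Re (f t) * Re m) - (Im l * Im (g t) + Im (f t) * Im m))
        by (unfold Re, Im; simpl; ring).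
      apply (is_derive_minus (K := R_AbsRing) (V := R_NormedModule)
        (fun s => Re (f s) * Re (g s)) (fun s => Im (f s) * Im (g s)));
      now apply is_derive_mul.
  - eapply is_derive_ext with (f := fun s => Re (f s) * Im (g s) + Im (f s) * Re (g s)).
    + intros s. reflexivity.
    + replace (Im (l * g t + f t * m)%C) with
        ((Re l * Im (g t) + Re (f t) * Im m) + (Im l * Re (g t) + Im (f t) * Re m))
        by (unfold Re, Im; simpl; ring).
      apply (is_derive_plus (K := R_AbsRing) (V := R_NormedModule)
        (fun s => Re (f s) * Im (g s)) (fun s => Im (f s) * Re (g s)));
      now apply is_derive_mul.
Qed.

Lemma cderiv_scal (c : C) (f : R -> C) (t : R) (l : C) :
  cderiv f t l -> cderiv (fun s => (c * f s)%C) t (c * l)%C.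
Proof.
  intros H. eapply cderiv_eq; [apply cderiv_mult; [apply cderiv_const|exact H]|]. cbv beta; ring.
Qed.

Lemma cderiv_opp (f : R -> C) (t : R) (l : C) :
  cderiv f t l -> cderiv (fun s => (- f s)%C) t (- l)%C.
Proof.
  intros H. apply (cderiv_ext (fun s => (- (1)) * f s)%C _ _ ((- (1)) * l)%C);
    [intros; ring|ring|now apply cderiv_scal].
Qed.

Lemma cderiv_minus (f g : R -> C) (t : R) (l m : C) :
  cderiv f t l -> cderiv g t m -> cderiv (fun s => (f s - g s)%C) t (l - m)%C.
Proof. intros. apply cderiv_plus; [|apply cderiv_opp]; assumption. Qed.

Lemma Cmod2 (z : C) : Re z * Re z + Im z * Im z = Cmod z * Cmod z.
Proof. pose proof (Cmod2_alt z). simpl in H. lra. Qed.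

Lemma cderiv_inv (f : R -> C) (t : R) (l : C) :
  f t <> RtoC 0 -> cderiv f t l -> cderiv (fun s => (/ f s)%C) t (- l / (f t * f t))%C.
Proof.
  intros Hf [H1 H2].
  assert (Hn : Re (f t) ^ 2 + Im (f t) ^ 2 <> 0).
  { rewrite <- Cmod2_alt. apply pow_nonzero. apply Cmod_gt_0 in Hf. lra. }
  assert (E : forall z : C, (Re z) ^ 2 + (Im z) ^ 2 <> 0 -> z <> RtoC 0).
  { intros z Hz ->. apply Hz. simpl. ring. }
  set (a := fun s => Re (f s)) in *. set (b := fun s => Im (f s)) in *.
  assert (HN : is_derive (fun s => a s ^ 2 + b s ^ 2) t
    (2 * a t * Re l + 2 * b t * Im l)).
  { apply (is_derive_plus (K := R_AbsRing) (V := R_NormedModule) (fun s => a s ^ 2) (fun s => b s ^ 2)).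
    - eapply is_derive_ext with (f := fun s => a s * a s); [intros; simpl; ring|].
      replace (2 * a t * Re l) with (Re l * a t + a t * Re l) by ring. now apply is_derive_mul.
    - eapply is_derive_ext with (f := fun s => b s * b s); [intros; simpl; ring|].
      replace (2 * b t * Im l) with (Im l * b t + b t * Im l) by ring. now apply is_derive_mul. }
  split.
  - eapply is_derive_ext with (f := fun s => a s / (a s ^ 2 + b s ^ 2)); [reflexivity|].
    replace (Re (- l / (f t * f t))%C) with
     ((Re l * (a t ^ 2 + b t ^ 2) - a t * (2 * a t * Re l + 2 * b t * Im l)) / (a t ^ 2 + b t ^ 2) ^ 2).
    + apply (is_derive_div a (fun s => a s ^ 2 + b s ^ 2)); auto.
    + unfold a, b, Re, Im in *. simpl. field. split; simpl in *; nra.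
  - eapply is_derive_ext with (f := fun s => - b s / (a s ^ 2 + b s ^ 2)); [reflexivity|].
    replace (Im (- l / (f t * f t))%C) with
     ((- Im l * (a t ^ 2 + b t ^ 2) - (- b t) * (2 * a t * Re l + 2 * b t * Im l)) / (a t ^ 2 + b t ^ 2) ^ 2).
    + apply (is_derive_div (fun s => - b s) (fun s => a s ^ 2 + b s ^ 2)); auto.
      now apply (is_derive_opp (K := R_AbsRing) (V := R_NormedModule) b).
    + unfold a, b, Re, Im in *. simpl. field. split; simpl in *; nra.
Qed.

Lemma cderiv_pow (f : R -> C) (t : R) (l : C) (n : nat) :
  cderiv f t l -> cderiv (fun s => (f s ^ S n)%C) t (INR (S n) * f t ^ n * l)%C.
Proof.
  intros H. induction n.
  - simpl. apply (cderiv_ext f _ _ l); [intros; ring|ring|exact H].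
  - apply (cderiv_eq _ _ (l * f t ^ S n + f t * (INR (S n) * f t ^ n * l))%C).
    + apply (cderiv_mult f (fun s => f s ^ S n)%C); assumption.
    + rewrite (S_INR (S n)), RtoC_plus. simpl. ring.
Qed.

Lemma cderiv_csn (F : nat -> R -> C) (F' : nat -> C) (t : R) (n : nat) :
  (forall k, (k < n)%nat -> cderiv (F k) t (F' k)) ->
  cderiv (fun s => csn (fun k => F k s) n) t (csn F' n).
Proof.
  induction n; intros H; simpl; [apply cderiv_const|].
  apply cderiv_plus; [apply IHn; auto|apply H; lia].
Qed.

Lemma cderiv_line (a b : C) (t : R) : cderiv (fun s => (a + s * b)%C) t b.
Proof.
  destruct a as [a1 a2], b as [b1 b2]. split; simpl.
  - unfold Re; simpl. auto_derive; auto. ring.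
  - unfold Im; simpl. auto_derive; auto. ring.
Qed.

Lemma cderiv_ray (u : C) (t : R) : cderiv (fun s : R => (s * u)%C) t u.
Proof.
  apply (cderiv_ext (fun s : R => (0 + s * u)%C) _ _ u);
    [intros; ring|reflexivity|apply cderiv_line].
Qed.

Lemma Re_conj_mul (D z : C) : Re (Cconj D * z)%C = Re D * Re z + Im D * Im z.
Proof. unfold Re, Im; simpl. ring. Qed.

Lemma cderiv_mvt (f f' : R -> C) (g g' : R -> R) (a b : R) :
  a <= b ->
  (forall t, a <= t <= b -> cderiv f t (f' t)) ->
  (forall t, a <= t <= b -> is_derive g t (g' t)) ->
  (forall t, a <= t <= b -> Cmod (f' t) <= g' t) ->
  Cmod (f b - f a)%C <= g b - g a.
Proof.
  intros Hab Hf Hg Hle.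
  destruct (Req_dec a b) as [<-|Hne].
  { replace (f a - f a)%C with (RtoC 0) by ring. rewrite Cmod_0. lra. }
  set (D := (f b - f a)%C).
  assert (Hg0 : 0 <= g b - g a).
  { destruct (MVT_gen g a b g') as [c [Hc E]];
      rewrite ?Rmin_left, ?Rmax_right in * by lra.
    - intros x Hx. apply Hg. lra.
    - intros x Hx. apply continuity_pt_filterlim.
      apply (ex_derive_continuous (K := R_AbsRing) (V := R_NormedModule)). eexists; apply Hg; lra.
    - rewrite E. apply Rmult_le_pos; [|lra].
      eapply Rle_trans; [apply Cmod_ge_0|apply Hle; lra]. }
  (* The mean value theorem has no complex form, so [f] is projected onto the direction [D] of its
     increment. This [phi] has nonpositive derivative because [|f'| <= g'], and its increment is
     [|D|^2 - |D| (g b - g a)]. *)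
  set (phi := fun t => Re D * Re (f t) + Im D * Im (f t) - Cmod D * g t).
  set (phi' := fun t => Re D * Re (f' t) + Im D * Im (f' t) - Cmod D * g' t).
  assert (Hphi : forall t, a <= t <= b -> is_derive phi t (phi' t)).
  { intros t Ht. destruct (Hf t Ht) as [H1 H2].
    apply (is_derive_minus (K := R_AbsRing) (V := R_NormedModule)
      (fun t => Re D * Re (f t) + Im D * Im (f t)) (fun t => Cmod D * g t)).
    - apply (is_derive_plus (K := R_AbsRing) (V := R_NormedModule)
      (fun t => Re D * Re (f t)) (fun t => Im D * Im (f t)));
      [apply (is_derive_scal (fun t => Re (f t)))|apply (is_derive_scal (fun t => Im (f t)))]; assumption.
    - apply (is_derive_scal g). auto. }
  destruct (MVT_gen phi a b phi') as [c [Hc E]];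
      rewrite ?Rmin_left, ?Rmax_right in * by lra.
  - intros x Hx. apply Hphi. lra.
  - intros x Hx. apply continuity_pt_filterlim.
    apply (ex_derive_continuous (K := R_AbsRing) (V := R_NormedModule)). eexists; apply Hphi; lra.
  - assert (Hneg : phi' c <= 0).
    { unfold phi'. rewrite <- Re_conj_mul.
      assert (Re (Cconj D * f' c)%C <= Cmod D * Cmod (f' c)).
      { eapply Rle_trans; [apply Rle_abs|]. eapply Rle_trans; [apply re_le_Cmod|].
        rewrite Cmod_mult, Cmod_conj. lra. }
      specialize (Hle c Hc). pose proof (Cmod_ge_0 D). nra. }
    assert (E2 : phi b - phi a = Cmod D * Cmod D - Cmod D * (g b - g a)).
    { unfold phi. rewrite <- Cmod2. unfold D, Re, Im; simpl. ring. }
    assert (phi b - phi a <= 0) by (rewrite E; nra).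
    pose proof (Cmod_ge_0 D).
    destruct (Rle_or_lt (Cmod D) (g b - g a)); [assumption|nra].
Qed.

Lemma cderiv_mvt_const (f f' : R -> C) (M : R) :
  (forall t, 0 <= t <= 1 -> cderiv f t (f' t)) ->
  (forall t, 0 <= t <= 1 -> Cmod (f' t) <= M) ->
  Cmod (f 1 - f 0)%C <= M.
Proof.
  intros Hf Hle.
  replace M with (M * 1 - M * 0) by ring.
  apply (cderiv_mvt f f' (fun t => M * t) (fun _ => M)); auto; try lra.
  intros t _. auto_derive; auto. ring.
Qed.

(** * The complex exponential and its Taylor series *)

Lemma Cexp_add (z w : C) : Cexp (z + w) = (Cexp z * Cexp w)%C.
Proof.
  unfold Cexp. destruct z as [a b], w as [c d]. simpl.
  rewrite exp_plus, cos_plus, sin_plus. apply C_ext; unfold Re, Im; simpl; ring.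
Qed.

Lemma Cexp_0 : Cexp (RtoC 0) = RtoC 1.
Proof. unfold Cexp. simpl. rewrite exp_0, cos_0, sin_0. apply C_ext; unfold Re, Im; simpl; ring. Qed.

Lemma Cmod_Cexp (z : C) : Cmod (Cexp z) = exp (Re z).
Proof.
  unfold Cexp. rewrite Cmod_mult, Cmod_R, Rabs_pos_eq by (left; apply exp_pos).
  replace (Cmod (cos (Im z), sin (Im z))) with 1; [ring|].
  rewrite <- sqrt_1 at 1. unfold Cmod. f_equal. simpl.
  pose proof (sin2_cos2 (Im z)). unfold Rsqr in H. lra.
Qed.

Lemma Cexp_neq_0 (z : C) : Cexp z <> RtoC 0.
Proof. apply Cmod_gt_0. rewrite Cmod_Cexp. apply exp_pos. Qed.

Lemma Cexp_opp (z : C) : Cexp (- z) = (/ Cexp z)%C.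
Proof.
  pose proof (Cexp_neq_0 z).
  replace (/ Cexp z)%C with (/ Cexp z * (Cexp (z + - z)))%C.
  - rewrite Cexp_add. field. auto.
  - replace (z + - z)%C with (RtoC 0) by ring. rewrite Cexp_0. field. auto.
Qed.

Lemma Cexp_nat (n : nat) (z : C) : Cexp (INR n * z) = (Cexp z ^ n)%C.
Proof.
  induction n.
  - simpl. replace (0 * z)%C with (RtoC 0) by ring. apply Cexp_0.
  - rewrite S_INR, RtoC_plus. replace ((INR n + 1) * z)%C with (z + INR n * z)%C by ring.
    rewrite Cexp_add, IHn. reflexivity.
Qed.

Lemma Cexp_RtoC (x : R) : Cexp (RtoC x) = RtoC (exp x).
Proof. unfold Cexp. simpl. rewrite cos_0, sin_0. apply C_ext; unfold Re, Im; simpl; ring. Qed.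

Lemma cderiv_Cexp (f : R -> C) (t : R) (l : C) :
  cderiv f t l -> cderiv (fun s => Cexp (f s)) t (Cexp (f t) * l)%C.
Proof.
  intros [H1 H2].
  apply (cderiv_ext (fun s => (RtoC (exp (Re (f s))) * (cos (Im (f s)), sin (Im (f s)))))%C _ _
    (RtoC (exp (Re (f t)) * Re l)%R * (cos (Im (f t)), sin (Im (f t)))
     + RtoC (exp (Re (f t))) * ((- sin (Im (f t)) * Im l)%R, (cos (Im (f t)) * Im l)%R))%C).
  - reflexivity.
  - unfold Cexp, Re, Im. destruct l as [l1 l2]; simpl. apply C_ext; unfold Re, Im; simpl; ring.
  - apply (cderiv_mult (fun s => RtoC (exp (Re (f s)))) (fun s => (cos (Im (f s)), sin (Im (f s))) : C)).
    + split; [|change (is_derive (fun _ : R => 0) t 0);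
        apply (is_derive_const (K := R_AbsRing) (V := R_NormedModule))].
      change (is_derive (fun s => exp (Re (f s))) t (exp (Re (f t)) * Re l)).
      rewrite Rmult_comm.
      apply (is_derive_comp (K := R_AbsRing) (V := R_NormedModule) exp (fun s => Re (f s))); [|exact H1].
      apply is_derive_Reals, derivable_pt_lim_exp.
    + split.
      * change (is_derive (fun s => cos (Im (f s))) t (- sin (Im (f t)) * Im l)).
        rewrite Rmult_comm.
        apply (is_derive_comp (K := R_AbsRing) (V := R_NormedModule) cos (fun s => Im (f s))); [|exact H2].
        apply is_derive_Reals, derivable_pt_lim_cos.
      * change (is_derive (fun s => sin (Im (f s))) t (cos (Im (f t)) * Im l)).
        rewrite Rmult_comm.
        apply (is_derive_comp (K := R_AbsRing) (V := R_NormedModule) sin (fun s => Im (f s))); [|exact H2].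
        apply is_derive_Reals, derivable_pt_lim_sin.
Qed.

Definition exp_term (u : C) (k : nat) : C := (u ^ k / INR (fact k))%C.

Lemma INR_fact_neq (k : nat) : RtoC (INR (fact k)) <> RtoC 0.
Proof. intros H. apply RtoC_inj in H. now apply (INR_fact_neq_0 k). Qed.

(** Along the ray [t u] the derivative of a Taylor remainder is [u] times the remainder of the
    preceding order, so the bound follows by induction from [cderiv_mvt]. *)
Lemma Cexp_taylor (n : nat) (u : C) :
  Cmod (Cexp u - csn (exp_term u) n)%C <= Cmod u ^ n / INR (fact n) * exp (Cmod u).
Proof.
  revert u. induction n; intros u.
  - simpl. replace (Cexp u - 0)%C with (Cexp u) by ring. rewrite Cmod_Cexp.
    replace (1 / 1 * exp (Cmod u)) with (exp (Cmod u)) by field.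
    destruct (Req_dec (Re u) (Cmod u)) as [->|E]; [lra|]. left. apply exp_increasing.
    pose proof (re_le_Cmod u). pose proof (Rle_abs (Re u)). lra.
  - pose proof (Cmod_ge_0 u) as Hu.
    pose proof (INR_fact_lt_0 n) as Hn.
    set (f := fun t : R => (Cexp (t * u) - csn (exp_term (t * u)) (S n))%C).
    set (g := fun t => Cmod u ^ S n * t ^ S n / INR (fact (S n)) * exp (Cmod u)).
    replace (Cexp u - csn (exp_term u) (S n))%C with (f 1 - f 0)%C.
    + replace (Cmod u ^ S n / INR (fact (S n)) * exp (Cmod u)) with (g 1 - g 0).
      2:{ unfold g. simpl pow. rewrite pow1. field. apply INR_fact_neq_0. }
      apply (cderiv_mvt f (fun t => u * (Cexp (t * u) - csn (exp_term (t * u)) n))%C g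
         (fun t => Cmod u ^ S n * t ^ n / INR (fact n) * exp (Cmod u))); [lra| | |].
      * intros t _.
        assert (Hl : cderiv (fun s : R => (s * u)%C) t u).
        { apply cderiv_ray. }
        eapply cderiv_eq; [apply cderiv_minus; [apply cderiv_Cexp, Hl|]|].
        -- apply (cderiv_csn (fun k s => exp_term (s * u)%C k)
             (fun k => match k with O => RtoC 0 | S k => u * exp_term (t * u)%C k end)%C).
           intros [|k] _.
           ++ unfold exp_term. simpl. apply cderiv_const.
           ++ unfold exp_term.
              apply (cderiv_ext (fun s : R => / INR (fact (S k)) * (s * u) ^ S k)%C _ _
                (/ INR (fact (S k)) * (INR (S k) * (t * u) ^ k * u))%C).
              ** intros s. unfold Cdiv. ring.
              ** rewrite fact_simpl, mult_INR, RtoC_mult. field.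
                 split; [apply INR_fact_neq|]. intros E; apply RtoC_inj in E. now apply not_0_INR in E.
              ** apply cderiv_scal, cderiv_pow, Hl.
        -- rewrite csn_S_first. rewrite csn_scal. ring.
      * intros t _. unfold g. auto_derive; [auto|].
        replace (fact n + n * fact n)%nat with (fact (S n)) by (simpl; lia).
        change (match n with O => 1 | S _ => INR n + 1 end) with (INR (S n)).
        rewrite fact_simpl, mult_INR. simpl pow. field.
        split; [apply INR_fact_neq_0|now apply not_0_INR].
      * intros t Ht. rewrite Cmod_mult.
        eapply Rle_trans; [apply Rmult_le_compat_l; [exact Hu|apply IHn]|].
        rewrite Cmod_mult, Cmod_R, Rabs_pos_eq, Rpow_mult_distr by lra.
        assert (exp (t * Cmod u) <= exp (Cmod u)).
        { destruct (Req_dec (t * Cmod u) (Cmod u)) as [->|]; [lra|].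
          left; apply exp_increasing. nra. }
        assert (0 <= t ^ n * Cmod u ^ n / INR (fact n)).
        { apply Rmult_le_pos; [apply Rmult_le_pos; apply pow_le; lra|left; now apply Rinv_0_lt_compat]. }
        replace (Cmod u ^ S n * t ^ n / INR (fact n) * exp (Cmod u))
          with (Cmod u * (t ^ n * Cmod u ^ n / INR (fact n) * exp (Cmod u)))
          by (simpl; unfold Rdiv; ring).
        apply Rmult_le_compat_l; [exact Hu|]. now apply Rmult_le_compat_l.
    + unfold f.
      rewrite (csn_S_first (exp_term (0 * u))).
      replace (1 * u)%C with u by ring. replace (0 * u)%C with (RtoC 0) by ring.
      replace (csn (fun k : nat => exp_term 0 (S k)) n) with (RtoC 0).
      * rewrite Cexp_0. unfold exp_term at 2. simpl. field.
      * clear. induction n; simpl; [reflexivity|]. rewrite <- IHn. unfold exp_term. simpl. unfold Cdiv. ring.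
Qed.

Lemma is_lim_exp_term (x : R) : is_lim_seq (fun n => x ^ n / INR (fact n)) 0.
Proof.
  pose proof (is_exp_Reals x) as H. 
  apply is_lim_seq_ext with (u := fun n => / INR (fact n) * x ^ n); [intros; unfold Rdiv; ring|].
  apply ex_series_lim_0. exists (exp x). now apply is_pseries_R.
Qed.

Lemma ex_series_exp (x : R) : ex_series (fun n => x ^ n / INR (fact n)).
Proof.
  pose proof (is_exp_Reals x) as H. exists (exp x).
  apply is_pseries_R in H. revert H. apply is_series_ext. intros; unfold Rdiv; apply Rmult_comm.
Qed.

Lemma Series_exp (x : R) : Series (fun n => x ^ n / INR (fact n)) = exp x.
Proof.
  apply is_series_unique. pose proof (is_exp_Reals x) as H.
  apply is_pseries_R in H. revert H. apply is_series_ext. intros; unfold Rdiv; apply Rmult_comm.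
Qed.

Lemma Cmod_exp_term (u : C) (k : nat) : Cmod (exp_term u k) = Cmod u ^ k / INR (fact k).
Proof.
  unfold exp_term. rewrite Cmod_div, Cmod_pow, Cmod_R, Rabs_pos_eq.
  - reflexivity.
  - apply pos_INR.
  - apply INR_fact_neq.
Qed.

Lemma csm_exp_term (u : C) : csm (exp_term u).
Proof.
  apply (csm_le _ (fun n => Cmod u ^ n / INR (fact n))); [|apply ex_series_exp].
  intros n. rewrite Cmod_exp_term. lra.
Qed.

Lemma csum_exp_term (u : C) : csum (exp_term u) = Cexp u.
Proof.
  apply csum_unique.
  apply (Ccv_squeeze _ _ (fun n => Cmod u ^ n / INR (fact n) * exp (Cmod u))).
  - intros n. rewrite Cmod_sub_sym. apply Cexp_taylor.
  - replace (Finite 0) with (Rbar_mult 0 (exp (Cmod u))) by (simpl; f_equal; ring).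
    apply is_lim_seq_scal_r, is_lim_exp_term.
Qed.

(** * The partial fraction expansion of the squared cosecant *)

Lemma RtoC_neq (x y : R) : x <> y -> RtoC x <> RtoC y.
Proof. intros H E. now apply RtoC_inj in E. Qed.

Lemma sum_f_R0_telescope (u : nat -> R) (n : nat) :
  sum_f_R0 (fun k => u k - u (S k)) n = u O - u (S n).
Proof. induction n; simpl; [ring|rewrite IHn; ring]. Qed.

Lemma lim_inv_S : is_lim_seq (fun n => / (INR n + 1)) 0.
Proof.
  apply (is_lim_seq_inv (fun n => INR n + 1) p_infty).
  - eapply is_lim_seq_plus; [apply is_lim_seq_INR|apply is_lim_seq_const|reflexivity].
  - discriminate.
Qed.

Lemma ex_series_inv_sq : ex_series (fun n => / (INR n + 1) ^ 2).
Proof.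
  (* A telescoping majorant. *)
  apply (ex_series_nonneg_le _ (fun n => 2 * (/ (INR n + 1) - / (INR (S n) + 1)))).
  - intros n. pose proof (pos_INR n). split.
    + left. apply Rinv_0_lt_compat. nra.
    + rewrite S_INR. apply Rminus_le_0.
      replace (2 * (/ (INR n + 1) - / (INR n + 1 + 1)) - / (INR n + 1) ^ 2)
        with (INR n * / ((INR n + 1) ^ 2 * (INR n + 2))) by (field; lra).
      apply Rmult_le_pos; [lra|]. left. apply Rinv_0_lt_compat. nra.
  - apply (ex_series_scal_l (V := R_NormedModule) 2).
    exists (/ (INR 0 + 1) - 0). apply partial_is_series.
    apply (is_lim_seq_ext (fun n => / (INR 0 + 1) - / (INR (S n) + 1))).
    + intros n. symmetry. apply (sum_f_R0_telescope (fun n => / (INR n + 1))).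
    + apply is_lim_seq_minus'; [apply is_lim_seq_const|].
      apply (is_lim_seq_incr_1 (fun n => / (INR n + 1))), lim_inv_S.
Qed.

Lemma pow_le_one (x : R) (n : nat) : 0 <= x <= 1 -> x ^ n <= 1.
Proof. intros H. rewrite <- (pow1 n). apply pow_incr. exact H. Qed.

Lemma csm_inv_pow (z : C) (k : nat) :
  (2 <= k)%nat -> csm (fun n => (/ (z + INR n)) ^ k)%C.
Proof.
  intros Hk.
  destruct (nfloor_ex (Cmod z)) as [N [_ HN]]; [apply Cmod_ge_0|].
  (* From index [N + 2 > |z| + 1] on, the denominators have modulus at least [n + 1]. Finitely many
     terms are skipped, possibly including one with the default inverse of 0. *)
  apply (ex_series_incr_n (V := R_NormedModule) _ (N + 2)).
  apply (ex_series_nonneg_le _ (fun n => / (INR n + 1) ^ 2)); [|apply ex_series_inv_sq].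
  intros n. split; [apply Cmod_ge_0|].
  pose proof (pos_INR n). pose proof (Cmod_ge_0 z).
  assert (Hb : INR n + 1 <= Cmod (z + INR (N + 2 + n))%C).
  { pose proof (Cmod_triangle_rev (INR (N + 2 + n)) (- z)%C) as H1.
    rewrite Cmod_opp, Cmod_R, Rabs_pos_eq in H1 by apply pos_INR.
    replace (INR (N + 2 + n) - - z)%C with (z + INR (N + 2 + n))%C in H1 by ring.
    rewrite !plus_INR in H1. simpl (INR 2) in H1. rewrite !plus_INR. simpl (INR 2). lra. }
  assert (Hne : (z + INR (N + 2 + n))%C <> RtoC 0) by (apply Cmod_gt_0; lra).
  rewrite Cmod_pow, Cmod_inv by exact Hne.
  replace k with (2 + (k - 2))%nat by lia. rewrite pow_add.
  assert (0 < / Cmod (z + INR (N + 2 + n))%C <= / (INR n + 1)).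
  { split; [apply Rinv_0_lt_compat; lra|apply Rinv_le_contravar; lra]. }
  assert (/ (INR n + 1) <= 1) by (rewrite <- Rinv_1; apply Rinv_le_contravar; lra).
  rewrite <- pow_inv.
  apply Rle_trans with ((/ Cmod (z + INR (N + 2 + n))%C) ^ 2 * 1).
  - apply Rmult_le_compat_l; [apply pow_le; lra|apply pow_le_one; lra].
  - rewrite Rmult_1_r. apply pow_incr. lra.
Qed.

Lemma csm_inv_pow_left (z : C) (k : nat) :
  (2 <= k)%nat -> csm (fun n => (/ (z - INR (S n))) ^ k)%C.
Proof.
  intros Hk. apply (ex_series_ext (fun n => Cmod ((/ (1 - z + INR n)) ^ k)%C)).
  - intros n. rewrite S_INR, RtoC_plus.
    replace (z - (INR n + 1))%C with (- (1 - z + INR n))%C by ring.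
    rewrite !Cmod_pow. f_equal.
    destruct (Ceq_dec (1 - z + INR n)%C 0) as [E|E].
    + rewrite E. f_equal. f_equal. ring.
    + rewrite !Cmod_inv, Cmod_opp; auto.
      intros E1. apply E. replace (1 - z + INR n)%C with (- - (1 - z + INR n))%C by ring.
      rewrite E1. ring.
  - now apply csm_inv_pow.
Qed.

(** [eis k z] is the sum of [(z + m)^(-k)] over all integers [m]. *)
Definition eis (k : nat) (z : C) : C :=
  (csum (fun n => (/ (z + INR n)) ^ k) + csum (fun n => (/ (z - INR (S n))) ^ k))%C.

Definition nonint (z : C) : Prop := forall k : Z, z <> RtoC (IZR k).

Lemma nonint_plus (z : C) (k : Z) : nonint z -> (z + IZR k)%C <> RtoC 0.
Proof.
  intros H E. apply (H (- k)%Z). rewrite opp_IZR, RtoC_opp.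
  replace z with ((z + IZR k) - IZR k)%C by ring. rewrite E. ring.
Qed.

Lemma nonint_plus_nat (z : C) (n : nat) : nonint z -> (z + INR n)%C <> RtoC 0.
Proof. rewrite INR_IZR_INZ. apply nonint_plus. Qed.

Lemma nonint_minus_nat (z : C) (n : nat) : nonint z -> (z - INR n)%C <> RtoC 0.
Proof.
  intros H. unfold Cminus. rewrite INR_IZR_INZ, <- RtoC_opp, <- opp_IZR. now apply nonint_plus.
Qed.

Lemma nonint_shift (z : C) (k : Z) : nonint z -> nonint (z + IZR k)%C.
Proof.
  intros H m E. apply (H (m - k)%Z). rewrite minus_IZR, RtoC_minus, <- E. ring.
Qed.

Lemma nonint_half (z : C) : nonint z -> nonint (z / 2)%C.
Proof.
  intros H k E. apply (H (2 * k)%Z). rewrite mult_IZR, RtoC_mult, <- E. field.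
Qed.

Lemma nonint_Im (z : C) : Im z <> 0 -> nonint z.
Proof. intros H k E. apply H. now rewrite E. Qed.

Lemma eis_shift (k : nat) (z : C) : (2 <= k)%nat -> eis k (z + 1) = eis k z.
Proof.
  intros Hk. unfold eis.
  rewrite (csum_S (fun n => (/ (z + INR n)) ^ k)%C) by now apply csm_inv_pow.
  rewrite (csum_S (fun n => (/ (z + 1 - INR (S n))) ^ k)%C) by now apply csm_inv_pow_left.
  rewrite (csum_ext (fun n => (/ (z + 1 + INR n)) ^ k)%C (fun n => (/ (z + INR (S n))) ^ k)%C).
  2:{ intros n. rewrite S_INR, RtoC_plus. do 2 f_equal. ring. }
  rewrite (csum_ext (fun n => (/ (z + 1 - INR (S (S n)))) ^ k)%C (fun n => (/ (z - INR (S n))) ^ k)%C).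
  2:{ intros n. rewrite (S_INR (S n)), RtoC_plus. do 2 f_equal. ring. }
  replace (z + 1 - INR 1)%C with z by (simpl; ring).
  replace (z + INR 0)%C with z by (simpl; ring). ring.
Qed.

Lemma INR_double (n : nat) : INR (2 * n) = 2 * INR n.
Proof. rewrite mult_INR. simpl. ring. Qed.

Lemma INR_double_1 (n : nat) : INR (2 * n + 1) = 2 * INR n + 1.
Proof. rewrite plus_INR, mult_INR. simpl. ring. Qed.

Lemma RtoC_2_neq : RtoC 2 <> RtoC 0.
Proof. apply RtoC_neq; lra. Qed.

(** The two sums are the even and the odd part of the third: [z/2 + n = (z + 2n)/2] and
    [(z+1)/2 + n = (z + 2n + 1)/2]. *)
Lemma csum_half_right (z : C) : nonint z ->
  (csum (fun n => (/ (z / 2 + INR n)) ^ 2) + csum (fun n => (/ ((z + 1) / 2 + INR n)) ^ 2)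
   = 4 * csum (fun n => (/ (z + INR n)) ^ 2))%C.
Proof.
  intros H.
  assert (E0 : forall n, ((/ (z / 2 + INR n)) ^ 2 = 4 * (/ (z + INR (2 * n)%nat)) ^ 2)%C).
  { intros n. pose proof (nonint_plus_nat z (2 * n) H) as Hn. rewrite INR_double, RtoC_mult in *.
    replace (z / 2 + INR n)%C with ((z + 2 * INR n) / 2)%C by (field; apply RtoC_2_neq).
    field. auto. }
  assert (E1 : forall n, ((/ ((z + 1) / 2 + INR n)) ^ 2 = 4 * (/ (z + INR (2 * n + 1)%nat)) ^ 2)%C).
  { intros n. pose proof (nonint_plus_nat z (2 * n + 1) H) as Hn.
    rewrite INR_double_1, RtoC_plus, RtoC_mult in *.
    replace ((z + 1) / 2 + INR n)%C with ((z + (2 * INR n + 1)) / 2)%C by (field; apply RtoC_2_neq).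
    field. auto. }
  pose proof (csm_inv_pow z 2 (le_n 2)) as S.
  assert (S0 : csm (fun n => (/ (z + INR (2 * n)%nat)) ^ 2)%C).
  { apply (csm_ext (fun n => / 4 * (/ (z / 2 + INR n)) ^ 2)%C).
    - intros n. rewrite E0. field. now apply nonint_plus_nat.
    - apply csm_scal, csm_inv_pow; lia. }
  assert (S1 : csm (fun n => (/ (z + INR (2 * n + 1)%nat)) ^ 2)%C).
  { apply (csm_ext (fun n => / 4 * (/ ((z + 1) / 2 + INR n)) ^ 2)%C).
    - intros n. rewrite E1. field. now apply nonint_plus_nat.
    - apply csm_scal, csm_inv_pow; lia. }
  rewrite (csum_even_odd (fun n => (/ (z + INR n)) ^ 2)%C) by assumption.
  rewrite (csum_ext _ _ E0), (csum_ext _ _ E1), !csum_scal by assumption. ring.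
Qed.

Lemma Cinv_opp (z : C) : (/ - z = - / z)%C.
Proof.
  destruct (Ceq_dec z 0) as [->|H].
  - replace (- (0))%C with (RtoC 0) by ring.
    unfold Cinv. apply C_ext; unfold Re, Im; simpl; unfold Rdiv;
      rewrite ?Ropp_0, ?Rmult_0_l; simpl; ring.
  - field. exact H.
Qed.

(** The reflection of [z] to [1 - z] reduces the negative half of [eis 2] to the positive half. *)
Lemma csum_left_right (z : C) :
  csum (fun n => (/ (z - INR (S n))) ^ 2)%C = csum (fun n => (/ (1 - z + INR n)) ^ 2)%C.
Proof.
  apply csum_ext. intros n. rewrite S_INR, RtoC_plus.
  replace (z - (INR n + 1))%C with (- (1 - z + INR n))%C by ring.
  rewrite Cinv_opp. ring.
Qed.

Lemma eis2_half (z : C) : nonint z ->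
  (eis 2 (z / 2) + eis 2 ((z + 1) / 2) = 4 * eis 2 z)%C.
Proof.
  intros H. unfold eis. rewrite !csum_left_right.
  assert (H' : nonint (1 - z)%C).
  { intros k E. apply (H (1 - k)%Z). rewrite minus_IZR, RtoC_minus, <- E. ring. }
  pose proof (csum_half_right z H) as E1. pose proof (csum_half_right (1 - z)%C H') as E2.
  replace ((1 - z) / 2)%C with (1 - (z + 1) / 2)%C in E2 by (field; apply RtoC_2_neq).
  replace ((1 - z + 1) / 2)%C with (1 - z / 2)%C in E2 by (field; apply RtoC_2_neq).
  rewrite !Cmult_plus_distr_l, <- E1, <- E2. ring.
Qed.

Lemma Ci_sq : (Ci * Ci)%C = (- (1))%C.
Proof. apply C_ext; unfold Re, Im, Ci; simpl; ring. Qed.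

Lemma Ci_neq_0 : Ci <> RtoC 0.
Proof. intros E. apply (f_equal Im) in E. unfold Im in E; simpl in E. lra. Qed.

Lemma RPI_neq_0 : RtoC PI <> RtoC 0.
Proof. apply RtoC_neq. pose proof PI_RGT_0. lra. Qed.

(** This is [pi^2 / sin^2(pi z)], since [sin^2(pi z) = -(1 - q)^2 / (4 q)]. In this form it expands
    in powers of [q] at once. *)
Definition csc2 (z : C) : C := (- (4 * PI ^ 2) * q_param z / (1 - q_param z) ^ 2)%C.

Lemma q_param_plus (z w : C) : q_param (z + w) = (q_param z * q_param w)%C.
Proof. unfold q_param. rewrite <- Cexp_add. f_equal. ring. Qed.

Lemma q_param_1 : q_param 1 = RtoC 1.
Proof.
  unfold q_param, Cexp.
  replace (Re (2 * PI * Ci * 1)%C) with 0 by (unfold Re, Ci; simpl; ring).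
  replace (Im (2 * PI * Ci * 1)%C) with (2 * PI) by (unfold Im, Ci; simpl; ring).
  rewrite exp_0, cos_2PI, sin_2PI. apply C_ext; unfold Re, Im; simpl; ring.
Qed.

Lemma q_param_half : q_param (1 / 2) = (- (1))%C.
Proof.
  unfold q_param, Cexp.
  replace (2 * PI * Ci * (1 / 2))%C with (PI * Ci)%C by (field; apply RtoC_2_neq).
  replace (Re (PI * Ci)%C) with 0 by (unfold Re, Ci; simpl; ring).
  replace (Im (PI * Ci)%C) with PI by (unfold Im, Ci; simpl; ring).
  rewrite exp_0, cos_PI, sin_PI. apply C_ext; unfold Re, Im; simpl; ring.
Qed.

Lemma q_param_eq (z : C) :
  q_param z = (exp (- (2 * PI * Im z)) * (cos (2 * PI * Re z), sin (2 * PI * Re z)))%C.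
Proof.
  unfold q_param, Cexp.
  replace (Re (2 * PI * Ci * z)%C) with (- (2 * PI * Im z)) by (unfold Re, Im, Ci; simpl; ring).
  replace (Im (2 * PI * Ci * z)%C) with (2 * PI * Re z) by (unfold Re, Im, Ci; simpl; ring).
  reflexivity.
Qed.

Lemma Cmod_q_param (z : C) : Cmod (q_param z) = exp (- (2 * PI * Im z)).
Proof.
  unfold q_param. rewrite Cmod_Cexp. f_equal. unfold Re, Im, Ci. simpl. ring.
Qed.

Lemma q_param_neq_0 (z : C) : q_param z <> RtoC 0.
Proof. apply Cexp_neq_0. Qed.

Lemma q_param_neq_1 (z : C) : nonint z -> (1 - q_param z)%C <> RtoC 0.
Proof.
  intros H E.
  assert (E1 : q_param z = RtoC 1).
  { replace (q_param z) with (1 - (1 - q_param z))%C by ring. rewrite E. ring. }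
  assert (HI : Im z = 0).
  { pose proof (f_equal Cmod E1) as E2. rewrite Cmod_q_param, Cmod_1, <- exp_0 in E2.
    apply exp_inv in E2. pose proof PI_RGT_0. nra. }
  rewrite q_param_eq, HI in E1.
  replace (- (2 * PI * 0)) with 0 in E1 by ring. rewrite exp_0 in E1.
  pose proof (f_equal Re E1) as E2. unfold Re in E2. simpl in E2.
  assert (E3 : cos (2 * (PI * fst z)) = 1).
  { replace (2 * (PI * fst z)) with (2 * PI * fst z) by ring. unfold Re in *. lra. }
  rewrite cos_2a_sin in E3.
  assert (E4 : sin (PI * fst z) = 0) by nra.
  apply sin_eq_0_0 in E4. destruct E4 as [k Hk].
  apply (H k). apply C_ext; [|exact HI]. unfold Re; simpl.
  pose proof PI_RGT_0. apply Rmult_eq_reg_l with PI; [|lra]. rewrite Hk. ring.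
Qed.

Lemma csc2_shift (z : C) : csc2 (z + 1) = csc2 z.
Proof. unfold csc2. rewrite q_param_plus, q_param_1. now rewrite Cmult_1_r. Qed.

(** With [s = q(z/2)] the shift by [1/2] replaces [s] by [-s], and
    [s/(1-s)^2 - s/(1+s)^2 = 4 s^2/(1-s^2)^2]. *)
Lemma csc2_half (z : C) : nonint z ->
  (csc2 (z / 2) + csc2 ((z + 1) / 2) = 4 * csc2 z)%C.
Proof.
  intros H.
  replace ((z + 1) / 2)%C with (z / 2 + 1 / 2)%C by (field; apply RtoC_2_neq).
  assert (E : q_param z = (q_param (z / 2) * q_param (z / 2))%C).
  { rewrite <- q_param_plus. f_equal. field. }
  pose proof (q_param_neq_1 z H) as Hn. rewrite E in Hn.
  unfold csc2. rewrite q_param_plus, q_param_half, E. set (s := q_param (z / 2)) in *.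
  assert (H1 : (1 - s)%C <> RtoC 0).
  { intros E1. apply Hn. replace (1 - s * s)%C with ((1 - s) * (1 + s))%C by ring. rewrite E1. ring. }
  assert (H2 : (1 + s)%C <> RtoC 0).
  { intros E1. apply Hn. replace (1 - s * s)%C with ((1 - s) * (1 + s))%C by ring. rewrite E1. ring. }
  replace (s * - (1))%C with (- s)%C by ring.
  replace (1 - - s)%C with (1 + s)%C by ring.
  replace (1 - s * s)%C with ((1 - s) * (1 + s))%C by ring.
  field. auto.
Qed.

Definition Csinh (v : C) : C := ((Cexp v - Cexp (- v)) / 2)%C.

(** The form in which the double pole at 0 is compared with that of [1 / z^2], by Taylor expansion
    of sinh. *)
Lemma csc2_Csinh (z : C) : nonint z ->
  csc2 z = (- (PI ^ 2) / Csinh (PI * Ci * z) ^ 2)%C /\ Csinh (PI * Ci * z) <> RtoC 0.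
Proof.
  intros H. pose proof (q_param_neq_1 z H) as Hn.
  assert (E : q_param z = (Cexp (PI * Ci * z) * Cexp (PI * Ci * z))%C).
  { rewrite <- Cexp_add. unfold q_param. f_equal. ring. }
  unfold csc2, Csinh. rewrite Cexp_opp. rewrite E in *.
  pose proof (Cexp_neq_0 (PI * Ci * z)) as H0.
  set (s := Cexp (PI * Ci * z)) in *.
  assert (Hs : (s - / s)%C <> RtoC 0).
  { intros E1. apply Hn. replace (1 - s * s)%C with (- s * (s - / s))%C by (field; auto).
    rewrite E1. ring. }
  assert (Hs2 : (s * s - 1)%C <> RtoC 0).
  { intros E1. apply Hn. replace (1 - s * s)%C with (- (s * s - 1))%C by ring.
    rewrite E1. ring. }
  split.
  - field. repeat split; auto; try apply RtoC_2_neq.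
  - intros E1. apply Hs. replace (s - / s)%C with (2 * ((s - / s) / 2))%C by (field; auto using RtoC_2_neq).
    rewrite E1. ring.
Qed.

(** A crude Jordan inequality: up to [pi/3] the derivative is at least [1/2], and beyond it
    [sin b >= sqrt 3 / 2]. *)
Lemma sin_ge_linear (b : R) : 0 <= b <= PI / 2 -> 2 / 5 * b <= sin b.
Proof.
  intros [H0 H1]. pose proof PI_4. pose proof PI_RGT_0.
  destruct (Rle_or_lt b (PI / 3)) as [Hb3|Hb3].
  - destruct (MVT_gen (fun b => sin b - 2 / 5 * b) 0 b (fun b => cos b - 2 / 5)) as [c [Hc E]];
      rewrite ?Rmin_left, ?Rmax_right in * by lra.
    + intros x Hx. auto_derive; auto. field.
    + intros x Hx. apply continuity_pt_filterlim.
      apply (ex_derive_continuous (K := R_AbsRing) (V := R_NormedModule) (fun b => sin b - 2 / 5 * b)).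
      auto_derive; auto.
    + assert (/ 2 <= cos c).
      { replace (/ 2) with (cos (PI / 3)) by (rewrite cos_PI3; field). apply cos_decr_1; lra. }
      rewrite sin_0 in E. nra.
  - assert (HS : sin (PI / 3) <= sin b) by (apply sin_incr_1; lra).
    rewrite sin_PI3 in HS.
    assert (17 / 10 <= sqrt 3).
    { apply Rsqr_incr_0_var; [|apply sqrt_pos]. rewrite Rsqr_sqrt by lra. unfold Rsqr. lra. }
    lra.
Qed.

Lemma sinh_abs_ge (a : R) : a ^ 2 / 4 <= ((exp a - exp (- a)) / 2) ^ 2.
Proof.
  assert (P : forall a, 0 <= a -> a / 2 <= (exp a - exp (- a)) / 2).
  { clear a. intros a Ha.
    pose proof (exp_ineq1_le a). pose proof (exp_ineq1_le (2 * a)) as H2.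
    assert (E : exp (2 * a) * exp (- a) = exp a) by (rewrite <- exp_plus; f_equal; ring).
    pose proof (exp_pos (- a)). pose proof (exp_pos a).
    assert (exp (- a) * (1 + 2 * a) <= exp a) by nra.
    assert (exp (- a) <= exp a / (1 + 2 * a)).
    { apply Rmult_le_reg_r with (1 + 2 * a); [lra|]. unfold Rdiv.
      rewrite Rmult_assoc, Rinv_l by lra. lra. }
    assert (exp a / (1 + 2 * a) <= exp a - a); [|lra].
    apply Rmult_le_reg_r with (1 + 2 * a); [lra|]. unfold Rdiv at 1.
    rewrite Rmult_assoc, Rinv_l by lra. nra. }
  destruct (Rle_or_lt 0 a) as [H|H].
  - specialize (P a H). nra.
  - assert (H' : 0 <= - a) by lra. specialize (P _ H'). rewrite Ropp_involutive in P. nra.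
Qed.

Lemma Csinh_lower (v : C) : Rabs (Im v) <= PI / 2 -> 2 / 5 * Cmod v <= Cmod (Csinh v).
Proof.
  intros H. apply Rsqr_incr_0_var; [|apply Cmod_ge_0]. unfold Rsqr.
  replace (2 / 5 * Cmod v * (2 / 5 * Cmod v)) with (4 / 25 * (Cmod v * Cmod v)) by field.
  rewrite <- !Cmod2.
  assert (HS : sin (Im v) ^ 2 >= 4 / 25 * Im v ^ 2).
  { destruct (Rle_or_lt 0 (Im v)) as [H0|H0].
    - rewrite Rabs_pos_eq in H by lra. pose proof (sin_ge_linear (Im v)). nra.
    - rewrite Rabs_left in H by lra. pose proof (sin_ge_linear (- Im v)) as H1.
      rewrite sin_neg in H1. nra. }
  pose proof (sinh_abs_ge (Re v)) as HC.
  unfold Csinh, Cexp. destruct v as [a b]. simpl in *. unfold Re, Im in *. simpl in *.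
  rewrite cos_neg, sin_neg.
  assert (E : exp a * exp (- a) = 1) by (rewrite <- exp_plus, Rplus_opp_r; apply exp_0).
  pose proof (sin2_cos2 b) as T. unfold Rsqr in T.
  set (p := exp a) in *. set (m := exp (- a)) in *. set (s := sin b) in *. set (c := cos b) in *.
  (* The identity [|sinh(a + i b)|^2 = sinh^2 a + sin^2 b], before [sin^2 + cos^2 = 1] and
     [exp a exp(-a) = 1] are inserted. *)
  match goal with |- _ <= ?X =>
    replace X with (((p - m) / 2) ^ 2 * (s * s + c * c) + s ^ 2 * (p * m)) by field end.
  rewrite T, E. nra.
Qed.

(** The even Taylor terms of [exp v] and [exp(-v)] cancel, leaving two third-order remainders;
    [exp 1 <= 3] gives the constant. *)
Lemma Csinh_near (v : C) : Cmod v <= 1 -> Cmod (Csinh v - v)%C <= Cmod v ^ 3 / 2.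
Proof.
  intros H. pose proof (Cmod_ge_0 v) as H0.
  pose proof (Cexp_taylor 3 v) as T1. pose proof (Cexp_taylor 3 (- v)%C) as T2.
  rewrite Cmod_opp in T2.
  set (d1 := (Cexp v - csn (exp_term v) 3)%C) in *.
  set (d2 := (Cexp (- v) - csn (exp_term (- v)) 3)%C) in *.
  assert (E : (Csinh v - v)%C = ((d1 - d2) / 2)%C).
  { unfold d1, d2, Csinh, exp_term. simpl. field.
    repeat split; apply RtoC_neq; lra. }
  rewrite E. rewrite Cmod_div by apply RtoC_2_neq. rewrite Cmod_R, (Rabs_pos_eq 2) by lra.
  pose proof (Cmod_triangle_sub d1 d2).
  assert (He : exp (Cmod v) <= 3).
  { apply Rle_trans with (exp 1); [|apply exp_le_3].
    destruct (Req_dec (Cmod v) 1) as [->|]; [lra|]. left; apply exp_increasing; lra. }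
  replace (INR (fact 3)) with 6 in * by (simpl; ring).
  assert (0 <= Cmod v ^ 3) by (apply pow_le; lra).
  pose proof (exp_pos (Cmod v)).
  assert (Cmod v ^ 3 / 6 * exp (Cmod v) <= Cmod v ^ 3 / 2) by nra. lra.
Qed.

(** Cancellation of the double poles. For [|v| <= 1] the quotient [(sinh v - v)(sinh v + v) / (v^2
    sinh^2 v)] is at most [(3/2) / (4/25) < 10]; for [|v| > 1] the two terms are at most [1] and
    [25/4]. *)
Lemma inv_sq_Csinh (v : C) : v <> RtoC 0 -> Csinh v <> RtoC 0 -> Rabs (Im v) <= PI / 2 ->
  Cmod (/ v ^ 2 - / Csinh v ^ 2)%C <= 10.
Proof.
  intros Hv HS H. pose proof (Csinh_lower v H) as L.
  assert (P : 0 < Cmod v) by now apply Cmod_gt_0.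
  assert (PS : 0 < Cmod (Csinh v)) by now apply Cmod_gt_0.
  assert (N : forall x : C, x <> RtoC 0 -> (x ^ 2)%C <> RtoC 0).
  { intros x Hx. apply Cpow_nz. exact Hx. }
  destruct (Rle_or_lt (Cmod v) 1) as [H1|H1].
  - pose proof (Csinh_near v H1) as B.
    replace (/ v ^ 2 - / Csinh v ^ 2)%C with
      ((Csinh v - v) * (Csinh v - v + 2 * v) / (v ^ 2 * Csinh v ^ 2))%C by (field; auto).
    rewrite Cmod_div by (apply Cmult_neq_0; auto).
    rewrite !Cmod_mult, !Cmod_pow.
    assert (B2 : Cmod (Csinh v - v + 2 * v)%C <= 3 * Cmod v).
    { eapply Rle_trans; [apply Cmod_triangle|].
      rewrite Cmod_mult, Cmod_R, Rabs_pos_eq by lra.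
      assert (Cmod v ^ 3 <= Cmod v) by (simpl; nra). lra. }
    assert (0 < Cmod v ^ 2 * Cmod (Csinh v) ^ 2).
    { apply Rmult_lt_0_compat; apply pow_lt; lra. }
    apply Rmult_le_reg_r with (Cmod v ^ 2 * Cmod (Csinh v) ^ 2); [assumption|].
    unfold Rdiv. rewrite Rmult_assoc, Rinv_l, Rmult_1_r by lra.
    apply Rle_trans with (Cmod v ^ 3 / 2 * (3 * Cmod v)).
    + apply Rmult_le_compat; try apply Cmod_ge_0; assumption.
    + assert ((2 / 5 * Cmod v) ^ 2 <= Cmod (Csinh v) ^ 2) by (apply pow_incr; lra).
      apply Rle_trans with (10 * (Cmod v ^ 2 * (2 / 5 * Cmod v) ^ 2)); [assert (0 <= Cmod v ^ 4) by (apply pow_le; lra); simpl in *; lra|].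
      apply Rmult_le_compat_l; [lra|]. apply Rmult_le_compat_l; [apply pow_le; lra|assumption].
  - eapply Rle_trans; [apply Cmod_triangle_sub|].
    rewrite !Cmod_inv, !Cmod_pow by auto.
    assert (/ Cmod v ^ 2 <= / 1 ) by (apply Rinv_le_contravar; nra).
    assert (/ Cmod (Csinh v) ^ 2 <= / (4 / 25)) by (apply Rinv_le_contravar; nra). lra.
Qed.

(** * Herglotz' trick *)

Definition herglotz (z : C) : C := (eis 2 z - csc2 z)%C.

Lemma herglotz_shift_nat (z : C) (n : nat) : herglotz (z + INR n) = herglotz z.
Proof.
  induction n.
  - simpl. f_equal. ring.
  - rewrite S_INR, RtoC_plus, Cplus_assoc, <- IHn. unfold herglotz.
    rewrite eis_shift by lia. now rewrite csc2_shift.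
Qed.

Lemma herglotz_shift (z : C) (k : Z) : herglotz (z + IZR k) = herglotz z.
Proof.
  destruct (Z_le_gt_dec 0 k) as [H|H].
  - rewrite <- (Z2Nat.id k), <- INR_IZR_INZ by lia. apply herglotz_shift_nat.
  - rewrite <- (herglotz_shift_nat (z + IZR k) (Z.to_nat (- k))), INR_IZR_INZ, Z2Nat.id by lia.
    rewrite opp_IZR, RtoC_opp. f_equal. ring.
Qed.

Definition strip_const : R := 2 * Series (fun n => / (INR n + / 2) ^ 2).

Lemma ex_series_strip : ex_series (fun n => / (INR n + / 2) ^ 2).
Proof.
  apply (ex_series_nonneg_le _ (fun n => 4 * / (INR n + 1) ^ 2)).
  - intros n. pose proof (pos_INR n). split; [left; apply Rinv_0_lt_compat; nra|].
    apply Rmult_le_reg_r with ((INR n + / 2) ^ 2); [nra|].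
    rewrite Rinv_l by nra.
    apply Rmult_le_reg_r with ((INR n + 1) ^ 2); [nra|]. field_simplify; nra.
  - apply (ex_series_scal_l (V := R_NormedModule) 4), ex_series_inv_sq.
Qed.

Lemma strip_far (z : C) (n : nat) : Rabs (Re z) <= / 2 ->
  INR n + / 2 <= Cmod (z + INR (S n))%C /\ INR n + / 2 <= Cmod (z - INR (S n))%C.
Proof.
  intros H. apply Rabs_le_between in H. pose proof (pos_INR n). rewrite S_INR.
  split; (eapply Rle_trans; [|apply re_le_Cmod]).
  - replace (Re (z + (INR n + 1)%R)%C) with (Re z + (INR n + 1)) by reflexivity.
    rewrite Rabs_pos_eq; lra.
  - replace (Re (z - (INR n + 1)%R)%C) with (Re z - (INR n + 1)) by reflexivity.
    rewrite Rabs_left1; lra.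
Qed.

(** By periodicity the strip [|Re z| <= 1/2] suffices. There the only pole is 0, removed by
    [inv_sq_Csinh], and all other terms of [eis 2] are dominated by [(n + 1/2)^-2]. *)
Lemma herglotz_bounded : exists M, forall z, nonint z -> Cmod (herglotz z) <= M.
Proof.
  exists (strip_const + 10 * PI ^ 2).
  assert (P : forall z, nonint z -> Rabs (Re z) <= / 2 ->
    Cmod (herglotz z) <= strip_const + 10 * PI ^ 2).
  { intros z Hz HR.
    assert (Hz0 : z <> RtoC 0) by apply (Hz 0%Z).
    unfold herglotz, eis.
    rewrite (csum_S (fun n => (/ (z + INR n)) ^ 2)%C) by (apply csm_inv_pow; lia).
    destruct (csc2_Csinh z Hz) as [E Hs]. rewrite E.
    set (v := (PI * Ci * z)%C) in *.
    pose proof RPI_neq_0 as Hpi. pose proof Ci_neq_0 as Hci.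
    assert (E2 : ((/ (z + INR 0)) ^ 2 = - PI ^ 2 * / v ^ 2)%C).
    { unfold v. replace (z + INR 0)%C with z by (simpl; ring).
      replace ((PI * Ci * z) ^ 2)%C with (PI ^ 2 * (Ci * Ci) * z ^ 2)%C by ring.
      rewrite Ci_sq. field. auto. }
    rewrite E2.
    set (A1 := csum (fun n => (/ (z + INR (S n))) ^ 2)%C).
    set (A2 := csum (fun n => (/ (z - INR (S n))) ^ 2)%C).
    replace (- PI ^ 2 * / v ^ 2 + A1 + A2 - - PI ^ 2 / Csinh v ^ 2)%C with
      ((A1 + A2) - PI ^ 2 * (/ v ^ 2 - / Csinh v ^ 2))%C.
    2:{ field. split; [exact Hs|]. unfold v. repeat apply Cmult_neq_0; auto. }
    eapply Rle_trans; [apply Cmod_triangle_sub|]. apply Rplus_le_compat.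
    - eapply Rle_trans; [apply Cmod_triangle|]. unfold strip_const.
      assert (Cmod A1 <= Series (fun n => / (INR n + / 2) ^ 2)).
      { apply csum_Cmod; [|apply ex_series_strip]. intros n.
        destruct (strip_far z n HR) as [B _]. pose proof (pos_INR n).
        rewrite Cmod_pow, Cmod_inv by (apply Cmod_gt_0; lra). rewrite <- pow_inv.
        apply pow_incr. split; [left; apply Rinv_0_lt_compat; lra|apply Rinv_le_contravar; lra]. }
      assert (Cmod A2 <= Series (fun n => / (INR n + / 2) ^ 2)).
      { apply csum_Cmod; [|apply ex_series_strip]. intros n.
        destruct (strip_far z n HR) as [_ B]. pose proof (pos_INR n).
        rewrite Cmod_pow, Cmod_inv by (apply Cmod_gt_0; lra). rewrite <- pow_inv.
        apply pow_incr. split; [left; apply Rinv_0_lt_compat; lra|apply Rinv_le_contravar; lra]. }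
      lra.
    - rewrite Cmod_mult, Cmod_pow, Cmod_R, Rabs_pos_eq by (pose proof PI_RGT_0; lra).
      rewrite Rmult_comm. apply Rmult_le_compat_r; [pose proof PI_RGT_0; nra|].
      apply inv_sq_Csinh; auto.
      + unfold v. repeat apply Cmult_neq_0; auto.
      + unfold v. replace (Im (PI * Ci * z)%C) with (PI * Re z) by (unfold Re, Im, Ci; simpl; ring).
        rewrite Rabs_mult, Rabs_pos_eq by (pose proof PI_RGT_0; lra).
        pose proof PI_RGT_0. unfold Rdiv. apply Rmult_le_compat_l; lra. }
  intros z Hz.
  (* [up (Re z - 1/2)] is an integer at distance at most [1/2] from [Re z]. *)
  pose proof (archimed (Re z - / 2)) as [Ha Hb].
  set (k := up (Re z - / 2)) in *.
  assert (E : z = ((z + IZR (- k)) + IZR k)%C) by (rewrite opp_IZR, RtoC_opp; ring).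
  rewrite E, herglotz_shift. apply P; [now apply nonint_shift|].
  replace (Re (z + IZR (- k))%C) with (Re z - IZR k).
  - apply Rabs_le. lra.
  - rewrite opp_IZR. reflexivity.
Qed.

(** Herglotz' trick: the difference is bounded and satisfies
    [4 h(z) = h(z/2) + h((z+1)/2)], so its supremum is at most half of itself. *)
Lemma eis2_csc2 (z : C) : nonint z -> eis 2 z = csc2 z.
Proof.
  destruct herglotz_bounded as [M HM].
  assert (P : forall n z, nonint z -> Cmod (herglotz z) <= M * (/ 2) ^ n).
  { induction n; intros w Hw; [rewrite Rmult_1_r; auto|].
    assert (E : herglotz w = (/ 4 * (herglotz (w / 2) + herglotz ((w + 1) / 2)))%C).
    { unfold herglotz. 
      replace (eis 2 (w / 2) - csc2 (w / 2) + (eis 2 ((w + 1) / 2) - csc2 ((w + 1) / 2)))%C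
        with ((eis 2 (w / 2) + eis 2 ((w + 1) / 2)) - (csc2 (w / 2) + csc2 ((w + 1) / 2)))%C by ring.
      rewrite eis2_half, csc2_half by assumption. field. }
    rewrite E, Cmod_mult, <- RtoC_inv, Cmod_R, Rabs_pos_eq by lra.
    pose proof (Cmod_triangle (herglotz (w / 2)) (herglotz ((w + 1) / 2))).
    pose proof (IHn _ (nonint_half _ Hw)).
    pose proof (IHn _ (nonint_half _ (nonint_shift _ 1 Hw))).
    simpl. lra. }
  intros Hz.
  assert (E : Cmod (herglotz z) <= 0).
  { apply (is_lim_seq_le (fun _ => Cmod (herglotz z)) (fun n => M * (/ 2) ^ n) (Cmod (herglotz z)) 0).
    - intros n. auto.
    - apply is_lim_seq_const.
    - replace (Finite 0) with (Rbar_mult M 0) by (simpl; f_equal; ring).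
      apply is_lim_seq_scal_l, is_lim_seq_geom. rewrite Rabs_pos_eq; lra. }
  assert (E0 : herglotz z = RtoC 0) by (apply Cmod_eq_0; pose proof (Cmod_ge_0 (herglotz z)); lra).
  unfold herglotz in E0. replace (eis 2 z) with (eis 2 z - csc2 z + csc2 z)%C by ring.
  rewrite E0. ring.
Qed.

(** * Complex power series *)

Lemma INR_S_neq (n : nat) : RtoC (INR (S n)) <> RtoC 0.
Proof. apply RtoC_neq. now apply not_0_INR. Qed.

Lemma pow_div_fact_le_exp (x : R) (k : nat) : 0 <= x -> x ^ k / INR (fact k) <= exp x.
Proof.
  intros Hx.
  assert (P : forall n, 0 <= x ^ n / INR (fact n)).
  { intros n. apply Rmult_le_pos; [now apply pow_le|]. left. apply Rinv_0_lt_compat, INR_fact_lt_0. }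
  rewrite <- Series_exp.
  eapply Rle_trans; [|apply (Series_partial_le _ k P (ex_series_exp x))].
  destruct k; [apply Rle_refl|]. rewrite tech5.
  assert (0 <= sum_f_R0 (fun n => x ^ n / INR (fact n)) k) by (apply cond_pos_sum; auto). lra.
Qed.

(** With [s = (1 + r)/2 = exp(-2 e)], the power [n^k] is absorbed by [exp(e n)], which leaves the
    geometric series of [exp(-e)]. *)
Lemma ex_series_pow_geom (k : nat) (r : R) : 0 <= r < 1 -> ex_series (fun n => INR n ^ k * r ^ n).
Proof.
  intros Hr. set (s := (1 + r) / 2).
  assert (Hs : 0 < s < 1) by (unfold s; lra).
  set (e := - ln s / 2).
  assert (He : 0 < e).
  { unfold e. assert (ln s < 0) by (rewrite <- ln_1; apply ln_increasing; lra). lra. }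
  assert (Hes : exp e * s = exp (- e)).
  { replace (exp e * s) with (exp e * exp (ln s)) by (rewrite exp_ln; lra).
    rewrite <- exp_plus. f_equal. unfold e. field. }
  assert (H1 : exp (- e) < 1) by (rewrite <- exp_0; apply exp_increasing; lra).
  pose proof (exp_pos (- e)). pose proof (INR_fact_lt_0 k).
  apply (ex_series_nonneg_le _ (fun n => (INR (fact k) * / e ^ k) * exp (- e) ^ n)).
  - intros n. pose proof (pos_INR n). split; [apply Rmult_le_pos; apply pow_le; lra|].
    apply Rle_trans with (INR n ^ k * s ^ n).
    { apply Rmult_le_compat_l; [now apply pow_le|]. apply pow_incr. unfold s; lra. }
    rewrite <- Hes, Rpow_mult_distr, <- Rmult_assoc. apply Rmult_le_compat_r; [apply pow_le; lra|].
    assert (Hp : (e * INR n) ^ k / INR (fact k) <= exp (e * INR n)) by (apply pow_div_fact_le_exp; nra).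
    replace (exp e ^ n) with (exp (e * INR n)).
    2:{ clear. induction n; [simpl; rewrite Rmult_0_r; apply exp_0|].
        rewrite S_INR, Rmult_plus_distr_l, exp_plus, IHn, Rmult_1_r. simpl. ring. }
    assert (0 < e ^ k) by now apply pow_lt.
    rewrite Rpow_mult_distr in Hp.
    apply Rle_trans with ((INR (fact k) * / e ^ k) * (e ^ k * INR n ^ k / INR (fact k))).
    + right. field. lra.
    + apply Rmult_le_compat_l; [|exact Hp]. left.
      apply Rmult_lt_0_compat; [lra|now apply Rinv_0_lt_compat].
  - apply (ex_series_scal_l (V := R_NormedModule) (INR (fact k) * / e ^ k)), ex_series_geom.
    rewrite Rabs_pos_eq; lra.
Qed.

Lemma ex_series_S_pow_geom (k : nat) (r : R) : 0 <= r < 1 ->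
  ex_series (fun n => INR (S n) ^ k * r ^ S n).
Proof.
  intros H. apply (ex_series_incr_1 (V := R_NormedModule) (fun n => INR n ^ k * r ^ n)).
  now apply ex_series_pow_geom.
Qed.

Lemma ex_series_S_pow_geom' (k : nat) (r : R) : 0 <= r < 1 ->
  ex_series (fun n => INR (S n) ^ k * r ^ n).
Proof.
  intros H. set (s := (1 + r) / 2).
  apply (ex_series_nonneg_le _ (fun n => / s * (INR (S n) ^ k * s ^ S n))).
  - intros n. pose proof (pos_INR (S n)). split; [apply Rmult_le_pos; apply pow_le; lra|].
    replace (/ s * (INR (S n) ^ k * s ^ S n)) with (INR (S n) ^ k * s ^ n) by (simpl; field; unfold s; lra).
    apply Rmult_le_compat_l; [now apply pow_le|]. apply pow_incr. unfold s; lra.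
  - apply (ex_series_scal_l (V := R_NormedModule) (/ s)), ex_series_S_pow_geom. unfold s; lra.
Qed.

Lemma csm_geom (x : C) : Cmod x < 1 -> csm (fun n => x ^ n)%C.
Proof.
  intros H. apply (csm_le _ (fun n => Cmod x ^ n)).
  - intros n. rewrite Cmod_pow. lra.
  - apply ex_series_geom. rewrite Rabs_pos_eq; [exact H|apply Cmod_ge_0].
Qed.

Lemma one_minus_neq_0 (x : C) : Cmod x < 1 -> (1 - x)%C <> RtoC 0.
Proof.
  intros H E. assert (x = RtoC 1) by (replace x with (1 - (1 - x))%C by ring; rewrite E; ring).
  subst. rewrite Cmod_1 in H. lra.
Qed.

Lemma csum_geom (x : C) : Cmod x < 1 -> csum (fun n => x ^ n)%C = (/ (1 - x))%C.
Proof.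
  intros H. pose proof (csum_S _ (csm_geom x H)) as E. simpl in E.
  rewrite csum_scal in E by now apply csm_geom.
  pose proof (one_minus_neq_0 x H) as Hn.
  set (G := csum _) in *. replace G with ((1 - x) * G / (1 - x))%C by (field; auto).
  replace ((1 - x) * G)%C with (G - x * G)%C by ring. rewrite E at 1. field. auto.
Qed.

Lemma csm_geom_deriv (x : C) : Cmod x < 1 -> csm (fun n => INR (S n) * x ^ n)%C.
Proof.
  intros H. apply (csm_le _ (fun n => INR (S n) ^ 1 * Cmod x ^ n)).
  - intros n. rewrite Cmod_mult, Cmod_pow, Cmod_R, Rabs_pos_eq by apply pos_INR. lra.
  - apply ex_series_S_pow_geom'. split; [apply Cmod_ge_0|exact H].
Qed.

Lemma csum_geom_deriv (x : C) : Cmod x < 1 ->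
  csum (fun n => INR (S n) * x ^ n)%C = (/ (1 - x) ^ 2)%C.
Proof.
  intros H. pose proof (csum_S _ (csm_geom_deriv x H)) as E. cbv beta in E.
  pose proof (one_minus_neq_0 x H) as Hn.
  rewrite (csum_ext (fun n => INR (S (S n)) * x ^ S n)%C
    (fun n => x * (INR (S n) * x ^ n) + x * x ^ n)%C) in E.
  2:{ intros n. rewrite (S_INR (S n)), RtoC_plus. simpl. ring. }
  rewrite csum_plus, !csum_scal, csum_geom in E
   by (auto using csm_geom, csm_geom_deriv, csm_scal).
  set (G := csum _) in *. replace G with ((1 - x) * G / (1 - x))%C by (field; auto).
  replace ((1 - x) * G)%C with (G - x * G)%C by ring. rewrite E at 1. simpl. field. auto.
Qed.

Lemma csm_powser_shift (a : nat -> C) (w : R) : w <> 0 ->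
  csm (fun k => a k * w ^ k)%C -> csm (fun k => a (S k) * w ^ k)%C.
Proof.
  intros Hw Hs. apply (csm_ext (fun k => / w * (a (S k) * w ^ S k))%C).
  - intros k. simpl. field. now apply RtoC_neq.
  - apply csm_scal. now apply (proj1 (csm_S (fun k => a k * w ^ k)%C)).
Qed.

Lemma csm_powser_le (a : nat -> C) (w r : R) : 0 <= w <= r ->
  csm (fun k => a k * r ^ k)%C -> csm (fun k => a k * w ^ k)%C.
Proof.
  intros Hw. apply csm_le. intros k. rewrite !Cmod_mult, !Cmod_pow, !Cmod_R.
  apply Rmult_le_compat_l; [apply Cmod_ge_0|]. apply pow_incr. rewrite !Rabs_pos_eq; lra.
Qed.

Lemma csum_powser_S (a : nat -> C) (w : R) : 0 < w ->
  csm (fun k => a k * w ^ k)%C ->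
  csum (fun k => a k * w ^ k)%C = (a O + w * csum (fun k => a (S k) * w ^ k))%C.
Proof.
  intros Hw Hs. rewrite csum_S by exact Hs. rewrite <- csum_scal by (apply csm_powser_shift; auto; lra).
  f_equal; [simpl; ring|]. apply csum_ext. intros n. simpl. ring.
Qed.

(** Vanishing at [w] makes [a 0] equal to [-w] times a bounded sum; [w = r/(n+2)] tends to 0. *)
Lemma csum_powser_zero_0 (a : nat -> C) (r : R) :
  0 < r -> csm (fun k => a k * r ^ k)%C ->
  (forall w : R, 0 < w < r -> csum (fun k => a k * w ^ k)%C = RtoC 0) ->
  a O = RtoC 0.
Proof.
  intros Hr Hs Hz.
  assert (Hs' := csm_powser_shift a r ltac:(lra) Hs).
  set (K := Series (fun k => Cmod (a (S k) * r ^ k)%C)).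
  assert (B : forall n : nat, Cmod (a O) <= (r * K) * / (INR n + 2)).
  { intros n. pose proof (pos_INR n). set (w := r / (INR n + 2)).
    assert (Hw : 0 < w < r).
    { unfold w. split; [apply Rdiv_lt_0_compat; lra|].
      apply Rmult_lt_reg_r with (INR n + 2); [lra|]. unfold Rdiv.
      rewrite Rmult_assoc, Rinv_l by lra. nra. }
    specialize (Hz w Hw).
    rewrite csum_powser_S in Hz by (try lra; apply (csm_powser_le _ _ r); auto; lra).
    replace (a O) with (- (w * csum (fun k => a (S k) * w ^ k)))%C.
    2:{ replace (a O) with (a O + w * csum (fun k => a (S k) * w ^ k)
          - w * csum (fun k => a (S k) * w ^ k))%C by ring. rewrite Hz. ring. }
    rewrite Cmod_opp, Cmod_mult, Cmod_R, Rabs_pos_eq by lra.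
    replace (r * K * / (INR n + 2)) with (w * K) by (unfold w; field; lra).
    apply Rmult_le_compat_l; [lra|]. apply csum_Cmod; [|exact Hs'].
    intros k. rewrite !Cmod_mult, !Cmod_pow, !Cmod_R. apply Rmult_le_compat_l; [apply Cmod_ge_0|].
    apply pow_incr. rewrite !Rabs_pos_eq; lra. }
  assert (E : Cmod (a O) <= 0).
  { apply (is_lim_seq_le (fun _ => Cmod (a O)) (fun n => r * K * / (INR n + 2)) (Cmod (a O)) 0 B).
    - apply is_lim_seq_const.
    - replace (Finite 0) with (Rbar_mult (r * K) 0) by (simpl; f_equal; ring).
      apply is_lim_seq_scal_l.
      apply (is_lim_seq_ext (fun n => / (INR (S n) + 1))).
      + intros n. rewrite S_INR. f_equal. ring.
      + apply (is_lim_seq_incr_1 (fun n => / (INR n + 1))), lim_inv_S. }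
  apply Cmod_eq_0. pose proof (Cmod_ge_0 (a O)). lra.
Qed.

Lemma csum_powser_unique (a : nat -> C) (r : R) :
  0 < r -> csm (fun k => a k * r ^ k)%C ->
  (forall w : R, 0 < w < r -> csum (fun k => a k * w ^ k)%C = RtoC 0) ->
  forall k, a k = RtoC 0.
Proof.
  intros Hr Hs Hz k. revert a Hs Hz. induction k; intros a Hs Hz.
  - now apply (csum_powser_zero_0 a r).
  - assert (H0 : a O = RtoC 0) by now apply (csum_powser_zero_0 a r).
    apply (IHk (fun k => a (S k))); [apply csm_powser_shift; auto; lra|].
    intros w Hw. specialize (Hz w Hw).
    rewrite csum_powser_S in Hz by (try lra; apply (csm_powser_le _ _ r); auto; lra).
    rewrite H0, Cplus_0_l in Hz.
    assert (Hn : RtoC w <> RtoC 0) by (apply RtoC_neq; lra).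
    set (G := csum _) in *. replace G with (/ w * (w * G))%C by (field; auto).
    rewrite Hz. ring.
Qed.

Lemma exp_pow (x : R) (n : nat) : exp x ^ n = exp (x * INR n).
Proof.
  induction n; [simpl; now rewrite Rmult_0_r, exp_0|].
  rewrite S_INR, Rmult_plus_distr_l, exp_plus, <- IHn, Rmult_1_r. simpl. ring.
Qed.

(** * Lipschitz' formula *)

Lemma Cmod_q_lt_1 (z : C) : 0 < Im z -> Cmod (q_param z) < 1.
Proof.
  intros H. rewrite Cmod_q_param, <- exp_0. apply exp_increasing. pose proof PI_RGT_0. nra.
Qed.

Lemma csm_pow_q (k : nat) (q : C) : Cmod q < 1 -> csm (fun n => INR (S n) ^ k * q ^ S n)%C.
Proof.
  intros H. apply (csm_le _ (fun n => INR (S n) ^ k * Cmod q ^ S n)).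
  - intros n. rewrite Cmod_mult, !Cmod_pow, Cmod_R, Rabs_pos_eq by apply pos_INR. lra.
  - apply ex_series_S_pow_geom. split; [apply Cmod_ge_0|exact H].
Qed.

Lemma csc2_series (z : C) : 0 < Im z ->
  csc2 z = (- (4 * PI ^ 2) * csum (fun n => INR (S n) * q_param z ^ S n))%C.
Proof.
  intros H. pose proof (Cmod_q_lt_1 z H) as Hq. unfold csc2.
  rewrite (csum_ext _ (fun n => q_param z * (INR (S n) * q_param z ^ n))%C)
    by (intros; simpl; ring).
  rewrite csum_scal, csum_geom_deriv by auto using csm_geom_deriv.
  pose proof (one_minus_neq_0 _ Hq). field. auto.
Qed.

(** The polylogarithm of order [-k]. *)
Definition lamb (k : nat) (q : C) : C := csum (fun n => INR (S n) ^ k * q ^ S n)%C.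

(** Re-expansion of a series of functions in powers of the displacement [w]; one majorant at the
    radius [r] serves every smaller [w]. *)
Lemma csum_swap_powser (c : nat -> nat -> C) (al be : nat -> R) (r w : R) :
  0 < r -> 0 <= w <= r ->
  (forall n k, Cmod (c n k * r ^ k)%C <= al n * be k) ->
  (forall n, 0 <= al n) -> (forall k, 0 <= be k) -> ex_series al -> ex_series be ->
  csum (fun n => csum (fun k => c n k * w ^ k))%C
    = csum (fun k => csum (fun n => c n k) * w ^ k)%C
  /\ csm (fun k => csum (fun n => c n k) * w ^ k)%C.
Proof.
  intros Hr Hw H Hal Hbe Sal Sbe.
  assert (H' : forall n k, Cmod (c n k * w ^ k)%C <= al n * be k).
  { intros n k. eapply Rle_trans; [|apply H]. rewrite !Cmod_mult, !Cmod_pow, !Cmod_R.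
    apply Rmult_le_compat_l; [apply Cmod_ge_0|]. apply pow_incr. rewrite !Rabs_pos_eq; lra. }
  assert (S : forall k, csm (fun n => c n k)).
  { intros k. apply (csm_le _ (fun n => al n * (be k * / r ^ k))).
    - intros n. assert (0 < r ^ k) by now apply pow_lt.
      apply Rmult_le_reg_r with (r ^ k); [assumption|].
      replace (al n * (be k * / r ^ k) * r ^ k) with (al n * be k) by (field; lra).
      specialize (H n k). rewrite Cmod_mult, Cmod_pow, Cmod_R, Rabs_pos_eq in H by lra. exact H.
    - now apply (ex_series_scal_r (be k * / r ^ k)). }
  assert (E : forall k, csum (fun n => c n k * w ^ k)%C = (csum (fun n => c n k) * w ^ k)%C).
  { intros k. rewrite Cmult_comm, <- csum_scal by apply S. apply csum_ext. intros; ring. }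
  split.
  - rewrite (csum_fubini _ al be H') by assumption. apply csum_ext, E.
  - apply (csm_ext (fun k => csum (fun n => c n k * w ^ k)%C)); [exact E|].
    apply (csm_fubini_rows (fun k n => c n k * w ^ k)%C be al); auto.
    intros. rewrite Rmult_comm. apply H'.
Qed.

(** The differentiated geometric series at [-w/a]. *)
Lemma inv_sq_binomial (a : C) (w : R) : Rabs w < Cmod a ->
  ((/ (a + w)) ^ 2 = csum (fun k => INR (S k) * (- (1)) ^ k * (/ a) ^ (k + 2) * w ^ k))%C.
Proof.
  intros H.
  assert (Ha : a <> RtoC 0) by (apply Cmod_gt_0; pose proof (Rabs_pos w); lra).
  assert (Hx : Cmod (- w * / a)%C < 1).
  { rewrite Cmod_mult, Cmod_opp, Cmod_R, Cmod_inv by exact Ha.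
    apply Rmult_lt_reg_r with (Cmod a); [pose proof (Rabs_pos w); lra|].
    rewrite Rmult_assoc, Rinv_l by (pose proof (Rabs_pos w); lra). lra. }
  rewrite (csum_ext _ (fun k => (/ a) ^ 2 * (INR (S k) * (- w * / a) ^ k))%C).
  2:{ intros k. replace (- w * / a)%C with ((- (1)) * (/ a) * w)%C by ring.
      rewrite !Cpow_mult_l, Cpow_add_r. ring. }
  rewrite csum_scal, csum_geom_deriv by auto using csm_geom_deriv.
  pose proof (one_minus_neq_0 _ Hx) as Hn.
  assert (Haw : (a + w)%C <> RtoC 0).
  { intros E. apply Hn. replace (1 - - w * / a)%C with ((a + w) / a)%C by (field; auto).
    rewrite E. unfold Cdiv. ring. }
  field. repeat split; auto.
  replace (a + w)%C with (a + w)%C in Haw by ring.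
  intros E. apply Haw. rewrite <- E. ring.
Qed.

Lemma Im_le_Cmod_shift (t : C) (x : R) : Im t <= Cmod (t + x)%C.
Proof.
  eapply Rle_trans; [apply Rle_abs|]. replace (Im t) with (Im (t + x)%C) by (unfold Im; simpl; ring).
  apply im_le_Cmod.
Qed.

Section Lipschitz.
Variable t : C.
Hypothesis Ht : 0 < Im t.
Let y := Im t.
(** A displacement of at most [y/4] leaves the ratio [1/4] in the expansions of [(t + m + w)^-2] and
    the ratio [1/2] in those of [q^n]. *)
Let r := y / 4.

(** The shifts [s] are arbitrary so that both halves of [eis], with shifts [n] and [-(n+1)], are
    covered. *)
Lemma lip_side (s : nat -> R) (w : R) :
  csm (fun n => (/ (t + s n)) ^ 2)%C -> 0 <= w <= r ->
  csum (fun n => (/ (t + w + s n)) ^ 2)%C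
    = csum (fun k => INR (S k) * (- (1)) ^ k * csum (fun n => (/ (t + s n)) ^ (k + 2)) * w ^ k)%C
  /\ csm (fun k => INR (S k) * (- (1)) ^ k * csum (fun n => (/ (t + s n)) ^ (k + 2)) * w ^ k)%C.
Proof.
  intros Hs Hw.
  assert (Hy : 0 < y) by exact Ht.
  assert (Hge : forall n, y <= Cmod (t + s n)%C) by (intros; apply Im_le_Cmod_shift).
  assert (Hne : forall n, (t + s n)%C <> RtoC 0).
  { intros n. apply Cmod_gt_0. specialize (Hge n). lra. }
  assert (Hs2 : forall k, csm (fun n => (/ (t + s n)) ^ (k + 2))%C).
  { intros k. apply (csm_le _ (fun n => (/ y) ^ k * Cmod ((/ (t + s n)) ^ 2)%C)).
    - intros n. rewrite Cpow_add_r, Cmod_mult. apply Rmult_le_compat_r; [apply Cmod_ge_0|].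
      rewrite Cmod_pow, Cmod_inv by auto. apply pow_incr. specialize (Hge n).
      split; [left; apply Rinv_0_lt_compat; lra|apply Rinv_le_contravar; lra].
    - now apply (ex_series_scal_l (V := R_NormedModule) ((/ y) ^ k)). }
  destruct (csum_swap_powser
    (fun n k => INR (S k) * (- (1)) ^ k * (/ (t + s n)) ^ (k + 2))%C
    (fun n => Cmod ((/ (t + s n)) ^ 2)%C) (fun k => INR (S k) ^ 1 * (/ 4) ^ k) r w) as [E Sm].
  - unfold r; lra.
  - exact Hw.
  - intros n k. rewrite Cpow_add_r, !Cmod_mult, (Cmod_R (INR (S k))), Rabs_pos_eq by apply pos_INR.
    rewrite (Cmod_pow (- (1))%C), Cmod_opp, Cmod_1, pow1.
    rewrite (Cmod_pow (RtoC r)), Cmod_R, Rabs_pos_eq by (unfold r; lra).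
    rewrite (Cmod_pow _ k), Cmod_inv by auto.
    replace (INR (S k) * 1 * ((/ Cmod (t + s n)%C) ^ k * Cmod ((/ (t + s n)) ^ 2)%C) * r ^ k)
     with (Cmod ((/ (t + s n)) ^ 2)%C * (INR (S k) ^ 1 * (/ Cmod (t + s n)%C * r) ^ k))
     by (rewrite Rpow_mult_distr; ring).
    apply Rmult_le_compat_l; [apply Cmod_ge_0|].
    apply Rmult_le_compat_l; [apply pow_le, pos_INR|]. apply pow_incr.
    specialize (Hge n). split.
    + apply Rmult_le_pos; [left; apply Rinv_0_lt_compat; lra|unfold r; lra].
    + apply Rmult_le_reg_l with (Cmod (t + s n)%C); [lra|].
      rewrite <- Rmult_assoc, Rinv_r by lra. unfold r; lra.
  - intros; apply Cmod_ge_0.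
  - intros; apply Rmult_le_pos; apply pow_le; [apply pos_INR|lra].
  - exact Hs.
  - apply ex_series_S_pow_geom'. lra.
  - assert (E2 : forall k, (csum (fun n => INR (S k) * (- (1)) ^ k * (/ (t + s n)) ^ (k + 2)) * w ^ k
      = INR (S k) * (- (1)) ^ k * csum (fun n => (/ (t + s n)) ^ (k + 2)) * w ^ k)%C).
    { intros k. rewrite csum_scal by apply Hs2. reflexivity. }
    split.
    + rewrite <- (csum_ext _ _ E2), <- E. apply csum_ext. intros n.
      replace (t + w + s n)%C with (t + s n + w)%C by ring.
      rewrite inv_sq_binomial; [reflexivity|].
      specialize (Hge n). rewrite Rabs_pos_eq by lra. unfold r in Hw. lra.
    + exact (csm_ext _ _ E2 Sm).
Qed.

Lemma lip_eis (w : R) : 0 <= w <= r ->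
  eis 2 (t + w) = csum (fun k => INR (S k) * (- (1)) ^ k * eis (k + 2) t * w ^ k)%C
  /\ csm (fun k => INR (S k) * (- (1)) ^ k * eis (k + 2) t * w ^ k)%C.
Proof.
  intros Hw.
  destruct (lip_side (fun n => INR n) w) as [E1 S1]; [apply csm_inv_pow; lia|exact Hw|].
  assert (X : forall z : C, forall n, (z + RtoC (- INR (S n)))%C = (z - INR (S n))%C).
  { intros. rewrite RtoC_opp. reflexivity. }
  destruct (lip_side (fun n => - INR (S n)) w) as [E2 S2]; [|exact Hw|].
  { apply (csm_ext (fun n => (/ (t - INR (S n))) ^ 2)%C); [intros; now rewrite X|].
    apply csm_inv_pow_left; lia. }
  assert (F : forall k, (INR (S k) * (- (1)) ^ k * eis (k + 2) t * w ^ k =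
    INR (S k) * (- (1)) ^ k * csum (fun n => (/ (t + INR n)) ^ (k + 2)) * w ^ k
    + INR (S k) * (- (1)) ^ k * csum (fun n => (/ (t + RtoC (- INR (S n)))) ^ (k + 2)) * w ^ k)%C).
  { intros k. unfold eis.
    rewrite (csum_ext (fun n => (/ (t + RtoC (- INR (S n)))) ^ (k + 2))%C
      (fun n => (/ (t - INR (S n))) ^ (k + 2))%C) by (intros; now rewrite X). ring. }
  split.
  - rewrite (csum_ext _ _ F), csum_plus by assumption. rewrite <- E1, <- E2.
    unfold eis. f_equal. apply csum_ext. intros. now rewrite X.
  - eapply csm_ext; [intros k; symmetry; apply F|]. now apply csm_plus.
Qed.

(** Each [q(t+w)^n] is expanded by the exponential series of [2 pi i n w]. Half of the decay
    [exp(-2 pi y n)] pays for [(2 pi n r)^k / k!], the other half for the sum over [n]. *)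
Lemma lip_csc2 (w : R) : 0 <= w <= r ->
  csc2 (t + w) = csum (fun k => (2 * PI * Ci) ^ (k + 2) / INR (fact k) * lamb (k + 1) (q_param t) * w ^ k)%C
  /\ csm (fun k => (2 * PI * Ci) ^ (k + 2) / INR (fact k) * lamb (k + 1) (q_param t) * w ^ k)%C.
Proof.
  intros Hw. assert (Hy : 0 < y) by exact Ht. pose proof PI_RGT_0 as HPI.
  pose proof (Cmod_q_lt_1 t Ht) as Hq.
  destruct (csum_swap_powser
    (fun n k => (2 * PI * Ci) ^ 2 * (INR (S n) * q_param t ^ S n) * exp_term (2 * PI * Ci * INR (S n)) k)%C
    (fun n => (2 * PI) ^ 2 * (INR (S n) ^ 1 * exp (- (2 * PI * (y / 2))) ^ S n)) (fun k => (/ 2) ^ k) r w) as [E Sm].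
  - unfold r; lra.
  - exact Hw.
  - intros n k. rewrite !Cmod_mult, Cmod_exp_term, !Cmod_pow, !Cmod_mult, Cmod_Ci, !Cmod_R.
    rewrite (Rabs_pos_eq 2), (Rabs_pos_eq PI), (Rabs_pos_eq (INR (S n))), (Rabs_pos_eq r)
      by (try apply pos_INR; unfold r; lra).
    rewrite Cmod_q_param. fold y.
    assert (E1 : exp (- (2 * PI * y)) ^ S n =
       exp (- (2 * PI * (y / 2))) ^ S n * exp (- (PI * y * INR (S n)))).
    { rewrite !exp_pow, <- exp_plus. f_equal. field. }
    rewrite E1.
    pose proof (pow_div_fact_le_exp (PI * y * INR (S n)) k) as B.
    pose proof (pos_INR (S n)) as Pn.
    assert (B' := B ltac:(apply Rmult_le_pos; [nra|lra])).
    rewrite (exp_Ropp (PI * y * INR (S n))).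
    set (X := exp (PI * y * INR (S n))) in *.
    assert (HX : 0 < X) by apply exp_pos.
    replace ((2 * PI * 1) ^ 2 * (INR (S n) * (exp (- (2 * PI * (y / 2))) ^ S n * / X)) *
      ((2 * PI * 1 * INR (S n)) ^ k / INR (fact k)) * r ^ k)
     with ((2 * PI) ^ 2 * (INR (S n) ^ 1 * exp (- (2 * PI * (y / 2))) ^ S n)
       * (/ X * ((PI * y * INR (S n)) ^ k / INR (fact k)) * (/ 2) ^ k)).
    2:{ replace (PI * y * INR (S n)) with ((2 * PI * 1 * INR (S n)) * r * 2) by (unfold r; field).
        rewrite (Rpow_mult_distr _ 2), (Rpow_mult_distr _ r), pow_inv, Rmult_1_r, pow_1.
        assert (2 ^ k <> 0) by (apply pow_nonzero; lra).
        set (G := exp (- (2 * PI * (y / 2))) ^ S n). set (Z := (2 * PI * INR (S n)) ^ k).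
        field. repeat split; auto; [apply INR_fact_neq_0|lra]. }
    apply Rmult_le_compat_l.
    + apply Rmult_le_pos; [apply pow_le; lra|]. apply Rmult_le_pos; apply pow_le; [lra|left; apply exp_pos].
    + rewrite <- (Rmult_1_l ((/ 2) ^ k)) at 2. apply Rmult_le_compat_r; [apply pow_le; lra|].
      apply Rmult_le_reg_l with X; [assumption|]. rewrite <- Rmult_assoc, Rinv_r by lra. lra.
  - intros n. apply Rmult_le_pos; [apply pow_le; lra|].
    apply Rmult_le_pos; apply pow_le; [apply pos_INR|left; apply exp_pos].
  - intros; apply pow_le; lra.
  - apply (ex_series_scal_l (V := R_NormedModule) ((2 * PI) ^ 2)), ex_series_S_pow_geom.
    split; [left; apply exp_pos|]. rewrite <- exp_0. apply exp_increasing. nra.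
  - apply ex_series_geom. rewrite Rabs_pos_eq; lra.
  - assert (E2 : forall k, (csum (fun n => (2 * PI * Ci) ^ 2 * (INR (S n) * q_param t ^ S n) *
        exp_term (2 * PI * Ci * INR (S n)) k) * w ^ k
      = (2 * PI * Ci) ^ (k + 2) / INR (fact k) * lamb (k + 1) (q_param t) * w ^ k)%C).
    { intros k. unfold lamb. rewrite <- csum_scal by now apply csm_pow_q. f_equal.
      apply csum_ext. intros n. unfold exp_term.
      rewrite (Cpow_mult_l (2 * PI * Ci)), !Cpow_add_r. unfold Cdiv. ring. }
    split.
    + rewrite <- (csum_ext _ _ E2), <- E.
      rewrite csc2_series by (unfold Im in *; simpl; lra).
      replace (- (4 * PI ^ 2))%C with ((2 * PI * Ci) ^ 2)%C.
      2:{ replace ((2 * PI * Ci) ^ 2)%C with (4 * PI ^ 2 * (Ci * Ci))%C by (replace (RtoC 4) with (2 * 2)%C by (rewrite <- RtoC_mult; f_equal; ring); ring).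
          rewrite Ci_sq. ring. }
      rewrite <- csum_scal.
      2:{ apply (csm_ext (fun n => INR (S n) ^ 1 * q_param (t + w) ^ S n)%C); [intros; simpl; ring|].
          apply csm_pow_q, Cmod_q_lt_1. unfold Im in *; simpl; lra. }
      apply csum_ext. intros n.
      rewrite (csum_ext _ (fun k => (2 * PI * Ci) ^ 2 * (INR (S n) * q_param t ^ S n)
         * exp_term (2 * PI * Ci * INR (S n) * w) k)%C).
      2:{ intros k. unfold exp_term. rewrite (Cpow_mult_l _ (RtoC w)). unfold Cdiv. ring. }
      rewrite csum_scal, csum_exp_term by apply csm_exp_term.
      rewrite q_param_plus, (Cpow_mult_l (q_param t)).
      replace (q_param w ^ S n)%C with (Cexp (2 * PI * Ci * INR (S n) * w)).
      * ring.
      * unfold q_param. rewrite <- Cexp_nat. f_equal. ring.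
    + exact (csm_ext _ _ E2 Sm).
Qed.

(** Lipschitz' formula, obtained by comparing Taylor coefficients in [w] on both sides of
    [eis 2 (t + w) = csc2 (t + w)]. *)
Lemma lipschitz (k : nat) :
  eis (k + 2) t = ((- (1)) ^ k * (2 * PI * Ci) ^ (k + 2) / INR (fact (S k)) * lamb (k + 1) (q_param t))%C.
Proof.
  assert (Hy : 0 < y) by exact Ht.
  assert (U : forall k, (INR (S k) * (- (1)) ^ k * eis (k + 2) t
     - (2 * PI * Ci) ^ (k + 2) / INR (fact k) * lamb (k + 1) (q_param t))%C = RtoC 0).
  { apply (csum_powser_unique _ r); [unfold r; lra| |].
    - destruct (lip_eis r) as [_ S1]; [unfold r; lra|].
      destruct (lip_csc2 r) as [_ S2]; [unfold r; lra|].
      eapply csm_ext; [|exact (csm_minus _ _ S1 S2)]. intros; cbv beta; ring.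
    - intros w Hw.
      destruct (lip_eis w) as [E1 S1]; [lra|].
      destruct (lip_csc2 w) as [E2 S2]; [lra|].
      rewrite (csum_ext _ (fun k => INR (S k) * (- (1)) ^ k * eis (k + 2) t * w ^ k
        - (2 * PI * Ci) ^ (k + 2) / INR (fact k) * lamb (k + 1) (q_param t) * w ^ k)%C)
        by (intros; ring).
      rewrite csum_minus, <- E1, <- E2 by assumption.
      rewrite eis2_csc2; [ring|]. apply nonint_Im. unfold y in *; unfold Im in *; simpl; lra. }
  specialize (U k).
  assert (Hs : ((- (1)) ^ k * (- (1)) ^ k)%C = RtoC 1).
  { rewrite <- Cpow_mult_l. replace (- (1) * - (1))%C with (RtoC 1) by ring. apply Cpow_1_l. }
  replace (eis (k + 2) t) with (((- (1)) ^ k * (- (1)) ^ k) * eis (k + 2) t)%C by (rewrite Hs; ring).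
  rewrite fact_simpl, mult_INR, RtoC_mult.
  pose proof (INR_S_neq k). pose proof (INR_fact_neq k).
  set (A := ((2 * PI * Ci) ^ (k + 2) / INR (fact k) * lamb (k + 1) (q_param t))%C) in *.
  replace ((- (1)) ^ k * (2 * PI * Ci) ^ (k + 2) / (INR (S k) * INR (fact k)) * lamb (k + 1) (q_param t))%C
    with ((- (1)) ^ k / INR (S k) * A)%C by (unfold A; field; auto).
  replace A with ((INR (S k) * (- (1)) ^ k * eis (k + 2) t) - (INR (S k) * (- (1)) ^ k * eis (k + 2) t - A))%C
    by ring.
  rewrite U. field. auto.
Qed.

End Lipschitz.

(** * The values of zeta at 2 and 4 *)

Definition zeta (k : nat) : C := csum (fun n => (/ INR (S n)) ^ k)%C.

Lemma csm_zeta (k : nat) : (2 <= k)%nat -> csm (fun n => (/ INR (S n)) ^ k)%C.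
Proof.
  intros Hk. apply (csm_ext (fun n => (/ (1 + INR n)) ^ k)%C); [|now apply csm_inv_pow].
  intros n. rewrite S_INR, RtoC_plus. do 2 f_equal. ring.
Qed.

Lemma half_plus_nat_neq (n : nat) : (1 / 2 + INR n)%C <> RtoC 0.
Proof.
  intros E. apply (f_equal Re) in E. pose proof (pos_INR n).
  replace (Re (1 / 2 + INR n)%C) with (1 / 2 + INR n) in E by (unfold Re; simpl; field).
  simpl in E. lra.
Qed.

(** Up to the factor [2^k] the left side runs over the odd integers, which carry the share
    [1 - 2^-k] of zeta. *)
Lemma zeta_half (k : nat) : (2 <= k)%nat ->
  (csum (fun n => (/ (1 / 2 + INR n)) ^ k) = (2 ^ k - 1) * zeta k)%C.
Proof.
  intros Hk.
  assert (H2 : (RtoC 2 ^ k)%C <> RtoC 0) by apply Cpow_nz, RtoC_2_neq.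
  assert (E0 : forall n, ((/ INR (S (2 * n))) ^ k = / 2 ^ k * (/ (1 / 2 + INR n)) ^ k)%C).
  { intros n. rewrite <- Cpow_inv by apply RtoC_2_neq. rewrite <- Cpow_mult_l. f_equal.
    pose proof (half_plus_nat_neq n) as Hn. pose proof (INR_S_neq (2 * n)) as Hm.
    rewrite S_INR, INR_double, RtoC_plus, RtoC_mult in *.
    replace (2 * INR n + 1)%C with (2 * (1 / 2 + INR n))%C by field.
    field. intros E; apply Hm; rewrite <- E; ring. }
  assert (E1 : forall n, ((/ INR (S (2 * n + 1))) ^ k = / 2 ^ k * (/ INR (S n)) ^ k)%C).
  { intros n. rewrite <- Cpow_inv by apply RtoC_2_neq. rewrite <- Cpow_mult_l. f_equal.
    pose proof (INR_S_neq n) as Hn.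
    replace (S (2 * n + 1))%nat with (2 * S n)%nat by lia.
    rewrite INR_double, RtoC_mult. field. auto. }
  pose proof (csm_zeta k Hk) as S.
  assert (S1 := csm_zeta k Hk).
  assert (S0 : csm (fun n => (/ (1 / 2 + INR n)) ^ k)%C) by now apply csm_inv_pow.
  assert (Z : zeta k = (/ 2 ^ k * csum (fun n => (/ (1 / 2 + INR n)) ^ k) + / 2 ^ k * zeta k)%C).
  { unfold zeta at 1. rewrite csum_even_odd; auto.
    - rewrite (csum_ext _ _ E0), (csum_ext _ _ E1), !csum_scal by auto. reflexivity.
    - eapply csm_ext; [intros n; symmetry; apply E0|]. now apply csm_scal.
    - eapply csm_ext; [intros n; symmetry; apply E1|]. now apply csm_scal. }
  set (X := csum _) in *.
  replace ((2 ^ k - 1) * zeta k)%C with (2 ^ k * zeta k - zeta k)%C by ring.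
  rewrite Z at 1. field. exact H2.
Qed.

Lemma eis_half_even (w : R) :
  eis 2 (1 / 2 + w) = (csum (fun n => (/ (1 / 2 + w + INR n)) ^ 2)
    + csum (fun n => (/ (1 / 2 - w + INR n)) ^ 2))%C.
Proof.
  unfold eis. rewrite csum_left_right. f_equal. apply csum_ext. intros n.
  do 2 f_equal. field.
Qed.

Lemma nonint_half_plus (w : R) : Rabs w < / 2 -> nonint (1 / 2 + w)%C.
Proof.
  intros H k E. apply (f_equal Re) in E.
  replace (Re (1 / 2 + w)%C) with (1 / 2 + w) in E by (unfold Re; simpl; field).
  simpl in E. apply Rabs_lt_between in H.
  assert (0 < IZR k < 1) by lra. destruct H0 as [H0 H1].
  apply lt_IZR in H0. apply lt_IZR in H1. lia.
Qed.

(** At [1/2] both halves of [eis 2] equal [3 zeta 2], while [csc2] has the value [pi^2]. *)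
Lemma zeta2 : zeta 2 = (PI ^ 2 / 6)%C.
Proof.
  pose proof (eis_half_even 0) as E.
  rewrite eis2_csc2 in E by (apply nonint_half_plus; rewrite Rabs_R0; lra).
  unfold csc2 in E. replace (1 / 2 + 0)%C with (1 / 2)%C in E by ring.
  rewrite q_param_half in E.
  replace (1 / 2 - 0)%C with (1 / 2)%C in E by ring.
  rewrite zeta_half in E by lia.
  replace (zeta 2) with (((2 ^ 2 - 1) * zeta 2 + (2 ^ 2 - 1) * zeta 2) / 6)%C by field.
  rewrite <- E. field. 
Qed.

Lemma csum_RtoC (u : nat -> R) : csum (fun n => RtoC (u n)) = RtoC (Series u).
Proof.
  unfold csum. apply C_ext; simpl; [reflexivity|].
  apply is_series_unique. apply partial_is_series.
  apply (is_lim_seq_ext (fun _ => 0)); [|apply is_lim_seq_const].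
  induction n; simpl in *; [reflexivity|]. rewrite <- IHn. lra.
Qed.

(** That is [pi^2 / cos^2(pi w)]; with the tangent, subtracting the value at [w = 0] leaves
    [pi^2 tan^2(pi w)]. *)
Lemma csc2_half_plus (w : R) : Rabs w < / 2 ->
  csc2 (1 / 2 + w) = RtoC (PI ^ 2 * (1 + tan (PI * w) ^ 2)) /\ cos (PI * w) <> 0.
Proof.
  intros H. pose proof PI_RGT_0. apply Rabs_lt_between in H.
  assert (Hc : cos (PI * w) <> 0).
  { assert (0 < cos (PI * w)); [apply cos_gt_0; nra|lra]. }
  split; [|exact Hc].
  unfold csc2. rewrite q_param_plus, q_param_half.
  set (c := cos (PI * w)) in *. set (s := sin (PI * w)).
  assert (T : s * s + c * c = 1) by (pose proof (sin2_cos2 (PI * w)); unfold Rsqr in *; assumption).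
  assert (T2 : (RtoC s * s + c * c)%C = RtoC 1) by (rewrite <- !RtoC_mult, <- RtoC_plus, T; reflexivity).
  assert (Q : q_param w = ((c + Ci * s) ^ 2)%C).
  { assert (E : q_param w = (Cexp (PI * Ci * w) ^ 2)%C).
    { unfold q_param. replace (2 * PI * Ci * w)%C with (PI * Ci * w + PI * Ci * w)%C by ring.
      rewrite Cexp_add. ring. }
    rewrite E. f_equal. unfold Cexp.
    replace (Re (PI * Ci * w)%C) with 0 by (unfold Re, Ci; simpl; ring).
    replace (Im (PI * Ci * w)%C) with (PI * w) by (unfold Im, Ci; simpl; ring).
    rewrite exp_0. fold c s. apply C_ext; unfold Re, Im, Ci; simpl; ring. }
  rewrite Q.
  assert (D : (1 - - (1) * (c + Ci * s) ^ 2 = 2 * c * (c + Ci * s))%C).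
  { transitivity (1 + (c * c + 2 * c * s * Ci + (Ci * Ci) * (s * s)))%C; [ring|].
    rewrite Ci_sq. transitivity (1 - s * s + c * c + 2 * c * s * Ci)%C; [ring|].
    rewrite <- T2. ring. }
  rewrite D.
  assert (Hn : (c + Ci * s)%C <> RtoC 0).
  { intros E. apply (f_equal Re) in E. unfold Re, Ci in E. simpl in E. lra. }
  assert (Hcc : RtoC c <> RtoC 0) by now apply RtoC_neq.
  transitivity (PI ^ 2 / (c * c))%C; [field; auto|].
  unfold tan. fold c s.
  replace (PI ^ 2 * (1 + (s / c) ^ 2)) with (PI * PI * (s * s + c * c) / (c * c)) by (field; auto).
  rewrite T, RtoC_div, !RtoC_mult by (apply Rmult_integral_contrapositive; auto). field. auto.
Qed.

Lemma tan_sq_lim : is_lim_seq (fun n => (tan (PI * / (INR n + 4)) / / (INR n + 4)) ^ 2) (PI ^ 2).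
Proof.
  set (x := fun n => PI * / (INR n + 4)).
  assert (Hx : is_lim_seq x 0).
  { replace (Finite 0) with (Rbar_mult PI 0) by (simpl; f_equal; ring).
    apply is_lim_seq_scal_l.
    apply (is_lim_seq_inv (fun n => INR n + 4) p_infty); [|discriminate].
    eapply is_lim_seq_plus; [apply is_lim_seq_INR|apply is_lim_seq_const|reflexivity]. }
  assert (Hpos : forall n, 0 < x n).
  { intros n. pose proof (pos_INR n). pose proof PI_RGT_0. apply Rmult_lt_0_compat; [lra|].
    apply Rinv_0_lt_compat; lra. }
  assert (Hs : is_lim_seq (fun n => sin (x n) / x n) 1).
  { apply (is_lim_comp_seq (fun y => sin y / y) x 0 1).
    - apply is_lim_sinc_0.
    - exists O. intros n _ E. injection E. specialize (Hpos n). lra.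
    - exact Hx. }
  assert (Hc : is_lim_seq (fun n => cos (x n)) 1).
  { rewrite <- cos_0. apply (is_lim_seq_continuous cos x 0); [|exact Hx].
    apply continuity_cos. }
  apply (is_lim_seq_ext (fun n => (PI * (sin (x n) / x n) / cos (x n)) ^ 2)).
  - intros n. f_equal. unfold tan. fold (x n). specialize (Hpos n). pose proof (pos_INR n).
    pose proof PI_RGT_0.
    assert (E : / / (INR n + 4) = PI * / x n).
    { unfold x. field. lra. }
    unfold Rdiv. rewrite E. ring.
  - replace (PI ^ 2) with ((PI * 1 / 1) ^ 2) by field.
    apply (is_lim_seq_ext (fun n => (PI * (sin (x n) / x n) / cos (x n)) * (PI * (sin (x n) / x n) / cos (x n))));
      [intros; ring|].
    replace ((PI * 1 / 1) ^ 2) with ((PI * 1 / 1) * (PI * 1 / 1)) by ring.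
    apply is_lim_seq_mult'; apply is_lim_seq_div'; try exact Hc; try lra;
      now apply (is_lim_seq_scal_l _ PI (Finite 1)).
Qed.

(** The difference is exactly [w^2 (10 a^2 - 6 w^2) / (a^4 (a^2 - w^2)^2)]. With
    [a^2 - w^2 >= 3/4 a^2] and [a^-4 <= 16] it is at most [10 * 16/9 * 16 < 300] times
    [w^2 / a^2]. *)
Lemma second_diff_bound (a w : R) : / 2 <= a -> 0 < w <= / 4 ->
  0 <= ((/ (a + w)) ^ 2 + (/ (a - w)) ^ 2 - 2 * (/ a) ^ 2) / w ^ 2 - 6 * (/ a) ^ 4
    <= 300 * w ^ 2 * (/ a) ^ 2.
Proof.
  intros Ha Hw.
  assert (E : ((/ (a + w)) ^ 2 + (/ (a - w)) ^ 2 - 2 * (/ a) ^ 2) / w ^ 2 - 6 * (/ a) ^ 4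
    = w ^ 2 * (10 * a ^ 2 - 6 * w ^ 2) / (a ^ 4 * (a ^ 2 - w ^ 2) ^ 2)).
  { field. repeat split; try lra; try nra. }
  rewrite E.
  assert (H1 : 3 / 4 * a ^ 2 <= a ^ 2 - w ^ 2) by nra.
  assert (H2 : 0 < a ^ 2 <= a ^ 2) by nra.
  assert (H3 : 0 < a ^ 4 * (a ^ 2 - w ^ 2) ^ 2).
  { apply Rmult_lt_0_compat; apply pow_lt; lra. }
  split.
  - apply Rmult_le_pos; [apply Rmult_le_pos; nra|]. left. now apply Rinv_0_lt_compat.
  - apply Rmult_le_reg_r with (a ^ 4 * (a ^ 2 - w ^ 2) ^ 2); [assumption|].
    unfold Rdiv. rewrite (Rmult_assoc _ (/ _)), Rinv_l, Rmult_1_r by lra.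
    replace (300 * w ^ 2 * (/ a) ^ 2 * (a ^ 4 * (a ^ 2 - w ^ 2) ^ 2))
      with (w ^ 2 * (300 * a ^ 2 * (a ^ 2 - w ^ 2) ^ 2)) by (field; lra).
    apply Rmult_le_compat_l; [nra|].
    assert ((3 / 4 * a ^ 2) ^ 2 <= (a ^ 2 - w ^ 2) ^ 2) by (apply pow_incr; nra).
    assert (/ 16 <= a ^ 4) by (replace (/ 16) with ((/ 2) ^ 4) by field; apply pow_incr; lra).
    assert (300 * a ^ 2 * (9 / 16 * / 16) <= 300 * a ^ 2 * (a ^ 2 - w ^ 2) ^ 2).
    { apply Rmult_le_compat_l; nra. }
    nra.
Qed.

(** The second difference of [eis 2 = csc2] at [1/2] with step [w], divided by [w^2], replaces
    termwise differentiation. One side tends to 6 times the sum of [(n + 1/2)^-4], which is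
    [15 zeta 4]; the other is [pi^2 (tan(pi w)/w)^2] and tends to [pi^4]. *)
Lemma zeta4 : zeta 4 = (PI ^ 4 / 90)%C.
Proof.
  set (u := fun n : nat => / (1 / 2 + INR n)).
  assert (Hu : forall n, / 2 <= 1 / 2 + INR n) by (intros n; pose proof (pos_INR n); lra).
  assert (X : forall (x : R), x <> 0 -> forall k, ((/ x) ^ k)%C = RtoC ((/ x) ^ k)).
  { intros x Hx k. now rewrite <- RtoC_inv, RtoC_pow by assumption. }
  assert (Eu : forall n k, ((/ (1 / 2 + INR n)) ^ k)%C = RtoC (u n ^ k)).
  { intros n k. rewrite <- RtoC_div, <- RtoC_plus by lra. apply X. specialize (Hu n). lra. }
  assert (Sk : forall k, (2 <= k)%nat -> ex_series (fun n => u n ^ k)).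
  { intros k Hk. apply (ex_series_ext (fun n => Cmod ((/ (1 / 2 + INR n)) ^ k)%C));
      [|now apply csm_inv_pow].
    intros n. rewrite Eu, Cmod_R, Rabs_pos_eq; [reflexivity|].
    apply pow_le. left. apply Rinv_0_lt_compat. specialize (Hu n). lra. }
  assert (E2 : Series (fun n => u n ^ 2) = PI ^ 2 / 2).
  { apply RtoC_inj. rewrite <- csum_RtoC. rewrite <- (csum_ext _ _ (fun n => Eu n 2%nat)).
    rewrite zeta_half, zeta2 by lia. rewrite RtoC_div, RtoC_pow by lra. field. }
  set (f := fun (w : R) n => (/ (1 / 2 + INR n + w)) ^ 2 + (/ (1 / 2 + INR n - w)) ^ 2).
  assert (Ef : forall w, 0 < w <= / 4 -> Series (f w) = PI ^ 2 * (1 + tan (PI * w) ^ 2) /\ ex_series (f w)).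
  { intros w Hw.
    assert (Hw' : Rabs w < / 2) by (rewrite Rabs_pos_eq; lra).
    assert (P1 : forall n, ((/ (1 / 2 + w + INR n)) ^ 2)%C = RtoC ((/ (1 / 2 + INR n + w)) ^ 2)).
    { intros n. specialize (Hu n). rewrite <- X by lra. do 2 f_equal.
      rewrite !RtoC_plus, RtoC_div by lra. ring. }
    assert (P2 : forall n, ((/ (1 / 2 - w + INR n)) ^ 2)%C = RtoC ((/ (1 / 2 + INR n - w)) ^ 2)).
    { intros n. specialize (Hu n). rewrite <- X by lra. do 2 f_equal.
      rewrite !RtoC_minus, !RtoC_plus, RtoC_div by lra. ring. }
    assert (Q1 : ex_series (fun n => (/ (1 / 2 + INR n + w)) ^ 2)).
    { apply (ex_series_ext (fun n => Cmod ((/ (1 / 2 + w + INR n)) ^ 2)%C)); [|apply csm_inv_pow; lia].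
      intros n. rewrite P1, Cmod_R, Rabs_pos_eq by (apply pow2_ge_0). reflexivity. }
    assert (Q2 : ex_series (fun n => (/ (1 / 2 + INR n - w)) ^ 2)).
    { apply (ex_series_ext (fun n => Cmod ((/ (1 / 2 - w + INR n)) ^ 2)%C)); [|apply csm_inv_pow; lia].
      intros n. rewrite P2, Cmod_R, Rabs_pos_eq by (apply pow2_ge_0). reflexivity. }
    split; [|now apply (ex_series_plus (V := R_NormedModule))].
    apply RtoC_inj. unfold f. rewrite Series_plus, RtoC_plus, <- !csum_RtoC by assumption.
    rewrite <- (csum_ext _ _ P1), <- (csum_ext _ _ P2), <- eis_half_even.
    rewrite eis2_csc2 by now apply nonint_half_plus. now apply csc2_half_plus. }
  assert (E4 : 6 * Series (fun n => u n ^ 4) = PI ^ 4).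
  { set (w := fun m => / (INR m + 4)).
    assert (Hw : forall m, 0 < w m <= / 4).
    { intros m. pose proof (pos_INR m). unfold w. split; [apply Rinv_0_lt_compat; lra|].
      apply Rinv_le_contravar; lra. }
    assert (Hw0 : is_lim_seq w 0).
    { apply (is_lim_seq_inv (fun n => INR n + 4) p_infty); [|discriminate].
      eapply is_lim_seq_plus; [apply is_lim_seq_INR|apply is_lim_seq_const|reflexivity]. }
    set (T := fun m => PI ^ 2 * (tan (PI * w m) / w m) ^ 2).
    assert (L1 : is_lim_seq T (PI ^ 4)).
    { replace (PI ^ 4) with (PI ^ 2 * PI ^ 2) by ring.
      apply (is_lim_seq_scal_l _ (PI ^ 2) (PI ^ 2)), tan_sq_lim. }
    assert (B : forall m, 6 * Series (fun n => u n ^ 4) <= T m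
       <= 6 * Series (fun n => u n ^ 4) + (300 * Series (fun n => u n ^ 2)) * (w m * w m)).
    { intros m. specialize (Hw m). destruct (Ef (w m) Hw) as [E S].
      set (g := fun n => (f (w m) n - 2 * u n ^ 2) / w m ^ 2).
      assert (S2 := Sk 2%nat (le_n 2)). assert (S4 := Sk 4%nat ltac:(lia)).
      assert (Sf : ex_series (fun n => f (w m) n - 2 * u n ^ 2)).
      { apply (ex_series_minus (V := R_NormedModule)); [exact S|].
        now apply (ex_series_scal_l (V := R_NormedModule) 2). }
      assert (Sg : ex_series g) by now apply (ex_series_scal_r (/ w m ^ 2)).
      assert (Eg : Series g = T m).
      { unfold g, Rdiv. rewrite Series_scal_r, Series_minus, Series_scal_l, E, E2
          by (auto; now apply (ex_series_scal_l (V := R_NormedModule) 2)).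
        unfold T. field. lra. }
      assert (Bd : forall n, 0 <= g n - 6 * u n ^ 4 <= 300 * w m ^ 2 * u n ^ 2).
      { intros n. apply second_diff_bound; auto. }
      assert (S6 : ex_series (fun n => 6 * u n ^ 4)) by now apply (ex_series_scal_l (V := R_NormedModule) 6).
      assert (S3 : ex_series (fun n => 300 * w m ^ 2 * u n ^ 2))
        by now apply (ex_series_scal_l (V := R_NormedModule) (300 * w m ^ 2)).
      rewrite <- Eg. split.
      - rewrite <- Series_scal_l. apply Series_le; [|exact Sg].
        intros n. specialize (Bd n). split; [|lra].
        apply Rmult_le_pos; [lra|]. apply pow_le. left. apply Rinv_0_lt_compat. specialize (Hu n). lra.
      - replace (300 * Series (fun n => u n ^ 2) * (w m * w m))
          with (300 * w m ^ 2 * Series (fun n => u n ^ 2)) by ring.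
        rewrite <- !Series_scal_l, <- Series_plus by assumption.
        apply Series_le; [|now apply (ex_series_plus (V := R_NormedModule))].
        intros n. specialize (Bd n).
        assert (0 <= 6 * u n ^ 4).
        { apply Rmult_le_pos; [lra|]. apply pow_le. left. apply Rinv_0_lt_compat. specialize (Hu n). lra. }
        lra. }
    assert (L2 : is_lim_seq T (6 * Series (fun n => u n ^ 4))).
    { apply (is_lim_seq_le_le _ _ _ _ B); [apply is_lim_seq_const|].
      replace (Finite (6 * Series (fun n => u n ^ 4))) with
       (Finite (6 * Series (fun n => u n ^ 4) + (300 * Series (fun n => u n ^ 2)) * (0 * 0))) by (f_equal; ring).
      apply is_lim_seq_plus'; [apply is_lim_seq_const|].
      apply (is_lim_seq_scal_l _ _ (Finite (0 * 0))). now apply is_lim_seq_mult'. }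
    apply is_lim_seq_unique in L1. apply is_lim_seq_unique in L2. congruence. }
  assert (E5 : ((2 ^ 4 - 1) * zeta 4)%C = RtoC (PI ^ 4 / 6)).
  { rewrite <- zeta_half by lia. rewrite (csum_ext _ _ (fun n => Eu n 4%nat)), csum_RtoC. f_equal. lra. }
  replace (zeta 4) with ((2 ^ 4 - 1) * zeta 4 / 15)%C by field.
  rewrite E5, RtoC_div, RtoC_pow by lra. field.
Qed.

(** * The partial fraction expansion of the cotangent *)

(** This is [pi cot(pi z)]. *)
Definition cotc (z : C) : C := (PI * Ci * (q_param z + 1) / (q_param z - 1))%C.

(** The poles [-n] and [n + 1] are symmetric about [1/2], so each term vanishes there, as the
    cotangent does. *)
Definition pterm (z : C) (n : nat) : C := (/ (z + INR n) + / (z - INR (S n)))%C.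

Lemma cderiv_q_param (f : R -> C) (t : R) (l : C) :
  cderiv f t l -> cderiv (fun s => q_param (f s)) t (q_param (f t) * (2 * PI * Ci * l))%C.
Proof. intros H. unfold q_param. now apply cderiv_Cexp, cderiv_scal. Qed.

Lemma q_minus_1_neq (z : C) : nonint z -> (q_param z - 1)%C <> RtoC 0.
Proof.
  intros H E. apply (q_param_neq_1 z H). replace (1 - q_param z)%C with (- (q_param z - 1))%C by ring.
  rewrite E. ring.
Qed.

Lemma cderiv_cotc (f : R -> C) (t : R) (l : C) : nonint (f t) ->
  cderiv f t l -> cderiv (fun s => cotc (f s)) t (- csc2 (f t) * l)%C.
Proof.
  intros Hn H. pose proof (q_minus_1_neq _ Hn) as H1. pose proof (q_param_neq_1 _ Hn) as H2.
  unfold cotc. pose proof (cderiv_q_param f t l H) as Hq.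
  eapply cderiv_eq.
  - apply (cderiv_mult (fun s => PI * Ci * (q_param (f s) + 1))%C (fun s => / (q_param (f s) - 1))%C).
    + apply cderiv_scal, cderiv_plus; [exact Hq|apply cderiv_const].
    + apply cderiv_inv; [exact H1|]. apply cderiv_minus; [exact Hq|apply cderiv_const].
  - cbv beta. unfold csc2.
    transitivity (- (4 * PI ^ 2 * (Ci * Ci)) * q_param (f t) * l / (q_param (f t) - 1) ^ 2)%C; [field; auto|].
    rewrite Ci_sq. field. auto.
Qed.

(** Integration of [eis 2 = csc2] from [1/2] to [z1]: both sides vanish at [1/2], the segment meets
    no integer, and the tail of [eis 2] is uniformly small on it. *)
Lemma cot_series (z1 : C) : 0 < Im z1 -> Ccv (csn (pterm z1)) (cotc z1).
Proof.
  intros Hz1. set (u := (z1 - 1 / 2)%C). set (z := fun s : R => (1 / 2 + s * u)%C).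
  assert (Hni : forall s, 0 <= s <= 1 -> nonint (z s)).
  { intros s Hs. destruct (Req_dec s 0) as [->|Hne].
    - unfold z. replace (1 / 2 + 0 * u)%C with (1 / 2 + RtoC 0)%C by ring.
      apply nonint_half_plus. rewrite Rabs_R0. lra.
    - apply nonint_Im. unfold z, u.
      replace (Im (1 / 2 + s * (z1 - 1 / 2))%C) with (s * Im z1) by (unfold Im; simpl; field).
      nra. }
  set (Rd := Cmod (1 / 2)%C + Cmod u).
  assert (HRd : forall s, 0 <= s <= 1 -> Cmod (z s) <= Rd).
  { intros s Hs. unfold z, Rd. eapply Rle_trans; [apply Cmod_triangle|].
    rewrite Cmod_mult, Cmod_R, Rabs_pos_eq by lra. pose proof (Cmod_ge_0 u). nra. }
  destruct (nfloor_ex Rd) as [N0 [_ HN0]].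
  { unfold Rd. pose proof (Cmod_ge_0 (1 / 2)%C). pose proof (Cmod_ge_0 u). lra. }
  set (b := fun n => / (INR n + 1) ^ 2).
  set (tail := fun N => Series (fun k => b (N + k)%nat)).
  assert (Bd : forall N s, 0 <= s <= 1 ->
    Cmod (csc2 (z s) - csn (fun n => (/ (z s + INR n)) ^ 2 + (/ (z s - INR (S n))) ^ 2) (N + (N0 + 2)))%C
      <= 2 * tail N).
  { intros N s Hs. rewrite <- eis2_csc2, csn_plus by auto. unfold eis.
    set (N1 := (N + (N0 + 2))%nat).
    pose proof (csm_inv_pow (z s) 2 (le_n 2)) as S1. pose proof (csm_inv_pow_left (z s) 2 (le_n 2)) as S2.
    match goal with |- Cmod (?a + ?b - (?c + ?d))%C <= _ =>
      replace (a + b - (c + d))%C with ((a - c) + (b - d))%C by ring end.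
    rewrite (csn_shift_tail _ N1 S1), (csn_shift_tail _ N1 S2).
    eapply Rle_trans; [apply Cmod_triangle|].
    replace (2 * tail N) with (tail N + tail N) by ring.
    assert (HL : forall k, INR (N + k) + 1 <= INR (N1 + k) - Rd).
    { intros k. unfold N1. rewrite !plus_INR. simpl. lra. }
    assert (G : forall (k : nat) (x : C), INR (N + k) + 1 <= Cmod x -> Cmod ((/ x) ^ 2)%C <= b (N + k)%nat).
    { intros k x Hx. pose proof (pos_INR (N + k)).
      rewrite Cmod_pow, Cmod_inv by (apply Cmod_gt_0; lra). unfold b. rewrite <- pow_inv.
      apply pow_incr. split; [left; apply Rinv_0_lt_compat; lra|apply Rinv_le_contravar; lra]. }
    specialize (HRd s Hs).
    apply Rplus_le_compat; apply csum_Cmod; try (apply ex_series_shift, ex_series_inv_sq);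
      intros k; apply G; specialize (HL k); eapply Rle_trans; try exact HL.
    - pose proof (Cmod_triangle_rev (INR (N1 + k)) (- z s)%C) as T.
      rewrite Cmod_R, Rabs_pos_eq, Cmod_opp in T by apply pos_INR.
      replace (INR (N1 + k) - - z s)%C with (z s + INR (N1 + k))%C in T by ring. lra.
    - pose proof (Cmod_triangle_rev (INR (S (N1 + k))) (z s)) as T.
      rewrite Cmod_R, Rabs_pos_eq, Cmod_sub_sym in T by apply pos_INR.
      rewrite S_INR in *. lra. }
  assert (Hlim : is_lim_seq (fun N => Cmod (csn (pterm z1) (N + (N0 + 2)) - cotc z1)%C) 0).
  { apply (is_lim_seq_le_le (fun _ => 0) _ (fun N => 2 * Cmod u * tail N)).
    - intros N. split; [apply Cmod_ge_0|]. set (N1 := (N + (N0 + 2))%nat).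
      set (f := fun s => (cotc (z s) - csn (pterm (z s)) N1)%C).
      replace (csn (pterm z1) N1 - cotc z1)%C with (- (f 1 - f 0))%C.
      + rewrite Cmod_opp.
        apply (cderiv_mvt_const f (fun s => - (csc2 (z s) -
           csn (fun n => (/ (z s + INR n)) ^ 2 + (/ (z s - INR (S n))) ^ 2) N1) * u)%C).
        * intros s Hs. specialize (Hni s Hs).
          assert (Dz : cderiv z s u) by apply cderiv_line.
          apply (cderiv_eq _ _ (- csc2 (z s) * u - csn (fun n =>
             - u * ((/ (z s + INR n)) ^ 2 + (/ (z s - INR (S n))) ^ 2)) N1)%C).
          2:{ rewrite csn_scal. ring. }
          apply cderiv_minus; [now apply cderiv_cotc|].
          apply (cderiv_csn (fun n s => pterm (z s) n)). intros n _. unfold pterm.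
          pose proof (nonint_plus_nat _ n Hni) as Hp. pose proof (nonint_minus_nat _ (S n) Hni) as Hm.
          eapply cderiv_eq; [apply cderiv_plus; apply cderiv_inv; try assumption|].
          -- apply cderiv_plus; [exact Dz|apply cderiv_const].
          -- apply cderiv_minus; [exact Dz|apply cderiv_const].
          -- cbv beta. field. auto.
        * intros s Hs. rewrite Cmod_mult, Cmod_opp.
          replace (2 * Cmod u * tail N) with (2 * tail N * Cmod u) by ring.
          apply Rmult_le_compat_r; [apply Cmod_ge_0|]. now apply Bd.
      + unfold f. replace (z 1) with z1 by (unfold z, u; ring).
        replace (z 0) with (1 / 2)%C by (unfold z; ring).
        replace (cotc (1 / 2)) with (RtoC 0).
        2:{ unfold cotc. rewrite q_param_half. replace (- (1) + 1)%C with (RtoC 0) by ring. unfold Cdiv. ring. }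
        rewrite (csn_ext (pterm (1 / 2)) (fun _ => RtoC 0)).
        2:{ intros k _. unfold pterm. rewrite S_INR, RtoC_plus.
            replace (1 / 2 - (INR k + 1))%C with (- (1 / 2 + INR k))%C by field.
            rewrite Cinv_opp. ring. }
        replace (csn (fun _ => RtoC 0) N1) with (RtoC 0); [ring|].
        clear. induction N1; simpl; [reflexivity|rewrite <- IHN1; ring].
    - apply is_lim_seq_const.
    - replace (Finite 0) with (Rbar_mult (2 * Cmod u) 0) by (simpl; f_equal; ring).
      apply is_lim_seq_scal_l. apply (Series_tail_lim b), ex_series_inv_sq. }
  unfold Ccv. apply (is_lim_seq_incr_n _ (N0 + 2)). exact Hlim.
Qed.

(** Here [q] tends to 0 geometrically, and [cotc] is [- pi i] at [q = 0]. This nonzero limit is the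
    source of the quasi-modularity of [E2]. *)
Lemma cotc_lim (s : C) : 0 < Im s -> Ccv (fun N => cotc ((INR N + 1 / 2) * s)) (- (PI * Ci))%C.
Proof.
  intros Hs. pose proof PI_RGT_0 as HPI.
  set (r := exp (- (2 * PI * Im s))).
  set (r0 := exp (- (PI * Im s))).
  assert (Hr : 0 < r < 1).
  { unfold r. split; [apply exp_pos|]. rewrite <- exp_0. apply exp_increasing. nra. }
  assert (Hr0 : 0 < r0 < 1).
  { unfold r0. split; [apply exp_pos|]. rewrite <- exp_0. apply exp_increasing. nra. }
  apply (Ccv_squeeze _ _ (fun N => (2 * PI / (1 - r0)) * r ^ N)).
  - intros N. set (z := ((INR N + 1 / 2) * s)%C).
    assert (HI : Im z = (INR N + 1 / 2) * Im s) by (unfold z, Im; simpl; field).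
    pose proof (pos_INR N) as HN.
    assert (Hq : Cmod (q_param z) = r0 * r ^ N).
    { rewrite Cmod_q_param, HI. unfold r0, r. rewrite exp_pow, <- exp_plus. f_equal. field. }
    assert (HrN : 0 < r ^ N <= 1) by (split; [apply pow_lt; lra|apply pow_le_one; lra]).
    assert (Hn : nonint z) by (apply nonint_Im; rewrite HI; nra).
    pose proof (q_minus_1_neq z Hn) as Hn1.
    replace (cotc z - - (PI * Ci))%C with (2 * PI * Ci * q_param z / (q_param z - 1))%C
      by (unfold cotc; field; auto).
    rewrite Cmod_div, !Cmod_mult, Cmod_Ci, !Cmod_R, Hq by auto.
    rewrite (Rabs_pos_eq 2), (Rabs_pos_eq PI) by lra.
    assert (1 - r0 <= Cmod (q_param z - 1)%C).
    { rewrite Cmod_sub_sym. eapply Rle_trans; [|apply Cmod_triangle_rev]. rewrite Cmod_1, Hq. nra. }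
    unfold Rdiv. replace (2 * PI * / (1 - r0) * r ^ N) with ((2 * PI * r ^ N) * / (1 - r0)) by ring.
    apply Rmult_le_compat.
    + apply Rmult_le_pos; nra.
    + left. apply Rinv_0_lt_compat. lra.
    + assert (r0 * r ^ N <= r ^ N) by nra. rewrite Rmult_1_r. apply Rmult_le_compat_l; lra.
    + apply Rinv_le_contravar; lra.
  - replace (Finite 0) with (Rbar_mult (2 * PI / (1 - r0)) 0) by (simpl; f_equal; ring).
    apply is_lim_seq_scal_l, is_lim_seq_geom. rewrite Rabs_pos_eq; lra.
Qed.

(** Pairing [m] with [-m] instead of [-(m+1)] changes the partial sums by [-1/z + 1/(z + K)], and
    the last term tends to 0. *)
Lemma cot_sum_pos (z : C) : 0 < Im z -> 
  csum (fun m => / (z + INR (S m)) + / (z - INR (S m)))%C = (cotc z - / z)%C.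
Proof.
  intros Hz. pose proof (nonint_Im z ltac:(lra)) as Hn.
  assert (E : forall K, (csn (fun m => / (z + INR (S m)) + / (z - INR (S m))) K
     = csn (pterm z) K - / z + / (z + INR K))%C).
  { induction K.
    - simpl. replace (z + 0)%C with z by ring. ring.
    - cbn [csn]. rewrite IHK. unfold pterm. ring. }
  apply csum_unique.
  apply (Ccv_ext (fun K => csn (pterm z) K - / z + / (z + INR K))%C); [intros; now rewrite E|].
  replace (cotc z - / z)%C with (cotc z - / z + 0)%C by ring.
  apply Ccv_plus; [apply Ccv_minus; [now apply cot_series|apply Ccv_const]|].
  assert (S2 := csm_inv_pow z 2 (le_n 2)). apply ex_series_lim_0 in S2.
  unfold Ccv. apply is_lim_seq_ext with (u := fun K => sqrt (Cmod ((/ (z + INR K)) ^ 2)%C)).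
  - intros K. rewrite Cmod_pow, sqrt_pow2 by apply Cmod_ge_0. f_equal. ring.
  - rewrite <- sqrt_0. apply (is_lim_seq_continuous sqrt _ 0); [|exact S2].
    apply continuity_pt_sqrt. lra.
Qed.

(** * Lattice sums *)

(** Determinant over trace of the quadratic form [|x t + y|^2] in [(x, y)], a lower bound for its
    smaller eigenvalue. *)
Definition qform (t : C) : R := Im t ^ 2 / (1 + Re t ^ 2 + Im t ^ 2).

Lemma qform_pos (t : C) : 0 < Im t -> 0 < qform t.
Proof. intros H. unfold qform. apply Rdiv_lt_0_compat; nra. Qed.

Lemma qform_lower (t : C) (x y : R) :
  qform t * (x ^ 2 + y ^ 2) <= Cmod (x * t + y)%C * Cmod (x * t + y)%C.
Proof.
  rewrite <- Cmod2. unfold qform.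
  replace (Re (x * t + y)%C) with (x * Re t + y) by (unfold Re, Im; simpl; ring).
  replace (Im (x * t + y)%C) with (x * Im t) by (unfold Re, Im; simpl; ring).
  set (a := Re t). set (b := Im t).
  assert (H : 0 < 1 + a ^ 2 + b ^ 2) by nra.
  apply Rmult_le_reg_r with (1 + a ^ 2 + b ^ 2); [exact H|].
  replace (b ^ 2 / (1 + a ^ 2 + b ^ 2) * (x ^ 2 + y ^ 2) * (1 + a ^ 2 + b ^ 2))
    with (b ^ 2 * (x ^ 2 + y ^ 2)) by (field; lra).
  apply Rminus_le_0.
  match goal with |- 0 <= ?X =>
    replace X with ((x * a ^ 2 + y * a + x * b ^ 2) ^ 2 + (x * a + y) ^ 2) by ring end.
  apply Rplus_le_le_0_compat; apply pow2_ge_0.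
Qed.

Section Rows.
Variable t : C.
Hypothesis Ht : 0 < Im t.
Let d := qform t.
Let Hd : 0 < d := qform_pos t Ht.

Let zp (m n : nat) : C := (INR (S m) * t + INR (S n))%C.
Let zm (m n : nat) : C := (INR (S m) * t - INR (S n))%C.

Lemma INR_S_ge_1 (n : nat) : 1 <= INR (S n).
Proof. rewrite S_INR. pose proof (pos_INR n). lra. Qed.

Lemma lattice_sq_lower (z : C) (m n : nat) : z = zp m n \/ z = zm m n ->
  d * (INR (S m) ^ 2 + INR (S n) ^ 2) <= Cmod z ^ 2.
Proof.
  intros H. replace (Cmod z ^ 2) with (Cmod z * Cmod z) by ring. destruct H as [->| ->].
  - apply qform_lower.
  - unfold zm. pose proof (qform_lower t (INR (S m)) (- INR (S n))) as L.
    rewrite RtoC_opp in L. replace ((- INR (S n)) ^ 2) with (INR (S n) ^ 2) in L by ring. exact L.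
Qed.

(** Each factor of [(z - 1/2)(z + 1/2)] is a lattice value with [n] moved by [1/2], hence at least
    [n/2] in absolute value because [n >= 1]. *)
Lemma lattice_quarter_lower (z : C) (m n : nat) : z = zp m n \/ z = zm m n ->
  d * (INR (S m) ^ 2 + INR (S n) ^ 2 / 4) <= Cmod (z ^ 2 - 1 / 4)%C.
Proof.
  intros H.
  assert (L : forall x y : R, / 2 * INR (S n) <= Rabs y -> x = INR (S m) ->
    d * (INR (S m) ^ 2 + INR (S n) ^ 2 / 4) <= Cmod (x * t + y)%C * Cmod (x * t + y)%C).
  { intros x y Hy ->. eapply Rle_trans; [|apply qform_lower]. fold d.
    pose proof (INR_S_ge_1 n).
    assert (INR (S n) ^ 2 / 4 <= y ^ 2).
    { rewrite <- (pow2_abs y). replace (INR (S n) ^ 2 / 4) with ((/ 2 * INR (S n)) ^ 2) by field.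
      apply pow_incr. split; [lra|exact Hy]. }
    apply Rmult_le_compat_l; lra. }
  assert (M : forall (x : C), exists y1 y2 : R, / 2 * INR (S n) <= Rabs y1 /\ / 2 * INR (S n) <= Rabs y2 /\
      (z ^ 2 - 1 / 4 = (INR (S m) * t + y1) * (INR (S m) * t + y2))%C).
  { intros _. pose proof (INR_S_ge_1 n). destruct H as [->| ->]; unfold zp, zm.
    - exists (INR (S n) - / 2), (INR (S n) + / 2).
      rewrite !Rabs_pos_eq by lra. repeat split; try lra.
      rewrite RtoC_minus, RtoC_plus, RtoC_inv by lra. field.
    - exists (- INR (S n) - / 2), (- INR (S n) + / 2).
      rewrite !Rabs_left by lra. repeat split; try lra.
      rewrite RtoC_minus, RtoC_plus, RtoC_opp, RtoC_inv by lra. field. }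
  destruct (M 0) as [y1 [y2 [H1 [H2 E]]]]. rewrite E, Cmod_mult.
  pose proof (L _ y1 H1 eq_refl). pose proof (L _ y2 H2 eq_refl).
  set (K := d * _) in *.
  assert (0 <= K). { unfold K. pose proof (pow2_ge_0 (INR (S m))). pose proof (pow2_ge_0 (INR (S n))). apply Rmult_le_pos; lra. }
  pose proof (Cmod_ge_0 (INR (S m) * t + y1)%C). pose proof (Cmod_ge_0 (INR (S m) * t + y2)%C).
  apply Rsqr_incr_0_var; [|nra]. unfold Rsqr.
  replace (Cmod (INR (S m) * t + y1)%C * Cmod (INR (S m) * t + y2)%C *
    (Cmod (INR (S m) * t + y1)%C * Cmod (INR (S m) * t + y2)%C))
   with ((Cmod (INR (S m) * t + y1)%C * Cmod (INR (S m) * t + y1)%C) *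
     (Cmod (INR (S m) * t + y2)%C * Cmod (INR (S m) * t + y2)%C)) by ring.
  apply Rmult_le_compat; assumption.
Qed.

Lemma lattice_nonzero (z : C) (m n : nat) : z = zp m n \/ z = zm m n ->
  z <> RtoC 0 /\ (z ^ 2 - 1 / 4)%C <> RtoC 0.
Proof.
  intros H. pose proof (lattice_sq_lower z m n H) as L1. pose proof (lattice_quarter_lower z m n H) as L2.
  pose proof (INR_S_ge_1 m). pose proof (INR_S_ge_1 n).
  assert (0 < d * (INR (S m) ^ 2 + INR (S n) ^ 2)) by (apply Rmult_lt_0_compat; nra).
  assert (0 < d * (INR (S m) ^ 2 + INR (S n) ^ 2 / 4)) by (apply Rmult_lt_0_compat; nra).
  split; intros E.
  - rewrite E, Cmod_0 in L1. rewrite pow_i in L1 by lia. lra.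
  - rewrite E, Cmod_0 in L2. lra.
Qed.

Definition latt (k : nat) (s : C) (m n : nat) : C :=
  ((/ (INR (S m) * s + INR (S n))) ^ k + (/ (INR (S m) * s - INR (S n))) ^ k)%C.

(** Comparison terms for [latt 2], whose double sum converges only conditionally: these telescope
    in [n], and the double sum of the difference converges absolutely. *)
Definition latq (s : C) (m n : nat) : C :=
  (/ ((INR (S m) * s + INR (S n)) ^ 2 - 1 / 4) + / ((INR (S m) * s - INR (S n)) ^ 2 - 1 / 4))%C.

Lemma latt2_bound (z : C) (m n : nat) : z = zp m n \/ z = zm m n ->
  Cmod ((/ z) ^ 2)%C <= / d * / INR (S m) ^ 2 /\ Cmod ((/ z) ^ 2)%C <= / d * / INR (S n) ^ 2
  /\ Cmod ((/ z) ^ 2)%C <= / d * (/ INR (S m) * / INR (S n)).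
Proof.
  intros H. destruct (lattice_nonzero z m n H) as [Hz _].
  pose proof (lattice_sq_lower z m n H) as L1.
  pose proof (INR_S_ge_1 m). pose proof (INR_S_ge_1 n).
  rewrite Cmod_pow, Cmod_inv, pow_inv by exact Hz.
  rewrite <- !Rinv_mult.
  set (a := INR (S m)) in *. set (b := INR (S n)) in *.
  assert (E1 : d * a ^ 2 <= d * (a ^ 2 + b ^ 2)) by (apply Rmult_le_compat_l; nra).
  assert (E2 : d * b ^ 2 <= d * (a ^ 2 + b ^ 2)) by (apply Rmult_le_compat_l; nra).
  assert (E3 : d * (a * b) <= d * (a ^ 2 + b ^ 2)) by (apply Rmult_le_compat_l; nra).
  repeat split; apply Rinv_le_contravar; try lra; apply Rmult_lt_0_compat; nra.
Qed.

Lemma latq_bound (z : C) (m n : nat) : z = zp m n \/ z = zm m n ->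
  Cmod (/ (z ^ 2 - 1 / 4))%C <= 4 * / d * / INR (S m) ^ 2 /\ Cmod (/ (z ^ 2 - 1 / 4))%C <= 4 * / d * / INR (S n) ^ 2
  /\ Cmod (/ (z ^ 2 - 1 / 4))%C <= / d * (/ INR (S m) * / INR (S n)).
Proof.
  intros H. destruct (lattice_nonzero z m n H) as [_ Hz].
  pose proof (lattice_quarter_lower z m n H) as L1.
  pose proof (INR_S_ge_1 m). pose proof (INR_S_ge_1 n).
  rewrite Cmod_inv by exact Hz.
  replace (4 * / d * / INR (S m) ^ 2) with (/ (d * INR (S m) ^ 2 / 4)) by (field; lra).
  replace (4 * / d * / INR (S n) ^ 2) with (/ (d * INR (S n) ^ 2 / 4)) by (field; lra).
  rewrite <- !Rinv_mult.
  set (a := INR (S m)) in *. set (b := INR (S n)) in *.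
  assert (E1 : d * a ^ 2 / 4 <= d * (a ^ 2 + b ^ 2 / 4)).
  { replace (d * a ^ 2 / 4) with (d * (a ^ 2 / 4)) by field. apply Rmult_le_compat_l; nra. }
  assert (E2 : d * b ^ 2 / 4 <= d * (a ^ 2 + b ^ 2 / 4)).
  { replace (d * b ^ 2 / 4) with (d * (b ^ 2 / 4)) by field. apply Rmult_le_compat_l; nra. }
  assert (E3 : d * (a * b) <= d * (a ^ 2 + b ^ 2 / 4)).
  { apply Rmult_le_compat_l; [lra|]. pose proof (pow2_ge_0 (a - b / 2)). nra. }
  assert (0 < d * a ^ 2) by (apply Rmult_lt_0_compat; nra).
  assert (0 < d * b ^ 2) by (apply Rmult_lt_0_compat; nra).
  assert (0 < d * (a * b)) by (apply Rmult_lt_0_compat; nra).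
  repeat split; apply Rinv_le_contravar; lra.
Qed.

(** The difference of [z^-2] and [(z^2 - 1/4)^-1] is [-1/4] times their product, hence of order 4 in
    the lattice vector. *)
Lemma latt_minus_latq_bound (m n : nat) :
  Cmod (latt 2 t m n - latq t m n)%C <= (/ d) ^ 2 * / INR (S m) ^ 2 * / INR (S n) ^ 2.
Proof.
  assert (P : forall z, z = zp m n \/ z = zm m n ->
    Cmod ((/ z) ^ 2 - / (z ^ 2 - 1 / 4))%C <= (/ d) ^ 2 * / INR (S m) ^ 2 * / INR (S n) ^ 2 / 4).
  { intros z H. destruct (lattice_nonzero z m n H) as [Hz1 Hz2].
    destruct (latt2_bound z m n H) as [_ [_ B1]]. destruct (latq_bound z m n H) as [_ [_ B2]].
    pose proof (INR_S_ge_1 m). pose proof (INR_S_ge_1 n).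
    replace ((/ z) ^ 2 - / (z ^ 2 - 1 / 4))%C with (- (1) / 4 * ((/ z) ^ 2 * / (z ^ 2 - 1 / 4)))%C.
    2:{ field. split; [|exact Hz1]. cbv beta. intros E. apply Hz2.
        replace (z ^ 2 - 1 / 4)%C with ((z ^ 2 * 4 - 1) / 4)%C by field. rewrite E. unfold Cdiv. ring. }
    rewrite Cmod_mult, Cmod_div, Cmod_opp, Cmod_1, Cmod_R, Rabs_pos_eq, Cmod_mult by (try lra; apply RtoC_neq; lra).
    replace ((/ d) ^ 2 * / INR (S m) ^ 2 * / INR (S n) ^ 2 / 4)
     with (1 / 4 * ((/ d * (/ INR (S m) * / INR (S n))) * (/ d * (/ INR (S m) * / INR (S n))))) by (field; lra).
    apply Rmult_le_compat_l; [lra|]. apply Rmult_le_compat; auto using Cmod_ge_0. }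
  pose proof (P (zp m n) (or_introl eq_refl)). pose proof (P (zm m n) (or_intror eq_refl)).
  unfold latt, latq. fold (zp m n) (zm m n).
  replace ((/ zp m n) ^ 2 + (/ zm m n) ^ 2 - (/ (zp m n ^ 2 - 1 / 4) + / (zm m n ^ 2 - 1 / 4)))%C
   with (((/ zp m n) ^ 2 - / (zp m n ^ 2 - 1 / 4)) + ((/ zm m n) ^ 2 - / (zm m n ^ 2 - 1 / 4)))%C by ring.
  eapply Rle_trans; [apply Cmod_triangle|].
  assert (0 <= (/ d) ^ 2 * / INR (S m) ^ 2 * / INR (S n) ^ 2); [|lra].
  pose proof (INR_S_ge_1 m). pose proof (INR_S_ge_1 n).
  assert (0 < / d) by now apply Rinv_0_lt_compat.
  repeat apply Rmult_le_pos; try lra; left; apply Rinv_0_lt_compat; apply pow_lt; lra.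
Qed.

Lemma latt4_bound (m n : nat) :
  Cmod (latt 4 t m n) <= (2 * (/ d) ^ 2 * / INR (S m) ^ 2) * / INR (S n) ^ 2.
Proof.
  assert (P : forall z, z = zp m n \/ z = zm m n ->
    Cmod ((/ z) ^ 4)%C <= (/ d) ^ 2 * / INR (S m) ^ 2 * / INR (S n) ^ 2).
  { intros z H. destruct (latt2_bound z m n H) as [_ [_ B1]].
    pose proof (INR_S_ge_1 m). pose proof (INR_S_ge_1 n).
    replace ((/ z) ^ 4)%C with ((/ z) ^ 2 * (/ z) ^ 2)%C by ring. rewrite Cmod_mult.
    replace ((/ d) ^ 2 * / INR (S m) ^ 2 * / INR (S n) ^ 2)
     with ((/ d * (/ INR (S m) * / INR (S n))) * (/ d * (/ INR (S m) * / INR (S n)))) by (field; lra).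
    apply Rmult_le_compat; auto using Cmod_ge_0. }
  pose proof (P (zp m n) (or_introl eq_refl)). pose proof (P (zm m n) (or_intror eq_refl)).
  unfold latt. fold (zp m n) (zm m n). eapply Rle_trans; [apply Cmod_triangle|]. lra.
Qed.

Lemma ex_series_inv_S_sq (c : R) : ex_series (fun n => c * / INR (S n) ^ 2).
Proof.
  apply (ex_series_scal_l (V := R_NormedModule) c).
  apply (ex_series_ext (fun n => / (INR n + 1) ^ 2)); [intros; now rewrite S_INR|apply ex_series_inv_sq].
Qed.

Lemma ex_series_inv_S_sq' : ex_series (fun n => / INR (S n) ^ 2).
Proof.
  apply (ex_series_ext (fun n => / (INR n + 1) ^ 2)); [intros; now rewrite S_INR|apply ex_series_inv_sq].
Qed.

Lemma inv_S_sq_pos (n : nat) : 0 <= / INR (S n) ^ 2.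
Proof. left. apply Rinv_0_lt_compat, pow_lt. pose proof (INR_S_ge_1 n). lra. Qed.

Lemma latt4_swap : csum (fun m => csum (latt 4 t m)) = csum (fun n => csum (fun m => latt 4 t m n)).
Proof.
  apply (csum_fubini _ _ _ latt4_bound); auto using inv_S_sq_pos, ex_series_inv_S_sq, ex_series_inv_S_sq'.
  intros m. apply Rmult_le_pos; [|apply inv_S_sq_pos].
  assert (0 < / d) by now apply Rinv_0_lt_compat. nra.
Qed.

Lemma csm_latt2_row (m : nat) : csm (latt 2 t m).
Proof.
  apply (csm_le _ (fun n => 2 * / d * / INR (S n) ^ 2)); [|apply ex_series_inv_S_sq].
  intros n. unfold latt. fold (zp m n) (zm m n).
  destruct (latt2_bound (zp m n) m n) as [_ [B1 _]]; auto.
  destruct (latt2_bound (zm m n) m n) as [_ [B2 _]]; auto.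
  eapply Rle_trans; [apply Cmod_triangle|]. lra.
Qed.

Lemma csm_latt2_col (n : nat) : csm (fun m => latt 2 t m n).
Proof.
  apply (csm_le _ (fun m => 2 * / d * / INR (S m) ^ 2)); [|apply ex_series_inv_S_sq].
  intros m. unfold latt. fold (zp m n) (zm m n).
  destruct (latt2_bound (zp m n) m n) as [B1 _]; auto.
  destruct (latt2_bound (zm m n) m n) as [B2 _]; auto.
  eapply Rle_trans; [apply Cmod_triangle|]. lra.
Qed.

Lemma csm_latq_row (m : nat) : csm (latq t m).
Proof.
  apply (csm_le _ (fun n => 8 * / d * / INR (S n) ^ 2)); [|apply ex_series_inv_S_sq].
  intros n. unfold latq. fold (zp m n) (zm m n).
  destruct (latq_bound (zp m n) m n) as [_ [B1 _]]; auto.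
  destruct (latq_bound (zm m n) m n) as [_ [B2 _]]; auto.
  eapply Rle_trans; [apply Cmod_triangle|]. lra.
Qed.

Lemma csm_latq_col (n : nat) : csm (fun m => latq t m n).
Proof.
  apply (csm_le _ (fun m => 8 * / d * / INR (S m) ^ 2)); [|apply ex_series_inv_S_sq].
  intros m. unfold latq. fold (zp m n) (zm m n).
  destruct (latq_bound (zp m n) m n) as [B1 _]; auto.
  destruct (latq_bound (zm m n) m n) as [B2 _]; auto.
  eapply Rle_trans; [apply Cmod_triangle|]. lra.
Qed.

Lemma diff_swap :
  csum (fun m => csum (fun n => latt 2 t m n - latq t m n))%C
  = csum (fun n => csum (fun m => latt 2 t m n - latq t m n))%C
  /\ csm (fun m => csum (fun n => latt 2 t m n - latq t m n))%C
  /\ csm (fun n => csum (fun m => latt 2 t m n - latq t m n))%C.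
Proof.
  assert (0 < / d) by now apply Rinv_0_lt_compat.
  assert (Hp : forall i, 0 <= (/ d) ^ 2 * / INR (S i) ^ 2).
  { intros i. apply Rmult_le_pos; [nra|apply inv_S_sq_pos]. }
  split; [|split].
  - apply (csum_fubini _ _ _ latt_minus_latq_bound); auto using inv_S_sq_pos, ex_series_inv_S_sq, ex_series_inv_S_sq'.
  - apply (csm_fubini_rows _ _ _ latt_minus_latq_bound); auto using ex_series_inv_S_sq, ex_series_inv_S_sq'.
  - apply (csm_fubini_rows (fun n m => latt 2 t m n - latq t m n)%C (fun n => / INR (S n) ^ 2)
      (fun m => (/ d) ^ 2 * / INR (S m) ^ 2)); auto using inv_S_sq_pos, ex_series_inv_S_sq, ex_series_inv_S_sq'.
    intros n m. rewrite Rmult_comm. apply latt_minus_latq_bound.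
Qed.

(** The term [n = 0], which [latq] leaves out but the telescoping over [|n| <= N] contains. *)
Let zeroq (m : nat) : C := (/ ((INR (S m) * t) ^ 2 - 1 / 4))%C.

(** The two ends left over when the terms with [|n| <= N] telescope. *)
Let edge (m N : nat) : C :=
  (/ (INR (S m) * t - (INR N + 1 / 2)) - / (INR (S m) * t + (INR N + 1 / 2)))%C.

Lemma Mt_plus_real_neq (m : nat) (x : R) : (INR (S m) * t + x)%C <> RtoC 0.
Proof.
  intros E. apply (f_equal Im) in E. 
  replace (Im (INR (S m) * t + x)%C) with (INR (S m) * Im t) in E by (unfold Im; simpl; ring).
  pose proof (INR_S_ge_1 m). change (Im (RtoC 0)) with 0 in E. nra.
Qed.

(** [1/(z^2 - 1/4) = 1/(z - 1/2) - 1/(z + 1/2)] telescopes. *)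
Lemma latq_partial (m N : nat) : csn (latq t m) N = (edge m N - zeroq m)%C.
Proof.
  assert (X : forall x : R, (INR (S m) * t + x)%C <> RtoC 0) by apply Mt_plus_real_neq.
  set (z := (INR (S m) * t)%C) in *.
  assert (Y : forall x y : R, RtoC x = (- y)%C -> (z - y)%C <> RtoC 0).
  { intros x y E. unfold Cminus. rewrite <- E. apply X. }
  assert (Q : forall w : C, (w - 1 / 2)%C <> RtoC 0 -> (w + 1 / 2)%C <> RtoC 0 ->
    (/ (w ^ 2 - 1 / 4) = / (w - 1 / 2) - / (w + 1 / 2))%C).
  { intros w H1 H2. replace (w ^ 2 - 1 / 4)%C with ((w - 1 / 2) * (w + 1 / 2))%C by field.
    field. split.
    - intros E. apply H2. replace (w + 1 / 2)%C with ((w * 2 + 1) / 2)%C by field. rewrite E. unfold Cdiv; ring.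
    - intros E. apply H1. replace (w - 1 / 2)%C with ((w * 2 - 1) / 2)%C by field. rewrite E. unfold Cdiv; ring. }
  assert (Z : forall x y : R, (z + x + y)%C <> RtoC 0).
  { intros x y. rewrite <- Cplus_assoc, <- RtoC_plus. apply X. }
  assert (W : forall (w : C) (x : R), w = (z + x)%C -> (/ (w ^ 2 - 1 / 4) = / (w - 1 / 2) - / (w + 1 / 2))%C).
  { intros w x ->. apply Q.
    - replace (z + x - 1 / 2)%C with (z + x + RtoC (- (1 / 2)))%C by (rewrite RtoC_opp, RtoC_div by lra; ring). apply Z.
    - replace (z + x + 1 / 2)%C with (z + x + RtoC (1 / 2))%C by (rewrite RtoC_div by lra; ring). apply Z. }
  induction N.
  - unfold zeroq, edge. fold z. rewrite (W z 0) by ring. simpl.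
    replace (z - (0 + 1 / 2))%C with (z - 1 / 2)%C by ring. replace (z + (0 + 1 / 2))%C with (z + 1 / 2)%C by ring.
    ring.
  - cbn [csn]. rewrite IHN. unfold latq, edge. fold z.
    rewrite (W (z + INR (S N))%C (INR (S N))) by reflexivity.
    rewrite (W (z - INR (S N))%C (- INR (S N))) by (rewrite RtoC_opp; reflexivity).
    rewrite S_INR, RtoC_plus.
    replace (z + (INR N + 1) - 1 / 2)%C with (z + (INR N + 1 / 2))%C by field.
    replace (z + (INR N + 1) + 1 / 2)%C with (z + (INR N + 1 + 1 / 2))%C by ring.
    replace (z - (INR N + 1) - 1 / 2)%C with (z - (INR N + 1 + 1 / 2))%C by ring.
    replace (z - (INR N + 1) + 1 / 2)%C with (z - (INR N + 1 / 2))%C by field.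
    ring.
Qed.

Lemma zeroq_neq (m : nat) : ((INR (S m) * t) ^ 2 - 1 / 4)%C <> RtoC 0.
Proof.
  pose proof (Mt_plus_real_neq m (1 / 2)) as H1. pose proof (Mt_plus_real_neq m (- (1 / 2))) as H2.
  replace ((INR (S m) * t) ^ 2 - 1 / 4)%C
    with ((INR (S m) * t + RtoC (1 / 2)) * (INR (S m) * t + RtoC (- (1 / 2))))%C
    by (rewrite RtoC_opp, RtoC_div by lra; field).
  now apply Cmult_neq_0.
Qed.

Lemma csm_zeroq : csm zeroq.
Proof.
  apply (csm_le _ (fun m => / d * / INR (S m) ^ 2)); [|apply ex_series_inv_S_sq].
  intros m. unfold zeroq. rewrite Cmod_inv by apply zeroq_neq.
  rewrite <- Rinv_mult. pose proof (INR_S_ge_1 m).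
  apply Rinv_le_contravar; [apply Rmult_lt_0_compat; nra|].
  pose proof (qform_lower t (INR (S m)) (1 / 2)) as L1. pose proof (qform_lower t (INR (S m)) (- (1 / 2))) as L2.
  fold d in L1, L2.
  replace ((INR (S m) * t) ^ 2 - 1 / 4)%C
    with ((INR (S m) * t + RtoC (1 / 2)) * (INR (S m) * t + RtoC (- (1 / 2))))%C
    by (rewrite RtoC_opp, RtoC_div by lra; field).
  rewrite Cmod_mult.
  set (p := Cmod (INR (S m) * t + RtoC (1 / 2))%C) in *. set (q := Cmod (INR (S m) * t + RtoC (- (1 / 2)))%C) in *.
  assert (0 <= p) by apply Cmod_ge_0. assert (0 <= q) by apply Cmod_ge_0.
  assert (H3 : d * INR (S m) ^ 2 <= p * p) by nra. assert (H4 : d * INR (S m) ^ 2 <= q * q) by nra.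
  assert (H5 : 0 <= d * INR (S m) ^ 2) by nra.
  apply Rsqr_incr_0_var; [|nra]. unfold Rsqr.
  replace (p * q * (p * q)) with ((p * p) * (q * q)) by ring.
  apply Rmult_le_compat; assumption.
Qed.

(** For fixed [m] the ends are of order [1/N] and disappear, unlike their sum over [m] in
    [edge_csum]. *)
Lemma csum_latq_row (m : nat) : csum (latq t m) = (- zeroq m)%C.
Proof.
  apply csum_unique.
  apply (Ccv_ext (fun N => edge m N - zeroq m)%C); [intros; now rewrite latq_partial|].
  replace (- zeroq m)%C with (0 - zeroq m)%C by ring.
  apply Ccv_minus; [|apply Ccv_const].
  assert (G : forall x y : R, Rabs y - Cmod (INR (S m) * t)%C <= Cmod (INR (S m) * t + y)%C).
  { intros _ y. pose proof (Cmod_triangle_rev y (- (INR (S m) * t))%C) as T.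
    rewrite Cmod_R, Cmod_opp in T. replace (y - - (INR (S m) * t))%C with (INR (S m) * t + y)%C in T by ring. exact T. }
  set (K := Cmod (INR (S m) * t)%C) in *.
  destruct (nfloor_ex K) as [N0 [_ HN0]]; [apply Cmod_ge_0|].
  unfold Ccv. apply (is_lim_seq_incr_n _ (N0 + 1)).
  apply (is_lim_seq_le_le (fun _ => 0) _ (fun N => 2 * (2 * / (INR N + 1)))).
  - intros N. split; [apply Cmod_ge_0|]. unfold edge.
    rewrite !plus_INR. simpl (INR 1). pose proof (pos_INR N). pose proof (pos_INR N0).
    set (x := INR N + (INR N0 + 1) + 1 / 2).
    replace (RtoC (INR N + (INR N0 + 1)) + 1 / 2)%C with (RtoC x)
      by (unfold x; rewrite (RtoC_plus _ (1 / 2)), RtoC_div by lra; reflexivity).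
    replace (/ (INR (S m) * t - x) - / (INR (S m) * t + x) - 0)%C
      with (/ (INR (S m) * t - x) - / (INR (S m) * t + x))%C by ring.
    assert (P : forall y : R, Rabs y = x -> Cmod (/ (INR (S m) * t + y))%C <= 2 * / (INR N + 1)).
    { intros y Hy. specialize (G 0 y). rewrite Hy in G.
      rewrite Cmod_inv by apply Mt_plus_real_neq.
      apply Rle_trans with (/ ((INR N + 1) / 2)); [|right; field; lra].
      apply Rinv_le_contravar; unfold x in *; lra. }
    eapply Rle_trans; [apply Cmod_triangle_sub|].
    pose proof (P x ltac:(apply Rabs_pos_eq; unfold x; lra)).
    pose proof (P (- x) ltac:(rewrite Rabs_left; unfold x; lra)) as P2.
    rewrite RtoC_opp in P2. unfold Cminus. lra.
  - apply is_lim_seq_const.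
  - replace (Finite 0) with (Finite (2 * (2 * 0))) by (f_equal; ring).
    apply (is_lim_seq_scal_l _ 2 (Finite (2 * 0))), (is_lim_seq_scal_l _ 2 (Finite 0)), lim_inv_S.
Qed.

Lemma Im_opp_inv (s : C) : Im s > 0 -> 0 < Im (- / s)%C.
Proof.
  intros H. unfold Im in *. destruct s as [a b]. simpl in *.
  replace (- (- b / (a * (a * 1) + b * (b * 1)))) with (b / (a * a + b * b)) by (field; nra).
  apply Rdiv_lt_0_compat; nra.
Qed.

(** Dividing by [t] turns the ends into the poles of the cotangent series at [-(N + 1/2)/t]. By
    [cotc_lim] the sum tends to [- pi i / t], not to 0. *)
Lemma edge_csum (N : nat) : csm (fun m => edge m N) /\
  csum (fun m => edge m N) = (/ t * (cotc ((INR N + 1 / 2) * - / t) - / ((INR N + 1 / 2) * - / t)))%C.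
Proof.
  assert (Ht0 : t <> RtoC 0) by (intros E; pose proof Ht as Ht1; rewrite E in Ht1; simpl in Ht1; lra).
  pose proof (Im_opp_inv t Ht) as Hs. pose proof (pos_INR N) as PN.
  assert (Hx : 0 < Im ((INR N + 1 / 2) * - / t)%C).
  { assert (EI : forall (x : R) (w : C), Im (x * w)%C = x * Im w) by (intros; unfold Im; simpl; ring).
    replace (INR N + 1 / 2)%C with (RtoC (INR N + 1 / 2)) by (rewrite RtoC_plus, RtoC_div by lra; reflexivity).
    rewrite EI.
    nra. }
  assert (Hn := nonint_Im _ (Rgt_not_eq _ _ Hx)).
  set (z := ((INR N + 1 / 2) * - / t)%C) in *.
  assert (E : forall m, edge m N = (/ t * (/ (z + INR (S m)) + / (z - INR (S m))))%C).
  { intros m. pose proof (nonint_plus_nat z (S m) Hn) as H1. pose proof (nonint_minus_nat z (S m) Hn) as H2.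
    pose proof (Mt_plus_real_neq m (INR N + 1 / 2)) as H3.
    pose proof (Mt_plus_real_neq m (- (INR N + 1 / 2))) as H4.
    unfold edge. 
    assert (Ez : (INR N + 1 / 2)%C = (- (z * t))%C) by (unfold z; field; exact Ht0).
    assert (Er : (INR N + 1 / 2)%C = RtoC (INR N + 1 / 2)) by (rewrite RtoC_plus, RtoC_div by lra; reflexivity).
    rewrite RtoC_opp, <- Er, Ez in H4. rewrite <- Er, Ez in H3. rewrite Ez.
    replace (INR (S m) * t - - (z * t))%C with (t * (z + INR (S m)))%C by ring.
    replace (INR (S m) * t + - (z * t))%C with (- t * (z - INR (S m)))%C by ring.
    field. auto. }
  assert (Sz : csm (fun m => edge m N)).
  { apply (csm_ext (fun m => csn (latq t m) N + zeroq m)%C).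
    - intros m. rewrite latq_partial. ring.
    - apply csm_plus; [apply csm_csn, csm_latq_col|apply csm_zeroq]. }
  split; [exact Sz|].
  rewrite (csum_ext _ _ E). rewrite csum_scal, cot_sum_pos; auto.
  apply (csm_ext (fun m => t * edge m N)%C); [|now apply csm_scal].
  intros m. rewrite E. field. repeat split; auto; [apply nonint_minus_nat|apply nonint_plus_nat]; exact Hn.
Qed.

Lemma csm_latt2_rows : csm (fun m => csum (latt 2 t m)).
Proof.
  destruct diff_swap as [_ [S1 _]].
  apply (csm_ext (fun m => csum (fun n => latt 2 t m n - latq t m n) - zeroq m)%C).
  - intros m. rewrite (csum_minus (latt 2 t m) (latq t m) (csm_latt2_row m) (csm_latq_row m)).
    rewrite csum_latq_row. ring.
  - apply csm_minus; [exact S1|apply csm_zeroq].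
Qed.

(** Only [latt 2 - latq] may be exchanged freely. Summed rows first, [latq] gives minus the sum of
    [zeroq]; its first [N] columns give the sum of the ends in addition, whose limit is the anomaly.
    The hypothesis is later obtained from [latt_inv], which turns these columns into rows at
    [-1/t]. *)
Lemma latt2_anomaly : csm (fun n => csum (fun m => latt 2 t m n)) ->
  (csum (fun n => csum (fun m => latt 2 t m n))
   = csum (fun m => csum (latt 2 t m)) - PI * Ci / t)%C.
Proof.
  intros HC. destruct diff_swap as [E [S1 S2]].
  assert (Ht0 : t <> RtoC 0) by (intros E0; pose proof Ht as Ht1; rewrite E0 in Ht1; simpl in Ht1; lra).
  set (H2 := csum (fun m => csum (latt 2 t m))) in *.
  set (H2' := csum (fun n => csum (fun m => latt 2 t m n))) in *.
  set (P := csum zeroq).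
  assert (E1 : csum (fun m => csum (fun n => latt 2 t m n - latq t m n))%C = (H2 + P)%C).
  { unfold H2, P. rewrite <- (csum_plus _ _ csm_latt2_rows csm_zeroq).
    apply csum_ext. intros m.
    rewrite (csum_minus (latt 2 t m) (latq t m) (csm_latt2_row m) (csm_latq_row m)).
    rewrite csum_latq_row. ring. }
  assert (L1 : Ccv (fun N => csn (fun n => csum (fun m => latt 2 t m n)) N
     - csn (fun n => csum (fun m => latt 2 t m n - latq t m n)) N)%C (H2' - (H2 + P))%C).
  { rewrite <- E1, E. apply Ccv_minus; now apply csum_cv. }
  assert (E2 : forall N, (csn (fun n => csum (fun m => latt 2 t m n)) N
     - csn (fun n => csum (fun m => latt 2 t m n - latq t m n)) N = csum (fun m => edge m N) - P)%C).
  { intros N. 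
    rewrite (csn_ext (fun n => csum (fun m => latt 2 t m n - latq t m n))%C
      (fun n => csum (fun m => latt 2 t m n) - csum (fun m => latq t m n))%C).
    2:{ intros n _. apply csum_minus; [apply csm_latt2_col|apply csm_latq_col]. }
    unfold Cminus at 2.
    rewrite csn_plus.
    assert (En : csn (fun n => - csum (fun m => latq t m n))%C N = (- csn (fun n => csum (fun m => latq t m n)) N)%C).
    { clear. induction N; cbn [csn]; [ring|rewrite IHN; ring]. }
    rewrite En, <- (csum_csn (latq t)) by apply csm_latq_col.
    rewrite (csum_ext (fun m => csn (latq t m) N) (fun m => edge m N - zeroq m)%C) by (intros; apply latq_partial).
    rewrite (csum_minus _ _ (proj1 (edge_csum N)) csm_zeroq). unfold P. ring. }
  assert (L2 : Ccv (fun N => csum (fun m => edge m N) - P)%C (- (PI * Ci) / t - P)%C).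
  { apply Ccv_minus; [|apply Ccv_const].
    apply (Ccv_ext (fun N => / t * (cotc ((INR N + 1 / 2) * - / t) - / ((INR N + 1 / 2) * - / t)))%C).
    { intros N. symmetry. apply edge_csum. }
    replace (- (PI * Ci) / t)%C with (/ t * (- (PI * Ci) - 0))%C by (unfold Cdiv; ring).
    apply Ccv_scal, Ccv_minus; [apply cotc_lim, Im_opp_inv, Ht|].
    apply (Ccv_squeeze _ _ (fun N => Cmod t * (2 * / (INR N + 1)))).
    - intros N. pose proof (pos_INR N).
      assert (Er : (INR N + 1 / 2)%C = RtoC (INR N + 1 / 2)) by (rewrite RtoC_plus, RtoC_div by lra; reflexivity).
      rewrite Er. assert (Hn : RtoC (INR N + 1 / 2) <> RtoC 0) by (apply RtoC_neq; lra).
      replace (/ (RtoC (INR N + 1 / 2) * - / t) - 0)%C with (- (t * / RtoC (INR N + 1 / 2)))%C by (field; auto).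
      rewrite Cmod_opp, Cmod_mult, Cmod_inv, Cmod_R, Rabs_pos_eq by (auto; lra).
      apply Rmult_le_compat_l; [apply Cmod_ge_0|].
      apply Rle_trans with (/ ((INR N + 1) / 2)); [|right; field; lra]. apply Rinv_le_contravar; lra.
    - replace (Finite 0) with (Finite (Cmod t * (2 * 0))) by (f_equal; ring).
      apply (is_lim_seq_scal_l _ (Cmod t) (Finite (2 * 0))), (is_lim_seq_scal_l _ 2 (Finite 0)), lim_inv_S. }
  assert (L3 := Ccv_unique _ _ _ (Ccv_ext _ _ _ E2 L1) L2).
  replace H2' with (H2' - (H2 + P) + (H2 + P))%C by ring. rewrite L3. unfold Cdiv. ring.
Qed.

End Rows.

(** Inversion exchanges [m] and [n] up to signs, which an even exponent ignores. Modularity thus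
    becomes an exchange of summations. *)
Lemma latt_inv (k : nat) (t : C) (m n : nat) : Nat.Even k -> 0 < Im t ->
  latt k (- / t) m n = (t ^ k * latt k t n m)%C.
Proof.
  intros [j ->] Ht. 
  assert (Ht0 : t <> RtoC 0) by (intros E0; rewrite E0 in Ht; simpl in Ht; lra).
  pose proof (Mt_plus_real_neq t Ht n (INR (S m))) as H1.
  pose proof (Mt_plus_real_neq t Ht n (- INR (S m))) as H2. rewrite RtoC_opp in H2.
  unfold latt. rewrite Cmult_plus_distr_l, <- !Cpow_mult_l, Cplus_comm.
  assert (Ev : forall w : C, ((- w) ^ (2 * j) = w ^ (2 * j))%C).
  { intros w. rewrite !Cpow_mult_r. f_equal. ring. }
  set (M := RtoC (INR (S m))) in *. set (N := RtoC (INR (S n))) in *.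
  assert (D : forall x : C, x <> RtoC 0 -> (/ (x / t) = t * / x)%C) by (intros; field; auto).
  f_equal.
  - replace (M * - / t - N)%C with (- ((N * t + M) / t))%C by (field; exact Ht0).
    rewrite Cinv_opp, Ev, D by exact H1. reflexivity.
  - replace (M * - / t + N)%C with ((N * t + - M) / t)%C by (field; exact Ht0).
    rewrite D by exact H2. reflexivity.
Qed.

(** * Eisenstein series *)

Definition lambert (k : nat) (q : C) : C :=
  csum (fun n => INR (S n) ^ k * (q ^ S n / (1 - q ^ S n)))%C.

Lemma Cmod_pow_S_lt_1 (q : C) (n : nat) : Cmod q < 1 -> Cmod (q ^ S n)%C < 1.
Proof.
  intros H. rewrite Cmod_pow. simpl. pose proof (Cmod_ge_0 q).
  assert (Cmod q ^ n <= 1) by (apply pow_le_one; lra). 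
  assert (0 <= Cmod q ^ n) by (apply pow_le; lra). nra.
Qed.

Lemma csum_geom_S (x : C) : Cmod x < 1 -> csum (fun m => x ^ S m)%C = (x / (1 - x))%C.
Proof.
  intros H. rewrite (csum_ext _ (fun m => x * x ^ m)%C) by reflexivity.
  rewrite csum_scal, csum_geom; auto using csm_geom.
Qed.

Lemma lambert_dom (k : nat) (q : C) (d m : nat) : Cmod q < 1 ->
  Cmod (INR (S d) ^ k * (q ^ S d) ^ S m)%C <= (INR (S d) ^ k * Cmod q ^ d) * Cmod q ^ m.
Proof.
  intros H. pose proof (Cmod_ge_0 q).
  rewrite Cmod_mult, !Cmod_pow, Cmod_R, Rabs_pos_eq, Rmult_assoc by apply pos_INR.
  apply Rmult_le_compat_l; [apply pow_le, pos_INR|].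
  rewrite <- pow_mult, <- pow_add.
  (* [(d+1)(m+1) >= d + m] turns the decay into a product, as [csum_fubini] requires. *)
  replace (S d * S m)%nat with (d + m + (S d * S m - (d + m)))%nat by nia.
  rewrite (pow_add _ (d + m)). rewrite <- (Rmult_1_r (Cmod q ^ (d + m))) at 2.
  apply Rmult_le_compat_l; [apply pow_le; lra|apply pow_le_one; lra].
Qed.

(** After expansion of [x/(1-x)], summing the other way gives a sum over the points [m t], at which
    Lipschitz' formula turns [lamb k] into [eis (k+1)] for [k >= 1]. *)
Lemma lambert_swap (k : nat) (q : C) : Cmod q < 1 ->
  lambert k q = csum (fun m => lamb k (q ^ S m)%C) /\ csm (fun m => lamb k (q ^ S m)%C).
Proof.
  intros H. pose proof (Cmod_ge_0 q).
  assert (E : forall m d, (INR (S d) ^ k * (q ^ S d) ^ S m = INR (S d) ^ k * (q ^ S m) ^ S d)%C).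
  { intros m d. rewrite <- !Cpow_mult_r. do 2 f_equal. lia. }
  assert (A0 : forall i, 0 <= INR (S i) ^ k * Cmod q ^ i).
  { intros; apply Rmult_le_pos; apply pow_le; [apply pos_INR|lra]. }
  assert (B0 : forall i, 0 <= Cmod q ^ i) by (intros; apply pow_le; lra).
  assert (SA : ex_series (fun d => INR (S d) ^ k * Cmod q ^ d)) by (apply ex_series_S_pow_geom'; lra).
  assert (SB : ex_series (fun m => Cmod q ^ m)) by (apply ex_series_geom; rewrite Rabs_pos_eq; lra).
  split.
  - unfold lambert. 
    rewrite (csum_ext _ (fun d => csum (fun m => INR (S d) ^ k * (q ^ S d) ^ S m))%C).
    2:{ intros d. pose proof (Cmod_pow_S_lt_1 q d H) as Hd.
        rewrite csum_scal; [now rewrite csum_geom_S|].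
        apply (csm_ext (fun m => q ^ S d * (q ^ S d) ^ m)%C); [reflexivity|now apply csm_scal, csm_geom]. }
    rewrite (csum_fubini _ _ _ (fun d m => lambert_dom k q d m H) A0 B0 SA SB).
    apply csum_ext. intros m. unfold lamb. apply csum_ext. intros d. apply E.
  - apply (csm_ext (fun m => csum (fun d => INR (S d) ^ k * (q ^ S d) ^ S m))%C).
    + intros m. unfold lamb. apply csum_ext. intros d. apply E.
    + apply (csm_fubini_rows (fun m d => INR (S d) ^ k * (q ^ S d) ^ S m)%C (fun m => Cmod q ^ m)
        (fun d => INR (S d) ^ k * Cmod q ^ d)); auto.
      intros m d. rewrite Rmult_comm. now apply lambert_dom.
Qed.

Lemma q_param_nat (n : nat) (t : C) : q_param (INR n * t) = (q_param t ^ n)%C.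
Proof. unfold q_param. rewrite <- Cexp_nat. f_equal. ring. Qed.

Lemma eis_split (k : nat) (z : C) : (2 <= k)%nat ->
  eis k z = ((/ z) ^ k + csum (fun n => (/ (z + INR (S n))) ^ k + (/ (z - INR (S n))) ^ k))%C.
Proof.
  intros Hk. unfold eis.
  pose proof (csm_inv_pow z k Hk) as S1. pose proof (csm_inv_pow_left z k Hk) as S2.
  rewrite csum_S by exact S1. replace (z + INR 0)%C with z by (simpl; ring).
  apply csm_S in S1.
  rewrite (csum_plus _ _ S1 S2). ring.
Qed.

Lemma Im_nat_mult (m : nat) (t : C) : 0 < Im t -> 0 < Im (INR (S m) * t)%C.
Proof.
  intros H. replace (Im (INR (S m) * t)%C) with (INR (S m) * Im t) by (unfold Im; simpl; ring).
  pose proof (INR_S_ge_1 m). nra.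
Qed.

(** The terms with zero integer shift are [(m t)^-k] and add up to the zeta value. *)
Lemma csum_eis_multiples (k : nat) (t : C) : (2 <= k)%nat -> t <> RtoC 0 ->
  csm (fun m => csum (latt k t m)) ->
  csum (fun m => eis k (INR (S m) * t)) = ((/ t) ^ k * zeta k + csum (fun m => csum (latt k t m)))%C.
Proof.
  intros Hk Ht S. pose proof (csm_zeta k Hk) as Z.
  rewrite (csum_ext _ (fun m => (/ t) ^ k * (/ INR (Datatypes.S m)) ^ k + csum (latt k t m))%C).
  - rewrite csum_plus, csum_scal by auto using csm_scal. reflexivity.
  - intros m. rewrite eis_split by exact Hk. f_equal.
    rewrite <- Cpow_mult_l. f_equal. field. split; auto using INR_S_neq.
Qed.

Lemma csm_latt4_rows (t : C) : 0 < Im t -> csm (fun m => csum (latt 4 t m)).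
Proof.
  intros Ht. apply (csm_fubini_rows _ _ _ (latt4_bound t Ht)); auto using ex_series_inv_S_sq, ex_series_inv_S_sq'.
  intros m. apply Rmult_le_pos; [|apply inv_S_sq_pos].
  pose proof (pow2_ge_0 (/ qform t)). lra.
Qed.

Lemma upper_neq_0 (t : C) : 0 < Im t -> t <> RtoC 0.
Proof. intros H E. rewrite E in H. simpl in H. lra. Qed.

Definition E4 (q : C) : C := (1 + 240 * lambert 3 q)%C.
Definition E2 (q : C) : C := (1 - 24 * lambert 1 q)%C.

Lemma two_pi_i_sq : ((2 * PI * Ci) ^ 2 = - (4 * PI ^ 2))%C.
Proof. transitivity (4 * PI ^ 2 * (Ci * Ci))%C; [ring|]. rewrite Ci_sq. ring. Qed.

(** The factor [8/3 pi^4] is [(2 pi i)^4 / 3!], and [240 / (8/3 pi^4) = 90 / pi^4] cancels [zeta 4].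
    In this shape inversion, up to [t^4], exchanges [1] with [t^-4] and rows with columns. *)
Lemma E4_lattice (t : C) : 0 < Im t ->
  E4 (q_param t) = (1 + (/ t) ^ 4 + 90 / PI ^ 4 * csum (fun m => csum (latt 4 t m)))%C.
Proof.
  intros Ht. pose proof (Cmod_q_lt_1 t Ht) as Hq.
  pose proof (csum_eis_multiples 4 t ltac:(lia) (upper_neq_0 t Ht) (csm_latt4_rows t Ht)) as E.
  destruct (lambert_swap 3 _ Hq) as [L S].
  rewrite (csum_ext _ (fun m => 8 / 3 * PI ^ 4 * lamb 3 (q_param t ^ Datatypes.S m))%C) in E.
  2:{ intros m. pose proof (lipschitz _ (Im_nat_mult m t Ht) 2) as Lk.
      change (2 + 2)%nat with 4%nat in Lk. rewrite Lk, q_param_nat.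
      replace ((2 * PI * Ci) ^ 4)%C with (((2 * PI * Ci) ^ 2) ^ 2)%C by ring.
      rewrite two_pi_i_sq. simpl (fact 3). simpl (2 + 1)%nat. replace (INR 6) with 6 by (simpl; ring). field. }
  rewrite csum_scal, <- L, zeta4 in E by exact S.
  unfold E4. pose proof RPI_neq_0 as HP. pose proof (upper_neq_0 t Ht).
  replace (lambert 3 (q_param t)) with (3 / (8 * PI ^ 4) * (8 / 3 * PI ^ 4 * lambert 3 (q_param t)))%C
    by (field; auto).
  rewrite E. field. auto.
Qed.

Lemma E2_lattice (t : C) : 0 < Im t ->
  E2 (q_param t) = (1 + (/ t) ^ 2 + 6 / PI ^ 2 * csum (fun m => csum (latt 2 t m)))%C.
Proof.
  intros Ht. pose proof (Cmod_q_lt_1 t Ht) as Hq.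
  pose proof (csum_eis_multiples 2 t ltac:(lia) (upper_neq_0 t Ht) (csm_latt2_rows t Ht)) as E.
  destruct (lambert_swap 1 _ Hq) as [L S].
  rewrite (csum_ext _ (fun m => - 4 * PI ^ 2 * lamb 1 (q_param t ^ Datatypes.S m))%C) in E.
  2:{ intros m. pose proof (lipschitz _ (Im_nat_mult m t Ht) 0) as Lk.
      change (0 + 2)%nat with 2%nat in Lk. rewrite Lk, q_param_nat.
      rewrite two_pi_i_sq. simpl (fact 1). simpl (0 + 1)%nat. replace (INR 1) with 1 by (simpl; ring). simpl. field. }
  rewrite csum_scal, <- L, zeta2 in E by exact S.
  unfold E2. pose proof RPI_neq_0 as HP. pose proof (upper_neq_0 t Ht).
  replace (lambert 1 (q_param t)) with (- (1) / (4 * PI ^ 2) * (- 4 * PI ^ 2 * lambert 1 (q_param t)))%C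
    by (field; auto).
  rewrite E. field. auto.
Qed.

Lemma csum_latt_inv (k : nat) (t : C) : Nat.Even k -> 0 < Im t -> 
  (forall m, csm (fun n => latt k t n m)) ->
  forall m, csum (latt k (- / t) m) = (t ^ k * csum (fun n => latt k t n m))%C.
Proof.
  intros Hk Ht S m. rewrite <- csum_scal by apply S. apply csum_ext. intros n. now apply latt_inv.
Qed.

Lemma E4_modular (t : C) : 0 < Im t ->
  E4 (q_param (- / t)) = (t ^ 4 * E4 (q_param t))%C.
Proof.
  intros Ht. pose proof (upper_neq_0 t Ht) as Ht0. pose proof RPI_neq_0 as HP.
  assert (C4 : forall m, csm (fun n => latt 4 t n m)).
  { intros m. eapply csm_le; [intros n; apply (latt4_bound t Ht)|].
    apply (ex_series_scal_r (/ INR (S m) ^ 2)), ex_series_inv_S_sq. }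
  assert (S4 : csm (fun m => csum (fun n => latt 4 t n m))).
  { apply (csm_ext (fun m => (/ t) ^ 4 * csum (latt 4 (- / t) m))%C).
    - intros m. rewrite (csum_latt_inv 4 t) by (auto; exists 2%nat; lia). field. exact Ht0.
    - apply csm_scal, csm_latt4_rows, Im_opp_inv, Ht. }
  rewrite !E4_lattice by (auto; now apply Im_opp_inv).
  rewrite (csum_ext (fun m => csum (latt 4 (- / t) m))
     (fun m => t ^ 4 * csum (fun n => latt 4 t n m))%C).
  2:{ intros m. apply csum_latt_inv; auto. exists 2%nat; lia. }
  rewrite csum_scal by exact S4. rewrite <- latt4_swap by exact Ht. 
  replace ((/ - / t) ^ 4)%C with (t ^ 4)%C.
  - field. auto.
  - rewrite Cinv_opp. field. exact Ht0.
Qed.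

(** As in weight 4, but the exchange leaves [- pi i / t]; times [6 t^2 / pi^2] this is the
    correction. *)
Lemma E2_quasimodular (t : C) : 0 < Im t ->
  E2 (q_param (- / t)) = (t ^ 2 * E2 (q_param t) - 6 * Ci * t / PI)%C.
Proof.
  intros Ht. pose proof (upper_neq_0 t Ht) as Ht0. pose proof RPI_neq_0 as HP.
  assert (S2 : csm (fun m => csum (fun n => latt 2 t n m))).
  { apply (csm_ext (fun m => (/ t) ^ 2 * csum (latt 2 (- / t) m))%C).
    - intros m. rewrite (csum_latt_inv 2 t); [field; exact Ht0|exists 1%nat; lia|exact Ht|].
      apply csm_latt2_col, Ht.
    - apply csm_scal, csm_latt2_rows, Im_opp_inv, Ht. }
  rewrite !E2_lattice by (auto; now apply Im_opp_inv).
  rewrite (csum_ext (fun m => csum (latt 2 (- / t) m))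
     (fun m => t ^ 2 * csum (fun n => latt 2 t n m))%C).
  2:{ intros m. apply csum_latt_inv; auto; [exists 1%nat; lia|]. apply csm_latt2_col, Ht. }
  rewrite csum_scal by exact S2. rewrite (latt2_anomaly t Ht S2).
  replace ((/ - / t) ^ 2)%C with (t ^ 2)%C.
  - field. auto.
  - rewrite Cinv_opp. field. exact Ht0.
Qed.

(** * The discriminant *)

Definition efac (q : C) (n : nat) : C := ((1 - q ^ n) ^ 24)%C.
Definition eprod (q : C) : C := Clim_seq (Cprod (efac q)).

Lemma exp_le (x y : R) : x <= y -> exp x <= exp y.
Proof. intros [H| ->]; [left; now apply exp_increasing|right; reflexivity]. Qed.

Fixpoint geom_part (r : R) (N : nat) : R :=
  match N with O => 0 | S M => geom_part r M + r ^ N end.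

Lemma geom_part_le (r : R) (N : nat) : 0 <= r < 1 -> geom_part r N <= r / (1 - r).
Proof.
  intros H.
  assert (E : geom_part r N = (r - r ^ S N) / (1 - r)).
  { induction N; cbn [geom_part]; [simpl; field; lra|]. rewrite IHN. simpl. field. lra. }
  rewrite E. apply Rmult_le_compat_r; [left; apply Rinv_0_lt_compat; lra|].
  assert (0 <= r ^ S N) by (apply pow_le; lra). lra.
Qed.

Lemma Cprod_upper_part (q : C) (r : R) (N : nat) : Cmod q <= r ->
  Cmod (Cprod (efac q) N) <= exp (24 * geom_part r N).
Proof.
  intros H. pose proof (Cmod_ge_0 q).
  induction N.
  - simpl. rewrite Rmult_0_r, exp_0, Cmod_1. lra.
  - cbn [Cprod geom_part]. rewrite Cmod_mult, Rmult_plus_distr_l, exp_plus.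
    apply Rmult_le_compat; try apply Cmod_ge_0; [exact IHN|].
    unfold efac. rewrite Cmod_pow.
    replace (24 * r ^ S N) with (r ^ S N * INR 24) by (simpl; ring). rewrite <- exp_pow.
    apply pow_incr. split; [apply Cmod_ge_0|].
    eapply Rle_trans; [apply Cmod_triangle_sub|]. rewrite Cmod_1, Cmod_pow.
    eapply Rle_trans; [|apply exp_ineq1_le]. apply Rplus_le_compat_l. apply pow_incr. lra.
Qed.

Lemma Cprod_upper (q : C) (r : R) (N : nat) : Cmod q <= r -> r < 1 ->
  Cmod (Cprod (efac q) N) <= exp (24 * (r / (1 - r))).
Proof.
  intros H Hr. pose proof (Cmod_ge_0 q).
  eapply Rle_trans; [apply (Cprod_upper_part q r N H)|].
  apply exp_le. apply Rmult_le_compat_l; [lra|]. apply geom_part_le. lra.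
Qed.

(** From [1/(1-x) = 1 + x/(1-x) <= exp(x/(1-x))]. *)
Lemma exp_lower_1_minus (x r : R) : 0 <= x <= r -> r < 1 -> exp (- (x / (1 - r))) <= 1 - x.
Proof.
  intros H Hr.
  assert (H1 : exp (- (x / (1 - r))) <= exp (- (x / (1 - x)))).
  { apply exp_le, Ropp_le_contravar. apply Rmult_le_compat_l; [lra|]. apply Rinv_le_contravar; lra. }
  eapply Rle_trans; [exact H1|]. rewrite exp_Ropp.
  pose proof (exp_ineq1_le (x / (1 - x))) as E.
  replace (1 + x / (1 - x)) with (/ (1 - x)) in E by (field; lra).
  apply Rle_trans with (/ / (1 - x)); [|rewrite Rinv_inv; lra]. apply Rinv_le_contravar; [apply Rinv_0_lt_compat; lra|exact E].
Qed.

Lemma pow_S_le (r : R) (n : nat) : 0 <= r <= 1 -> r ^ S n <= r.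
Proof.
  intros H. simpl. pose proof (pow_le_one r n H). assert (0 <= r ^ n) by (apply pow_le; lra). nra.
Qed.

(** Uniform in [N] and in the disc of radius [r], so the infinite product is nonzero and quotients
    of partial products converge. *)
Lemma Cprod_lower (q : C) (r : R) (N : nat) : Cmod q <= r -> r < 1 ->
  exp (- (24 * (r / (1 - r) ^ 2))) <= Cmod (Cprod (efac q) N).
Proof.
  intros H Hr. pose proof (Cmod_ge_0 q).
  apply Rle_trans with (exp (- (24 * (geom_part r N / (1 - r))))).
  { apply exp_le, Ropp_le_contravar, Rmult_le_compat_l; [lra|].
    replace (r / (1 - r) ^ 2) with (r / (1 - r) / (1 - r)) by (field; lra).
    apply Rmult_le_compat_r; [left; apply Rinv_0_lt_compat; lra|]. apply geom_part_le. lra. }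
  induction N.
  - simpl. unfold Rdiv. rewrite Rmult_0_l, Rmult_0_r, Ropp_0, exp_0, Cmod_1. lra.
  - cbn [Cprod geom_part]. rewrite Cmod_mult.
    replace (- (24 * ((geom_part r N + r ^ S N) / (1 - r))))
      with (- (24 * (geom_part r N / (1 - r))) + - (r ^ S N / (1 - r)) * INR 24)
      by (simpl INR; field; lra).
    rewrite exp_plus, <- exp_pow.
    apply Rmult_le_compat; try (left; apply exp_pos); [apply pow_le; left; apply exp_pos|exact IHN|].
    unfold efac. rewrite Cmod_pow. apply pow_incr. split; [left; apply exp_pos|].
    pose proof (Cmod_triangle_rev 1 (q ^ S N)%C) as T. rewrite Cmod_1, Cmod_pow in T.
    eapply Rle_trans; [|exact T].
    assert (0 <= Cmod q ^ S N <= r ^ S N).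
    { split; [apply pow_le; lra|apply pow_incr; lra]. }
    assert (r ^ S N <= r) by (apply pow_S_le; lra).
    eapply Rle_trans; [apply exp_lower_1_minus; lra|]. lra.
Qed.

Lemma pow_minus_one_bound (x : C) (k : nat) : Cmod x <= 1 ->
  Cmod ((1 - x) ^ k - 1)%C <= (2 ^ k - 1) * Cmod x.
Proof.
  intros H. pose proof (Cmod_ge_0 x). induction k.
  - simpl. replace (1 - 1)%C with (RtoC 0) by ring. rewrite Cmod_0. lra.
  - replace ((1 - x) ^ S k - 1)%C with ((1 - x) * ((1 - x) ^ k - 1) - x)%C by (simpl; ring).
    eapply Rle_trans; [apply Cmod_triangle_sub|]. rewrite Cmod_mult.
    assert (Cmod (1 - x)%C <= 2).
    { eapply Rle_trans; [apply Cmod_triangle_sub|]. rewrite Cmod_1. lra. }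
    pose proof (Cmod_ge_0 ((1 - x) ^ k - 1)%C). pose proof (Cmod_ge_0 (1 - x)%C).
    apply Rle_trans with (2 * ((2 ^ k - 1) * Cmod x) + Cmod x); [|simpl; lra].
    apply Rplus_le_compat_r. apply Rmult_le_compat; assumption.
Qed.

Lemma Cprod_eprod (q : C) : Cmod q < 1 -> Ccv (Cprod (efac q)) (eprod q).
Proof.
  intros Hq. pose proof (Cmod_ge_0 q).
  set (dif := fun n => (Cprod (efac q) (S n) - Cprod (efac q) n)%C).
  assert (S : csm dif).
  { apply (csm_le _ (fun n => (exp (24 * (Cmod q / (1 - Cmod q))) * 2 ^ 24) * Cmod q ^ n)).
    - intros n. unfold dif. cbn [Cprod].
      replace (Cprod (efac q) n * efac q (S n) - Cprod (efac q) n)%C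
        with (Cprod (efac q) n * (efac q (S n) - 1))%C by ring.
      rewrite Cmod_mult, Rmult_assoc. apply Rmult_le_compat; try apply Cmod_ge_0.
      + apply Cprod_upper; lra.
      + assert (H1 : Cmod (q ^ S n)%C <= 1) by (left; now apply Cmod_pow_S_lt_1).
        eapply Rle_trans; [apply (pow_minus_one_bound _ 24 H1)|].
        assert (Cmod (q ^ S n)%C <= Cmod q ^ n).
        { rewrite Cmod_pow. simpl. assert (0 <= Cmod q ^ n) by (apply pow_le; lra). nra. }
        pose proof (Cmod_ge_0 (q ^ S n)%C). apply Rmult_le_compat; lra.
    - apply (ex_series_scal_l (V := R_NormedModule) (exp (24 * (Cmod q / (1 - Cmod q))) * 2 ^ 24)), ex_series_geom. rewrite Rabs_pos_eq; lra. }
  assert (L : Ccv (Cprod (efac q)) (1 + csum dif)%C).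
  { apply (Ccv_ext (fun n => 1 + csn dif n)%C).
    - induction n; [simpl; ring|]. cbn [csn]. rewrite Cplus_assoc, IHn. unfold dif. ring.
    - apply Ccv_plus; [apply Ccv_const|now apply csum_cv]. }
  unfold eprod. now rewrite (Clim_seq_unique _ _ L).
Qed.

Lemma eprod_lower (q : C) (r : R) : Cmod q <= r -> r < 1 ->
  exp (- (24 * (r / (1 - r) ^ 2))) <= Cmod (eprod q).
Proof.
  intros H Hr.
  assert (L := Ccv_Cmod _ _ (Cprod_eprod q ltac:(lra))).
  apply (is_lim_seq_le (fun _ => exp (- (24 * (r / (1 - r) ^ 2)))) _
    (exp (- (24 * (r / (1 - r) ^ 2)))) (Cmod (eprod q))
    (fun n => Cprod_lower q r n H Hr)); [apply is_lim_seq_const|exact L].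
Qed.

Lemma eprod_neq_0 (q : C) : Cmod q < 1 -> eprod q <> RtoC 0.
Proof.
  intros H. apply Cmod_gt_0. eapply Rlt_le_trans; [|apply (eprod_lower q (Cmod q)); lra]. apply exp_pos.
Qed.

(** In the form [f' = f e], which needs neither a logarithm nor a division. *)
Definition logderiv (f : R -> C) (t : R) (e : C) : Prop := cderiv f t (f t * e)%C.

Lemma logderiv_mult (f g : R -> C) (t : R) (a b : C) :
  logderiv f t a -> logderiv g t b -> logderiv (fun s => f s * g s)%C t (a + b)%C.
Proof.
  intros H1 H2. unfold logderiv. eapply cderiv_eq; [apply cderiv_mult; [exact H1|exact H2]|].
  cbv beta. ring.
Qed.

Lemma logderiv_inv (f : R -> C) (t : R) (a : C) : f t <> RtoC 0 ->
  logderiv f t a -> logderiv (fun s => / f s)%C t (- a)%C.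
Proof.
  intros Hf H. unfold logderiv. eapply cderiv_eq; [apply cderiv_inv; [exact Hf|exact H]|].
  cbv beta. field. exact Hf.
Qed.

Lemma logderiv_pow (f : R -> C) (t : R) (a : C) (n : nat) :
  logderiv f t a -> logderiv (fun s => f s ^ S n)%C t (INR (S n) * a)%C.
Proof.
  intros H. unfold logderiv. eapply cderiv_eq; [apply cderiv_pow; exact H|]. cbv beta. simpl Cpow. ring.
Qed.

Definition E2part (N : nat) (q : C) : C :=
  (1 - 24 * csn (fun n => INR (S n) ^ 1 * (q ^ S n / (1 - q ^ S n))) N)%C.

(** Only finite products are differentiated; the limit [N -> infinity] is taken afterwards in an
    integrated estimate. *)
Lemma logderiv_delta_part (w : R -> C) (s : R) (l : C) (N : nat) : 0 < Im (w s) -> cderiv w s l ->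
  logderiv (fun x => q_param (w x) * Cprod (efac (q_param (w x))) N)%C s
    (2 * PI * Ci * l * E2part N (q_param (w s)))%C.
Proof.
  intros Hw H. pose proof (Cmod_q_lt_1 _ Hw) as Hq.
  assert (Hlq : logderiv (fun x => q_param (w x)) s (2 * PI * Ci * l)%C) by (apply cderiv_q_param, H).
  assert (HP : logderiv (fun x => Cprod (efac (q_param (w x))) N) s
    (- 24 * (2 * PI * Ci * l) * csn (fun n => INR (S n) ^ 1 * (q_param (w s) ^ S n / (1 - q_param (w s) ^ S n))) N)%C).
  { induction N.
    - simpl. unfold logderiv. eapply cderiv_eq; [apply cderiv_const|]. ring.
    - cbn [Cprod csn]. rewrite Cmult_plus_distr_l. apply logderiv_mult; [exact IHN|].
      unfold efac.
      assert (Hn := one_minus_neq_0 _ (Cmod_pow_S_lt_1 _ N Hq)).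
      assert (HF : logderiv (fun x => 1 - q_param (w x) ^ S N)%C s
        (- (INR (S N) * (2 * PI * Ci * l)) * (q_param (w s) ^ S N / (1 - q_param (w s) ^ S N)))%C).
      { unfold logderiv. eapply cderiv_eq.
        - apply cderiv_minus; [apply cderiv_const|]. apply logderiv_pow. exact Hlq.
        - cbv beta. field. exact Hn. }
      unfold logderiv. eapply cderiv_eq; [apply (logderiv_pow _ _ _ 23 HF)|].
      cbv beta. replace (INR 24) with 24 by (simpl; ring). f_equal. ring. }
  unfold logderiv. eapply cderiv_eq; [apply (logderiv_mult _ _ _ _ _ Hlq HP)|].
  cbv beta. f_equal. unfold E2part. ring.
Qed.

Lemma E2part_tail (N : nat) (q : C) (r : R) : Cmod q <= r -> r < 1 ->
  Cmod (E2part N q - E2 q)%C <= 24 / (1 - r) * Series (fun k => INR (S (N + k)) ^ 1 * r ^ S (N + k)).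
Proof.
  intros H Hr. pose proof (Cmod_ge_0 q).
  assert (Hq : Cmod q < 1) by lra.
  assert (B : forall n, Cmod (INR (S n) ^ 1 * (q ^ S n / (1 - q ^ S n)))%C <= / (1 - r) * (INR (S n) ^ 1 * r ^ S n)).
  { intros n. pose proof (one_minus_neq_0 _ (Cmod_pow_S_lt_1 _ n Hq)) as Hn.
    rewrite Cmod_mult, Cmod_div, !Cmod_pow, Cmod_R, Rabs_pos_eq by (auto using pos_INR).
    replace (/ (1 - r) * (INR (S n) ^ 1 * r ^ S n)) with (INR (S n) ^ 1 * (r ^ S n * / (1 - r))) by ring.
    apply Rmult_le_compat_l; [apply pow_le, pos_INR|].
    apply Rmult_le_compat; [apply pow_le; lra| |apply pow_incr; lra|].
    - left. apply Rinv_0_lt_compat. now apply Cmod_gt_0.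
    - apply Rinv_le_contravar; [lra|]. pose proof (Cmod_triangle_rev 1 (q ^ S n)%C) as T.
      rewrite Cmod_1, Cmod_pow in T. 
      assert (Cmod q ^ S n <= r ^ S n) by (apply pow_incr; lra).
      assert (r ^ S n <= r) by (apply pow_S_le; lra). lra. }
  assert (SS : ex_series (fun n => / (1 - r) * (INR (S n) ^ 1 * r ^ S n))).
  { apply (ex_series_scal_l (V := R_NormedModule) (/ (1 - r))), ex_series_S_pow_geom. lra. }
  assert (S := csm_le _ _ B SS).
  unfold E2part, E2, lambert.
  set (a := csn _ N). set (b := csum _).
  replace (1 - 24 * a - (1 - 24 * b))%C with (24 * (b - a))%C by ring. unfold a, b.
  rewrite csn_shift_tail by exact S. rewrite Cmod_mult, Cmod_R, Rabs_pos_eq by lra.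
  unfold Rdiv. rewrite Rmult_assoc. apply Rmult_le_compat_l; [lra|].
  rewrite <- Series_scal_l. apply csum_Cmod; [intros k; apply (B (N + k)%nat)|].
  apply (ex_series_shift (fun n => / (1 - r) * (INR (Datatypes.S n) ^ 1 * r ^ Datatypes.S n))), SS.
Qed.

Definition mdelta (q : C) : C := (q * eprod q)%C.

Lemma mdelta_neq_0 (t : C) : 0 < Im t -> mdelta (q_param t) <> RtoC 0.
Proof.
  intros H. unfold mdelta. apply Cmult_neq_0; [apply q_param_neq_0|apply eprod_neq_0, Cmod_q_lt_1, H].
Qed.

Lemma Im_opp_inv_lower (w : C) : 0 < Im w -> Im (- / w)%C = Im w / Cmod w ^ 2.
Proof.
  intros H. rewrite Cmod2_alt. unfold Im, Re in *. destruct w as [a b]. simpl in *. field. nra.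
Qed.

(** The logarithmic derivative along the segment from [i] to [t] of the finite-product version of
    [mdelta(-1/w) / (w^12 mdelta(w))] is [2 pi i w'] times
    [w^-2 E2part(-1/w) - 12/(2 pi i w) - E2part(w)], which tends to 0 uniformly. *)
Lemma mdelta_modular (t : C) : 0 < Im t ->
  mdelta (q_param (- / t)) = (t ^ 12 * mdelta (q_param t))%C.
Proof.
  intros Ht. pose proof PI_RGT_0 as HPI.
  set (u := (t - Ci)%C). set (w := fun s : R => (Ci + s * u)%C).
  set (y0 := Rmin 1 (Im t)). set (Rd := 1 + Cmod u).
  assert (Hy0 : 0 < y0) by (unfold y0; apply Rmin_case; lra).
  assert (HRd : 1 <= Rd) by (unfold Rd; pose proof (Cmod_ge_0 u); lra).
  assert (HI : forall s, 0 <= s <= 1 -> y0 <= Im (w s)).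
  { intros s Hs. unfold w, u. replace (Im (Ci + s * (t - Ci))%C) with (1 + s * (Im t - 1)) by (unfold Im, Ci; simpl; ring).
    pose proof (Rmin_l 1 (Im t)). pose proof (Rmin_r 1 (Im t)). fold y0 in H, H0. nra. }
  assert (HR : forall s, 0 <= s <= 1 -> Cmod (w s) <= Rd).
  { intros s Hs. unfold w, Rd. eapply Rle_trans; [apply Cmod_triangle|].
    rewrite Cmod_Ci, Cmod_mult, Cmod_R, Rabs_pos_eq by lra. pose proof (Cmod_ge_0 u). nra. }
  assert (HL : forall s, 0 <= s <= 1 -> y0 <= Cmod (w s)).
  { intros s Hs. eapply Rle_trans; [apply (HI s Hs)|]. eapply Rle_trans; [apply Rle_abs|apply im_le_Cmod]. }
  assert (HI2 : forall s, 0 <= s <= 1 -> y0 / Rd ^ 2 <= Im (- / w s)%C).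
  { intros s Hs. specialize (HI s Hs). specialize (HR s Hs). specialize (HL s Hs).
    rewrite Im_opp_inv_lower by lra.
    apply Rmult_le_compat; [lra|left; apply Rinv_0_lt_compat, pow_lt; lra|lra|].
    apply Rinv_le_contravar; [apply pow_lt; lra|]. apply pow_incr; lra. }
  (* A common bound for the nomes at [w] and at [-1/w] along the whole segment, from
     [Im (-1/w) = Im w / |w|^2 >= y0 / Rd^2]. *)
  set (r := exp (- (2 * PI * (y0 / Rd ^ 2)))).
  assert (Hr : 0 < r < 1).
  { unfold r. split; [apply exp_pos|]. rewrite <- exp_0. apply exp_increasing.
    assert (0 < y0 / Rd ^ 2) by (apply Rdiv_lt_0_compat; [lra|apply pow_lt; lra]). nra. }
  assert (Hq2 : forall s, 0 <= s <= 1 -> Cmod (q_param (- / w s)%C) <= r).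
  { intros s Hs. rewrite Cmod_q_param. apply exp_le. specialize (HI2 s Hs). nra. }
  assert (Hq1 : forall s, 0 <= s <= 1 -> Cmod (q_param (w s)) <= r).
  { intros s Hs. rewrite Cmod_q_param. apply exp_le. specialize (HI s Hs).
    assert (y0 / Rd ^ 2 <= y0).
    { apply Rmult_le_reg_r with (Rd ^ 2); [apply pow_lt; lra|]. unfold Rdiv.
      rewrite Rmult_assoc, Rinv_l by (apply pow_nonzero; lra).
      assert (1 <= Rd ^ 2) by nra. nra. }
    nra. }
  set (Dn := fun N z => (q_param z * Cprod (efac (q_param z)) N)%C).
  assert (HD : forall N s, 0 <= s <= 1 -> Dn N (w s) <> RtoC 0).
  { intros N s Hs. unfold Dn. apply Cmult_neq_0; [apply q_param_neq_0|]. apply Cmod_gt_0.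
    eapply Rlt_le_trans; [|apply (Cprod_lower _ r); auto; lra]. apply exp_pos. }
  set (F := fun N s => (Dn N (- / w s) * (/ w s ^ 12 * / Dn N (w s)))%C).
  set (tail := fun N => 24 / (1 - r) * Series (fun k => INR (S (N + k)) ^ 1 * r ^ S (N + k))).
  set (K := exp (24 * (r / (1 - r))) * (/ y0 ^ 12 * / (exp (- (2 * PI * Rd)) * exp (- (24 * (r / (1 - r) ^ 2)))))).
  assert (HF : forall N s, 0 <= s <= 1 -> Cmod (F N s) <= K).
  { intros N s Hs. unfold F, K.
    assert (Hws : w s <> RtoC 0) by (apply Cmod_gt_0; specialize (HL s Hs); lra).
    rewrite !Cmod_mult, !Cmod_inv, Cmod_pow by (auto; now apply Cpow_nz).
    specialize (HL s Hs). specialize (HR s Hs).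
    assert (B1 : Cmod (Dn N (- / w s)%C) <= exp (24 * (r / (1 - r)))).
    { unfold Dn. rewrite Cmod_mult.
      pose proof (Cprod_upper (q_param (- / w s)%C) r N (Hq2 s Hs) ltac:(lra)).
      pose proof (Hq2 s Hs). pose proof (Cmod_ge_0 (q_param (- / w s)%C)).
      pose proof (Cmod_ge_0 (Cprod (efac (q_param (- / w s)%C)) N)). nra. }
    assert (B2 : exp (- (2 * PI * Rd)) * exp (- (24 * (r / (1 - r) ^ 2))) <= Cmod (Dn N (w s))).
    { unfold Dn. rewrite Cmod_mult. apply Rmult_le_compat; try (left; apply exp_pos).
      - rewrite Cmod_q_param. apply exp_le.
        assert (Im (w s) <= Cmod (w s)) by (eapply Rle_trans; [apply Rle_abs|apply im_le_Cmod]). nra.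
      - apply Cprod_lower; auto; lra. }
    assert (P : 0 < exp (- (2 * PI * Rd)) * exp (- (24 * (r / (1 - r) ^ 2)))) by (apply Rmult_lt_0_compat; apply exp_pos).
    assert (0 < y0 ^ 12) by now apply pow_lt.
    apply Rmult_le_compat; [apply Cmod_ge_0| |exact B1|].
    - apply Rmult_le_pos; left; apply Rinv_0_lt_compat; [apply pow_lt; lra|lra].
    - apply Rmult_le_compat; try (left; apply Rinv_0_lt_compat); [apply pow_lt; lra|lra| |].
      + apply Rinv_le_contravar; [assumption|]. apply pow_incr; lra.
      + apply Rinv_le_contravar; assumption. }
  set (G := fun N s => (2 * PI * Ci * (u / w s ^ 2) * E2part N (q_param (- / w s))
     + (- (12 * (u / w s)) + - (2 * PI * Ci * u * E2part N (q_param (w s)))))%C).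
  assert (HG : forall N s, 0 <= s <= 1 -> Cmod (G N s) <= 2 * PI * Cmod u * (/ y0 ^ 2 + 1) * tail N).
  { intros N s Hs.
    assert (Hws : w s <> RtoC 0) by (apply Cmod_gt_0; specialize (HL s Hs); lra).
    assert (E : G N s = (2 * PI * Ci * u * ((/ w s) ^ 2 * (E2part N (q_param (- / w s)) - E2 (q_param (- / w s)))
       - (E2part N (q_param (w s)) - E2 (q_param (w s)))))%C).
    (* The correction [-6 i w / pi], times [2 pi i u / w^2], is [12 u / w] and cancels the
       contribution of [w^-12]. *)
    { unfold G. rewrite (E2_quasimodular (w s)) by (specialize (HI s Hs); lra).
      pose proof RPI_neq_0.
      transitivity (2 * PI * Ci * (u / w s ^ 2) * E2part N (q_param (- / w s)) +
        (12 * (Ci * Ci) * (u / w s) + - (2 * PI * Ci * u * E2part N (q_param (w s)))))%C.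
      - rewrite Ci_sq. ring.
      - field. auto. }
    rewrite E, !Cmod_mult, Cmod_Ci, !Cmod_R, (Rabs_pos_eq 2), (Rabs_pos_eq PI) by lra.
    replace (2 * PI * Cmod u * (/ y0 ^ 2 + 1) * tail N)
      with (2 * PI * 1 * Cmod u * ((/ y0 ^ 2) * tail N + tail N)) by ring.
    apply Rmult_le_compat_l; [pose proof (Cmod_ge_0 u); apply Rmult_le_pos; lra|].
    eapply Rle_trans; [apply Cmod_triangle_sub|]. rewrite Cmod_mult, Cmod_pow, Cmod_inv by exact Hws.
    specialize (HL s Hs).
    apply Rplus_le_compat; [|apply E2part_tail; auto; lra].
    apply Rmult_le_compat; [apply pow_le; left; apply Rinv_0_lt_compat; lra|apply Cmod_ge_0| |apply E2part_tail; auto; lra].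
    rewrite <- pow_inv. apply pow_incr. split; [left; apply Rinv_0_lt_compat; lra|apply Rinv_le_contravar; lra]. }
  assert (HFG : forall N s, 0 <= s <= 1 -> cderiv (F N) s (F N s * G N s)%C).
  { intros N s Hs.
    assert (Hws : w s <> RtoC 0) by (apply Cmod_gt_0; specialize (HL s Hs); lra).
    assert (Dw : cderiv w s u) by apply cderiv_line.
    assert (Dw2 : cderiv (fun x => - / w x)%C s (u / w s ^ 2)%C).
    { eapply cderiv_eq; [apply cderiv_opp, cderiv_inv; [exact Hws|exact Dw]|]. field. exact Hws. }
    apply (logderiv_mult (fun s => Dn N (- / w s)) (fun s => / w s ^ 12 * / Dn N (w s)))%C.
    - apply (logderiv_delta_part (fun x => - / w x)%C); [|exact Dw2].
      eapply Rlt_le_trans; [|apply (HI2 s Hs)]. apply Rdiv_lt_0_compat; [lra|apply pow_lt; lra].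
    - apply (logderiv_mult (fun s => / w s ^ 12) (fun s => / Dn N (w s)))%C.
      + apply logderiv_inv; [now apply Cpow_nz|].
        assert (L1 : logderiv w s (u / w s)%C).
        { unfold logderiv. eapply cderiv_eq; [exact Dw|]. field. exact Hws. }
        replace (RtoC 12) with (RtoC (INR 12)) by (simpl; f_equal; ring).
        apply (logderiv_pow w s _ 11 L1).
      + apply logderiv_inv; [now apply HD|]. apply logderiv_delta_part; [specialize (HI s Hs); lra|exact Dw]. }
  (* The base point [i] is fixed by inversion, and [i^12 = 1]. *)
  assert (F0 : forall N, F N 0 = RtoC 1).
  { intros N. unfold F. replace (w 0) with Ci by (unfold w; ring).
    assert (EI : (- / Ci)%C = Ci) .
    { replace (- / Ci)%C with ((- (1)) / Ci)%C by (field; apply Ci_neq_0). rewrite <- Ci_sq. field. apply Ci_neq_0. }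
    rewrite EI. specialize (HD N 0 ltac:(lra)). replace (w 0) with Ci in HD by (unfold w; ring).
    replace (Ci ^ 12)%C with (((Ci * Ci) ^ 2) ^ 3)%C by ring. rewrite Ci_sq. field. exact HD. }
  assert (L : Ccv (fun N => F N 1) (RtoC 1)).
  { apply (Ccv_squeeze _ _ (fun N => K * (2 * PI * Cmod u * (/ y0 ^ 2 + 1) * tail N))).
    - intros N. rewrite <- (F0 N).
      apply (cderiv_mvt_const (F N) (fun s => F N s * G N s)%C); [intros; now apply HFG|].
      intros s Hs. rewrite Cmod_mult. apply Rmult_le_compat; auto using Cmod_ge_0.
    - replace (Finite 0) with (Finite (K * (2 * PI * Cmod u * (/ y0 ^ 2 + 1) * (24 / (1 - r) * 0)))) by (f_equal; ring).
      apply (is_lim_seq_scal_l _ K (Finite _)).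
      apply (is_lim_seq_scal_l _ (2 * PI * Cmod u * (/ y0 ^ 2 + 1)) (Finite _)).
      apply (is_lim_seq_scal_l _ (24 / (1 - r)) (Finite 0)).
      apply (Series_tail_lim (fun n => INR (S n) ^ 1 * r ^ S n)), ex_series_S_pow_geom. lra. }
  assert (Ew : w 1 = t) by (unfold w, u; ring).
  assert (Ht0 := upper_neq_0 t Ht).
  assert (Htq := Cmod_q_lt_1 t Ht). assert (Htq' := Cmod_q_lt_1 _ (Im_opp_inv t Ht)).
  assert (L2 : Ccv (fun N => F N 1) (mdelta (q_param (- / t)) * (/ t ^ 12 * / mdelta (q_param t)))%C).
  { unfold F. rewrite Ew. unfold Dn, mdelta.
    apply Ccv_mult; [now apply Ccv_scal, Cprod_eprod|]. apply Ccv_scal.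
    apply (Ccv_inv _ _ (Cmod (q_param t) * exp (- (24 * (r / (1 - r) ^ 2))))).
    - apply Rmult_lt_0_compat; [apply Cmod_gt_0, q_param_neq_0|apply exp_pos].
    - intros N. rewrite Cmod_mult. apply Rmult_le_compat_l; [apply Cmod_ge_0|].
      apply Cprod_lower; [rewrite <- Ew; apply Hq1; lra|lra].
    - now apply Ccv_scal, Cprod_eprod. }
  assert (E := Ccv_unique _ _ _ L L2).
  pose proof (mdelta_neq_0 t Ht) as HDt.
  replace (mdelta (q_param (- / t))) with (t ^ 12 * mdelta (q_param t) * (mdelta (q_param (- / t)) * (/ t ^ 12 * / mdelta (q_param t))))%C.
  - rewrite <- E. ring.
  - field. auto.
Qed.

(** * The modular invariant *)

Lemma csn_add (a : nat -> C) (n m : nat) : csn a (n + m) = (csn a n + csn (fun k => a (n + k)%nat) m)%C.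
Proof.
  induction m; [rewrite Nat.add_0_r; simpl; ring|].
  rewrite Nat.add_succ_r. cbn [csn]. rewrite IHm. ring.
Qed.

Lemma csn_zero (a : nat -> C) (n : nat) : (forall k, (k < n)%nat -> a k = RtoC 0) -> csn a n = RtoC 0.
Proof.
  induction n; intros H; [reflexivity|]. cbn [csn]. rewrite IHn, H; auto. ring.
Qed.

Lemma csum_finite (a : nat -> C) (N : nat) : (forall n, (N <= n)%nat -> a n = RtoC 0) -> csum a = csn a N.
Proof.
  intros H. apply csum_unique. unfold Ccv. apply (is_lim_seq_incr_n _ N).
  apply (is_lim_seq_ext (fun _ => 0)); [|apply is_lim_seq_const].
  intros n. rewrite Nat.add_comm, csn_add, (csn_zero (fun k => a (N + k)%nat)).
  - replace (csn a N + 0 - csn a N)%C with (RtoC 0) by ring. now rewrite Cmod_0.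
  - intros k _. apply H. lia.
Qed.

(** * Divisor sums as Lambert series *)

Definition dvd_ind (n d : nat) : C := if n mod d =? 0 then RtoC 1 else RtoC 0.

Lemma divisor_sigma_csn (k n : nat) :
  RtoC (INR (divisor_sigma k n)) = csn (fun d => dvd_ind n (S d) * INR (S d) ^ k)%C n.
Proof.
  unfold divisor_sigma.
  assert (P : forall m, RtoC (INR (list_sum (map (fun d => (d ^ k)%nat) (filter (fun d => n mod d =? 0) (seq 1 m)))))
    = csn (fun d => dvd_ind n (S d) * INR (S d) ^ k)%C m); [|apply P].
  induction m; [reflexivity|].
  rewrite seq_S, filter_app, map_app, list_sum_app, plus_INR, RtoC_plus, IHm.
  cbn [csn]. f_equal. cbn [filter Nat.add]. unfold dvd_ind.
  destruct (n mod S m =? 0); cbn [map list_sum fold_right].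
  - rewrite Nat.add_0_r, pow_INR, RtoC_pow. ring.
  - simpl. ring.
Qed.

(** Blocks of length [d + 1] each contain exactly one multiple of [d + 1], in last position. *)
Lemma csum_lacunary (b : nat -> C) (d : nat) : 
  csm (fun N => dvd_ind (S N) (S d) * b (S N))%C ->
  csum (fun N => dvd_ind (S N) (S d) * b (S N))%C = csum (fun m => b (S d * S m)%nat).
Proof.
  intros S. set (f := fun N => (dvd_ind (Datatypes.S N) (Datatypes.S d) * b (Datatypes.S N))%C) in *.
  set (D := Datatypes.S d).
  assert (E : forall M, csn f (D * M) = csn (fun m => b (D * Datatypes.S m)%nat) M).
  { induction M; [rewrite Nat.mul_0_r; reflexivity|].
    rewrite Nat.mul_succ_r, csn_add, IHM. cbn [csn]. f_equal.
    unfold D at 2. cbn [csn]. rewrite csn_zero.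
    - unfold f, dvd_ind. fold D. replace (Datatypes.S (D * M + d)) with (D * Datatypes.S M)%nat by (unfold D; lia).
      rewrite Nat.mul_comm, Nat.Div0.mod_mul. cbn [Nat.eqb]. ring.
    - intros k Hk. unfold f, dvd_ind. fold D.
      replace (Datatypes.S (D * M + k)) with (Datatypes.S k + M * D)%nat by lia.
      rewrite Nat.Div0.mod_add, Nat.mod_small by (unfold D; lia). cbn [Nat.eqb]. ring. }
  symmetry. apply csum_unique.
  apply (Ccv_ext (fun M => csn f (D * M))); [exact E|].
  apply csum_cv in S.
  apply (is_lim_seq_subseq (fun n => Cmod (csn f n - csum f)%C) 0 (fun n => (D * n)%nat)); [|exact S].
  apply eventually_subseq. intros n. unfold D. lia.
Qed.

Lemma sigma_lambert (k : nat) (q : C) : Cmod q < 1 ->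
  csm (fun n => INR (divisor_sigma k (S n)) * q ^ S n)%C /\
  csum (fun n => INR (divisor_sigma k (S n)) * q ^ S n)%C = lambert k q.
Proof.
  intros Hq. pose proof (Cmod_ge_0 q) as Hq0.
  (* A divisor [d + 1] of [N + 1] has [d <= N], so [|q|^(N+1) <= s^N s^d] is a product majorant. *)
  set (s := sqrt (Cmod q)).
  assert (Hs : 0 <= s < 1).
  { unfold s. split; [apply sqrt_pos|]. rewrite <- sqrt_1. apply sqrt_lt_1; lra. }
  assert (Hs2 : s * s = Cmod q) by (apply sqrt_sqrt; lra).
  set (a := fun N d => (dvd_ind (S N) (S d) * INR (S d) ^ k * q ^ S N)%C).
  assert (E : forall N, (INR (divisor_sigma k (S N)) * q ^ S N = csum (a N))%C).
  { intros N. rewrite divisor_sigma_csn, Cmult_comm, <- csn_scal. symmetry.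
    rewrite (csum_finite _ (S N)).
    - apply csn_ext. intros; unfold a; ring.
    - intros n Hn. unfold a, dvd_ind. rewrite (Nat.mod_small (S N) (S n)) by lia. cbn [Nat.eqb]. ring. }
  assert (B : forall N d, Cmod (a N d) <= s ^ N * (INR (S d) ^ k * s ^ d)).
  { intros N d. unfold a, dvd_ind. destruct (S N mod S d =? 0) eqn:Em.
    - apply Nat.eqb_eq in Em. apply Nat.Div0.mod_divides in Em. destruct Em as [c Hc].
      assert (d <= N)%nat by (destruct c; nia).
      rewrite Cmult_1_l, Cmod_mult, !Cmod_pow, Cmod_R, Rabs_pos_eq by apply pos_INR.
      replace (s ^ N * (INR (S d) ^ k * s ^ d)) with (INR (S d) ^ k * (s ^ N * s ^ d)) by ring.
      apply Rmult_le_compat_l; [apply pow_le, pos_INR|].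
      rewrite <- Hs2, Rpow_mult_distr.
      assert (s ^ S N <= s ^ N) by (simpl; assert (0 <= s ^ N) by (apply pow_le; lra); nra).
      assert (s ^ S N <= s ^ d).
      { replace (S N) with (d + (S N - d))%nat by lia. rewrite pow_add.
        rewrite <- (Rmult_1_r (s ^ d)) at 2. apply Rmult_le_compat_l; [apply pow_le; lra|apply pow_le_one; lra]. }
      apply Rmult_le_compat; try apply pow_le; lra.
    - rewrite !Cmult_0_l, Cmod_0. apply Rmult_le_pos; [apply pow_le; lra|].
      apply Rmult_le_pos; apply pow_le; [apply pos_INR|lra]. }
  assert (A0 : forall i, 0 <= s ^ i) by (intros; apply pow_le; lra).
  assert (B0 : forall i, 0 <= INR (S i) ^ k * s ^ i).
  { intros; apply Rmult_le_pos; [apply pow_le, pos_INR|auto]. }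
  assert (SA : ex_series (fun N => s ^ N)) by (apply ex_series_geom; rewrite Rabs_pos_eq; lra).
  assert (SB : ex_series (fun d => INR (S d) ^ k * s ^ d)) by (apply ex_series_S_pow_geom'; lra).
  split.
  - eapply csm_ext; [intros N; symmetry; apply E|]. now apply (csm_fubini_rows a _ _ B).
  - rewrite (csum_ext _ _ E), (csum_fubini a _ _ B) by assumption.
    unfold lambert. apply csum_ext. intros d.
    pose proof (Cmod_pow_S_lt_1 q d Hq) as Hd.
    assert (Sd : csm (fun N => a N d)).
    { apply (csm_le _ (fun N => s ^ N * (INR (S d) ^ k * s ^ d))); [intros; apply B|].
      now apply (ex_series_scal_r (INR (S d) ^ k * s ^ d)). }
    rewrite (csum_ext (fun N => a N d) (fun N => dvd_ind (S N) (S d) * (INR (S d) ^ k * q ^ S N))%C)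
      by (intros; unfold a; ring).
    rewrite (csum_lacunary (fun N => INR (S d) ^ k * q ^ N)%C).
    + rewrite <- csum_geom_S by exact Hd. rewrite <- csum_scal.
      * apply csum_ext. intros m. now rewrite Cpow_mult_r.
      * apply (csm_ext (fun m => q ^ S d * (q ^ S d) ^ m)%C); [reflexivity|now apply csm_scal, csm_geom].
    + apply (csm_ext (fun N => a N d)); [intros; unfold a; ring|exact Sd].
Qed.

Lemma modular_j_E4 (t : C) : 0 < Im t ->
  modular_j t = (E4 (q_param t) ^ 3 / mdelta (q_param t))%C.
Proof.
  intros Ht. pose proof (Cmod_q_lt_1 t Ht) as Hq. destruct (sigma_lambert 3 _ Hq) as [S E].
  unfold modular_j, E4, mdelta, eprod, efac. cbv zeta. rewrite Cseries_csum by exact S. rewrite E. reflexivity.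
Qed.

Lemma modular_j_inv (t : C) : 0 < Im t -> modular_j (- / t) = modular_j t.
Proof.
  intros Ht. rewrite !modular_j_E4 by (auto; now apply Im_opp_inv).
  rewrite E4_modular, mdelta_modular by exact Ht.
  pose proof (mdelta_neq_0 t Ht). pose proof (upper_neq_0 t Ht). field. auto.
Qed.

(** * The Poincare-type series and its coefficients *)

Definition exp_rem (w : C) : C := (Cexp w - 1 - w)%C.

Lemma exp_rem_series (w : C) : csm (fun k => exp_term w (k + 2)) /\
  csum (fun k => exp_term w (k + 2)) = exp_rem w.
Proof.
  pose proof (csm_exp_term w) as S.
  assert (S2 : csm (fun k => exp_term w (2 + k)%nat)) by apply (ex_series_shift (fun k => Cmod (exp_term w k)) 2 S).
  assert (X : forall k, exp_term w (2 + k) = exp_term w (k + 2)) by (intros; f_equal; lia).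
  split; [exact (csm_ext _ _ X S2)|].
  rewrite <- (csum_ext _ _ X), <- (csn_shift_tail _ 2 S), csum_exp_term.
  unfold exp_rem, exp_term. cbn [csn]. simpl. field.
Qed.

Lemma exp_rem_bound (w : C) : Cmod (exp_rem w) <= Cmod w ^ 2 / 2 * exp (Cmod w).
Proof.
  pose proof (Cexp_taylor 2 w) as T.
  replace (Cexp w - csn (exp_term w) 2)%C with (exp_rem w) in T.
  - exact T.
  - unfold exp_rem, exp_term. simpl. field.
Qed.

(** The sum over all integers [m] of [exp(2 pi i/(t + m))], which is [1/q] at [-1/(t + m)], made
    absolutely convergent by removing the first two Taylor terms. *)
Definition bser (t : C) : C :=
  (csum (fun n => exp_rem (2 * PI * Ci / (t + INR n)))
   + csum (fun n => exp_rem (2 * PI * Ci / (t - INR (S n)))))%C.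

Lemma fact_le_add (k j : nat) : INR (fact k) <= INR (fact (k + j)).
Proof. apply le_INR. apply fact_le. lia. Qed.

Section Poincare.
Variable t : C.
Hypothesis Ht : 0 < Im t.
Let y := Im t.

Lemma bser_side (s : nat -> R) : csm (fun n => (/ (t + s n)) ^ 2)%C ->
  csum (fun n => exp_rem (2 * PI * Ci / (t + s n)))
   = csum (fun k => (2 * PI * Ci) ^ (k + 2) / INR (fact (k + 2)) * csum (fun n => (/ (t + s n)) ^ (k + 2)))%C
  /\ csm (fun k => (2 * PI * Ci) ^ (k + 2) / INR (fact (k + 2)) * csum (fun n => (/ (t + s n)) ^ (k + 2)))%C.
Proof.
  intros Hs. pose proof PI_RGT_0 as HPI.
  assert (Hy : 0 < y) by exact Ht.
  assert (Hge : forall n, y <= Cmod (t + s n)%C) by (intros; apply Im_le_Cmod_shift).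
  assert (Hne : forall n, (t + s n)%C <> RtoC 0).
  { intros n. apply Cmod_gt_0. specialize (Hge n). lra. }
  assert (HB : forall n k, Cmod ((/ (t + s n)) ^ (k + 2))%C <= (/ y) ^ k * Cmod ((/ (t + s n)) ^ 2)%C).
  { intros n k. rewrite Cpow_add_r, Cmod_mult. apply Rmult_le_compat_r; [apply Cmod_ge_0|].
    rewrite Cmod_pow, Cmod_inv by auto. apply pow_incr. specialize (Hge n).
    split; [left; apply Rinv_0_lt_compat; lra|apply Rinv_le_contravar; lra]. }
  assert (Hs2 : forall k, csm (fun n => (/ (t + s n)) ^ (k + 2))%C).
  { intros k. apply (csm_le _ _ (fun n => HB n k)).
    now apply (ex_series_scal_l (V := R_NormedModule) ((/ y) ^ k)). }
  set (a := fun n k => exp_term (2 * PI * Ci / (t + s n)) (k + 2)).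
  set (be := fun k => (2 * PI) ^ 2 * ((2 * PI * / y) ^ k / INR (fact k))).
  assert (HA : forall n k, Cmod (a n k) <= Cmod ((/ (t + s n)) ^ 2)%C * be k).
  { intros n k. unfold a, be. rewrite Cmod_exp_term. unfold Cdiv. rewrite Cmod_mult, Rpow_mult_distr, <- (Cmod_pow (/ (t + s n))%C).
    specialize (HB n k).
    assert (Hc : Cmod (2 * PI * Ci)%C = 2 * PI).
    { rewrite !Cmod_mult, Cmod_Ci, !Cmod_R, !Rabs_pos_eq by lra. ring. }
    rewrite Hc, pow_add, (Rpow_mult_distr _ (/ y)).
    pose proof (fact_le_add k 2). pose proof (INR_fact_lt_0 k).
    assert (0 < (2 * PI) ^ k) by (apply pow_lt; lra). assert (0 < (2 * PI) ^ 2) by (apply pow_lt; lra).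
    replace (Cmod ((/ (t + s n)) ^ 2)%C * ((2 * PI) ^ 2 * ((2 * PI) ^ k * (/ y) ^ k / INR (fact k))))
     with (((2 * PI) ^ k * (2 * PI) ^ 2 * ((/ y) ^ k * Cmod ((/ (t + s n)) ^ 2)%C)) * / INR (fact k))
     by (unfold Rdiv; ring).
    apply Rmult_le_compat.
    - apply Rmult_le_pos; [nra|apply Cmod_ge_0].
    - left. apply Rinv_0_lt_compat. lra.
    - apply Rmult_le_compat_l; [nra|exact HB].
    - apply Rinv_le_contravar; lra. }
  assert (Hbe : forall k, 0 <= be k).
  { intros k. unfold be. apply Rmult_le_pos; [apply pow_le; lra|].
    apply Rmult_le_pos; [apply pow_le; apply Rmult_le_pos; [lra|left; now apply Rinv_0_lt_compat]|].
    left; apply Rinv_0_lt_compat, INR_fact_lt_0. }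
  assert (Sbe : ex_series be) by apply (ex_series_scal_l (V := R_NormedModule) ((2 * PI) ^ 2)), ex_series_exp.
  assert (E : forall k, csum (fun n => a n k) =
    ((2 * PI * Ci) ^ (k + 2) / INR (fact (k + 2)) * csum (fun n => (/ (t + s n)) ^ (k + 2)))%C).
  { intros k. rewrite <- csum_scal by apply Hs2. apply csum_ext. intros n. unfold a, exp_term.
    unfold Cdiv. rewrite (Cpow_mult_l (2 * PI * Ci)). ring. }
  split.
  - rewrite <- (csum_ext _ _ E), <- (csum_fubini a _ _ HA); auto using Cmod_ge_0.
    apply csum_ext. intros n. symmetry. apply exp_rem_series.
  - apply (csm_ext _ _ E).
    apply (csm_fubini_rows (fun k n => a n k) be (fun n => Cmod ((/ (t + s n)) ^ 2)%C)); auto.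
    intros k n. rewrite Rmult_comm. apply HA.
Qed.

Lemma bser_eis : 
  bser t = csum (fun k => (2 * PI * Ci) ^ (k + 2) / INR (fact (k + 2)) * eis (k + 2) t)%C.
Proof.
  destruct (bser_side (fun n => INR n)) as [E1 S1]; [apply csm_inv_pow; lia|].
  assert (X : forall n, (t + RtoC (- INR (S n)))%C = (t - INR (S n))%C) by (intros; rewrite RtoC_opp; reflexivity).
  destruct (bser_side (fun n => - INR (S n))) as [E2 S2].
  { apply (csm_ext (fun n => (/ (t - INR (S n))) ^ 2)%C); [intros; now rewrite X|].
    apply csm_inv_pow_left; lia. }
  unfold bser. rewrite E1.
  rewrite (csum_ext (fun n => exp_rem (2 * PI * Ci / (t - INR (S n))))
    (fun n => exp_rem (2 * PI * Ci / (t + RtoC (- INR (S n)))))%C) by (intros; now rewrite X).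
  rewrite E2, <- csum_plus by assumption.
  apply csum_ext. intros k. unfold eis.
  rewrite (csum_ext (fun n => (/ (t + RtoC (- INR (S n)))) ^ (k + 2))%C
      (fun n => (/ (t - INR (S n))) ^ (k + 2))%C) by (intros; now rewrite X). ring.
Qed.
End Poincare.

Definition bess_term (x : R) (k : nat) : R :=
  (4 * PI ^ 2) ^ (k + 2) * x ^ (k + 1) / (INR (fact (k + 2)) * INR (fact (k + 1))).

(** For [x > 0] this is [2 pi I_1(4 pi sqrt x) / sqrt x - 4 pi^2] with the modified Bessel function
    [I_1]; its first part is the leading term of the Petersson-Rademacher formula for [c(n)]. *)
Definition bess (x : R) : R := Series (bess_term x).

Lemma bser_powser (t : C) : 0 < Im t ->
  bser t = csum (fun n => bess (INR (S n)) * q_param t ^ S n)%C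
  /\ csm (fun n => bess (INR (S n)) * q_param t ^ S n)%C.
Proof.
  intros Ht. pose proof PI_RGT_0 as HPI. pose proof (Cmod_q_lt_1 t Ht) as Hq.
  set (y := Im t) in *. set (e := PI * y). set (L := 4 * PI ^ 2).
  assert (He : 0 < e) by (unfold e; nra). assert (HL : 0 < L) by (unfold L; nra).
  set (a := fun k n => (RtoC (bess_term (INR (S n)) k) * q_param t ^ S n)%C).
  set (al := fun k => L * ((L / e) ^ (S k) / INR (fact (S k)))).
  set (be := fun n => INR (S n) ^ 0 * exp (- e) ^ S n).
  assert (HA : forall k n, Cmod (a k n) <= al k * be n).
  { intros k n. unfold a, al, be, bess_term. fold L.
    pose proof (INR_fact_lt_0 (k + 2)). pose proof (INR_fact_lt_0 (k + 1)). pose proof (pos_INR (S n)) as Pn.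
    assert (0 < / (INR (fact (k + 2)) * INR (fact (k + 1)))) by (apply Rinv_0_lt_compat; nra).
    rewrite Cmod_mult, Cmod_R, Cmod_pow, Cmod_q_param. fold y.
    rewrite Rabs_pos_eq.
    2:{ apply Rmult_le_pos; [apply Rmult_le_pos; apply pow_le; lra|lra]. }
    (* Half of the decay is kept for the sum over [n]; the other half bounds
       [(e n)^(k+1) / (k+1)!]. *)
    assert (Q : exp (- (2 * PI * y)) ^ S n = exp (- e) ^ S n * / exp (e * INR (S n))).
    { rewrite !exp_pow, <- exp_Ropp, <- exp_plus. f_equal. unfold e. ring. }
    rewrite Q. pose proof (pow_div_fact_le_exp (e * INR (S n)) (k + 1) ltac:(nra)) as B.
    set (X := exp (e * INR (S n))) in *. assert (HX : 0 < X) by apply exp_pos.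
    replace (L ^ (k + 2) * INR (S n) ^ (k + 1) / (INR (fact (k + 2)) * INR (fact (k + 1))) * (exp (- e) ^ S n * / X))
     with (L * ((L / e) ^ (k + 1) * / INR (fact (k + 2))) * exp (- e) ^ S n * ((e * INR (S n)) ^ (k + 1) / INR (fact (k + 1)) * / X)).
    2:{ replace (L ^ (k + 2)) with (L * L ^ (k + 1)) by (replace (k + 2)%nat with (S (k + 1)) by lia; reflexivity).
        unfold Rdiv. rewrite !Rpow_mult_distr, pow_inv.
        assert (e ^ (k + 1) <> 0) by (apply pow_nonzero; lra). field. repeat split; lra. }
    assert (B1 : (e * INR (S n)) ^ (k + 1) / INR (fact (k + 1)) * / X <= 1).
    { apply Rmult_le_reg_r with X; [assumption|]. rewrite Rmult_assoc, Rinv_l by lra. lra. }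
    replace (S k) with (k + 1)%nat by lia. rewrite pow_O, Rmult_1_l.
    assert (0 <= exp (- e) ^ S n) by (apply pow_le; left; apply exp_pos).
    assert (0 < (L / e) ^ (k + 1)) by (apply pow_lt, Rdiv_lt_0_compat; lra).
    apply Rle_trans with (L * ((L / e) ^ (k + 1) * / INR (fact (k + 2))) * exp (- e) ^ S n * 1).
    - apply Rmult_le_compat_l; [|exact B1]. apply Rmult_le_pos; [|assumption].
      apply Rmult_le_pos; [lra|]. apply Rmult_le_pos; [lra|left; now apply Rinv_0_lt_compat].
    - rewrite Rmult_1_r. apply Rmult_le_compat_r; [assumption|]. apply Rmult_le_compat_l; [lra|].
      unfold Rdiv at 2. apply Rmult_le_compat_l; [lra|]. apply Rinv_le_contravar; [lra|].
      replace (k + 2)%nat with ((k + 1) + 1)%nat by lia. apply fact_le_add. }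
  assert (Hal : forall k, 0 <= al k).
  { intros k. unfold al. apply Rmult_le_pos; [lra|]. apply Rmult_le_pos.
    - apply pow_le. apply Rlt_le, Rdiv_lt_0_compat; lra.
    - left; apply Rinv_0_lt_compat, INR_fact_lt_0. }
  assert (Hbe : forall n, 0 <= be n).
  { intros n. unfold be. apply Rmult_le_pos; apply pow_le; [apply pos_INR|left; apply exp_pos]. }
  assert (Sal : ex_series al).
  { apply (ex_series_scal_l (V := R_NormedModule) L).
    apply (ex_series_incr_1 (V := R_NormedModule) (fun k => (L / e) ^ k / INR (fact k))), ex_series_exp. }
  assert (Sbe : ex_series be).
  { apply ex_series_S_pow_geom. split; [left; apply exp_pos|]. rewrite <- exp_0. apply exp_increasing. lra. }
  assert (Eb : forall n, csum (fun k => a k n) = (bess (INR (S n)) * q_param t ^ S n)%C).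
  { intros n. unfold a, bess. rewrite <- csum_RtoC.
    rewrite (csum_ext _ (fun k => q_param t ^ S n * RtoC (bess_term (INR (S n)) k))%C) by (intros; ring).
    rewrite csum_scal; [ring|].
    apply (csm_ext (fun k => / (q_param t ^ S n) * a k n)%C).
    - intros k. unfold a. field. apply Cpow_nz, q_param_neq_0.
    - apply csm_scal. apply (csm_le _ (fun k => al k * be n)); [intros; apply HA|].
      now apply (ex_series_scal_r (be n)). }
  split.
  - rewrite <- (csum_ext _ _ Eb), <- (csum_fubini a _ _ HA) by assumption.
    rewrite bser_eis by exact Ht. apply csum_ext. intros k.
    rewrite lipschitz by exact Ht. unfold a, lamb.
    rewrite (csum_ext (fun n => RtoC (bess_term (INR (S n)) k) * q_param t ^ S n)%C
      (fun n => RtoC (L ^ (k + 2) / (INR (fact (k + 2)) * INR (fact (k + 1)))) * (INR (S n) ^ (k + 1) * q_param t ^ S n))%C).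
    2:{ intros n. unfold bess_term. fold L.
        replace (L ^ (k + 2) * INR (S n) ^ (k + 1) / (INR (fact (k + 2)) * INR (fact (k + 1))))
          with (L ^ (k + 2) / (INR (fact (k + 2)) * INR (fact (k + 1))) * INR (S n) ^ (k + 1)) by (unfold Rdiv; ring).
        rewrite RtoC_mult, (RtoC_pow (INR (S n))). ring. }
    rewrite csum_scal by now apply csm_pow_q.
    replace (S k) with (k + 1)%nat by lia.
    pose proof (INR_fact_neq (k + 1)). pose proof (INR_fact_neq (k + 2)).
    rewrite RtoC_div, RtoC_mult by (apply Rmult_integral_contrapositive; split; apply INR_fact_neq_0).
    (* One power of [2 pi i] comes from the exponential series, the other and the sign from
       Lipschitz' formula; together they are positive. *)
    assert (EL : (RtoC (L ^ (k + 2)) = (2 * PI * Ci) ^ (k + 2) * ((- (1)) ^ k * (2 * PI * Ci) ^ (k + 2)))%C).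
    { transitivity (((2 * PI * Ci) ^ 2) ^ (k + 2) * (- (1)) ^ (k + 2))%C.
      - rewrite two_pi_i_sq, <- Cpow_mult_l, RtoC_pow. f_equal. unfold L. rewrite RtoC_mult, RtoC_pow. ring.
      - replace ((2 * PI * Ci) ^ 2)%C with ((2 * PI * Ci) * (2 * PI * Ci))%C by ring.
        rewrite Cpow_mult_l, (Cpow_add_r (- (1))%C). ring. }
    rewrite EL. field. auto.
  - apply (csm_ext _ _ Eb).
    apply (csm_fubini_rows (fun n k => a k n) be al); auto.
    intros n k. rewrite Rmult_comm. apply HA.
Qed.

(** * Coefficient bounds by averaging *)

Lemma Cmod_q_real (x : R) : Cmod (q_param x) = 1.
Proof.
  rewrite Cmod_q_param. replace (Im (RtoC x)) with 0 by reflexivity. rewrite Rmult_0_r, Ropp_0. apply exp_0.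
Qed.

Lemma q_param_0 : q_param 0 = RtoC 1.
Proof. unfold q_param. replace (2 * PI * Ci * 0)%C with (RtoC 0) by ring. apply Cexp_0. Qed.

Lemma q_param_int (k : Z) : q_param (IZR k) = RtoC 1.
Proof.
  assert (P : forall n : nat, q_param (INR n) = RtoC 1).
  { intros n. replace (RtoC (INR n)) with (INR n * 1)%C by ring.
    rewrite q_param_nat, q_param_1. apply Cpow_1_l. }
  destruct (Z_le_gt_dec 0 k) as [H|H].
  - rewrite <- (Z2Nat.id k), <- INR_IZR_INZ by lia. apply P.
  - assert (E : (q_param (IZR k) * q_param (INR (Z.to_nat (- k))) = 1)%C).
    { rewrite <- q_param_plus, INR_IZR_INZ, Z2Nat.id, opp_IZR, RtoC_opp by lia.
      replace (IZR k + - IZR k)%C with (RtoC 0) by ring. apply q_param_0. }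
    rewrite P in E. rewrite <- E. ring.
Qed.

Lemma csn_geom (x : C) (N : nat) : (x - 1 <> 0 -> csn (fun k => x ^ k) N = (x ^ N - 1) / (x - 1))%C.
Proof.
  intros H. induction N; simpl; [field; exact H|]. rewrite IHN. field. exact H.
Qed.

Lemma csn_const (x : C) (N : nat) : csn (fun _ => x) N = (INR N * x)%C.
Proof. induction N; [simpl; ring|]. cbn [csn]. rewrite IHN, S_INR, RtoC_plus. ring. Qed.

Lemma csn_Cmod_le (a : nat -> C) (M : R) (N : nat) :
  (forall k, Cmod (a k) <= M) -> Cmod (csn a N) <= INR N * M.
Proof.
  intros H. induction N; [simpl; rewrite Cmod_0; lra|]. cbn [csn].
  eapply Rle_trans; [apply Cmod_triangle|]. rewrite S_INR. specialize (H N). lra.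
Qed.

Lemma csn_single (a : nat -> C) (n N : nat) : (n < N)%nat ->
  (forall k, (k < N)%nat -> k <> n -> a k = RtoC 0) -> csn a N = a n.
Proof.
  intros Hn H. replace N with (n + (1 + (N - n - 1)))%nat by lia.
  rewrite csn_add, csn_zero by (intros k Hk; apply H; lia).
  rewrite csn_add, (csn_zero _ (N - n - 1)) by (intros k Hk; apply H; lia).
  cbn [csn]. rewrite Nat.add_0_r. ring.
Qed.

(** The character sum that detects [m = n] modulo [N]. *)
Definition avg_weight (N n m : nat) : C :=
  (/ INR N * csn (fun k => q_param (INR k * ((INR m - INR n) / INR N))) N)%C.

Lemma avg_weight_diag (N n : nat) : (0 < N)%nat -> avg_weight N n n = RtoC 1.
Proof.
  intros H. unfold avg_weight. rewrite (csn_ext _ (fun _ => RtoC 1)).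
  - rewrite csn_const. field. apply RtoC_neq, not_0_INR. lia.
  - intros k _. replace (INR k * ((INR n - INR n) / INR N))%C with (RtoC 0) by (unfold Cdiv; ring).
    apply q_param_0.
Qed.

Lemma avg_weight_le (N n m : nat) : (0 < N)%nat -> Cmod (avg_weight N n m) <= 1.
Proof.
  intros H. assert (HN : 0 < INR N) by now apply lt_0_INR.
  assert (HN' : RtoC (INR N) <> RtoC 0) by (apply RtoC_neq; lra).
  unfold avg_weight. rewrite Cmod_mult, Cmod_inv, Cmod_R, Rabs_pos_eq by (auto; lra).
  apply Rmult_le_reg_l with (INR N); [exact HN|]. rewrite <- Rmult_assoc, Rinv_r, Rmult_1_l by lra.
  apply csn_Cmod_le. intros k.
  replace (INR k * ((INR m - INR n) / INR N))%C with (RtoC (INR k * ((INR m - INR n) / INR N)))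
    by (rewrite RtoC_mult, RtoC_div, RtoC_minus by lra; reflexivity).
  rewrite Cmod_q_real. lra.
Qed.

Lemma avg_weight_off (N n m : nat) : (m < N)%nat -> (n < N)%nat -> m <> n -> avg_weight N n m = RtoC 0.
Proof.
  intros Hm Hn Hmn. assert (HN : 0 < INR N) by (apply lt_0_INR; lia).
  assert (HN' : RtoC (INR N) <> RtoC 0) by (apply RtoC_neq; lra).
  unfold avg_weight. set (x := ((INR m - INR n) / INR N)%C).
  rewrite (csn_ext _ (fun k => q_param x ^ k)%C) by (intros; apply q_param_nat).
  assert (Hx : nonint x).
  { intros k E. assert (E2 : (INR m - INR n)%C = (INR N * IZR k)%C).
    { rewrite <- E. unfold x. field. exact HN'. }
    rewrite <- RtoC_minus, <- RtoC_mult in E2. apply RtoC_inj in E2.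
    rewrite !INR_IZR_INZ, <- minus_IZR, <- mult_IZR in E2. apply eq_IZR in E2.
    assert (k = 0 \/ 1 <= Z.abs k)%Z by lia. nia. }
  rewrite csn_geom by (apply q_minus_1_neq, Hx).
  replace (q_param x ^ N)%C with (RtoC 1); [unfold Cdiv; ring|].
  rewrite <- q_param_nat. replace (INR N * x)%C with (RtoC (IZR (Z.of_nat m - Z.of_nat n))).
  - symmetry. apply q_param_int.
  - rewrite minus_IZR, RtoC_minus, <- !INR_IZR_INZ. unfold x. field. exact HN'.
Qed.

(** Averaging over [N]-th roots of unity isolates the coefficients congruent to [n] mod [N];
    the aliased ones vanish as [N] grows. *)
Lemma coefficient_bound (d : nat -> C) (y M : R) :
  csm (fun n => d n * exp (- (2 * PI * y)) ^ n)%C ->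
  (forall x : R, Cmod (csum (fun n => d n * q_param (x + y * Ci) ^ n)%C) <= M) ->
  forall n, Cmod (d n) * exp (- (2 * PI * y)) ^ n <= M.
Proof.
  intros S HM n. set (r := exp (- (2 * PI * y))) in *.
  assert (Hr : 0 < r) by apply exp_pos.
  assert (Q : forall x : R, q_param (x + y * Ci) = (r * q_param x)%C).
  { intros x. rewrite q_param_plus, Cmult_comm. f_equal. unfold q_param.
    replace (2 * PI * Ci * (y * Ci))%C with (2 * PI * y * (Ci * Ci))%C by ring. rewrite Ci_sq.
    replace (2 * PI * y * - (1))%C with (RtoC (- (2 * PI * y))) by (rewrite RtoC_opp, !RtoC_mult; ring).
    apply Cexp_RtoC. }
  set (b := fun m => (d m * r ^ m)%C) in *.
  assert (Sx : forall x : R, csm (fun m => b m * q_param x ^ m)%C).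
  { intros x. apply (csm_le _ (fun m => Cmod (b m))); [|exact S].
    intros m. rewrite Cmod_mult, Cmod_pow, Cmod_q_real, pow1. lra. }
  assert (B : forall N, (n < N)%nat -> Cmod (b n) <= M + Series (fun k => Cmod (b (N + k)%nat))).
  { intros N HN. assert (PN : 0 < INR N) by (apply lt_0_INR; lia).
    assert (PN' : RtoC (INR N) <> RtoC 0) by (apply RtoC_neq; lra).
    set (f := fun m k => (b m * q_param (INR k * ((INR m - INR n) / INR N)))%C).
    assert (Ef : forall m k, f m k = (q_param (INR k * (- INR n / INR N)) * (b m * q_param (RtoC (INR k / INR N)) ^ m))%C).
    { intros m k. unfold f. rewrite <- q_param_nat.
      replace (INR k * ((INR m - INR n) / INR N))%C
       with (INR k * (- INR n / INR N) + INR m * RtoC (INR k / INR N))%C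
       by (rewrite RtoC_div by lra; field; exact PN').
      rewrite q_param_plus. ring. }
    assert (Sf : forall k, csm (fun m => f m k)).
    { intros k. eapply csm_ext; [intros m; symmetry; apply Ef|]. now apply csm_scal. }
    assert (EA : csum (fun m => b m * avg_weight N n m)%C = (/ INR N * csn (fun k => csum (fun m => f m k)) N)%C).
    { rewrite <- csum_csn by exact Sf. rewrite <- csum_scal by now apply csm_csn.
      apply csum_ext. intros m. unfold avg_weight, f. rewrite csn_scal. ring. }
    assert (BA : Cmod (csum (fun m => b m * avg_weight N n m)%C) <= M).
    { rewrite EA, Cmod_mult, Cmod_inv, Cmod_R, Rabs_pos_eq by (auto; lra).
      apply Rmult_le_reg_l with (INR N); [exact PN|]. rewrite <- Rmult_assoc, Rinv_r, Rmult_1_l by lra.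
      apply csn_Cmod_le. intros k. rewrite (csum_ext _ _ (fun m => Ef m k)), csum_scal by apply Sx.
      rewrite Cmod_mult.
      replace (INR k * (- INR n / INR N))%C with (RtoC (INR k * (- INR n / INR N)))
        by (rewrite RtoC_mult, RtoC_div, RtoC_opp by lra; reflexivity).
      rewrite Cmod_q_real, Rmult_1_l. 
      rewrite (csum_ext _ (fun m => d m * q_param (RtoC (INR k / INR N) + y * Ci) ^ m)%C); [apply HM|].
      intros m. rewrite Q, Cpow_mult_l. unfold b. ring. }
    assert (SA : csm (fun m => b m * avg_weight N n m)%C).
    { apply (csm_le _ (fun m => Cmod (b m))); [|exact S].
      intros m. rewrite Cmod_mult. pose proof (avg_weight_le N n m ltac:(lia)). pose proof (Cmod_ge_0 (b m)). nra. }
    assert (E1 : csn (fun m => b m * avg_weight N n m)%C N = b n).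
    { rewrite (csn_single _ n) by (auto; intros k Hk Hkn; rewrite avg_weight_off by auto; ring).
      rewrite avg_weight_diag by lia. ring. }
    replace (b n) with (csum (fun m => b m * avg_weight N n m)
      - (csum (fun m => b m * avg_weight N n m) - csn (fun m => b m * avg_weight N n m) N))%C
      by (rewrite E1; ring).
    eapply Rle_trans; [apply Cmod_triangle_sub|]. apply Rplus_le_compat; [exact BA|].
    rewrite csn_shift_tail by exact SA. apply csum_Cmod; [|apply (ex_series_shift (fun k => Cmod (b k))), S].
    intros k. rewrite Cmod_mult. pose proof (avg_weight_le N n (N + k) ltac:(lia)). pose proof (Cmod_ge_0 (b (N + k)%nat)). nra. }
  replace (Cmod (d n) * r ^ n) with (Cmod (b n)).
  2:{ unfold b. rewrite Cmod_mult, Cmod_pow, Cmod_R, Rabs_pos_eq by lra. reflexivity. }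
  apply (is_lim_seq_le_loc (fun _ => Cmod (b n)) (fun N => M + Series (fun k => Cmod (b (N + k)%nat))) (Cmod (b n)) M).
  - exists (Datatypes.S n). intros N HN. apply B. lia.
  - apply is_lim_seq_const.
  - replace (Finite M) with (Finite (M + 0)) by (f_equal; ring).
    apply is_lim_seq_plus'; [apply is_lim_seq_const|]. apply (Series_tail_lim (fun k => Cmod (b k))), S.
Qed.

(** * The modular invariant near the cusp *)

Lemma PI_gt_3 : 3 < PI.
Proof. pose proof PI2_3_2. lra. Qed.

(** As [6 < 2 pi], this gives [|q| <= 1/200] for [Im t >= 1]. *)
Lemma exp_6_ge : 200 <= exp 6.
Proof.
  replace 6 with (/ 4 * INR 24) by (simpl; field). rewrite <- exp_pow.
  apply Rle_trans with ((1 + / 4) ^ 24); [lra|]. apply pow_incr. split; [lra|apply exp_ineq1_le].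
Qed.

Lemma cube_le_pow8 (n : nat) : INR (S n) ^ 3 <= 8 ^ n.
Proof.
  induction n; [simpl; lra|].
  pose proof (pos_INR n). rewrite !S_INR in *. change (8 ^ S n) with (8 * 8 ^ n).
  apply Rle_trans with (8 * (INR n + 1) ^ 3); [|lra].
  replace (8 * (INR n + 1) ^ 3) with ((2 * (INR n + 1)) ^ 3) by ring. apply pow_incr. lra.
Qed.

Lemma lambert_dom_real (k : nat) (q : C) (n : nat) : Cmod q < 1 ->
  Cmod (INR (S n) ^ k * (q ^ S n / (1 - q ^ S n)))%C
   <= INR (S n) ^ k * (Cmod q ^ S n / (1 - Cmod q ^ S n)).
Proof.
  intros Hq. pose proof (Cmod_ge_0 q).
  pose proof (Cmod_pow_S_lt_1 q n Hq) as H1.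
  pose proof (one_minus_neq_0 _ H1) as Hn.
  rewrite Cmod_mult, Cmod_div, !Cmod_pow, Cmod_R, Rabs_pos_eq by (auto using pos_INR).
  rewrite Cmod_pow in H1.
  apply Rmult_le_compat_l; [apply pow_le, pos_INR|].
  apply Rmult_le_compat_l; [apply pow_le; lra|].
  apply Rinv_le_contravar; [lra|].
  pose proof (Cmod_triangle_rev 1 (q ^ S n)%C) as T. now rewrite Cmod_1, Cmod_pow in T.
Qed.

Lemma ex_series_lambert (k : nat) (r : R) : 0 <= r < 1 ->
  ex_series (fun n => INR (S n) ^ k * (r ^ S n / (1 - r ^ S n))).
Proof.
  intros Hr. apply (ex_series_nonneg_le _ (fun n => / (1 - r) * (INR (S n) ^ k * r ^ S n))).
  - intros n. pose proof (pos_INR (S n)).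
    assert (0 <= r ^ S n) by (apply pow_le; lra). assert (r ^ S n <= r) by (apply pow_S_le; lra).
    assert (0 <= INR (S n) ^ k) by now apply pow_le.
    assert (0 < / (1 - r ^ S n) <= / (1 - r)).
    { split; [apply Rinv_0_lt_compat; lra|apply Rinv_le_contravar; lra]. }
    split; [apply Rmult_le_pos; [assumption|apply Rmult_le_pos; lra]|].
    replace (/ (1 - r) * (INR (S n) ^ k * r ^ S n)) with (INR (S n) ^ k * (r ^ S n * / (1 - r))) by ring.
    apply Rmult_le_compat_l; [assumption|]. apply Rmult_le_compat_l; lra.
  - apply (ex_series_scal_l (V := R_NormedModule) (/ (1 - r))). now apply ex_series_S_pow_geom.
Qed.

Lemma lambert3_small (q : C) : Cmod q <= / 200 -> Cmod (lambert 3 q) <= 11 / 10 * Cmod q.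
Proof.
  intros H. pose proof (Cmod_ge_0 q). set (r := Cmod q) in *.
  assert (B : forall n, Cmod (INR (S n) ^ 3 * (q ^ S n / (1 - q ^ S n)))%C <= (r / (1 - r)) * (8 * r) ^ n).
  { intros n. eapply Rle_trans; [apply lambert_dom_real; fold r; lra|]. fold r.
    assert (0 <= r ^ S n) by (apply pow_le; lra). assert (r ^ S n <= r) by (apply pow_S_le; lra).
    pose proof (cube_le_pow8 n). pose proof (pow_le _ 3 (pos_INR (S n))).
    rewrite Rpow_mult_distr.
    replace (r / (1 - r) * (8 ^ n * r ^ n)) with (8 ^ n * (r ^ S n * / (1 - r))) by (simpl; unfold Rdiv; ring).
    apply Rmult_le_compat; try assumption.
    - apply Rmult_le_pos; [assumption|left; apply Rinv_0_lt_compat; lra].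
    - apply Rmult_le_compat_l; [assumption|]. apply Rinv_le_contravar; lra. }
  unfold lambert. eapply Rle_trans; [apply (csum_Cmod _ _ B)|].
  - apply (ex_series_scal_l (V := R_NormedModule) (r / (1 - r))), ex_series_geom. rewrite Rabs_pos_eq; lra.
  - rewrite Series_scal_l, Series_geom by (rewrite Rabs_pos_eq; lra).
    apply Rmult_le_reg_r with ((1 - r) * (1 - 8 * r)); [nra|].
    replace (r / (1 - r) * / (1 - 8 * r) * ((1 - r) * (1 - 8 * r))) with r by (field; lra).
    nra.
Qed.

Lemma eprod_near_1 (q : C) : Cmod q < 1 ->
  Cmod (eprod q - 1)%C <= exp (24 * (Cmod q / (1 - Cmod q))) * 2 ^ 24 * (Cmod q / (1 - Cmod q)).
Proof.
  intros Hq. pose proof (Cmod_ge_0 q).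
  set (U := exp (24 * (Cmod q / (1 - Cmod q))) * 2 ^ 24).
  assert (HU : 0 <= U) by (unfold U; pose proof (exp_pos (24 * (Cmod q / (1 - Cmod q)))); nra).
  assert (P : forall N, Cmod (Cprod (efac q) N - 1)%C <= U * geom_part (Cmod q) N).
  { induction N.
    - simpl. replace (1 - 1)%C with (RtoC 0) by ring. rewrite Cmod_0. lra.
    - cbn [Cprod geom_part].
      replace (Cprod (efac q) N * efac q (S N) - 1)%C
        with ((Cprod (efac q) N - 1) + Cprod (efac q) N * (efac q (S N) - 1))%C by ring.
      eapply Rle_trans; [apply Cmod_triangle|]. rewrite Rmult_plus_distr_l. apply Rplus_le_compat; [exact IHN|].
      rewrite Cmod_mult. unfold U. rewrite Rmult_assoc.
      apply Rmult_le_compat; try apply Cmod_ge_0; [apply Cprod_upper; lra|].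
      assert (H1 : Cmod (q ^ S N)%C <= 1) by (left; now apply Cmod_pow_S_lt_1).
      eapply Rle_trans; [apply (pow_minus_one_bound _ 24 H1)|].
      rewrite Cmod_pow. apply Rmult_le_compat_r; [apply pow_le; lra|lra]. }
  apply (Ccv_Cmod_le (fun N => Cprod (efac q) N - 1)%C).
  - intros N. eapply Rle_trans; [apply P|]. apply Rmult_le_compat_l; [exact HU|]. apply geom_part_le. lra.
  - apply Ccv_minus; [now apply Cprod_eprod|apply Ccv_const].
Qed.

(** The pole cancels because [E4^3] and [eprod] are both [1 + O(q)]. The size of the constant comes
    from the crude factor [2^24] in [pow_minus_one_bound]; numerator and inverse product give
    [2 (3000 + 34000000)]. *)
Lemma modular_j_cusp (t : C) : 1 <= Im t -> Cmod (modular_j t - / q_param t)%C <= 100000000.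
Proof.
  intros Ht. pose proof PI_gt_3. pose proof (Cmod_q_lt_1 t ltac:(lra)) as Hq.
  rewrite modular_j_E4 by lra. unfold mdelta.
  set (q := q_param t) in *.
  assert (Hq0 : q <> RtoC 0) by apply q_param_neq_0.
  assert (Hr0 : 0 < Cmod q) by now apply Cmod_gt_0.
  assert (Hr : Cmod q <= / 200).
  { unfold q. rewrite Cmod_q_param. rewrite exp_Ropp.
    apply Rinv_le_contravar; [lra|]. eapply Rle_trans; [apply exp_6_ge|]. apply exp_le. nra. }
  pose proof (eprod_neq_0 q Hq) as He0.
  pose proof (lambert3_small q Hr) as HL.
  pose proof (eprod_near_1 q Hq) as HE.
  pose proof (eprod_lower q (Cmod q) (Rle_refl _) Hq) as HEl.
  set (r := Cmod q) in *.
  assert (Hf : r / (1 - r) <= 202 / 200 * r).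
  { apply Rmult_le_reg_r with (1 - r); [lra|]. unfold Rdiv at 1. rewrite Rmult_assoc, Rinv_l by lra. nra. }
  assert (HU : exp (24 * (r / (1 - r))) <= 2).
  { apply Rle_trans with (exp (/ 2)); [apply exp_le; lra|].
    assert (exp (/ 2) * exp (/ 2) <= 4).
    { rewrite <- exp_plus. replace (/ 2 + / 2) with 1 by field. pose proof exp_le_3. lra. }
    pose proof (exp_pos (/ 2)). nra. }
  assert (HEl2 : / 2 <= Cmod (eprod q)).
  { eapply Rle_trans; [|exact HEl]. eapply Rle_trans; [|apply exp_ineq1_le].
    assert (r / (1 - r) ^ 2 <= 2 * r).
    { apply Rmult_le_reg_r with ((1 - r) ^ 2); [nra|]. unfold Rdiv. rewrite Rmult_assoc, Rinv_l by nra. nra. }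
    lra. }
  assert (HEn : Cmod (eprod q - 1)%C <= 34000000 * r).
  { eapply Rle_trans; [exact HE|].
    apply Rle_trans with (2 * 2 ^ 24 * (202 / 200 * r)); [|lra].
    assert (H0 := exp_pos (24 * (r / (1 - r)))).
    apply Rmult_le_compat; [apply Rmult_le_pos; lra| |apply Rmult_le_compat_r; lra|exact Hf].
    apply Rmult_le_pos; [lra|left; apply Rinv_0_lt_compat; lra]. }
  set (a := (240 * lambert 3 q)%C).
  assert (Ha : Cmod a <= 264 * r).
  { unfold a. rewrite Cmod_mult, Cmod_R, Rabs_pos_eq by lra. lra. }
  assert (H3 : Cmod ((1 + a) ^ 3 - 1)%C <= 3000 * r).
  { replace ((1 + a) ^ 3 - 1)%C with (a * (3 + 3 * a + a * a))%C by ring.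
    rewrite Cmod_mult. pose proof (Cmod_ge_0 a).
    assert (Cmod (3 + 3 * a + a * a)%C <= 3 + 3 * Cmod a + Cmod a * Cmod a).
    { eapply Rle_trans; [apply Cmod_triangle|]. rewrite Cmod_mult. apply Rplus_le_compat_r.
      eapply Rle_trans; [apply Cmod_triangle|]. rewrite Cmod_mult, Cmod_R, Rabs_pos_eq by lra. lra. }
    assert (Cmod a <= 132 / 100) by lra.
    assert (3 + 3 * Cmod a + Cmod a * Cmod a <= 9) by nra.
    pose proof (Cmod_ge_0 (3 + 3 * a + a * a)%C).
    apply Rle_trans with (264 * r * 9); [apply Rmult_le_compat; lra|lra]. }
  unfold E4. fold a.
  replace ((1 + a) ^ 3 / (q * eprod q) - / q)%C with ((((1 + a) ^ 3 - 1) - (eprod q - 1)) / (q * eprod q))%C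
    by (field; auto).
  rewrite Cmod_div, Cmod_mult by now apply Cmult_neq_0. fold r.
  apply Rmult_le_reg_r with (r * Cmod (eprod q)); [nra|].
  unfold Rdiv. rewrite Rmult_assoc, Rinv_l, Rmult_1_r by nra.
  eapply Rle_trans; [apply Cmod_triangle_sub|]. nra.
Qed.

(** * Comparison with the Bessel coefficients *)

Lemma E4_le_real (q : C) : Cmod q < 1 -> Cmod (E4 q) <= Cmod (E4 (Cmod q)).
Proof.
  intros Hq. pose proof (Cmod_ge_0 q). set (r := Cmod q) in *.
  set (s := fun n => INR (S n) ^ 3 * (r ^ S n / (1 - r ^ S n))).
  assert (Hs : ex_series s) by (apply ex_series_lambert; lra).
  assert (P : forall n, 0 < 1 - r ^ S n).
  { intros n. assert (r ^ S n <= r) by (apply pow_S_le; lra). lra. }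
  assert (Hs0 : forall n, 0 <= s n).
  { intros n. unfold s. specialize (P n). apply Rmult_le_pos; [apply pow_le, pos_INR|].
    apply Rmult_le_pos; [apply pow_le; lra|left; now apply Rinv_0_lt_compat]. }
  assert (HS : 0 <= Series s).
  { eapply Rle_trans; [|apply (Series_partial_le s 0 Hs0 Hs)]. apply Hs0. }
  assert (ER : lambert 3 r = RtoC (Series s)).
  { unfold lambert. rewrite <- csum_RtoC. apply csum_ext. intros n. unfold s. specialize (P n).
    rewrite RtoC_mult, RtoC_div, RtoC_minus, !RtoC_pow by lra. reflexivity. }
  assert (EL : Cmod (lambert 3 q) <= Series s).
  { unfold lambert. apply csum_Cmod; [|exact Hs]. intros n. now apply lambert_dom_real. }
  unfold E4. rewrite ER, <- RtoC_mult, <- RtoC_plus, Cmod_R, Rabs_pos_eq by lra.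
  eapply Rle_trans; [apply Cmod_triangle|]. rewrite Cmod_1, Cmod_mult, Cmod_R, Rabs_pos_eq by lra. lra.
Qed.

Lemma eprod_ge_real (q : C) : Cmod q < 1 -> Cmod (eprod (Cmod q)) <= Cmod (eprod q).
Proof.
  intros Hq. pose proof (Cmod_ge_0 q). set (r := Cmod q) in *.
  assert (Hr : Cmod (RtoC r) < 1) by (rewrite Cmod_R, Rabs_pos_eq; lra).
  apply (is_lim_seq_le (fun N => Cmod (Cprod (efac r) N)) (fun N => Cmod (Cprod (efac q) N))
     (Cmod (eprod r)) (Cmod (eprod q))); try (apply Ccv_Cmod, Cprod_eprod; assumption).
  induction n; [simpl; lra|]. cbn [Cprod]. rewrite !Cmod_mult.
  apply Rmult_le_compat; try apply Cmod_ge_0; [exact IHn|].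
  unfold efac. rewrite !Cmod_pow. apply pow_incr. split; [apply Cmod_ge_0|].
  pose proof (Cmod_triangle_rev 1 (q ^ S n)%C) as T. rewrite Cmod_1, Cmod_pow in T. fold r in T.
  eapply Rle_trans; [|exact T].
  rewrite <- RtoC_pow, <- RtoC_minus, Cmod_R, Rabs_pos_eq; [lra|].
  assert (r ^ S n <= r) by (apply pow_S_le; lra). lra.
Qed.

Lemma Im_scale_Ci (y : R) : Im (y * Ci)%C = y.
Proof. unfold Im, Ci; simpl. ring. Qed.

(** [E4] has positive coefficients and [|1 - q^n| >= 1 - |q|^n]. Hence low points need no reduction
    to a fundamental domain: the imaginary axis, on which a single inversion suffices, dominates. *)
Lemma modular_j_le_imaginary (t : C) : 0 < Im t ->
  Cmod (modular_j t) <= Cmod (modular_j (Im t * Ci)).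
Proof.
  intros Ht. rewrite !modular_j_E4 by (rewrite ?Im_scale_Ci; lra).
  assert (Eq : q_param (Im t * Ci) = RtoC (Cmod (q_param t))).
  { rewrite Cmod_q_param. unfold q_param. rewrite <- Cexp_RtoC. f_equal.
    transitivity (2 * PI * Im t * (Ci * Ci))%C; [ring|].
    rewrite Ci_sq, RtoC_opp, !RtoC_mult. ring. }
  pose proof (Cmod_q_lt_1 t Ht) as Hq. pose proof (q_param_neq_0 t) as Hq0.
  rewrite Eq. set (q := q_param t) in *.
  assert (Hr0 : 0 < Cmod q) by now apply Cmod_gt_0.
  assert (HrC : RtoC (Cmod q) <> RtoC 0) by (apply RtoC_neq; lra).
  assert (Hr1 : Cmod (RtoC (Cmod q)) < 1) by (rewrite Cmod_R, Rabs_pos_eq; lra).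
  pose proof (eprod_neq_0 q Hq). pose proof (eprod_neq_0 _ Hr1) as He.
  unfold mdelta. rewrite !Cmod_div by (apply Cmult_neq_0; auto).
  rewrite !Cmod_mult, !Cmod_pow, (Cmod_R (Cmod q)), (Rabs_pos_eq (Cmod q)) by lra.
  apply Cmod_gt_0 in He.
  apply Rmult_le_compat.
  - apply pow_le, Cmod_ge_0.
  - left. apply Rinv_0_lt_compat. apply Rmult_lt_0_compat; [assumption|now apply Cmod_gt_0].
  - apply pow_incr. split; [apply Cmod_ge_0|now apply E4_le_real].
  - apply Rinv_le_contravar; [nra|]. apply Rmult_le_compat_l; [lra|now apply eprod_ge_real].
Qed.

Definition G0 : R := 100000000.

Lemma modular_j_low (t : C) : 0 < Im t <= 1 ->
  Cmod (modular_j t) <= exp (2 * PI / Im t) + G0.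
Proof.
  intros Ht. eapply Rle_trans; [apply modular_j_le_imaginary; lra|].
  assert (Hy : 1 <= / Im t) by (rewrite <- Rinv_1; apply Rinv_le_contravar; lra).
  rewrite <- modular_j_inv by (rewrite Im_scale_Ci; lra).
  assert (E : (- / (Im t * Ci))%C = (RtoC (/ Im t) * Ci)%C).
  { assert (RtoC (Im t) <> RtoC 0) by (apply RtoC_neq; lra). pose proof Ci_neq_0.
    rewrite RtoC_inv by lra. transitivity (- (1) / (Im t * Ci))%C; [field; auto|]. rewrite <- Ci_sq. field. auto. }
  rewrite E. set (s := (RtoC (/ Im t) * Ci)%C).
  assert (HI : Im s = / Im t) by apply Im_scale_Ci.
  pose proof (modular_j_cusp s ltac:(lra)) as B.
  replace (modular_j s) with (modular_j s - / q_param s + / q_param s)%C by ring.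
  eapply Rle_trans; [apply Cmod_triangle|].
  rewrite Cmod_inv by apply q_param_neq_0. rewrite Cmod_q_param, HI, exp_Ropp, Rinv_inv.
  unfold Rdiv, G0. lra.
Qed.

(** Above [2 * 8 * 32 * 3^16]: two half-sums, each at most 8 by [strip_series_le], with the factor
    from [exp_rem_far]. *)
Definition far_const : R := 30000000000.

Lemma exp_16_le : exp 16 <= 43046721.
Proof.
  replace 16 with (1 * INR 16) by (simpl; ring). rewrite <- exp_pow.
  replace 43046721 with (3 ^ 16) by ring. apply pow_incr. split; [left; apply exp_pos|apply exp_le_3].
Qed.

(** By [zeta_half] the sum is [3 zeta 2 = pi^2 / 2]. *)
Lemma strip_series_le : Series (fun n => / (INR n + / 2) ^ 2) <= 8.
Proof.
  pose proof ex_series_strip as S. pose proof PI_4. pose proof PI_gt_3.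
  assert (E : RtoC (Series (fun n => / (INR n + / 2) ^ 2)) = RtoC (PI ^ 2 / 2)).
  { rewrite <- csum_RtoC.
    rewrite (csum_ext _ (fun n => (/ (1 / 2 + INR n)) ^ 2)%C).
    - rewrite zeta_half, zeta2 by lia. rewrite RtoC_div, RtoC_pow by lra. field.
    - intros n. pose proof (pos_INR n).
      rewrite RtoC_inv, RtoC_pow, RtoC_plus, RtoC_inv by (try apply pow_nonzero; lra).
      assert ((INR n + / 2)%C <> RtoC 0).
      { rewrite <- RtoC_inv, <- RtoC_plus by lra. apply RtoC_neq. lra. }
      replace (1 / 2 + INR n)%C with (INR n + / 2)%C by field. field. 
      intros E0. apply H2. rewrite <- (Cmult_0_l (/ 2)%C), <- E0. field. }
  apply RtoC_inj in E. rewrite E. nra.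
Qed.

(** Since [2 pi <= 8], [|w| <= 8/(n + 1/2) <= 16]; then [|w|^2 / 2] gives the factor 32 and
    [exp 16 <= 3^16 = 43046721] the other. *)
Lemma exp_rem_far (w z : C) (n : nat) : INR n + / 2 <= Cmod z -> w = (2 * PI * Ci / z)%C ->
  Cmod (exp_rem w) <= (32 * 43046721) * / (INR n + / 2) ^ 2.
Proof.
  intros Hz ->. pose proof (pos_INR n). pose proof PI_4. pose proof PI_gt_3.
  assert (Hz0 : z <> RtoC 0) by (apply Cmod_gt_0; lra).
  assert (Hw : Cmod (2 * PI * Ci / z)%C <= 8 * / (INR n + / 2)).
  { rewrite Cmod_div, !Cmod_mult, Cmod_Ci, !Cmod_R, !Rabs_pos_eq by (auto; lra).
    apply Rmult_le_compat; [lra|left; apply Rinv_0_lt_compat; lra|lra|apply Rinv_le_contravar; lra]. }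
  pose proof (Cmod_ge_0 (2 * PI * Ci / z)%C).
  assert (/ (INR n + / 2) <= 2) by (rewrite <- (Rinv_inv 2); apply Rinv_le_contravar; lra).
  assert (0 < / (INR n + / 2)) by (apply Rinv_0_lt_compat; lra).
  eapply Rle_trans; [apply exp_rem_bound|].
  assert (exp (Cmod (2 * PI * Ci / z)%C) <= 43046721).
  { eapply Rle_trans; [|apply exp_16_le]. apply exp_le. lra. }
  replace (32 * 43046721 * / (INR n + / 2) ^ 2) with ((8 * / (INR n + / 2)) ^ 2 / 2 * 43046721) by (field; lra).
  apply Rmult_le_compat; [|left; apply exp_pos| |assumption].
  - pose proof (pow2_ge_0 (Cmod (2 * PI * Ci / z)%C)). lra.
  - apply Rmult_le_compat_r; [lra|]. apply pow_incr. lra.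
Qed.

Lemma bser_far (t : C) : 0 < Im t -> Rabs (Re t) <= / 2 ->
  Cmod (bser t - exp_rem (2 * PI * Ci / t))%C <= far_const.
Proof.
  intros Ht HR. unfold bser.
  set (c := 32 * 43046721).
  assert (Sc : ex_series (fun n => c * / (INR n + / 2) ^ 2))
    by apply (ex_series_scal_l (V := R_NormedModule) c), ex_series_strip.
  assert (B1 : forall n, Cmod (exp_rem (2 * PI * Ci / (t + INR (S n)))) <= c * / (INR n + / 2) ^ 2).
  { intros n. apply (exp_rem_far _ (t + INR (S n))%C); [apply strip_far, HR|reflexivity]. }
  assert (B2 : forall n, Cmod (exp_rem (2 * PI * Ci / (t - INR (S n)))) <= c * / (INR n + / 2) ^ 2).
  { intros n. apply (exp_rem_far _ (t - INR (S n))%C); [apply strip_far, HR|reflexivity]. }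
  rewrite (csum_S (fun n => exp_rem (2 * PI * Ci / (t + INR n)))).
  2:{ apply csm_S. exact (csm_le _ _ B1 Sc). }
  replace (t + INR 0)%C with t by (simpl; ring).
  set (X := csum _). set (Y := csum _).
  replace (exp_rem (2 * PI * Ci / t) + X + Y - exp_rem (2 * PI * Ci / t))%C with (X + Y)%C by ring.
  eapply Rle_trans; [apply Cmod_triangle|].
  pose proof (csum_Cmod _ _ B1 Sc) as C1. pose proof (csum_Cmod _ _ B2 Sc) as C2.
  fold X in C1. fold Y in C2. rewrite Series_scal_l in C1, C2.
  pose proof strip_series_le. unfold c, far_const in *. lra.
Qed.

(** The series of [bser] starts with [q^1], so [c 0] is left as it is. *)
Definition dev (c : nat -> Z) (n : nat) : R :=
  match n with O => IZR (c O) | S _ => IZR (c n) - bess (INR n) end.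

(** Abel's lemma: convergence at [s] makes the terms eventually smaller than 1, which leaves the
    majorant [(r/s)^n] at [r]. The hypothesis on [c] provides convergence only, but at every
    height. *)
Lemma csm_of_is_series (a : nat -> C) (r s : R) : 0 < r < s ->
  (exists l, Ccv (csn (fun n => a n * s ^ n)%C) l) -> csm (fun n => a n * r ^ n)%C.
Proof.
  intros Hrs [l Hl].
  assert (H0 : Ccv (fun n => a n * s ^ n)%C (RtoC 0)).
  { apply (Ccv_ext (fun n => csn (fun n => a n * s ^ n) (S n) - csn (fun n => a n * s ^ n) n)%C).
    - intros n. cbn [csn]. ring.
    - replace (RtoC 0) with (l - l)%C by ring. apply Ccv_minus; [apply (proj1 (Ccv_incr_1 _ _) Hl)|exact Hl]. }
  apply Ccv_Cmod in H0. rewrite Cmod_0 in H0.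
  assert (Hb : eventually (fun n => Cmod (a n * s ^ n)%C < 1)).
  { apply is_lim_seq_spec in H0. destruct (H0 (mkposreal 1 Rlt_0_1)) as [N HN]. exists N.
    intros n Hn. specialize (HN n Hn). rewrite Rminus_0_r, Rabs_pos_eq in HN by apply Cmod_ge_0. exact HN. }
  destruct Hb as [N HN].
  apply (ex_series_incr_n (V := R_NormedModule) _ N).
  apply (ex_series_nonneg_le _ (fun n => (r / s) ^ n)).
  - intros n. split; [apply Cmod_ge_0|]. specialize (HN (N + n)%nat ltac:(lia)).
    rewrite Cmod_mult, Cmod_pow, Cmod_R, Rabs_pos_eq in * by lra.
    assert (Hs : 0 < s ^ (N + n)) by (apply pow_lt; lra).
    replace (r ^ (N + n)) with (s ^ (N + n) * (r / s) ^ (N + n)).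
    + assert (0 < (r / s) ^ n) by (apply pow_lt, Rdiv_lt_0_compat; lra).
      assert ((r / s) ^ (N + n) <= (r / s) ^ n).
      { rewrite pow_add. rewrite <- (Rmult_1_l ((r / s) ^ n)) at 2. apply Rmult_le_compat_r; [lra|].
        apply pow_le_one. split; [apply Rlt_le, Rdiv_lt_0_compat; lra|].
        apply Rmult_le_reg_r with s; [lra|]. unfold Rdiv. rewrite Rmult_assoc, Rinv_l by lra. lra. }
      assert (0 <= (r / s) ^ (N + n)) by (apply pow_le, Rlt_le, Rdiv_lt_0_compat; lra).
      pose proof (Cmod_ge_0 (a (N + n)%nat)).
      rewrite <- Rmult_assoc. apply Rle_trans with (1 * (r / s) ^ (N + n)); [|lra].
      apply Rmult_le_compat_r; lra.
    + rewrite <- Rpow_mult_distr. f_equal. field. lra.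
  - apply ex_series_geom. rewrite Rabs_pos_eq; [|apply Rlt_le, Rdiv_lt_0_compat; lra].
    apply Rmult_lt_reg_r with s; [lra|]. unfold Rdiv. rewrite Rmult_assoc, Rinv_l by lra. lra.
Qed.

Lemma q_param_scale_Ci (y : R) : q_param (y * Ci) = RtoC (exp (- (2 * PI * y))).
Proof.
  unfold q_param. rewrite <- Cexp_RtoC. f_equal.
  transitivity (2 * PI * y * (Ci * Ci))%C; [ring|].
  rewrite Ci_sq, RtoC_opp, !RtoC_mult. ring.
Qed.

Lemma fourier_csm (c : nat -> Z) (y : R) : j_fourier_coefficients c -> 0 < y ->
  csm (fun n => RtoC (IZR (c n)) * exp (- (2 * PI * y)) ^ n)%C.
Proof.
  intros hc Hy. pose proof PI_RGT_0.
  apply (csm_of_is_series _ _ (exp (- (2 * PI * (y / 2))))).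
  - split; [apply exp_pos|]. apply exp_increasing. nra.
  - specialize (hc (RtoC (y / 2) * Ci)%C). rewrite Im_scale_Ci in hc. specialize (hc ltac:(lra)).
    apply is_series_Ccv in hc. eexists. revert hc. rewrite q_param_scale_Ci. intros hc. exact hc.
Qed.

Lemma Cmod_q_pow_le (a : nat -> C) (t : C) :
  csm (fun n => a n * exp (- (2 * PI * Im t)) ^ n)%C -> csm (fun n => a n * q_param t ^ n)%C.
Proof.
  apply ex_series_ext. intros n. rewrite !Cmod_mult, !Cmod_pow, Cmod_q_param, Cmod_R, Rabs_pos_eq; [reflexivity|].
  left. apply exp_pos.
Qed.

Lemma dev_series (c : nat -> Z) (t : C) : j_fourier_coefficients c -> 0 < Im t ->
  csum (fun n => RtoC (dev c n) * q_param t ^ n)%C = (modular_j t - / q_param t - bser t)%C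
  /\ csm (fun n => RtoC (dev c n) * q_param t ^ n)%C.
Proof.
  intros hc Ht. pose proof (Cmod_q_pow_le _ t (fourier_csm c (Im t) hc Ht)) as S1.
  destruct (bser_powser t Ht) as [E2 S2].
  pose proof (hc t Ht) as E1. apply is_series_Ccv in E1.
  assert (E1' := csum_unique _ _ E1). 
  assert (S1' := proj1 (csm_S _) S1).
  assert (X : forall n, (RtoC (dev c (S n)) * q_param t ^ S n =
     RtoC (IZR (c (S n))) * q_param t ^ S n - RtoC (bess (INR (S n))) * q_param t ^ S n)%C).
  { intros n. unfold dev. rewrite RtoC_minus. ring. }
  assert (S3 : csm (fun n => RtoC (dev c n) * q_param t ^ n)%C).
  { apply csm_S. eapply csm_ext; [intros n; symmetry; apply X|]. now apply csm_minus. }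
  split; [|exact S3].
  rewrite csum_S by exact S3. rewrite (csum_ext _ _ X), csum_minus, <- E2 by assumption.
  rewrite <- E1'. rewrite (csum_S (fun n => RtoC (IZR (c n)) * q_param t ^ n)%C) by exact S1.
  simpl dev. ring.
Qed.

(** The first term is [exp(2 pi / Im(-1/t))] at its largest in the strip, at [Re t = 1/2]. Next come
    the bounds near the cusp and for [bser], then 7000 for [3^8 + 1], and finally the moduli of
    [2 pi i / t] and [1/q]. *)
Definition dev_bound (y : R) : R :=
  exp (2 * PI * (/ (4 * y) + y)) + (2 * G0 + far_const + 7000 + 2 * PI / y + exp (2 * PI * y)).

(** The pole of [j] at [-1/t] is [Cexp w] with [w = 2 pi i / t], and [exp_rem w] is the term [m = 0]
    of [bser t]; they cancel up to [1 + w]. The rest of [j(-1/t)] is bounded by [modular_j_cusp] if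
    [Im(-1/t) >= 1]; otherwise [j] and the pole are bounded separately. *)
Lemma dev_sum_strip (c : nat -> Z) (t : C) : j_fourier_coefficients c -> 0 < Im t ->
  Rabs (Re t) <= / 2 ->
  Cmod (csum (fun n => RtoC (dev c n) * q_param t ^ n)%C) <= dev_bound (Im t).
Proof.
  intros hc Ht HR. destruct (dev_series c t hc Ht) as [E _]. rewrite E.
  pose proof PI_4. pose proof PI_gt_3.
  pose proof (upper_neq_0 t Ht) as Ht0. pose proof (Im_opp_inv t Ht) as Ht'.
  set (w := (2 * PI * Ci / t)%C).
  assert (Eq : (/ q_param (- / t))%C = Cexp w).
  { unfold q_param. rewrite <- Cexp_opp. f_equal. unfold w. field. exact Ht0. }
  rewrite <- modular_j_inv by exact Ht.
  replace (modular_j (- / t) - / q_param t - bser t)%C with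
    ((modular_j (- / t) - / q_param (- / t)) + (1 + w - / q_param t - (bser t - exp_rem w)))%C
    by (rewrite Eq; unfold exp_rem; ring).
  assert (Hy : Im (- / t)%C = Im t / (Re t ^ 2 + Im t ^ 2)).
  { rewrite Im_opp_inv_lower by exact Ht. now rewrite Cmod2_alt. }
  assert (B1 : Cmod (modular_j (- / t) - / q_param (- / t))%C <= exp (2 * PI * (/ (4 * Im t) + Im t)) + (2 * G0 + 6561)).
  { pose proof (exp_pos (2 * PI * (/ (4 * Im t) + Im t))).
    destruct (Rle_or_lt 1 (Im (- / t)%C)) as [Hc|Hc].
    - eapply Rle_trans; [apply modular_j_cusp, Hc|]. unfold G0. lra.
    - eapply Rle_trans; [apply Cmod_triangle_sub|].
      pose proof (modular_j_low (- / t)%C ltac:(lra)) as B.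
      assert (B2 : exp (2 * PI / Im (- / t)%C) <= exp (2 * PI * (/ (4 * Im t) + Im t))).
      { apply exp_le. unfold Rdiv. apply Rmult_le_compat_l; [lra|].
        rewrite Hy.
        replace (/ (Im t / (Re t ^ 2 + Im t ^ 2))) with ((Re t ^ 2 + Im t ^ 2) / Im t) by (field; split; nra).
        replace (/ (4 * Im t) + Im t) with ((/ 4 + Im t ^ 2) / Im t) by (field; lra).
        apply Rmult_le_compat_r; [left; now apply Rinv_0_lt_compat|].
        apply Rplus_le_compat_r. rewrite <- pow2_abs. replace (/ 4) with ((/ 2) ^ 2) by field.
        apply pow_incr. split; [apply Rabs_pos|exact HR]. }
      assert (B3 : Cmod (/ q_param (- / t))%C <= 6561).
      { rewrite Cmod_inv, Cmod_q_param, exp_Ropp, Rinv_inv by apply q_param_neq_0.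
        apply Rle_trans with (exp (1 * INR 8)); [apply exp_le; replace (1 * INR 8) with 8 by (simpl; ring); nra|].
        rewrite <- exp_pow. replace 6561 with (3 ^ 8) by ring. apply pow_incr.
        split; [left; apply exp_pos|apply exp_le_3]. }
      unfold G0 in *. lra. }
  assert (B2 : Cmod w <= 2 * PI / Im t).
  { unfold w. rewrite Cmod_div, !Cmod_mult, Cmod_Ci, !Cmod_R, !Rabs_pos_eq by (auto; lra).
    unfold Rdiv. rewrite Rmult_1_r. apply Rmult_le_compat_l; [lra|]. apply Rinv_le_contravar; [lra|].
    eapply Rle_trans; [apply Rle_abs|apply im_le_Cmod]. }
  assert (B3 : Cmod (/ q_param t)%C = exp (2 * PI * Im t)).
  { rewrite Cmod_inv, Cmod_q_param, exp_Ropp, Rinv_inv by apply q_param_neq_0. reflexivity. }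
  pose proof (bser_far t Ht HR) as B4. fold w in B4.
  eapply Rle_trans; [apply Cmod_triangle|].
  assert (B5 : Cmod (1 + w - / q_param t - (bser t - exp_rem w))%C <= 1 + 2 * PI / Im t + exp (2 * PI * Im t) + far_const).
  { eapply Rle_trans; [apply Cmod_triangle_sub|]. apply Rplus_le_compat; [|exact B4].
    eapply Rle_trans; [apply Cmod_triangle_sub|]. rewrite B3. apply Rplus_le_compat_r.
    eapply Rle_trans; [apply Cmod_triangle|]. rewrite Cmod_1. lra. }
  unfold dev_bound. lra.
Qed.

Lemma dev_sum_line (c : nat -> Z) (x y : R) : j_fourier_coefficients c -> 0 < y ->
  Cmod (csum (fun n => RtoC (dev c n) * q_param (x + y * Ci) ^ n)%C) <= dev_bound y.
Proof.
  intros hc Hy. pose proof (archimed (x - / 2)) as [Ha Hb].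
  set (k := up (x - / 2)) in *.
  assert (E : q_param (x + y * Ci) = q_param (RtoC (x - IZR k) + y * Ci)).
  { replace (x + y * Ci)%C with (RtoC (x - IZR k) + y * Ci + IZR k)%C by (rewrite RtoC_minus; ring).
    rewrite (q_param_plus _ (IZR k)), q_param_int. ring. }
  rewrite E. set (t := (RtoC (x - IZR k) + y * Ci)%C).
  assert (HI : Im t = y) by (unfold t, Im, Ci; simpl; ring).
  rewrite <- HI. apply dev_sum_strip; [exact hc|lra|].
  replace (Re t) with (x - IZR k) by (unfold t, Re, Ci; simpl; ring).
  apply Rabs_le. lra.
Qed.

Lemma coefficient_dev (c : nat -> Z) (y : R) (n : nat) : j_fourier_coefficients c -> 0 < y ->
  Rabs (dev c n) <= dev_bound y * exp (2 * PI * y * INR n).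
Proof.
  intros hc Hy.
  assert (S : csm (fun n => RtoC (dev c n) * exp (- (2 * PI * y)) ^ n)%C).
  { pose proof (dev_series c (y * Ci)%C hc) as H. rewrite Im_scale_Ci in H.
    destruct (H Hy) as [_ S]. rewrite q_param_scale_Ci in S. exact S. }
  pose proof (coefficient_bound (fun n => RtoC (dev c n)) y (dev_bound y) S
    (fun x => dev_sum_line c x y hc Hy) n) as B.
  cbv beta in B. rewrite Cmod_R in B.
  apply Rmult_le_reg_r with (exp (- (2 * PI * y)) ^ n); [apply pow_lt, exp_pos|].
  eapply Rle_trans; [exact B|]. right. rewrite exp_pow, Rmult_assoc, <- exp_plus.
  replace (2 * PI * y * INR n + - (2 * PI * y) * INR n) with 0 by ring. rewrite exp_0. ring.
Qed.

(** * The Laguerre expression of a Bessel-type function *)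

Fixpoint rsn (a : nat -> R) (n : nat) : R :=
  match n with O => 0 | S k => rsn a k + a k end.

Lemma sum_f_R0_rsn (a : nat -> R) (n : nat) : sum_f_R0 a n = rsn a (S n).
Proof. induction n; simpl in *; [ring|rewrite IHn; ring]. Qed.

Lemma rsn_ext (a b : nat -> R) (n : nat) : (forall k, (k < n)%nat -> a k = b k) -> rsn a n = rsn b n.
Proof. induction n; simpl; intros H; [reflexivity|]. rewrite IHn, H; auto. Qed.

Lemma rsn_le (a b : nat -> R) (n : nat) : (forall k, (k < n)%nat -> a k <= b k) -> rsn a n <= rsn b n.
Proof.
  induction n; simpl; intros H; [lra|]. apply Rplus_le_compat; [apply IHn; auto|apply H; lia].
Qed.

Lemma rsn_plus (a b : nat -> R) (n : nat) : rsn (fun k => a k + b k) n = rsn a n + rsn b n.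
Proof. induction n; simpl; [ring|rewrite IHn; ring]. Qed.

Lemma rsn_scal (c : R) (a : nat -> R) (n : nat) : rsn (fun k => c * a k) n = c * rsn a n.
Proof. induction n; simpl; [ring|rewrite IHn; ring]. Qed.

Lemma rsn_zero (a : nat -> R) (n : nat) : (forall k, (k < n)%nat -> a k = 0) -> rsn a n = 0.
Proof. induction n; simpl; intros H; [reflexivity|]. rewrite IHn, H; auto. ring. Qed.

Lemma rsn_S_first (a : nat -> R) (n : nat) : rsn a (S n) = a O + rsn (fun k => a (S k)) n.
Proof. induction n; simpl in *; [ring|rewrite IHn; ring]. Qed.

Lemma rsn_add (a : nat -> R) (n m : nat) : rsn a (n + m) = rsn a n + rsn (fun k => a (n + k)%nat) m.
Proof.
  induction m; [rewrite Nat.add_0_r; simpl; ring|].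
  rewrite Nat.add_succ_r. cbn [rsn]. rewrite IHm. ring.
Qed.

Lemma rsn_swap (a : nat -> nat -> R) (n m : nat) :
  rsn (fun i => rsn (a i) m) n = rsn (fun j => rsn (fun i => a i j) n) m.
Proof.
  induction n; simpl; [symmetry; now apply rsn_zero|]. now rewrite IHn, <- rsn_plus.
Qed.

(** Binomial coefficients by Pascal's rule, zero for [k > n], so that [vandermonde] can be proved by
    induction without side conditions on the terms. *)
Fixpoint rbin (n k : nat) : R :=
  match n, k with
  | _, O => 1
  | O, S _ => 0
  | S n', S k' => rbin n' k' + rbin n' k
  end.

(** [inv_fact_diff a b] is [1/(a-b)!], and 0 if [b > a]. *)
Definition inv_fact_diff (a b : nat) : R := if (b <=? a)%nat then / INR (fact (a - b)) else 0.

Lemma rbin_fact (n k : nat) : rbin n k = INR (fact n) * / INR (fact k) * inv_fact_diff n k.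
Proof.
  revert k. induction n; intros k.
  - destruct k; unfold inv_fact_diff; cbn [Nat.leb rbin]; [simpl; field|ring].
  - destruct k.
    + unfold inv_fact_diff. cbn [Nat.leb rbin]. rewrite Nat.sub_0_r. simpl (fact 0). simpl (INR 1).
      field. apply INR_fact_neq_0.
    + cbn [rbin]. rewrite !IHn. unfold inv_fact_diff. change (S k <=? S n)%nat with (k <=? n)%nat.
      rewrite !fact_simpl, !mult_INR, (Nat.sub_succ n k).
      pose proof (INR_fact_neq_0 n). pose proof (INR_fact_neq_0 k).
      pose proof (not_0_INR (S k) ltac:(lia)).
      destruct (k <=? n)%nat eqn:E1.
      * apply Nat.leb_le in E1. destruct (S k <=? n)%nat eqn:E2.
        -- apply Nat.leb_le in E2. replace (n - k)%nat with (S (n - S k)) by lia.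
           rewrite fact_simpl, mult_INR.
           assert (EI : INR (S (n - S k)) = INR n - INR k).
           { rewrite <- minus_INR by lia. f_equal. lia. }
           pose proof (INR_fact_neq_0 (n - S k)). pose proof (not_0_INR (S (n - S k)) ltac:(lia)).
           rewrite EI in *. rewrite !S_INR in *. field. repeat split; auto.
        -- apply Nat.leb_gt in E2. assert (n = k) by lia. subst. rewrite Nat.sub_diag. simpl (fact 0). simpl (INR 1).
           field. auto.
      * apply Nat.leb_gt in E1. destruct (S k <=? n)%nat eqn:E2; [apply Nat.leb_le in E2; lia|]. ring.
Qed.

Lemma vandermonde (m n s R : nat) : (m <= R)%nat ->
  rsn (fun r => rbin m r * rbin n (s + r)) (S R) = rbin (m + n) (m + s).
Proof.
  revert s R. induction m; intros s R HR.
  - rewrite rsn_S_first, rsn_zero by (intros; simpl; ring). simpl. rewrite Nat.add_0_r. destruct n; ring.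
  - destruct R as [|R]; [lia|].
    rewrite rsn_S_first.
    rewrite (rsn_ext _ (fun r => rbin m r * rbin n (S s + r) + rbin m (S r) * rbin n (s + S r))).
    2:{ intros k _. cbn [rbin]. rewrite Nat.add_succ_r, Nat.add_succ_l. ring. }
    rewrite rsn_plus, IHm by lia.
    pose proof (IHm s (S R) ltac:(lia)) as I2. rewrite rsn_S_first in I2.
    replace (S m + n)%nat with (S (m + n)) by lia. replace (S m + s)%nat with (S (m + s)) by lia.
    cbn [rbin]. rewrite <- I2. rewrite Nat.add_succ_r. destruct m; cbn [rbin]; ring.
Qed.

Definition hweight (r : nat) : R := / (INR (fact r) * INR (fact (S r))).

Lemma hweight_pos (r : nat) : 0 < hweight r.
Proof. apply Rinv_0_lt_compat, Rmult_lt_0_compat; apply INR_fact_lt_0. Qed.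

(** Vandermonde's identity for the binomials [(i, r)] and [(j+1, r+1)], divided by [i! (j+1)!]. It
    resolves the weights [1/(i!(i+1)!)] of [phi] into terms on which [symmetric_row] acts. *)
Lemma vandermonde_weights (i j R : nat) : (i <= R)%nat ->
  rsn (fun r => hweight r * inv_fact_diff i r * inv_fact_diff j r) (S R)
   = INR (fact (i + j + 1)) * hweight i * hweight j.
Proof.
  intros H. pose proof (vandermonde i (S j) 1 R H) as V.
  pose proof (INR_fact_neq_0 i) as H1. pose proof (INR_fact_neq_0 j) as H2.
  pose proof (INR_fact_neq_0 (S i)) as H3. pose proof (INR_fact_neq_0 (S j)) as H4.
  rewrite (rsn_ext _ (fun r => / (INR (fact i) * INR (fact (S j))) * (rbin i r * rbin (S j) (1 + r)))).
  - rewrite rsn_scal, V, rbin_fact. unfold inv_fact_diff, hweight.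
    replace (i + 1 <=? i + S j)%nat with true by (symmetry; apply Nat.leb_le; lia).
    replace (i + S j - (i + 1))%nat with j by lia. replace (i + S j)%nat with (i + j + 1)%nat by lia.
    replace (i + 1)%nat with (S i) by lia. field. auto.
  - intros r _. rewrite !rbin_fact. replace (1 + r)%nat with (S r) by lia.
    unfold hweight. assert (E : inv_fact_diff (S j) (S r) = inv_fact_diff j r) by reflexivity.
    rewrite E. pose proof (INR_fact_neq_0 r). pose proof (INR_fact_neq_0 (S r)). field. auto.
Qed.

(** Only [r <= i <= N - r] contributes; after [(x y)^r] is extracted, the rest is the binomial
    theorem for exponent [N - 2 r]. *)
Lemma symmetric_row (N r : nat) (x y : R) :
  rsn (fun i => x ^ i * y ^ (N - i) * (inv_fact_diff i r * inv_fact_diff (N - i) r)) (S N)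
   = (x * y) ^ r * (x + y) ^ (N - 2 * r) * inv_fact_diff N (2 * r).
Proof.
  assert (Z : forall a, (a < r)%nat -> inv_fact_diff a r = 0).
  { intros a Ha. unfold inv_fact_diff. destruct (r <=? a)%nat eqn:E; [apply Nat.leb_le in E; lia|reflexivity]. }
  assert (NZ : forall a b, inv_fact_diff (a + b) a = / INR (fact b)).
  { intros a b. unfold inv_fact_diff. replace (a <=? a + b)%nat with true by (symmetry; apply Nat.leb_le; lia).
    do 3 f_equal. lia. }
  destruct (Nat.le_gt_cases (2 * r) N) as [H|H].
  - replace (S N) with (r + (S (N - 2 * r) + r))%nat by lia.
    rewrite rsn_add, rsn_zero by (intros k Hk; rewrite (Z k Hk); ring).
    rewrite rsn_add.
    rewrite (rsn_zero (fun k => x ^ (r + (S (N - 2 * r) + k)) * _ * _)).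
    2:{ intros k Hk. rewrite (Z (N - _)%nat) by lia. ring. }
    set (n := (N - 2 * r)%nat).
    replace (inv_fact_diff N (2 * r)) with (/ INR (fact n)).
    2:{ rewrite <- (NZ (2 * r)%nat n). f_equal. unfold n. lia. }
    rewrite binomial, sum_f_R0_rsn.
    rewrite Rplus_0_r, Rplus_0_l, Rmult_assoc, (Rmult_comm (rsn _ _)), <- Rmult_assoc, <- rsn_scal.
    apply rsn_ext. intros a Ha.
    rewrite NZ. replace (N - (r + a))%nat with (r + (n - a))%nat by (unfold n; lia).
    rewrite NZ, !pow_add, Rpow_mult_distr. unfold Binomial.C.
    pose proof (INR_fact_neq_0 n). pose proof (INR_fact_neq_0 a). pose proof (INR_fact_neq_0 (n - a)).
    field. auto.
  - replace (inv_fact_diff N (2 * r)) with 0.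
    2:{ unfold inv_fact_diff. destruct (2 * r <=? N)%nat eqn:E; [apply Nat.leb_le in E; lia|reflexivity]. }
    rewrite Rmult_0_r. apply rsn_zero. intros i Hi.
    destruct (Nat.lt_ge_cases i r) as [Hc|Hc]; [rewrite (Z i Hc); ring|rewrite (Z (N - i)%nat) by lia; ring].
Qed.

Definition phi_term (x : R) (k : nat) : R := x ^ k * hweight k.
Definition phi (x : R) : R := Series (phi_term x).

Definition phi_hom (N : nat) (p w : R) : R :=
  / INR (fact (N + 1)) * rsn (fun r => hweight r * inv_fact_diff N (2 * r) * p ^ (N - 2 * r) * w ^ r) (S N).

(** The degree-[N] part of [phi x * phi y] has positive coefficients in [x + y] and [x y]. *)
Lemma phi_cauchy (N : nat) (x y : R) :
  sum_f_R0 (fun i => phi_term x i * phi_term y (N - i)) N = phi_hom N (x + y) (x * y).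
Proof.
  rewrite sum_f_R0_rsn. unfold phi_hom, phi_term.
  pose proof (INR_fact_neq_0 (N + 1)) as HN.
  rewrite (rsn_ext _ (fun i => / INR (fact (N + 1)) *
    rsn (fun r => hweight r * (x ^ i * y ^ (N - i) * (inv_fact_diff i r * inv_fact_diff (N - i) r))) (S N))).
  - rewrite rsn_scal, rsn_swap. f_equal. apply rsn_ext. intros r _.
    rewrite rsn_scal, symmetric_row. ring.
  - intros i Hi.
    rewrite (rsn_ext _ (fun r => (x ^ i * y ^ (N - i)) * (hweight r * inv_fact_diff i r * inv_fact_diff (N - i) r)))
      by (intros; ring).
    rewrite rsn_scal, vandermonde_weights by lia.
    replace (i + (N - i) + 1)%nat with (N + 1)%nat by lia. field. exact HN.
Qed.

Lemma phi_term_pos (x : R) (k : nat) : 0 <= x -> 0 <= phi_term x k.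
Proof. intros H. apply Rmult_le_pos; [now apply pow_le|left; apply hweight_pos]. Qed.

Lemma fact_ge_1 (n : nat) : 1 <= INR (fact n).
Proof. apply (le_INR 1). pose proof (lt_O_fact n). lia. Qed.

Lemma phi_term_le_exp_term (x : R) (k : nat) : 0 <= x -> phi_term x k <= x ^ k / INR (fact k).
Proof.
  intros H. unfold phi_term, hweight, Rdiv. apply Rmult_le_compat_l; [now apply pow_le|].
  pose proof (fact_ge_1 k). pose proof (fact_ge_1 (S k)). apply Rinv_le_contravar; nra.
Qed.

Lemma ex_series_phi (x : R) : 0 <= x -> ex_series (phi_term x).
Proof.
  intros H. apply (ex_series_nonneg_le _ (fun k => x ^ k / INR (fact k))); [|apply ex_series_exp].
  intros k. split; [now apply phi_term_pos|now apply phi_term_le_exp_term].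
Qed.

Lemma phi_product (x y : R) : 0 <= x -> 0 <= y ->
  is_series (fun N => phi_hom N (x + y) (x * y)) (phi x * phi y).
Proof.
  intros Hx Hy.
  apply (is_series_ext (fun N => sum_f_R0 (fun i => phi_term x i * phi_term y (N - i)) N)).
  - intros N. apply phi_cauchy.
  - apply is_series_mult_pos; try (apply Series_correct, ex_series_phi; assumption);
      intros; now apply phi_term_pos.
Qed.

Lemma power_convexity (A e : R) (r : nat) : 0 <= A -> 0 <= e ->
  12 * e ^ 2 * A ^ r <= A ^ (S (S r)) - 4 * (A + 3 * e) ^ (S (S r)) + 3 * (A + 4 * e) ^ (S (S r)).
Proof.
  intros HA He. induction r.
  - simpl. right. ring.
  - set (F := fun k => A ^ k - 4 * (A + 3 * e) ^ k + 3 * (A + 4 * e) ^ k).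
    assert (E : F (S (S (S r))) = A * F (S (S r)) + 12 * e * ((A + 4 * e) ^ (S (S r)) - (A + 3 * e) ^ (S (S r))))
      by (unfold F; simpl; ring).
    fold (F (S (S (S r)))). rewrite E. fold (F (S (S r))) in IHr.
    assert ((A + 3 * e) ^ (S (S r)) <= (A + 4 * e) ^ (S (S r))) by (apply pow_incr; lra).
    replace (12 * e ^ 2 * A ^ S r) with (A * (12 * e ^ 2 * A ^ r)) by (simpl; ring).
    assert (A * (12 * e ^ 2 * A ^ r) <= A * F (S (S r))) by (apply Rmult_le_compat_l; assumption).
    assert (0 <= 12 * e * ((A + 4 * e) ^ S (S r) - (A + 3 * e) ^ S (S r))) by (apply Rmult_le_pos; lra).
    lra.
Qed.

(** The exponents 0 and 1, which the weights [1, -4, 3] annihilate and which therefore have to be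
    given up in the lower bound. *)
Definition low_part (A : R) (r : nat) : R :=
  match r with O => 1 | S O => A | _ => 0 end.

(** [A^2 <= z^4] restores the exponent [r] lost in [power_convexity], so that the bound can be
    summed to a multiple of a product of values of [phi]. *)
Lemma bracket_lower (z h : R) (r : nat) : 0 < z -> 0 <= h -> 2 * h <= z ->
  12 * h ^ 4 / z ^ 4 * ((z ^ 2 - 4 * h ^ 2) ^ r - low_part (z ^ 2 - 4 * h ^ 2) r)
   <= (z ^ 2 - 4 * h ^ 2) ^ r - 4 * (z ^ 2 - h ^ 2) ^ r + 3 * (z ^ 2) ^ r.
Proof.
  intros Hz Hh H. set (A := z ^ 2 - 4 * h ^ 2).
  assert (HA : 0 <= A) by (unfold A; nra).
  destruct r as [|[|r]].
  - simpl. lra.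
  - simpl low_part. rewrite !pow_1. unfold A. replace (z ^ 2 - 4 * h ^ 2 - (z ^ 2 - 4 * h ^ 2)) with 0 by ring. lra.
  - pose proof (power_convexity A (h ^ 2) r HA ltac:(nra)) as P.
    replace (A + 3 * h ^ 2) with (z ^ 2 - h ^ 2) in P by (unfold A; ring).
    replace (A + 4 * h ^ 2) with (z ^ 2) in P by (unfold A; ring).
    eapply Rle_trans; [|exact P]. simpl low_part. rewrite Rminus_0_r.
    assert (HA2 : A ^ 2 <= z ^ 4).
    { replace (z ^ 4) with ((z ^ 2) ^ 2) by ring. apply pow_incr. unfold A in *. nra. }
    assert (0 <= A ^ r) by now apply pow_le.
    assert (Hz4 : 0 < z ^ 4) by now apply pow_lt.
    replace (12 * h ^ 4 / z ^ 4 * A ^ S (S r)) with (12 * h ^ 4 * A ^ r * (A ^ 2 / z ^ 4)) by (simpl; field; lra).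
    replace (12 * (h ^ 2) ^ 2 * A ^ r) with (12 * h ^ 4 * A ^ r * 1) by ring.
    apply Rmult_le_compat_l.
    + apply Rmult_le_pos; [|assumption]. apply Rmult_le_pos; [lra|apply pow_le; lra].
    + apply Rmult_le_reg_r with (z ^ 4); [assumption|]. unfold Rdiv. rewrite Rmult_assoc, Rinv_l by lra. lra.
Qed.

Lemma inv_fact_diff_pos (a b : nat) : 0 <= inv_fact_diff a b.
Proof.
  unfold inv_fact_diff. destruct (b <=? a)%nat; [left; apply Rinv_0_lt_compat, INR_fact_lt_0|lra].
Qed.

Lemma low_sum (c : nat -> R) (A : R) (N : nat) : (forall r, 0 <= c r) -> 0 <= A ->
  rsn (fun r => c r * low_part A r) (S N) <= c O + c 1%nat * A.
Proof.
  intros Hc HA. destruct N.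
  - simpl. pose proof (Hc O). pose proof (Hc 1%nat). nra.
  - rewrite !rsn_S_first, rsn_zero by (intros; simpl; ring). simpl. lra.
Qed.

(** Majorizes the degree-[N] share of the terms with exponent 0 and 1; the shift of [N] by 2 makes
    the sum over [N] a multiple of [phi (2 * z)]. *)
Definition phi_low (z : R) (N : nat) : R :=
  phi_term (2 * z) N + (match N with S (S M) => z ^ 2 * phi_term (2 * z) M | _ => 0 end).

Lemma phi_low_bound (z A : R) (N : nat) : 0 < z -> 0 <= A <= z ^ 2 ->
  / INR (fact (N + 1)) * (hweight 0 * inv_fact_diff N 0 * (2 * z) ^ N
     + hweight 1 * inv_fact_diff N 2 * (2 * z) ^ (N - 2) * A) <= phi_low z N.
Proof.
  intros Hz HA. rewrite Rmult_plus_distr_l. unfold phi_low.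
  apply Rplus_le_compat.
  - right. unfold phi_term, hweight, inv_fact_diff. cbn [Nat.leb]. rewrite Nat.sub_0_r, Nat.add_1_r.
    simpl (fact 0). simpl (fact 1). simpl (INR 1).
    pose proof (INR_fact_neq_0 N). pose proof (INR_fact_neq_0 (S N)). field. auto.
  - destruct N as [|[|M]].
    + unfold inv_fact_diff. simpl Nat.leb. cbv iota. right. ring.
    + unfold inv_fact_diff. simpl Nat.leb. cbv iota. right. ring.
    + unfold inv_fact_diff, phi_term. cbn [Nat.leb]. replace (S (S M) - 2)%nat with M by lia.
      assert (0 <= (2 * z) ^ M) by (apply pow_le; lra).
      assert (W : hweight 1 = / 2) by (unfold hweight; simpl; field).
      rewrite W. pose proof (INR_fact_lt_0 M) as F1. pose proof (INR_fact_lt_0 (S M)) as F2.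
      assert (F3 : INR (fact (S M)) <= INR (fact (S (S M) + 1))).
      { replace (S (S M) + 1)%nat with (S M + 2)%nat by lia. apply le_INR, fact_le. lia. }
      unfold hweight.
      replace (/ INR (fact (S (S M) + 1)) * (/ 2 * / INR (fact M) * (2 * z) ^ M * A))
       with ((2 * z) ^ M * / INR (fact M) * (/ 2 * A * / INR (fact (S (S M) + 1)))) by ring.
      replace (z ^ 2 * ((2 * z) ^ M * / (INR (fact M) * INR (fact (S M)))))
       with ((2 * z) ^ M * / INR (fact M) * (z ^ 2 * / INR (fact (S M)))) by (field; lra).
      assert (0 < / INR (fact M)) by now apply Rinv_0_lt_compat.
      apply Rmult_le_compat_l; [apply Rmult_le_pos; lra|].
      apply Rmult_le_compat; [lra|left; apply Rinv_0_lt_compat; lra|lra|apply Rinv_le_contravar; lra].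
Qed.

Lemma phi_low_series (z : R) : 0 < z ->
  ex_series (phi_low z) /\ Series (phi_low z) = (1 + z ^ 2) * phi (2 * z).
Proof.
  intros Hz. pose proof (ex_series_phi (2 * z) ltac:(lra)) as S.
  set (g := fun N : nat => match N with S (S M) => z ^ 2 * phi_term (2 * z) M | _ => 0 end).
  assert (Sg0 : ex_series (fun M => g (2 + M)%nat)) by apply (ex_series_scal_l (V := R_NormedModule) (z ^ 2)), S.
  assert (Sg : ex_series g) by now apply (ex_series_incr_n (V := R_NormedModule) g 2).
  split; [now apply (ex_series_plus (V := R_NormedModule))|].
  change (Series (fun N => phi_term (2 * z) N + g N) = (1 + z ^ 2) * phi (2 * z)).
  rewrite (Series_plus (phi_term (2 * z)) g S Sg).
  rewrite (Series_incr_n_aux g 2).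
  - simpl. rewrite Series_scal_l. unfold phi. ring.
  - intros [|[|k]] Hk; [reflexivity|reflexivity|lia].
Qed.

Lemma Series_nonneg (a : nat -> R) : (forall n, 0 <= a n) -> ex_series a -> 0 <= Series a.
Proof.
  intros H S. eapply Rle_trans; [|apply (Series_partial_le a 0 H S)]. apply H.
Qed.

(** The three products have the same sum of arguments [2 z] and differ only in the product of
    arguments, so [bracket_lower] applies to every coefficient of [phi_hom]. The loss
    [(1 + z^2) phi (2 * z)] grows like [exp(2 sqrt(2 z))], against [exp(4 sqrt z)] for the
    products. *)
Lemma phi_laguerre (z h : R) : 0 < z -> 0 <= h -> 2 * h <= z ->
  12 * h ^ 4 / z ^ 4 * (phi (z + 2 * h) * phi (z - 2 * h) - (1 + z ^ 2) * phi (2 * z))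
   <= phi (z + 2 * h) * phi (z - 2 * h) - 4 * (phi (z + h) * phi (z - h)) + 3 * (phi z * phi z).
Proof.
  intros Hz Hh H. set (A := z ^ 2 - 4 * h ^ 2). set (K := 12 * h ^ 4 / z ^ 4).
  assert (HA : 0 <= A <= z ^ 2) by (unfold A; nra).
  assert (HK : 0 <= K).
  { unfold K. apply Rmult_le_pos; [apply Rmult_le_pos; [lra|apply pow_le; lra]|].
    left; apply Rinv_0_lt_compat, pow_lt, Hz. }
  pose proof (phi_product (z + 2 * h) (z - 2 * h) ltac:(lra) ltac:(lra)) as P2.
  pose proof (phi_product (z + h) (z - h) ltac:(lra) ltac:(lra)) as P1.
  pose proof (phi_product z z ltac:(lra) ltac:(lra)) as P0.
  set (H2 := fun N => phi_hom N (z + 2 * h + (z - 2 * h)) ((z + 2 * h) * (z - 2 * h))) in *.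
  set (H1 := fun N => phi_hom N (z + h + (z - h)) ((z + h) * (z - h))) in *.
  set (H0 := fun N => phi_hom N (z + z) (z * z)) in *.
  destruct (phi_low_series z Hz) as [SL EL].
  assert (T : forall N, K * (H2 N - phi_low z N) <= H2 N - 4 * H1 N + 3 * H0 N).
  { intros N.
    set (c := fun r => hweight r * inv_fact_diff N (2 * r) * (2 * z) ^ (N - 2 * r)).
    assert (Hc : forall r, 0 <= c r).
    { intros r. unfold c. pose proof (hweight_pos r). pose proof (inv_fact_diff_pos N (2 * r)).
      apply Rmult_le_pos; [nra|apply pow_le; lra]. }
    set (u := / INR (fact (N + 1))).
    assert (Hu : 0 < u) by apply Rinv_0_lt_compat, INR_fact_lt_0.
    assert (E2 : H2 N = u * rsn (fun r => c r * A ^ r) (S N)).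
    { unfold H2, phi_hom, c. fold u. f_equal. apply rsn_ext. intros r _.
      replace (z + 2 * h + (z - 2 * h)) with (2 * z) by ring.
      replace ((z + 2 * h) * (z - 2 * h)) with A by (unfold A; ring). ring. }
    assert (E1 : H1 N = u * rsn (fun r => c r * (z ^ 2 - h ^ 2) ^ r) (S N)).
    { unfold H1, phi_hom, c. fold u. f_equal. apply rsn_ext. intros r _.
      replace (z + h + (z - h)) with (2 * z) by ring.
      replace ((z + h) * (z - h)) with (z ^ 2 - h ^ 2) by ring. ring. }
    assert (E0 : H0 N = u * rsn (fun r => c r * (z ^ 2) ^ r) (S N)).
    { unfold H0, phi_hom, c. fold u. f_equal. apply rsn_ext. intros r _.
      replace (z + z) with (2 * z) by ring. replace (z * z) with (z ^ 2) by ring. ring. }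
    assert (L : u * rsn (fun r => c r * low_part A r) (S N) <= phi_low z N).
    { eapply Rle_trans; [|apply (phi_low_bound z A N Hz HA)]. fold u.
      apply Rmult_le_compat_l; [lra|]. eapply Rle_trans; [apply low_sum; [exact Hc|lra]|].
      unfold c. replace (N - 2 * 0)%nat with N by lia. simpl (2 * 1)%nat. simpl (2 * 0)%nat. lra. }
    rewrite E2, E1, E0.
    apply Rle_trans with (K * (u * rsn (fun r => c r * A ^ r) (S N) - u * rsn (fun r => c r * low_part A r) (S N))).
    { apply Rmult_le_compat_l; lra. }
    replace (K * (u * rsn (fun r => c r * A ^ r) (S N) - u * rsn (fun r => c r * low_part A r) (S N)))
      with (u * rsn (fun r => K * (c r * A ^ r) + - K * (c r * low_part A r)) (S N))
      by (rewrite rsn_plus, !rsn_scal; ring).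
    replace (u * rsn (fun r => c r * A ^ r) (S N) - 4 * (u * rsn (fun r => c r * (z ^ 2 - h ^ 2) ^ r) (S N))
        + 3 * (u * rsn (fun r => c r * (z ^ 2) ^ r) (S N)))
      with (u * rsn (fun r => c r * A ^ r + - 4 * (c r * (z ^ 2 - h ^ 2) ^ r) + 3 * (c r * (z ^ 2) ^ r)) (S N))
      by (rewrite !rsn_plus, !rsn_scal; ring).
    apply Rmult_le_compat_l; [lra|]. apply rsn_le. intros r _.
    pose proof (bracket_lower z h r Hz Hh H) as B. fold A K in B. specialize (Hc r). nra. }
  assert (S2 : ex_series H2) by (eexists; exact P2).
  assert (S1 : ex_series H1) by (eexists; exact P1).
  assert (S0 : ex_series H0) by (eexists; exact P0).
  rewrite <- EL, <- (is_series_unique _ _ P2), <- (is_series_unique _ _ P1), <- (is_series_unique _ _ P0).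
  assert (S4 : ex_series (fun N => 4 * H1 N)) by now apply (ex_series_scal_l (V := R_NormedModule) 4).
  assert (S3 : ex_series (fun N => 3 * H0 N)) by now apply (ex_series_scal_l (V := R_NormedModule) 3).
  assert (S24 : ex_series (fun N => H2 N - 4 * H1 N)) by now apply (ex_series_minus (V := R_NormedModule)).
  assert (SD : ex_series (fun N => H2 N - phi_low z N)) by now apply (ex_series_minus (V := R_NormedModule)).
  rewrite <- Series_minus, <- !Series_scal_l, <- Series_minus, <- Series_plus by assumption.
  apply Rminus_le_0. rewrite <- Series_minus.
  - apply Series_nonneg.
    + intros N. specialize (T N). lra.
    + apply (ex_series_minus (V := R_NormedModule)); [now apply (ex_series_plus (V := R_NormedModule))|].
      now apply (ex_series_scal_l (V := R_NormedModule) K).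
  - now apply (ex_series_plus (V := R_NormedModule)).
  - now apply (ex_series_scal_l (V := R_NormedModule) K).
Qed.

(** * Growth of the Bessel-type function *)

(** With [x = sqrt w] a term is at most [(x^k/k!)^2]; one factor is bounded by [exp x], the other is
    summed to [exp x]. *)
Lemma phi_upper (w : R) : 0 <= w -> phi w <= exp (2 * sqrt w).
Proof.
  intros Hw. pose proof (sqrt_pos w) as Hs.
  replace (2 * sqrt w) with (sqrt w + sqrt w) by ring. rewrite exp_plus.
  rewrite <- (Series_exp (sqrt w)) at 1. rewrite <- Series_scal_r.
  apply Series_le; [|apply (ex_series_scal_r (exp (sqrt w))), ex_series_exp].
  intros k. split; [now apply phi_term_pos|].
  pose proof (INR_fact_lt_0 k) as F.
  apply Rle_trans with (sqrt w ^ k / INR (fact k) * (sqrt w ^ k / INR (fact k))).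
  - unfold phi_term, hweight. rewrite <- (sqrt_sqrt w Hw) at 1. rewrite Rpow_mult_distr.
    replace (sqrt w ^ k / INR (fact k) * (sqrt w ^ k / INR (fact k)))
      with (sqrt w ^ k * sqrt w ^ k * / (INR (fact k) * INR (fact k))) by (field; lra).
    assert (0 <= sqrt w ^ k) by now apply pow_le.
    apply Rmult_le_compat_l; [nra|]. apply Rinv_le_contravar; [nra|].
    apply Rmult_le_compat_l; [lra|]. apply le_INR, fact_le. lia.
  - apply Rmult_le_compat_l; [|now apply pow_div_fact_le_exp].
    apply Rmult_le_pos; [now apply pow_le|left; now apply Rinv_0_lt_compat].
Qed.

Lemma cosh_series (u : R) :
  ex_series (fun k => u ^ (2 * k) / INR (fact (2 * k))) /\
  2 * Series (fun k => u ^ (2 * k) / INR (fact (2 * k))) = exp u + exp (- u).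
Proof.
  set (ev := fun k => exp_term (RtoC u) (2 * k)). set (od := fun k => exp_term (RtoC u) (2 * k + 1)).
  pose proof (csm_exp_term (RtoC u)) as S. pose proof (csm_exp_term (RtoC (- u))) as S'.
  assert (Ee : forall k, Cmod (ev k) = Rabs u ^ (2 * k) / INR (fact (2 * k))).
  { intros k. unfold ev. now rewrite Cmod_exp_term, Cmod_R. }
  assert (Sub : forall (phi : nat -> nat), (forall n, (phi n < phi (Datatypes.S n))%nat) ->
    csm (fun k => exp_term (RtoC u) (phi k))).
  { intros f Hf. assert (Hm : forall n, (n <= f n)%nat) by (induction n; [lia|specialize (Hf n); lia]).
    apply (csm_le _ (fun k => exp (2 * Rabs u) * (/ 2) ^ k)).
    - intros k. rewrite Cmod_exp_term, Cmod_R.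
      pose proof (pow_div_fact_le_exp (2 * Rabs u) (f k) ltac:(pose proof (Rabs_pos u); lra)) as B.
      rewrite Rpow_mult_distr in B. pose proof (INR_fact_lt_0 (f k)).
      assert (P2 : 0 < 2 ^ f k) by (apply pow_lt; lra).
      replace (Rabs u ^ f k / INR (fact (f k))) with ((2 ^ f k * Rabs u ^ f k / INR (fact (f k))) * / 2 ^ f k) by (field; lra).
      apply Rmult_le_compat.
      + apply Rmult_le_pos; [apply Rmult_le_pos; [lra|apply pow_le, Rabs_pos]|left; now apply Rinv_0_lt_compat].
      + left. now apply Rinv_0_lt_compat.
      + exact B.
      + rewrite pow_inv. apply Rinv_le_contravar; [apply pow_lt; lra|]. apply Rle_pow; [lra|apply Hm].
    - apply (ex_series_scal_l (V := R_NormedModule) (exp (2 * Rabs u))), ex_series_geom. rewrite Rabs_pos_eq; lra. }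
  assert (Se : csm ev) by (apply (Sub (fun k => (2 * k)%nat)); intros; lia).
  assert (So : csm od) by (apply (Sub (fun k => (2 * k + 1)%nat)); intros; lia).
  assert (Ne : forall k, exp_term (RtoC (- u)) (2 * k) = ev k).
  { intros k. unfold ev, exp_term. rewrite !Cpow_mult_r, RtoC_opp. do 2 f_equal. ring. }
  assert (No : forall k, exp_term (RtoC (- u)) (2 * k + 1) = (- od k)%C).
  { intros k. unfold od, exp_term. rewrite !Cpow_add_r, !Cpow_mult_r, RtoC_opp.
    replace ((- u) ^ 2)%C with (u ^ 2)%C by ring. unfold Cdiv. ring. }
  pose proof (csum_exp_term (RtoC u)) as E1. pose proof (csum_exp_term (RtoC (- u))) as E2.
  rewrite csum_even_odd in E1 by assumption.
  rewrite csum_even_odd in E2.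
  2: exact S'.
  2:{ eapply csm_ext; [intros k; symmetry; apply Ne|exact Se]. }
  2:{ eapply csm_ext; [intros k; symmetry; apply No|now apply csm_opp]. }
  rewrite (csum_ext _ _ Ne), (csum_ext _ _ No), csum_opp in E2 by exact So.
  assert (E3 : (2 * csum ev)%C = RtoC (exp u + exp (- u))).
  { rewrite RtoC_plus, <- !Cexp_RtoC, <- E1, <- E2. fold ev od. ring. }
  assert (X : forall k, ev k = RtoC (u ^ (2 * k) / INR (fact (2 * k)))).
  { intros k. unfold ev, exp_term. rewrite RtoC_div, RtoC_pow by apply INR_fact_neq_0. reflexivity. }
  split.
  - apply (ex_series_ext (fun k => Cmod (ev k))); [|exact Se].
    intros k. rewrite X, Cmod_R, Rabs_pos_eq; [reflexivity|].
    apply Rmult_le_pos; [rewrite pow_mult; apply pow_le, pow2_ge_0|left; apply Rinv_0_lt_compat, INR_fact_lt_0].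
  - apply RtoC_inj. rewrite <- E3, (csum_ext _ _ X), csum_RtoC, RtoC_mult. reflexivity.
Qed.

(** Compares the weights of [phi] with the coefficients of cosh, for use in [phi_lower]. *)
Lemma central_fact_bound (k : nat) :
  2 * (4 ^ k * (INR (fact k) * INR (fact (S k)))) <= INR (fact (2 * S k)).
Proof.
  induction k; [simpl; lra|].
  replace (2 * S (S k))%nat with (S (S (2 * S k))) by lia.
  rewrite (fact_simpl (S (2 * S k))), (fact_simpl (2 * S k)), (fact_simpl (S k)), !mult_INR.
  rewrite (fact_simpl k) at 1. rewrite mult_INR. change (4 ^ S k) with (4 * 4 ^ k).
  rewrite !S_INR. replace (INR (2 * S k)) with (2 * (INR k + 1)) by (rewrite INR_double, S_INR; ring).
  pose proof (pos_INR k) as Pk.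
  set (Y := INR (fact (2 * S k))) in *. set (A := 4 ^ k) in *. set (B := INR (fact k)) in *.
  rewrite fact_simpl, mult_INR, S_INR in *. fold B in IHk |- *.
  assert (0 < A) by (apply pow_lt; lra). assert (0 < B) by apply INR_fact_lt_0.
  set (W := A * (B * ((INR k + 1) * B))) in *.
  assert (0 <= W) by (unfold W; repeat (apply Rmult_le_pos; try lra)).
  apply Rle_trans with ((4 * (INR k + 1) * (INR k + 1 + 1)) * (2 * W)).
  - right. unfold W. ring.
  - apply Rle_trans with (((2 * (INR k + 1) + 1 + 1) * (2 * (INR k + 1) + 1)) * Y); [|right; ring].
    apply Rmult_le_compat; nra.
Qed.

(** With [u = 2 sqrt z], termwise [phi z >= (2/u^2)(cosh u - 1)], and [cosh u - 1 >= exp u / 4] once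
    [exp u >= 4]. *)
Lemma phi_lower (z : R) : 0 < z -> 4 <= exp (2 * sqrt z) ->
  exp (2 * sqrt z) / (2 * (2 * sqrt z) ^ 2) <= phi z.
Proof.
  intros Hz Hu. set (u := 2 * sqrt z) in *.
  assert (Hs : 0 < sqrt z) by now apply sqrt_lt_R0.
  assert (Hu0 : u <> 0) by (unfold u; lra).
  assert (Hu2 : u ^ 2 = 4 * z).
  { unfold u. replace ((2 * sqrt z) ^ 2) with (4 * (sqrt z * sqrt z)) by ring. rewrite sqrt_sqrt; lra. }
  destruct (cosh_series u) as [S E].
  rewrite Series_incr_1 in E by exact S. 
  apply (ex_series_incr_1 (V := R_NormedModule)) in S.
  change (u ^ (2 * 0) / INR (fact (2 * 0))) with (1 / 1) in E.
  pose proof (exp_pos (- u)).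
  set (T := Series _) in E.
  assert (B : 2 / u ^ 2 * T <= phi z).
  { unfold T. rewrite <- Series_scal_l. apply Series_le; [|apply ex_series_phi; lra].
    intros k. pose proof (INR_fact_lt_0 (2 * Datatypes.S k)) as F. pose proof (INR_fact_lt_0 k) as F1.
    pose proof (INR_fact_lt_0 (Datatypes.S k)) as F2.
    assert (Hk : u ^ (2 * Datatypes.S k) = u ^ 2 * (4 ^ k * z ^ k)).
    { rewrite pow_mult, Hu2. simpl pow. rewrite Rpow_mult_distr. ring. }
    rewrite Hk. assert (0 < u ^ 2) by lra.
    replace (2 / u ^ 2 * (u ^ 2 * (4 ^ k * z ^ k) / INR (fact (2 * Datatypes.S k))))
      with (z ^ k * (2 * 4 ^ k * / INR (fact (2 * Datatypes.S k)))) by (field; split; [apply INR_fact_neq_0|exact Hu0]).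
    assert (0 < z ^ k) by now apply pow_lt. assert (0 < 4 ^ k) by (apply pow_lt; lra).
    assert (0 < / INR (fact (2 * Datatypes.S k))) by now apply Rinv_0_lt_compat.
    split; [apply Rmult_le_pos; [lra|apply Rmult_le_pos; lra]|].
    unfold phi_term, hweight. apply Rmult_le_compat_l; [lra|].
    pose proof (central_fact_bound k) as C.
    apply Rmult_le_reg_r with (INR (fact (2 * Datatypes.S k))); [assumption|].
    rewrite Rmult_assoc, Rinv_l, Rmult_1_r by lra.
    apply Rmult_le_reg_l with (INR (fact k) * INR (fact (Datatypes.S k))); [nra|].
    match goal with |- _ <= ?x * (/ ?x * ?y) => replace (x * (/ x * y)) with y by (field; lra) end. lra. }
  eapply Rle_trans; [|exact B].
  assert (HT : exp u / 4 <= T) by lra.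
  replace (exp u / (2 * u ^ 2)) with (2 / u ^ 2 * (exp u / 4)) by (field; nra).
  apply Rmult_le_compat_l; [|exact HT]. left. apply Rdiv_lt_0_compat; nra.
Qed.

Lemma phi_mono (x y : R) : 0 <= x <= y -> phi x <= phi y.
Proof.
  intros H. apply Series_le; [|apply ex_series_phi; lra]. intros k.
  split; [apply phi_term_pos; lra|]. unfold phi_term. apply Rmult_le_compat_r; [left; apply hweight_pos|].
  now apply pow_incr.
Qed.

(** The constant [4 pi^2] that separates this from [bess] is counted as error, so that
    [phi_laguerre] applies directly. *)
Definition main_coef (x : R) : R := 4 * PI ^ 2 * phi (4 * PI ^ 2 * x).

Lemma bess_phi (x : R) : 0 <= x -> bess x = main_coef x - 4 * PI ^ 2.
Proof.
  intros Hx. pose proof PI_RGT_0. set (L := 4 * PI ^ 2). assert (HL : 0 < L) by (unfold L; nra).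
  unfold bess, main_coef. fold L. unfold phi.
  rewrite (Series_incr_1 (phi_term (L * x))) by (apply ex_series_phi; nra).
  rewrite (Series_ext (bess_term x) (fun k => L * phi_term (L * x) (S k))).
  - rewrite Series_scal_l. unfold phi_term at 2, hweight. simpl. field.
  - intros k. unfold bess_term, phi_term, hweight. fold L.
    replace (k + 2)%nat with (S (S k)) by lia. replace (k + 1)%nat with (S k) by lia.
    rewrite Rpow_mult_distr. change (L ^ S (S k)) with (L * L ^ S k).
    pose proof (INR_fact_neq_0 (S k)). pose proof (INR_fact_neq_0 (S (S k))). field. auto.
Qed.

(** * Large indices *)

(** The linear terms cost [(2 + 8 + 6) E f4]; of the quadratic ones [3 d2^2] is nonnegative and the
    others cost at most [5 E^2]. *)
Lemma laguerre_perturb (f0 f1 f2 f3 f4 c0 c1 c2 c3 c4 E : R) :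
  0 <= f0 <= f4 -> 0 <= f1 <= f4 -> 0 <= f2 <= f4 -> 0 <= f3 <= f4 ->
  Rabs (c0 - f0) <= E -> Rabs (c1 - f1) <= E -> Rabs (c2 - f2) <= E ->
  Rabs (c3 - f3) <= E -> Rabs (c4 - f4) <= E ->
  16 * E * f4 + 8 * E ^ 2 <= f4 * f0 - 4 * (f3 * f1) + 3 * (f2 * f2) ->
  0 <= c0 * c4 - 4 * (c1 * c3) + 3 * (c2 * c2).
Proof.
  intros H0 H1 H2 H3 B0 B1 B2 B3 B4 H.
  set (d0 := c0 - f0) in *. set (d1 := c1 - f1) in *. set (d2 := c2 - f2) in *.
  set (d3 := c3 - f3) in *. set (d4 := c4 - f4) in *.
  replace c0 with (f0 + d0) by (unfold d0; ring). replace c1 with (f1 + d1) by (unfold d1; ring).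
  replace c2 with (f2 + d2) by (unfold d2; ring). replace c3 with (f3 + d3) by (unfold d3; ring).
  replace c4 with (f4 + d4) by (unfold d4; ring).
  assert (HE : 0 <= E) by (pose proof (Rabs_pos d0); lra).
  assert (L : forall f d, 0 <= f <= f4 -> Rabs d <= E -> - (E * f4) <= f * d <= E * f4).
  { intros f d Hf Hd. apply Rabs_le_between in Hd. nra. }
  assert (Q : forall a b, Rabs a <= E -> Rabs b <= E -> - E ^ 2 <= a * b <= E ^ 2).
  { intros a b Ha Hb. apply Rabs_le_between. rewrite Rabs_mult. simpl. rewrite Rmult_1_r.
    apply Rmult_le_compat; auto using Rabs_pos. }
  pose proof (L f0 d4 H0 B4). pose proof (L f4 d0 ltac:(lra) B0).
  pose proof (L f1 d3 H1 B3). pose proof (L f3 d1 H3 B1). pose proof (L f2 d2 H2 B2).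
  pose proof (Q d0 d4 B0 B4). pose proof (Q d1 d3 B1 B3). 
  pose proof (pow2_ge_0 d2). nra.
Qed.

(** [53248 = 2 * 26 * 1024] is the factor needed in [main_laguerre]; it lies below [4^8], which the
    eighth power of [4 X <= exp(X/4)] provides. *)
Lemma exp_poly_8 (X : R) : 30 <= X -> 53248 * X ^ 8 <= exp (2 * X).
Proof.
  intros HX.
  assert (B : 4 * X <= exp (X / 4)).
  { pose proof (pow_div_fact_le_exp (X / 4) 4 ltac:(lra)) as P.
    replace (INR (fact 4)) with 24 in P by (simpl; ring).
    eapply Rle_trans; [|exact P].
    replace ((X / 4) ^ 4 / 24) with (X * X ^ 3 / 6144) by field.
    assert (30 ^ 3 <= X ^ 3) by (apply pow_incr; lra). nra. }
  replace (2 * X) with (X / 4 * INR 8) by (simpl; field). rewrite <- exp_pow.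
  apply Rle_trans with ((4 * X) ^ 8); [|apply pow_incr; lra].
  rewrite Rpow_mult_distr. apply Rmult_le_compat_r; [apply pow_le; lra|lra].
Qed.

(** The tenth power of [2.2 X <= exp(3 X / 20)]. The exponent is the gap between [exp(4 X)] and the
    error [exp(5 X / 2)] in [err_small]. *)
Lemma exp_poly_10 (X : R) : 30 <= X -> 2600 * X ^ 10 <= exp (3 / 2 * X).
Proof.
  intros HX.
  assert (B0 : 78 <= exp (9 / 2)).
  { replace (9 / 2) with (/ 16 * INR 72) by (simpl; field). rewrite <- exp_pow.
    apply Rle_trans with ((1 + / 16) ^ 72); [lra|]. apply pow_incr. split; [lra|apply exp_ineq1_le]. }
  assert (B : 22 / 10 * X <= exp (3 / 20 * X)).
  { replace (3 / 20 * X) with (9 / 2 + 3 / 20 * (X - 30)) by field. rewrite exp_plus.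
    pose proof (exp_ineq1_le (3 / 20 * (X - 30))). nra. }
  replace (3 / 2 * X) with (3 / 20 * X * INR 10) by (simpl; field). rewrite <- exp_pow.
  apply Rle_trans with ((22 / 10 * X) ^ 10); [|apply pow_incr; lra].
  rewrite Rpow_mult_distr. apply Rmult_le_compat_r; [apply pow_le; lra|lra].
Qed.

Lemma exp_15_ge : 930000 <= exp 15.
Proof.
  replace 15 with (/ 8 * INR 120) by (simpl; field). rewrite <- exp_pow.
  apply Rle_trans with ((1 + / 8) ^ 120); [lra|]. apply pow_incr. split; [lra|apply exp_ineq1_le].
Qed.

Lemma exp_nat_le (n : nat) (x : R) : x <= INR n -> exp x <= 3 ^ n.
Proof.
  intros H. apply Rle_trans with (exp (1 * INR n)); [apply exp_le; lra|]. rewrite <- exp_pow.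
  apply pow_incr. split; [left; apply exp_pos|apply exp_le_3].
Qed.

Section Large.
Variables (c : nat -> Z) (n : nat).
Hypothesis hc : j_fourier_coefficients c.
Hypothesis Hn : (100 <= n)%nat.

Let s := sqrt (INR n).
Let X := PI * s.
Let L := 4 * PI ^ 2.
(** The product [40000 * 81] of [dev_bound_large] and the shift of [n] by at most 4, with room for
    the constant [4 pi^2 <= 64]. *)
Let err := 3300000 * exp (5 / 2 * X).

Lemma s_ge : 10 <= s.
Proof.
  unfold s. replace 10 with (sqrt (10 * 10)) by (apply sqrt_square; lra).
  apply sqrt_le_1; [lra|apply pos_INR|]. apply le_INR in Hn. replace (INR 100) with 100 in Hn by (simpl; ring). lra.
Qed.

Lemma s_sq : s * s = INR n.
Proof. apply sqrt_sqrt, pos_INR. Qed.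

Lemma X_ge : 30 <= X.
Proof. unfold X. pose proof PI_gt_3. pose proof s_ge. nra. Qed.

Lemma dev_bound_large : dev_bound (/ s) <= 40000 * exp (X / 2).
Proof.
  pose proof PI_gt_3 as P3. pose proof PI_4 as P4. pose proof s_ge as Hs. pose proof X_ge as HX.
  unfold dev_bound.
  assert (Hsi : 0 < / s <= / 10) by (split; [apply Rinv_0_lt_compat; lra|apply Rinv_le_contravar; lra]).
  replace (2 * PI * (/ (4 * / s) + / s)) with (X / 2 + 2 * PI * / s) by (unfold X; field; lra).
  replace (2 * PI / / s) with (2 * X) by (unfold X; field; lra).
  assert (E1 : exp (2 * PI * / s) <= 3 ^ 1) by (apply exp_nat_le; simpl; nra).
  rewrite exp_plus.
  (* As [X >= 30], about 40000 times [exp 15] absorbs [far_const] and the other constants; this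
     fixes the factor 40000. *)
  assert (E2 : 930000 * (1 + (X / 2 - 15)) <= exp (X / 2)).
  { replace (X / 2) with (15 + (X / 2 - 15)) at 2 by ring. rewrite exp_plus.
    pose proof exp_15_ge. pose proof (exp_ineq1_le (X / 2 - 15)). apply Rmult_le_compat; lra. }
  pose proof (exp_pos (X / 2)).
  assert (exp (X / 2) * exp (2 * PI * / s) <= exp (X / 2) * 3) by (apply Rmult_le_compat_l; lra).
  unfold G0, far_const. lra.
Qed.

Lemma coef_error (k : nat) : (k <= 4)%nat ->
  Rabs (IZR (c (n + k)) - main_coef (INR (n + k))) <= err.
Proof.
  intros Hk. pose proof PI_gt_3 as P3. pose proof PI_4 as P4. pose proof s_ge as Hs. pose proof X_ge as HX.
  pose proof s_sq as Hss. pose proof dev_bound_large as HD.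
  assert (Hsi : 0 < / s <= / 10) by (split; [apply Rinv_0_lt_compat; lra|apply Rinv_le_contravar; lra]).
  pose proof (coefficient_dev c (/ s) (n + k) hc ltac:(lra)) as B.
  destruct (n + k)%nat as [|m] eqn:Em; [lia|]. unfold dev in B. rewrite <- Em in *.
  rewrite bess_phi in B by apply pos_INR. fold L in B.
  assert (HE : exp (2 * PI * / s * INR (n + k)) <= 81 * exp (2 * X)).
  { rewrite plus_INR, <- Hss. replace (2 * PI * / s * (s * s + INR k)) with (2 * X + 2 * PI * / s * INR k) by (unfold X; field; lra).
    rewrite exp_plus, Rmult_comm. apply Rmult_le_compat_r; [left; apply exp_pos|].
    replace 81 with (3 ^ 4) by ring. apply exp_nat_le. apply le_INR in Hk.
    replace (INR 4) with 4 in * by (simpl; ring). pose proof (pos_INR k).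
    assert (2 * PI * / s <= 1) by nra. nra. }
  assert (HB : dev_bound (/ s) * exp (2 * PI * / s * INR (n + k)) <= 3240000 * exp (5 / 2 * X)).
  { replace (3240000 * exp (5 / 2 * X)) with ((40000 * exp (X / 2)) * (81 * exp (2 * X))).
    - apply Rmult_le_compat; try assumption; [|left; apply exp_pos].
      unfold dev_bound, G0, far_const. pose proof (exp_pos (2 * PI * (/ (4 * / s) + / s))).
      pose proof (exp_pos (2 * PI * / s)).
      assert (0 < 2 * PI / / s) by (apply Rdiv_lt_0_compat; lra). lra.
    - replace (5 / 2 * X) with (X / 2 + 2 * X) by field. rewrite exp_plus. ring. }
  assert (HL : L <= 64) by (unfold L; nra).
  assert (HL0 : 0 <= L) by (unfold L; nra).
  assert (H1 : 1 <= exp (5 / 2 * X)) by (pose proof (exp_ineq1_le (5 / 2 * X)); lra).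
  replace (IZR (c (n + k)) - main_coef (INR (n + k)))
    with (IZR (c (n + k)) - (main_coef (INR (n + k)) - L) + - L) by ring.
  eapply Rle_trans; [apply Rabs_triang|]. rewrite Rabs_Ropp, (Rabs_pos_eq L) by exact HL0.
  unfold err. lra.
Qed.

Let F (k : nat) := main_coef (INR (n + k)).

Lemma F_pos_mono (i j : nat) : (i <= j)%nat -> 0 <= F i <= F j.
Proof.
  intros Hij. unfold F, main_coef. pose proof PI_RGT_0. assert (HL : 0 < L) by (unfold L; nra). fold L.
  pose proof (pos_INR (n + i)). assert (INR (n + i) <= INR (n + j)) by (apply le_INR; lia).
  assert (phi (L * INR (n + i)) <= phi (L * INR (n + j))) by (apply phi_mono; nra).
  assert (0 <= phi (L * INR (n + i))).
  { apply Series_nonneg; [intros k; apply phi_term_pos; nra|apply ex_series_phi; nra]. }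
  split; [nra|]. apply Rmult_le_compat_l; lra.
Qed.

(** [phi_lower] at [L n], where [2 sqrt(L n) = 4 X] and [2 (4 X)^2 = 32 X^2]. *)
Lemma F0_lower : L / 32 * exp (4 * X) <= X ^ 2 * F 0.
Proof.
  pose proof PI_gt_3 as P3. pose proof s_ge as Hs. pose proof X_ge as HX.
  assert (HL : 36 <= L) by (unfold L; nra).
  unfold F, main_coef. fold L. rewrite Nat.add_0_r.
  assert (E : 2 * sqrt (L * INR n) = 4 * X).
  { assert (E1 : L * INR n = (2 * X) * (2 * X)) by (rewrite <- s_sq; unfold L, X; ring).
    rewrite E1, sqrt_square by lra. ring. }
  pose proof (phi_lower (L * INR n)) as B. rewrite E in B.
  assert (HB : exp (4 * X) / (2 * (4 * X) ^ 2) <= phi (L * INR n)).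
  { apply B; [|pose proof (exp_ineq1_le (4 * X)); lra]. rewrite <- s_sq. apply Rmult_lt_0_compat; nra. }
  pose proof (exp_pos (4 * X)).
  replace (L / 32 * exp (4 * X)) with (X ^ 2 * (L * (exp (4 * X) / (2 * (4 * X) ^ 2)))) by (field; lra).
  apply Rmult_le_compat_l; [nra|]. apply Rmult_le_compat_l; lra.
Qed.

Let m := INR (n + 2).

Lemma m_bounds : 102 <= m <= 102 / 100 * (s * s).
Proof.
  unfold m. rewrite plus_INR, <- s_sq. replace (INR 2) with 2 by (simpl; ring). pose proof s_ge. nra.
Qed.

(** From [m <= 1.02 s^2] and [X >= 3 s]: [1.02^4 <= 3^8 / 6000]. *)
Lemma m4_bound : m ^ 4 <= X ^ 8 / 6000.
Proof.
  pose proof m_bounds as Hm. pose proof s_ge as Hs. pose proof PI_gt_3 as P3.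
  assert (H1 : m ^ 4 <= (102 / 100 * (s * s)) ^ 4) by (apply pow_incr; lra).
  assert (H2 : (3 * s) ^ 8 <= X ^ 8) by (apply pow_incr; unfold X; nra).
  assert (H3 : 0 <= s ^ 8) by (apply pow_le; lra).
  replace ((102 / 100 * (s * s)) ^ 4) with ((102 / 100) ^ 4 * s ^ 8) in H1 by ring.
  replace ((3 * s) ^ 8) with (6561 * s ^ 8) in H2 by ring. lra.
Qed.

Lemma err_small : 4 * m ^ 4 * err <= F 0.
Proof.
  pose proof X_ge as HX. pose proof m4_bound as Hm. pose proof F0_lower as HF.
  pose proof (exp_poly_10 X HX) as HE.
  assert (He : exp (4 * X) = exp (5 / 2 * X) * exp (3 / 2 * X)) by (rewrite <- exp_plus; f_equal; field).
  pose proof (exp_pos (5 / 2 * X)) as H5. set (e := exp (5 / 2 * X)) in *.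
  assert (HX2 : 0 < X ^ 2) by nra.
  apply Rmult_le_reg_l with (X ^ 2); [exact HX2|].
  assert (HL : 36 <= L) by (unfold L; pose proof PI_gt_3; nra).
  apply Rle_trans with (exp (4 * X)); [|pose proof (exp_pos (4 * X)); nra]. rewrite He. unfold err. fold e.
  apply Rle_trans with (e * (2600 * X ^ 10)); [|apply Rmult_le_compat_l; lra].
  apply Rle_trans with (X ^ 2 * (4 * (X ^ 8 / 6000) * (3300000 * e))).
  - apply Rmult_le_compat_l; [lra|]. apply Rmult_le_compat_r; lra.
  - assert (0 <= X ^ 10) by (apply pow_le; lra).
    replace (X ^ 2 * (4 * (X ^ 8 / 6000) * (3300000 * e))) with (2200 * (e * X ^ 10)) by field.
    assert (0 <= e * X ^ 10) by nra. lra.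
Qed.

(** [phi_laguerre] with [z = L m] and [h = L] gives the factor [12 / m^4]; half of it pays for the
    term with [phi (2 * z)]. *)
Lemma main_laguerre : 6 / m ^ 4 * (F 4 * F 0) <= F 4 * F 0 - 4 * (F 3 * F 1) + 3 * (F 2 * F 2).
Proof.
  pose proof PI_gt_3 as P3. pose proof s_ge as Hs. pose proof X_ge as HX. pose proof m_bounds as Hm.
  pose proof F0_lower as HF. pose proof (F_pos_mono 0 4 ltac:(lia)) as HF4.
  assert (HL : 36 <= L) by (unfold L; nra).
  set (z := L * m).
  assert (Hz : 0 < z) by (unfold z; nra).
  pose proof (phi_laguerre z L Hz ltac:(lra) ltac:(unfold z; nra)) as P.
  assert (EF : forall k x, INR (n + k) = m + x -> F k = L * phi (z + L * x)).
  { intros k x E. unfold F, main_coef. fold L. rewrite E. do 2 f_equal. unfold z. ring. }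
  assert (E0 : F 0 = L * phi (z - 2 * L)).
  { rewrite (EF 0%nat (-2)) by (unfold m; rewrite !plus_INR; simpl; ring). do 2 f_equal. ring. }
  assert (E1 : F 1 = L * phi (z - L)).
  { rewrite (EF 1%nat (-1)) by (unfold m; rewrite !plus_INR; simpl; ring). do 2 f_equal. ring. }
  assert (E2 : F 2 = L * phi z).
  { rewrite (EF 2%nat 0) by (unfold m; rewrite !plus_INR; simpl; ring). do 2 f_equal. ring. }
  assert (E3 : F 3 = L * phi (z + L)).
  { rewrite (EF 3%nat 1) by (unfold m; rewrite !plus_INR; simpl; ring). do 2 f_equal. ring. }
  assert (E4 : F 4 = L * phi (z + 2 * L)).
  { rewrite (EF 4%nat 2) by (unfold m; rewrite !plus_INR; simpl; ring). do 2 f_equal. ring. }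
  assert (HK : 12 * L ^ 4 / z ^ 4 = 12 / m ^ 4) by (unfold z; field; lra).
  rewrite HK in P.
  assert (Hz2 : 1 + z ^ 2 <= 26 * X ^ 4).
  { assert (Z1 : z <= 5 * X ^ 2).
    { unfold z. replace (5 * X ^ 2) with (L * (5 / 4 * (s * s))) by (unfold L, X; field).
      apply Rmult_le_compat_l; nra. }
    assert (z ^ 2 <= (5 * X ^ 2) ^ 2) by (apply pow_incr; lra).
    assert (1 <= X ^ 4) by (rewrite <- (pow1 4); apply pow_incr; lra). nra. }
  (* [2 m <= 2.04 s^2 <= 9/4 s^2], so [sqrt (2 * z) <= 3 X]. *)
  assert (Hp : phi (2 * z) <= exp (6 * X)).
  { eapply Rle_trans; [apply phi_upper; lra|]. apply exp_le.
    assert (sqrt (2 * z) <= 3 * X); [|lra].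
    rewrite <- (sqrt_square (3 * X)) by lra. apply sqrt_le_1; [lra|nra|].
    unfold z. replace (3 * X * (3 * X)) with (L * (9 / 4 * (s * s))) by (unfold L, X; field).
    replace (2 * (L * m)) with (L * (2 * m)) by ring. apply Rmult_le_compat_l; nra. }
  assert (Hp0 : 0 <= phi (2 * z)).
  { apply Series_nonneg; [intros k; apply phi_term_pos; lra|apply ex_series_phi; lra]. }
  (* The loss is at most [26 X^4 exp(6 X)], while [F 0] squared is of order [exp(8 X) / X^4];
     [exp_poly_8] bridges the powers of [X]. *)
  assert (Low : 2 * (L ^ 2 * ((1 + z ^ 2) * phi (2 * z))) <= F 4 * F 0).
  { pose proof (exp_poly_8 X HX) as H8.
    assert (HL64 : L <= 64) by (unfold L; pose proof PI_4; nra).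
    assert (A1 : (1 + z ^ 2) * phi (2 * z) <= 26 * X ^ 4 * exp (6 * X)).
    { apply Rmult_le_compat; try assumption. nra. }
    assert (HF0 : 0 <= F 0) by lra.
    apply Rle_trans with (F 0 * F 0); [|apply Rmult_le_compat_r; lra].
    assert (HX4 : 0 < X ^ 4) by (apply pow_lt; lra).
    pose proof (exp_pos (4 * X)) as e4. pose proof (exp_pos (6 * X)) as e6.
    assert (Sq : (L / 32 * exp (4 * X)) * (L / 32 * exp (4 * X)) <= (X ^ 2 * F 0) * (X ^ 2 * F 0)).
    { apply Rmult_le_compat; try exact HF; apply Rmult_le_pos; lra. }
    assert (E8 : exp (4 * X) * exp (4 * X) = exp (2 * X) * exp (6 * X)) by (rewrite <- !exp_plus; f_equal; ring).
    apply Rmult_le_reg_l with (X ^ 4); [exact HX4|].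
    replace (X ^ 4 * (F 0 * F 0)) with ((X ^ 2 * F 0) * (X ^ 2 * F 0)) by ring.
    eapply Rle_trans; [|exact Sq].
    replace (L / 32 * exp (4 * X) * (L / 32 * exp (4 * X))) with (L ^ 2 / 1024 * (exp (4 * X) * exp (4 * X))) by field.
    rewrite E8.
    assert (HL2 : 0 < L ^ 2) by nra.
    apply Rle_trans with (L ^ 2 / 1024 * (53248 * X ^ 8 * exp (6 * X))).
    - replace (L ^ 2 / 1024 * (53248 * X ^ 8 * exp (6 * X))) with (X ^ 4 * (2 * (L ^ 2 * (26 * X ^ 4 * exp (6 * X))))) by field.
      apply Rmult_le_compat_l; [lra|]. apply Rmult_le_compat_l; [lra|]. apply Rmult_le_compat_l; lra.
    - apply Rmult_le_compat_l; [lra|]. apply Rmult_le_compat_r; lra. }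
  assert (Hm4 : 0 < 12 / m ^ 4) by (apply Rdiv_lt_0_compat; [lra|apply pow_lt; lra]).
  rewrite E0, E1, E2, E3, E4 in *.
  set (a := phi (z + 2 * L)) in *. set (b := phi (z - 2 * L)) in *.
  set (T := (1 + z ^ 2) * phi (2 * z)) in *.
  replace (L * a * (L * b) - 4 * (L * phi (z + L) * (L * phi (z - L))) + 3 * (L * phi z * (L * phi z)))
    with (L ^ 2 * (a * b - 4 * (phi (z + L) * phi (z - L)) + 3 * (phi z * phi z))) by ring.
  apply Rle_trans with (L ^ 2 * (12 / m ^ 4 * (a * b - T))).
  - replace (6 / m ^ 4 * (L * a * (L * b))) with (12 / m ^ 4 * (/ 2 * (L * a * (L * b)))) by (field; lra).
    replace (L ^ 2 * (12 / m ^ 4 * (a * b - T))) with (12 / m ^ 4 * (L * a * (L * b) - L ^ 2 * T)) by ring.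
    apply Rmult_le_compat_l; lra.
  - apply Rmult_le_compat_l; [nra|exact P].
Qed.

Lemma laguerre_large :
  0 <= IZR (c n) * IZR (c (n + 4)) - 4 * (IZR (c (n + 1)) * IZR (c (n + 3))) + 3 * (IZR (c (n + 2)) * IZR (c (n + 2))).
Proof.
  pose proof m_bounds as Hm. pose proof err_small as HE. pose proof main_laguerre as HM.
  pose proof (F_pos_mono 0 4 ltac:(lia)) as H0. pose proof (F_pos_mono 1 4 ltac:(lia)) as H1.
  pose proof (F_pos_mono 2 4 ltac:(lia)) as H2. pose proof (F_pos_mono 3 4 ltac:(lia)) as H3.
  pose proof (coef_error 0 ltac:(lia)) as B0. rewrite Nat.add_0_r in B0.
  assert (E0 : F 0 = main_coef (INR n)) by (unfold F; now rewrite Nat.add_0_r).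
  rewrite <- E0 in B0.
  apply (laguerre_perturb (F 0) (F 1) (F 2) (F 3) (F 4) _ _ _ _ _ err); auto; try (apply coef_error; lia).
  eapply Rle_trans; [|exact HM].
  assert (Hm4 : 1 <= m ^ 4) by (rewrite <- (pow1 4); apply pow_incr; lra).
  assert (Herr : 0 < err) by (unfold err; pose proof (exp_pos (5 / 2 * X)); lra).
  apply Rmult_le_reg_l with (m ^ 4); [lra|].
  replace (m ^ 4 * (6 / m ^ 4 * (F 4 * F 0))) with (6 * F 0 * F 4) by (field; lra).
  set (w := m ^ 4) in *.
  assert (w * err * F 4 <= F 0 / 4 * F 4) by (apply Rmult_le_compat_r; lra).
  assert (err <= F 4) by nra.
  assert (w * err * err <= F 0 / 4 * F 4) by (apply Rmult_le_compat; nra).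
  nra.
Qed.
End Large.

(** * Truncated integer power series *)

(** Integer polynomials as coefficient lists, lowest degree first. *)
Fixpoint peval (l : list Z) (x : C) : C :=
  match l with nil => RtoC 0 | a :: l' => (RtoC (IZR a) + x * peval l' x)%C end.

Fixpoint padd (a b : list Z) : list Z :=
  match a, b with
  | nil, _ => b
  | _, nil => a
  | x :: a', y :: b' => (x + y)%Z :: padd a' b'
  end.

Definition pscale (x : Z) (a : list Z) : list Z := map (Z.mul x) a.

Fixpoint pmul (a b : list Z) : list Z :=
  match a with nil => nil | x :: a' => padd (pscale x b) (0%Z :: pmul a' b) end.

(** Power series quotient to [k] terms, assuming the constant coefficient of [p] is 1. *)
Fixpoint pquot (k : nat) (e p : list Z) : list Z :=
  match k with
  | O => nil
  | S k' => hd 0%Z e :: pquot k' (tl (padd e (pscale (- hd 0%Z e) p))) p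
  end.

Definition pshift (n : nat) (l : list Z) : list Z := repeat 0%Z n ++ l.

Lemma peval_padd (a b : list Z) (x : C) : peval (padd a b) x = (peval a x + peval b x)%C.
Proof.
  revert b. induction a as [|u a IH]; intros b; simpl; [ring|].
  destruct b as [|v b]; simpl; [ring|]. rewrite IH, plus_IZR, RtoC_plus. ring.
Qed.

Lemma peval_pscale (u : Z) (a : list Z) (x : C) : peval (pscale u a) x = (RtoC (IZR u) * peval a x)%C.
Proof.
  induction a as [|v a IH]; simpl; [ring|]. fold (pscale u a). rewrite IH, mult_IZR, RtoC_mult. ring.
Qed.

Lemma peval_pmul (a b : list Z) (x : C) : peval (pmul a b) x = (peval a x * peval b x)%C.
Proof.
  induction a as [|u a IH]; simpl; [ring|].
  rewrite peval_padd, peval_pscale. simpl. rewrite IH. ring.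
Qed.

Lemma peval_pshift (n : nat) (l : list Z) (x : C) : peval (pshift n l) x = (x ^ n * peval l x)%C.
Proof.
  unfold pshift. induction n; simpl; [ring|]. rewrite IHn. ring.
Qed.

Lemma peval_firstn (k : nat) (l : list Z) (x : C) :
  peval l x = (peval (firstn k l) x + x ^ k * peval (skipn k l) x)%C.
Proof.
  revert l. induction k; intros l; simpl; [ring|].
  destruct l as [|a l]; simpl; [ring|]. rewrite (IHk l) at 1. ring.
Qed.

Lemma peval_hd_tl (l : list Z) (x : C) : peval l x = (RtoC (IZR (hd 0%Z l)) + x * peval (tl l) x)%C.
Proof. destruct l; simpl; ring. Qed.

Lemma hd_padd (a b : list Z) : hd 0%Z (padd a b) = (hd 0 a + hd 0 b)%Z.
Proof. destruct a, b; simpl; lia. Qed.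

Lemma hd_pscale (u : Z) (a : list Z) : hd 0%Z (pscale u a) = (u * hd 0 a)%Z.
Proof. destruct a; simpl; lia. Qed.

(** Long division from the constant term upwards. The remainder is one polynomial for all [x], hence
    contributes [O(x^k)]. *)
Lemma peval_pquot (k : nat) (e p : list Z) : hd 0%Z p = 1%Z ->
  exists rest, forall x, peval e x = (peval (pquot k e p) x * peval p x + x ^ k * peval rest x)%C.
Proof.
  intros Hp. revert e. induction k; intros e.
  - exists e. intros x. simpl. ring.
  - destruct (IHk (tl (padd e (pscale (- hd 0%Z e) p)))) as [rest H]. exists rest. intros x.
    cbn [pquot peval Cpow].
    assert (E : peval e x = (RtoC (IZR (hd 0%Z e)) * peval p x
        + x * peval (tl (padd e (pscale (- hd 0%Z e) p))) x)%C).
    { pose proof (peval_hd_tl (padd e (pscale (- hd 0%Z e) p)) x) as T.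
      rewrite hd_padd, hd_pscale, Hp in T.
      replace (hd 0 e + - hd 0 e * 1)%Z with 0%Z in T by lia.
      rewrite peval_padd, peval_pscale, opp_IZR, RtoC_opp in T.
      replace (peval e x) with (peval e x + - IZR (hd 0%Z e) * peval p x + IZR (hd 0%Z e) * peval p x)%C by ring.
      rewrite T. ring. }
    rewrite E, H. ring.
Qed.

Lemma peval_bounded (l : list Z) : exists K, 0 <= K /\ forall x, Cmod x <= 1 -> Cmod (peval l x) <= K.
Proof.
  induction l as [|a l [K [HK H]]].
  - exists 0. split; [lra|]. intros x _. simpl. rewrite Cmod_0. lra.
  - exists (Rabs (IZR a) + K). split; [pose proof (Rabs_pos (IZR a)); lra|]. intros x Hx. simpl.
    eapply Rle_trans; [apply Cmod_triangle|]. rewrite Cmod_R, Cmod_mult. apply Rplus_le_compat_l.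
    specialize (H x Hx). pose proof (Cmod_ge_0 x). pose proof (Cmod_ge_0 (peval l x)). nra.
Qed.

Section Truncation.
Variable M : nat.

(** Congruence modulo the [M]-th power of [q], expressed through values at small real [q], so that
    identities between functions pass to coefficients. *)
Definition eqM (f g : R -> C) : Prop :=
  exists K, forall r, 0 < r <= / 2 -> Cmod (f r - g r)%C <= K * r ^ M.

Definition repr (f : R -> C) (l : list Z) : Prop := eqM f (fun r => peval l r).

Lemma eqM_sym (f g : R -> C) : eqM f g -> eqM g f.
Proof. intros [K H]. exists K. intros r Hr. rewrite Cmod_sub_sym. auto. Qed.

Lemma eqM_trans (f g h : R -> C) : eqM f g -> eqM g h -> eqM f h.
Proof.
  intros [K1 H1] [K2 H2]. exists (K1 + K2). intros r Hr.
  replace (f r - h r)%C with ((f r - g r) + (g r - h r))%C by ring.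
  eapply Rle_trans; [apply Cmod_triangle|]. specialize (H1 r Hr). specialize (H2 r Hr). lra.
Qed.

Lemma eqM_mult (f g u v : R -> C) (A B : R) :
  (forall r, 0 < r <= / 2 -> Cmod (u r) <= A) -> (forall r, 0 < r <= / 2 -> Cmod (g r) <= B) ->
  eqM f g -> eqM u v -> eqM (fun r => f r * u r)%C (fun r => g r * v r)%C.
Proof.
  intros HA HB [K1 H1] [K2 H2]. exists (K1 * A + B * K2). intros r Hr.
  replace (f r * u r - g r * v r)%C with ((f r - g r) * u r + g r * (u r - v r))%C by ring.
  eapply Rle_trans; [apply Cmod_triangle|]. rewrite !Cmod_mult.
  specialize (H1 r Hr). specialize (H2 r Hr). specialize (HA r Hr). specialize (HB r Hr).
  assert (0 < r ^ M) by (apply pow_lt; lra).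
  replace ((K1 * A + B * K2) * r ^ M) with (K1 * r ^ M * A + B * (K2 * r ^ M)) by ring.
  apply Rplus_le_compat; apply Rmult_le_compat; auto using Cmod_ge_0.
Qed.

Lemma pow_M_le_1 (r : R) : 0 < r <= / 2 -> 0 < r ^ M <= 1.
Proof. intros H. split; [apply pow_lt; lra|apply pow_le_one; lra]. Qed.

Lemma Cmod_small (r : R) : 0 < r <= / 2 -> Cmod (RtoC r) <= 1.
Proof. intros H. rewrite Cmod_R, Rabs_pos_eq; lra. Qed.

Lemma repr_bounded (f : R -> C) (l : list Z) : repr f l ->
  exists A, forall r, 0 < r <= / 2 -> Cmod (f r) <= A.
Proof.
  intros [K H]. destruct (peval_bounded l) as [B [_ HB]]. exists (Rmax K 0 + B). intros r Hr.
  replace (f r) with ((f r - peval l r) + peval l r)%C by ring.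
  eapply Rle_trans; [apply Cmod_triangle|]. apply Rplus_le_compat; [|apply HB, Cmod_small, Hr].
  eapply Rle_trans; [apply H, Hr|]. pose proof (pow_M_le_1 r Hr).
  pose proof (Rmax_l K 0). pose proof (Rmax_r K 0). nra.
Qed.

Lemma repr_firstn (f : R -> C) (l : list Z) : repr f l -> repr f (firstn M l).
Proof.
  intros H. apply (eqM_trans _ _ _ H). destruct (peval_bounded (skipn M l)) as [B [HB0 HB]].
  exists B. intros r Hr. rewrite (peval_firstn M l).
  replace (peval (firstn M l) r + r ^ M * peval (skipn M l) r - peval (firstn M l) r)%C
    with (r ^ M * peval (skipn M l) r)%C by ring.
  rewrite Cmod_mult, <- RtoC_pow, Cmod_R, Rabs_pos_eq by (left; apply pow_M_le_1, Hr).
  rewrite Rmult_comm. apply Rmult_le_compat_r; [left; apply pow_M_le_1, Hr|apply HB, Cmod_small, Hr].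
Qed.

Lemma repr_ext (f g : R -> C) (l : list Z) : (forall r, 0 < r <= / 2 -> f r = g r) -> repr f l -> repr g l.
Proof. intros E [K H]. exists K. intros r Hr. rewrite <- E by exact Hr. auto. Qed.

Lemma repr_mult (f g : R -> C) (a b : list Z) : repr f a -> repr g b ->
  repr (fun r => f r * g r)%C (firstn M (pmul a b)).
Proof.
  intros Ha Hb. apply repr_firstn.
  destruct (repr_bounded _ _ Hb) as [A HA]. destruct (peval_bounded a) as [B [_ HB]].
  destruct (eqM_mult f (fun r => peval a r) g (fun r => peval b r) A B HA
    (fun r Hr => HB r (Cmod_small r Hr)) Ha Hb) as [K HK].
  exists K. intros r Hr. rewrite peval_pmul. auto.
Qed.

Lemma repr_mult_one_minus (f : R -> C) (a : list Z) (n : nat) : repr f a ->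
  repr (fun r => f r * (1 - RtoC r ^ n))%C (firstn M (padd a (pscale (-1) (pshift n a)))).
Proof.
  intros [K H]. apply repr_firstn. exists (K * 2). intros r Hr.
  rewrite peval_padd, peval_pscale, peval_pshift.
  replace (f r * (1 - r ^ n) - (peval a r + RtoC (IZR (-1)) * (r ^ n * peval a r)))%C
    with ((f r - peval a r) * (1 - r ^ n))%C by ring.
  rewrite Cmod_mult. replace (K * 2 * r ^ M) with (K * r ^ M * 2) by ring.
  apply Rmult_le_compat; auto using Cmod_ge_0.
  eapply Rle_trans; [apply Cmod_triangle_sub|].
  rewrite Cmod_1, Cmod_pow, Cmod_R, Rabs_pos_eq by lra.
  assert (r ^ n <= 1) by (apply pow_le_one; lra). lra.
Qed.

Lemma repr_powser (u : nat -> Z) : csm (fun n => RtoC (IZR (u n)) * / 2 ^ n)%C ->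
  repr (fun r => csum (fun n => RtoC (IZR (u n)) * r ^ n)%C) (map u (seq 0 M)).
Proof.
  intros S.
  assert (P : forall k m r, csn (fun n => RtoC (IZR (u (m + n)%nat)) * r ^ n)%C k = peval (map u (seq m k)) r).
  { induction k; intros m r; [reflexivity|]. rewrite csn_S_first. cbn [seq map peval].
    rewrite <- IHk, <- csn_scal, Nat.add_0_r. f_equal; [simpl; ring|].
    apply csn_ext. intros j _. rewrite Nat.add_succ_r. simpl. ring. }
  assert (T : forall r, 0 < r <= / 2 -> csm (fun n => RtoC (IZR (u n)) * RtoC r ^ n)%C).
  { intros r Hr. apply (csm_le _ (fun n => Cmod (RtoC (IZR (u n)) * / 2 ^ n)%C)); [|exact S].
    intros n. rewrite !Cmod_mult, <- RtoC_pow, <- RtoC_pow, <- RtoC_inv, !Cmod_R by (apply pow_nonzero; lra).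
    apply Rmult_le_compat_l; [apply Rabs_pos|].
    assert (0 < / 2 ^ n) by (apply Rinv_0_lt_compat, pow_lt; lra).
    rewrite (Rabs_pos_eq (r ^ n)) by (apply pow_le; lra). rewrite Rabs_pos_eq by lra.
    rewrite <- pow_inv. apply pow_incr. lra. }
  exists (Series (fun k => Cmod (RtoC (IZR (u (M + k)%nat)) * / 2 ^ k)%C)).
  intros r Hr. rewrite <- (P M 0%nat (RtoC r)).
  rewrite (csn_ext (fun n => RtoC (IZR (u (0 + n)%nat)) * RtoC r ^ n)%C (fun n => RtoC (IZR (u n)) * RtoC r ^ n)%C) by reflexivity.
  rewrite csn_shift_tail by (apply T, Hr).
  rewrite Rmult_comm, <- Series_scal_l.
  assert (E2 : forall k, Cmod (RtoC (IZR (u (M + k)%nat)) * / 2 ^ k)%C = Rabs (IZR (u (M + k)%nat)) * / 2 ^ k).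
  { intros k. rewrite Cmod_mult, <- RtoC_pow, <- RtoC_inv, !Cmod_R by (apply pow_nonzero; lra). f_equal.
    apply Rabs_pos_eq. left. apply Rinv_0_lt_compat, pow_lt; lra. }
  apply csum_Cmod.
  - intros k. rewrite E2, Cmod_mult, <- RtoC_pow, !Cmod_R, (Rabs_pos_eq (r ^ (M + k))) by (apply pow_le; lra).
    rewrite pow_add.
    replace (r ^ M * (Rabs (IZR (u (M + k)%nat)) * / 2 ^ k)) with (Rabs (IZR (u (M + k)%nat)) * (r ^ M * / 2 ^ k)) by ring.
    apply Rmult_le_compat_l; [apply Rabs_pos|]. apply Rmult_le_compat_l; [left; apply pow_M_le_1, Hr|].
    rewrite <- pow_inv. apply pow_incr. lra.
  - apply (ex_series_scal_l (V := R_NormedModule) (r ^ M)).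
    apply (ex_series_ext (fun k => 2 ^ M * Cmod (RtoC (IZR (u (M + k)%nat)) * / 2 ^ (M + k))%C)).
    + intros k. match goal with |- ?a = ?b => change (@eq R a b) end.
      rewrite E2, Cmod_mult, <- RtoC_pow, <- RtoC_inv, !Cmod_R by (apply pow_nonzero; lra).
      rewrite (Rabs_pos_eq (/ _)) by (left; apply Rinv_0_lt_compat, pow_lt; lra).
      rewrite pow_add. field. split; apply pow_nonzero; lra.
    + apply (ex_series_scal_l (V := R_NormedModule) (2 ^ M)).
      apply (ex_series_shift (fun k => Cmod (RtoC (IZR (u k)) * / 2 ^ k)%C)), S.
Qed.
End Truncation.

Lemma small_real_zero (a K : R) : (forall r, 0 < r <= / 2 -> Rabs a <= K * r) -> a = 0.
Proof.
  intros H. destruct (Req_dec a 0) as [E|E]; [exact E|exfalso].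
  apply Rabs_pos_lt in E. pose proof (H (/ 2) ltac:(lra)) as H1.
  assert (HK : 0 < K) by nra.
  set (r := Rmin (/ 2) (Rabs a / (2 * K))).
  assert (Hr : 0 < r) by (unfold r; apply Rmin_case; [lra|apply Rdiv_lt_0_compat; lra]).
  pose proof (Rmin_l (/ 2) (Rabs a / (2 * K))). pose proof (Rmin_r (/ 2) (Rabs a / (2 * K))). fold r in H0, H2.
  specialize (H r ltac:(lra)).
  assert (K * r <= K * (Rabs a / (2 * K))) by (apply Rmult_le_compat_l; lra).
  replace (K * (Rabs a / (2 * K))) with (Rabs a / 2) in H3 by (field; lra). lra.
Qed.

(** As [r] tends to 0 the constant terms must agree; after division by [r] the same argument applies
    to the tails. *)
Lemma peval_unique (l : list Z) (K : R) : forall l', length l = length l' ->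
  (forall r, 0 < r <= / 2 -> Cmod (peval l r - peval l' r)%C <= K * r ^ length l) -> l = l'.
Proof.
  induction l as [|a l IH]; intros [|b l'] Hl H; try discriminate; [reflexivity|].
  simpl in Hl. injection Hl as Hl.
  destruct (peval_bounded l) as [B1 [HB1 H1]]. destruct (peval_bounded l') as [B2 [HB2 H2]].
  assert (Hab : IZR a - IZR b = 0).
  { apply (small_real_zero _ (Rmax K 0 + (B1 + B2))). intros r Hr. specialize (H r Hr).
    rewrite <- (Cmod_R (IZR a - IZR b)), RtoC_minus.
    replace (IZR a - IZR b)%C with ((peval (a :: l) r - peval (b :: l') r) - r * (peval l r - peval l' r))%C
      by (simpl; ring).
    eapply Rle_trans; [apply Cmod_triangle_sub|]. rewrite Rmult_plus_distr_r. apply Rplus_le_compat.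
    - eapply Rle_trans; [exact H|]. simpl length. simpl pow.
      assert (0 <= r ^ length l <= 1) by (split; [apply pow_le; lra|apply pow_le_one; lra]).
      pose proof (Rmax_l K 0). pose proof (Rmax_r K 0).
      assert (0 <= r * r ^ length l <= r) by nra. nra.
    - rewrite Cmod_mult, Cmod_R, Rabs_pos_eq by lra.
      pose proof (Cmod_triangle_sub (peval l r) (peval l' r)).
      specialize (H1 r (Cmod_small r Hr)). specialize (H2 r (Cmod_small r Hr)).
      rewrite Rmult_comm. apply Rmult_le_compat_r; lra. }
  assert (E : a = b) by (apply eq_IZR; lra). subst b. f_equal.
  apply IH; [exact Hl|]. intros r Hr. specialize (H r Hr).
  replace (peval (a :: l) r - peval (a :: l') r)%C with (r * (peval l r - peval l' r))%C in H by (simpl; ring).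
  rewrite Cmod_mult, Cmod_R, Rabs_pos_eq in H by lra. simpl in H.
  apply Rmult_le_reg_l with r; [lra|]. lra.
Qed.

Fixpoint euler_poly (M N : nat) : list Z :=
  match N with
  | O => 1%Z :: nil
  | S N' => let a := euler_poly M N' in firstn M (padd a (pscale (-1) (pshift N a)))
  end.

Fixpoint ppow (M : nat) (a : list Z) (k : nat) : list Z :=
  match k with O => 1%Z :: nil | S k' => firstn M (pmul a (ppow M a k')) end.

Lemma repr_one (M : nat) : repr M (fun _ => RtoC 1) (1%Z :: nil).
Proof.
  exists 0. intros r _. simpl. replace (1 - (1 + r * 0))%C with (RtoC 0) by ring. rewrite Cmod_0. lra.
Qed.

Lemma repr_ppow (M : nat) (f : R -> C) (a : list Z) (k : nat) : repr M f a ->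
  repr M (fun r => f r ^ k)%C (ppow M a k).
Proof.
  intros H. induction k; [apply repr_one|]. cbn [ppow Cpow]. now apply repr_mult.
Qed.

Lemma repr_euler (M N : nat) : repr M (fun r => Cprod (fun n => 1 - RtoC r ^ n)%C N) (euler_poly M N).
Proof.
  induction N; [apply repr_one|]. cbn [euler_poly Cprod]. now apply repr_mult_one_minus.
Qed.

Lemma Cprod_efac (q : C) (N : nat) : Cprod (efac q) N = (Cprod (fun n => 1 - q ^ n) N ^ 24)%C.
Proof.
  induction N; [simpl; ring|]. cbn [Cprod]. rewrite IHN, Cpow_mult_l. reflexivity.
Qed.

(** Each further factor [n] changes the product by [O(r^n)], so the factors up to [N] determine it
    modulo [r^(N+1)]. *)
Lemma eprod_tail (r : R) (N : nat) : 0 < r <= / 2 ->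
  Cmod (eprod r - Cprod (efac r) N)%C <= exp 24 * 2 ^ 24 * 2 * r ^ S N.
Proof.
  intros Hr. assert (Hr1 : Cmod (RtoC r) <= / 2) by (rewrite Cmod_R, Rabs_pos_eq; lra).
  assert (P : forall k, Cmod (Cprod (efac r) (N + k) - Cprod (efac r) N)%C
     <= exp 24 * 2 ^ 24 * (r ^ S N * (2 - 2 * r ^ k))).
  { assert (HU : 0 < exp 24 * 2 ^ 24) by (pose proof (exp_pos 24); nra).
    assert (HS : 0 < r ^ S N) by (apply pow_lt; lra).
    induction k.
    - rewrite Nat.add_0_r. replace (Cprod (efac r) N - Cprod (efac r) N)%C with (RtoC 0) by ring.
      rewrite Cmod_0. simpl. lra.
    - rewrite Nat.add_succ_r. cbn [Cprod].
      replace (Cprod (efac r) (N + k) * efac r (S (N + k)) - Cprod (efac r) N)%C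
        with ((Cprod (efac r) (N + k) - Cprod (efac r) N)
              + Cprod (efac r) (N + k) * (efac r (S (N + k)) - 1))%C by ring.
      eapply Rle_trans; [apply Cmod_triangle|].
      assert (B : Cmod (Cprod (efac r) (N + k) * (efac r (S (N + k)) - 1))%C <= exp 24 * 2 ^ 24 * (r ^ S N * r ^ k)).
      { rewrite Cmod_mult, Rmult_assoc. apply Rmult_le_compat; try apply Cmod_ge_0.
        - eapply Rle_trans; [apply (Cprod_upper _ (/ 2)); lra|]. apply exp_le. lra.
        - assert (H1 : Cmod (RtoC r ^ S (N + k))%C <= 1) by (left; apply Cmod_pow_S_lt_1; lra).
          eapply Rle_trans; [apply (pow_minus_one_bound _ 24 H1)|].
          rewrite Cmod_pow, Cmod_R, Rabs_pos_eq by lra.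
          replace (r ^ S (N + k)) with (r ^ S N * r ^ k) by (rewrite <- pow_add; f_equal; lia).
          assert (0 < r ^ k) by (apply pow_lt; lra). apply Rmult_le_compat_r; [nra|lra]. }
      apply Rle_trans with (exp 24 * 2 ^ 24 * (r ^ S N * (2 - 2 * r ^ k)) + exp 24 * 2 ^ 24 * (r ^ S N * r ^ k)); [lra|].
      rewrite <- Rmult_plus_distr_l. apply Rmult_le_compat_l; [lra|].
      rewrite <- Rmult_plus_distr_l. apply Rmult_le_compat_l; [lra|].
      assert (0 < r ^ k) by (apply pow_lt; lra). simpl. nra. }
  assert (L : Ccv (fun k => Cprod (efac r) (N + k) - Cprod (efac r) N)%C (eprod r - Cprod (efac r) N)%C).
  { apply Ccv_minus; [|apply Ccv_const].
    apply (is_lim_seq_ext (fun k => Cmod (Cprod (efac r) (k + N) - eprod r)%C)); [intros; now rewrite Nat.add_comm|].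
    apply (is_lim_seq_incr_n (fun k => Cmod (Cprod (efac r) k - eprod r)%C) N), Cprod_eprod. lra. }
  apply (Ccv_Cmod_le _ _ _) with (2 := L). intros k. eapply Rle_trans; [apply P|].
  pose proof (exp_pos 24). assert (0 < r ^ k) by (apply pow_lt; lra). assert (0 < r ^ S N) by (apply pow_lt; lra).
  replace (exp 24 * 2 ^ 24 * 2 * r ^ S N) with (exp 24 * 2 ^ 24 * (r ^ S N * 2)) by ring.
  apply Rmult_le_compat_l; [lra|]. apply Rmult_le_compat_l; lra.
Qed.

Definition E4_coef (n : nat) : Z :=
  match n with O => 1 | S _ => 240 * Z.of_nat (divisor_sigma 3 n) end.

(** The exponent 24 is reached as [3 * 2 * 2 * 2], with truncation throughout. By [eprod_tail] the
    factors up to [M - 1] suffice. *)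
Definition delta_poly (M : nat) : list Z :=
  let e3 := ppow M (euler_poly M (pred M)) 3 in ppow M (ppow M (ppow M e3 2) 2) 2.

(** The coefficients of [E4] are an argument, so that the fast [E4_coef_Z] can be substituted for
    the computation. *)
Definition j_poly (M : nat) (E : list Z) : list Z := pquot M (ppow M E 3) (delta_poly M).

(** * Small indices *)

(** [E4_coef] without unary numbers, for evaluation by [vm_compute]. *)
Definition E4_coef_Z (n : nat) : Z :=
  match n with
  | O => 1
  | S _ => 240 * fold_right Z.add 0 (map (fun d => Z.of_nat d ^ 3) (filter (fun d => n mod d =? 0)%nat (seq 1 n)))
  end%Z.

Lemma E4_coef_Z_eq (n : nat) : E4_coef_Z n = E4_coef n.
Proof.
  destruct n as [|n]; [reflexivity|]. unfold E4_coef_Z, E4_coef, divisor_sigma. f_equal.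
  induction (filter _ _) as [|d l IH]; [reflexivity|].
  cbn [map fold_right list_sum]. rewrite IH. rewrite Nat2Z.inj_add, Nat2Z.inj_pow. reflexivity.
Qed.

Lemma repr_E4 (M : nat) : repr M (fun r => E4 r) (map E4_coef (seq 0 M)).
Proof.
  assert (X : forall q : C, forall n, (RtoC (IZR (E4_coef (S n))) * q ^ S n
     = 240 * (INR (divisor_sigma 3 (S n)) * q ^ S n))%C).
  { intros q n. unfold E4_coef. rewrite mult_IZR, RtoC_mult, INR_IZR_INZ. ring. }
  assert (S : forall q : C, Cmod q < 1 -> csm (fun n => RtoC (IZR (E4_coef n)) * q ^ n)%C).
  { intros q Hq. apply csm_S. eapply csm_ext; [intros n; symmetry; apply X|].
    apply csm_scal, sigma_lambert, Hq. }
  apply (repr_ext M (fun r => csum (fun n => RtoC (IZR (E4_coef n)) * RtoC r ^ n)%C)).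
  - intros r Hr. assert (Hq : Cmod (RtoC r) < 1) by (rewrite Cmod_R, Rabs_pos_eq; lra).
    destruct (sigma_lambert 3 _ Hq) as [S3 E3].
    rewrite csum_S by now apply S. rewrite (csum_ext _ _ (X (RtoC r))), csum_scal, E3 by exact S3.
    unfold E4. simpl E4_coef. simpl Cpow. ring.
  - apply repr_powser. apply (csm_ext (fun n => RtoC (IZR (E4_coef n)) * (/ RtoC 2) ^ n)%C).
    + intros n. rewrite Cpow_inv by apply RtoC_2_neq. reflexivity.
    + apply S. rewrite Cmod_inv, Cmod_R, Rabs_pos_eq by (try apply RtoC_2_neq; lra). lra.
Qed.

Lemma repr_eprod (M : nat) : repr (S M) (fun r => eprod r) (delta_poly (S M)).
Proof.
  assert (H : repr (S M) (fun r => Cprod (efac r) M) (delta_poly (S M))).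
  { pose proof (repr_ppow (S M) _ _ 3 (repr_euler (S M) M)) as H3.
    pose proof (repr_ppow (S M) _ _ 2 (repr_ppow (S M) _ _ 2 (repr_ppow (S M) _ _ 2 H3))) as H24.
    revert H24. apply repr_ext. intros r Hr. rewrite Cprod_efac, <- !Cpow_mult_r. reflexivity. }
  apply (eqM_trans (S M) _ (fun r => Cprod (efac r) M)); [|exact H].
  eexists. intros r Hr. apply eprod_tail, Hr.
Qed.

Lemma fourier_product (c : nat -> Z) (r : R) : j_fourier_coefficients c -> 0 < r <= / 2 ->
  csm (fun n => RtoC (IZR (c n)) * RtoC r ^ n)%C /\
  ((1 + r * csum (fun n => RtoC (IZR (c n)) * RtoC r ^ n)) * eprod r = E4 r ^ 3)%C.
Proof.
  intros hc Hr. pose proof PI_RGT_0.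
  (* The height at which the nome on the imaginary axis equals [r]. *)
  set (y := - ln r / (2 * PI)).
  assert (Hln : ln r < 0) by (rewrite <- ln_1; apply ln_increasing; lra).
  assert (Hy : 0 < y) by (unfold y; apply Rdiv_lt_0_compat; lra).
  assert (Er : exp (- (2 * PI * y)) = r).
  { unfold y. replace (- (2 * PI * (- ln r / (2 * PI)))) with (ln r) by (field; lra). apply exp_ln. lra. }
  pose proof (fourier_csm c y hc Hy) as S. rewrite Er in S. split; [exact S|].
  assert (Eq : q_param (y * Ci) = RtoC r) by (rewrite q_param_scale_Ci, Er; reflexivity).
  pose proof (hc (y * Ci)%C) as Hs. rewrite Im_scale_Ci in Hs. specialize (Hs Hy).
  apply is_series_Ccv, csum_unique in Hs. rewrite modular_j_E4, Eq in Hs by (rewrite Im_scale_Ci; exact Hy).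
  rewrite Hs. unfold mdelta.
  assert (RtoC r <> RtoC 0) by (apply RtoC_neq; lra).
  assert (eprod r <> RtoC 0) by (apply eprod_neq_0; rewrite Cmod_R, Rabs_pos_eq; lra).
  field. auto.
Qed.

(** The shift by one makes [q j] an ordinary power series, equal to [E4^3 / eprod]. *)
Definition q_times_j_coef (c : nat -> Z) (n : nat) : Z :=
  match n with O => 1%Z | S m => c m end.

Lemma length_pquot (k : nat) (e p : list Z) : length (pquot k e p) = k.
Proof. revert e. induction k; intros e; simpl; auto. Qed.

(** Both lists, multiplied by [eprod], agree with [E4^3] up to [O(r^N)]. The condition on the
    constant term, required for division, is left to computation. *)
Lemma fourier_coefficients_poly (c : nat -> Z) (M : nat) : j_fourier_coefficients c ->
  hd 0%Z (delta_poly (S M)) = 1%Z ->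
  map (q_times_j_coef c) (seq 0 (S M)) = j_poly (S M) (map E4_coef (seq 0 (S M))).
Proof.
  intros hc Hp. set (N := S M) in *. set (u := q_times_j_coef c).
  set (e3 := ppow N (map E4_coef (seq 0 N)) 3). set (p := delta_poly N) in *.
  set (J := j_poly N (map E4_coef (seq 0 N))).
  set (A := fun r : R => csum (fun n => RtoC (IZR (u n)) * RtoC r ^ n)%C).
  assert (Su : forall r, 0 < r <= / 2 -> csm (fun n => RtoC (IZR (u n)) * RtoC r ^ n)%C
     /\ (A r * eprod r = E4 r ^ 3)%C).
  { intros r Hr. destruct (fourier_product c r hc Hr) as [S E].
    assert (Hs : csm (fun n => RtoC (IZR (u n)) * RtoC r ^ n)%C).
    { apply csm_S. apply (csm_ext (fun n => r * (RtoC (IZR (c n)) * RtoC r ^ n))%C).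
      - intros n. simpl. ring.
      - now apply csm_scal. }
    split; [exact Hs|]. rewrite <- E. f_equal. unfold A. rewrite csum_S by exact Hs.
    rewrite <- csum_scal by exact S. f_equal; [simpl; ring|]. apply csum_ext. intros n. simpl. ring. }
  assert (RA : repr N A (map u (seq 0 N))).
  { apply repr_powser. destruct (Su (/ 2) ltac:(lra)) as [S _].
    revert S. apply csm_ext. intros n. f_equal. rewrite RtoC_inv, Cpow_inv by (try apply RtoC_2_neq; lra). reflexivity. }
  assert (RP : repr N (fun r => eprod r) p) by apply repr_eprod.
  assert (RE : repr N (fun r => E4 r ^ 3)%C e3) by apply repr_ppow, repr_E4.
  destruct (peval_pquot N e3 p Hp) as [rest Hrest].
  change (pquot N e3 p) with J in Hrest.
  destruct (repr_bounded N _ _ RP) as [B1 HB1].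
  destruct (peval_bounded (map u (seq 0 N))) as [B2 [_ HB2]].
  destruct (peval_bounded J) as [B3 [_ HB3]].
  destruct (peval_bounded rest) as [B4 [_ HB4]].
  assert (Q1 : eqM N (fun r => A r * eprod r)%C (fun r => peval (map u (seq 0 N)) r * eprod r)%C).
  { apply (eqM_mult N _ _ _ _ B1 B2); [exact HB1|intros r Hr; apply HB2, Cmod_small, Hr|exact RA|].
    exists 0. intros r _. replace (eprod r - eprod r)%C with (RtoC 0) by ring. rewrite Cmod_0. lra. }
  assert (Q2 : eqM N (fun r => peval J r * eprod r)%C (fun r => peval J r * peval p r)%C).
  { apply (eqM_mult N _ _ _ _ B1 B3); [exact HB1|intros r Hr; apply HB3, Cmod_small, Hr| |exact RP].
    exists 0. intros r _. replace (peval J r - peval J r)%C with (RtoC 0) by ring. rewrite Cmod_0. lra. }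
  assert (Q3 : eqM N (fun r => peval J r * peval p r)%C (fun r => peval e3 r)).
  { exists B4. intros r Hr. rewrite Hrest.
    replace (peval J r * peval p r - (peval J r * peval p r + r ^ N * peval rest r))%C
      with (- (r ^ N * peval rest r))%C by ring.
    rewrite Cmod_opp, Cmod_mult, <- RtoC_pow, Cmod_R, Rabs_pos_eq by (apply pow_le; lra).
    rewrite Rmult_comm. apply Rmult_le_compat_r; [apply pow_le; lra|apply HB4, Cmod_small, Hr]. }
  assert (Q4 : eqM N (fun r => peval e3 r) (fun r => A r * eprod r)%C).
  { apply eqM_sym. destruct RE as [K HK]. exists K. intros r Hr.
    rewrite (proj2 (Su r Hr)). now apply HK. }
  destruct (eqM_trans N _ _ _ Q2 (eqM_trans N _ _ _ Q3 (eqM_trans N _ _ _ Q4 Q1))) as [K HK].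
  (* A lower bound for [eprod] on the disc of radius [1/2], which allows the common factor to be
     cancelled. *)
  set (d := exp (- (24 * (/ 2 / (1 - / 2) ^ 2)))).
  assert (Hd : 0 < d) by apply exp_pos.
  symmetry. apply (peval_unique _ (K / d)).
  - unfold J, j_poly. rewrite length_pquot, length_map, length_seq. reflexivity.
  - intros r Hr. unfold J at 2. unfold j_poly. rewrite length_pquot. specialize (HK r Hr).
    replace (peval J r * eprod r - peval (map u (seq 0 N)) r * eprod r)%C
      with ((peval J r - peval (map u (seq 0 N)) r) * eprod r)%C in HK by ring.
    rewrite Cmod_mult in HK.
    assert (Hl : d <= Cmod (eprod r)) by (apply eprod_lower; [rewrite Cmod_R, Rabs_pos_eq; lra|lra]).
    apply Rmult_le_reg_r with d; [exact Hd|].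
    replace (K / d * r ^ N * d) with (K * r ^ N) by (field; lra).
    eapply Rle_trans; [|exact HK]. apply Rmult_le_compat_l; [apply Cmod_ge_0|exact Hl].
Qed.

Definition laguerre_Z (a : nat -> Z) (n : nat) : Z :=
  (a n * a (n + 4)%nat - 4 * (a (n + 1)%nat * a (n + 3)%nat) + 3 * (a (n + 2)%nat * a (n + 2)%nat))%Z.

Definition laguerre_check (l : list Z) (m : nat) : bool :=
  forallb (fun n => Z.leb 0 (laguerre_Z (fun k => nth (S k) l 0%Z) n)) (seq 1 m).

(** The indices [n <= 99] involve [c] up to 103, which is entry 104 of [q j]; hence 105 terms. *)
Lemma j_poly_check :
  hd 0%Z (delta_poly 105) = 1%Z /\
  laguerre_check (j_poly 105 (map E4_coef_Z (seq 0 105))) 99 = true.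
Proof. split; vm_compute; reflexivity. Qed.

Lemma laguerre_small (c : nat -> Z) (n : nat) : j_fourier_coefficients c -> (1 <= n < 100)%nat ->
  (0 <= laguerre_Z c n)%Z.
Proof.
  intros hc Hn. destruct j_poly_check as [Hp Hl].
  rewrite (map_ext _ _ E4_coef_Z_eq), <- (fourier_coefficients_poly c 104 hc Hp) in Hl.
  unfold laguerre_check in Hl. rewrite forallb_forall in Hl.
  specialize (Hl n ltac:(apply in_seq; lia)). apply Z.leb_le in Hl.
  assert (E : forall k, (k < 104)%nat -> nth (S k) (map (q_times_j_coef c) (seq 0 105)) 0%Z = c k).
  { intros k Hk. rewrite (nth_indep _ 0%Z (q_times_j_coef c 0)) by (rewrite length_map, length_seq; lia).
    rewrite map_nth, seq_nth by lia. reflexivity. }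
  unfold laguerre_Z in *. rewrite !E in Hl by lia. exact Hl.
Qed.

Theorem theorem4p4 (c : nat -> Z) (hc : j_fourier_coefficients c) :
  laguerre_inequality 2 (fun n : nat => IZR (c n)).
Proof.
  intros n Hn.
  (* The terms [k] and [4 - k] of the sum coincide, so half of it is this expression with weights
     [1, -4, 3]. *)
  assert (H : 0 <= IZR (c n) * IZR (c (n + 4)%nat) - 4 * (IZR (c (n + 1)%nat) * IZR (c (n + 3)%nat))
     + 3 * (IZR (c (n + 2)%nat) * IZR (c (n + 2)%nat))).
  { destruct (Nat.le_gt_cases 100 n) as [Hl|Hl]; [now apply laguerre_large|].
    pose proof (laguerre_small c n hc (conj Hn Hl)) as L. apply IZR_le in L.
    unfold laguerre_Z in L. rewrite plus_IZR, minus_IZR, !mult_IZR in L. exact L. }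
  apply Rle_ge. eapply Rle_trans; [exact H|]. right.
  unfold Binomial.C. cbn [Nat.mul Nat.add sum_f_R0 Nat.sub].
  replace (INR (fact 4)) with 24 by (simpl; ring). replace (INR (fact 3)) with 6 by (simpl; ring).
  replace (INR (fact 2)) with 2 by (simpl; ring). replace (INR (fact 1)) with 1 by (simpl; ring).
  replace (INR (fact 0)) with 1 by (simpl; ring).
  rewrite Nat.add_0_r.
  replace (S (S (S (S n)))) with (n + 4)%nat by lia. replace (S (S (S n))) with (n + 3)%nat by lia.
  replace (S (S n)) with (n + 2)%nat by lia. replace (S n) with (n + 1)%nat by lia.
  field.
Qed.
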